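(* Let $n\ge 2$, $0<\beta<1$, $b\in \mathrm{Lip}_\beta(\mathbb{R}^n)$ and $r>1$. Let $\tilde\Omega$ be homogeneous of degree $0$ on $\mathbb{R}^n$ with $\tilde\Omega\in L^r(S^{n-1})$, and suppose $$\int_{S^{n-1}}\tilde\Omega(x')\,d\sigma(x')=0\qquad\text{and}\qquad \int_0^1\frac{\tilde\omega_r(\delta)}{\delta^{1+\beta}}\,d\delta<+\infty .$$ Then $[b,T_{\tilde\Omega}]$ is bounded from $H^{n/(n+\beta)}(\mathbb{R}^n)$ into weak $L^1(\mathbb{R}^n)$; that is, there is a positive constant $C$, independent of $f$ and $b$, such that for all $f\in H^{n/(n+\beta)}(\mathbb{R}^n)$ and all $\lambda>0$ $$\big|\{x\in\mathbb{R}^n: |[b,T_{\tilde\Omega}]f(x)|>\lambda\}\big|\le C\,\|b\|_{\mathrm{Lip}_\beta(\mathbb{R}^n)}\,\lambda^{-1}\,\|f\|_{H^{n/(n+\beta)}(\mathbb{R}^n)} .$$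
   Context: $S^{n-1}$ is the unit sphere of $\mathbb{R}^n$ with normalized Lebesgue measure $d\sigma$; $|E|$ denotes Lebesgue measure of $E\subset\mathbb{R}^n$. Integral modulus of order $r$ of $\tilde\Omega$: $\tilde\omega_r(\delta)=\sup_{|\rho|<\delta}\big(\int_{S^{n-1}}|\tilde\Omega(\rho z')-\tilde\Omega(z')|^r\,d\sigma(z')\big)^{1/r}$, where $\rho$ ranges over rotations of $\mathbb{R}^n$ and $|\rho|=\sup_{z'\in S^{n-1}}|\rho z'-z'|$. Lipschitz space: for $0<\beta\le1$, $\mathrm{Lip}_\beta(\mathbb{R}^n)$ is the set of functions $g$ with $\|g\|_{\mathrm{Lip}_\beta(\mathbb{R}^n)}=\sup_{x\ne y}\frac{|g(x)-g(y)|}{|x-y|^\beta}<\infty$. $T_{\tilde\Omega}f(x)=\mathrm{p.v.}\int_{\mathbb{R}^n}\frac{\tilde\Omega(x-y)}{|x-y|^{n}}f(y)\,dy$ is the Calderón–Zygmund singular integral, and its commutator with $b$ is (defined formally by) $$[b,T_{\tilde\Omega}]f(x)=\int_{\mathbb{R}^n}\frac{\tilde\Omega(x-y)}{|x-y|^{n}}\,(b(x)-b(y))f(y)\,dy .$$ Hardy space and atoms: $H^p(\mathbb{R}^n)$ is the usual real Hardy space. For $0<p\le1\le \ell<\infty$, $p\neq \ell$, and an integer $s\ge[n(1/p-1)]$, where $[t]$ is the greatest integer less than or equal to $t$, a $(p,\ell)$-atom centered at $x_0$ is a function $a\in L^\ell(\mathbb{R}^n)$ supported in a ball $B(x_0,d)=\{x:|x-x_0|\le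 d\}$, $d>0$, with $\|a\|_{L^\ell}\le|B(x_0,d)|^{1/\ell-1/p}$ and $\int a(x)x^\gamma\,dx=0$ for $0\le|\gamma|\le s$. A distribution $f$ belongs to $H^p$ if and only if $f=\sum_j\lambda_ja_j$ in the sense of distributions with $(p,\ell)$-atoms $a_j$ and $\sum_j|\lambda_j|^p<\infty$, and $\|f\|_{H^p}\sim\inf(\sum_j|\lambda_j|^p)^{1/p}$ over all such decompositions. The formal operator acts on $f\in H^p$ through atomic decompositions, $[b,T_{\tilde\Omega}]f=\sum_j\lambda_j[b,T_{\tilde\Omega}]a_j$, with $(p,\ell)$-atoms, $1<\ell<\infty$ (here $p=n/(n+\beta)$). *)

(* Defs.v *)
From HB Require Import structures.
From mathcomp Require Import all_boot all_order all_algebra.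
From mathcomp Require Import all_classical all_reals all_analysis measurable_realfun.

Set Implicit Arguments.
Unset Strict Implicit.
Unset Printing Implicit Defensive.
Import Order.TTheory GRing.Theory Num.Theory.
Import numFieldNormedType.Exports.

Local Open Scope classical_set_scope.
Local Open Scope ring_scope.

(* R^n is 'rV[R]_n, with the sigma-algebra generated by the coordinates, i.e.
   the Borel sigma-algebra (same construction as for n.-tuple T). *)
Section measurable_rV.
Context (R : realType) (n : nat).

Definition rV_coord (i : 'I_n) (x : 'rV[R]_n) : R := x ord0 i.

Let rV_set0 : g_sigma_preimage rV_coord set0.
Proof. exact: sigma_algebra0. Qed.

Let rV_setC A : g_sigma_preimage rV_coord A -> g_sigma_preimage rV_coord (~` A).
Proof. exact: sigma_algebraC. Qed.

Let rV_bigcup (F : (set 'rV[R]_n)^nat) :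
  (forall i, g_sigma_preimage rV_coord (F i)) ->
  g_sigma_preimage rV_coord (\bigcup_i (F i)).
Proof. exact: sigma_algebra_bigcup. Qed.

HB.instance Definition _ := @isMeasurable.Build
  (measure_tuple_display default_measure_display) 'rV[R]_n
  (g_sigma_preimage rV_coord) rV_set0 rV_setC rV_bigcup.

Lemma measurable_coord (i : 'I_n) :
  measurable_fun [set: 'rV[R]_n] (fun x : 'rV[R]_n => x ord0 i).
Proof.
move=> _ Y mY; rewrite setTI; apply: sub_sigma_algebra => /=.
rewrite -bigcup_seq/=; exists i => /=; first by rewrite mem_index_enum.
by exists Y => //; rewrite setTI.
Qed.

Lemma measurable_fun_rV d (T : measurableType d) (f : T -> 'rV[R]_n) :
  (forall i, measurable_fun [set: T] (fun t => f t ord0 i)) ->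
  measurable_fun [set: T] f.
Proof.
move=> mf _ A mA; rewrite setTI.
suff : g_sigma_preimage rV_coord `<=` [set B | measurable (f @^-1` B)] by apply.
apply: smallest_sub.
  split => /=.
  - by rewrite preimage_set0.
  - by move=> B mB; rewrite setTD preimage_setC; exact: measurableC.
  - by move=> F mF; rewrite preimage_bigcup; exact: bigcup_measurable.
rewrite -bigcup_seq/= => B [i _ [C mC <-]] /=.
by rewrite setTI; have := mf i measurableT C mC; rewrite setTI.
Qed.

End measurable_rV.

Lemma prod_sigma_finite d1 d2 (T1 : measurableType d1) (T2 : measurableType d2)
    (R : realType) (m1 : {sigma_finite_measure set T1 -> \bar R})
    (m2 : {sigma_finite_measure set T2 -> \bar R}) :
  sigma_finite setT (m1 \x m2)%E.
Proof.
have /sigma_finiteP[F [TF ndF Foo]] := sigma_finiteT m1.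
have /sigma_finiteP[G [TG ndG Goo]] := sigma_finiteT m2.
exists (fun n => F n `*` G n).
  rewrite -setXTT TF TG predeqE => -[x y]; split.
    move=> [/= [n _ Fnx] [k _ Gky]]; exists (maxn n k) => //; split.
    - by move: x Fnx; exact/subsetPset/ndF/leq_maxl.
    - by move: y Gky; exact/subsetPset/ndG/leq_maxr.
  by move=> [n _ []/= ? ?]; split; exists n.
move=> k; have [? ?] := Foo k; have [? ?] := Goo k.
split; first exact: measurableX.
by rewrite product_measure1E// lte_mul_pinfty// ge0_fin_numE.
Qed.

Section lebesgue_rV.
Context (R : realType).

Definition cons_rV (n : nat) (tx : measurableTypeR R * 'rV[R]_n) : 'rV[R]_n.+1 :=
  row_mx (const_mx tx.1 : 'rV[R]_1) tx.2.

Lemma measurable_cons_rV n : measurable_fun setT (@cons_rV n).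
Proof.
apply: measurable_fun_rV => i.
case: (@split_ordP 1 n i) => j ->.
  rewrite (_ : (fun _ => _) = fst); first exact: measurable_fst.
  by apply/funext => -[t x]; rewrite /cons_rV (@row_mxEl _ 1 1 n) mxE.
rewrite (_ : (fun _ => _) = (fun x : 'rV[R]_n => x ord0 j) \o snd).
  by apply: measurableT_comp => //; exact: measurable_coord.
by apply/funext => -[t x]; rewrite /cons_rV (@row_mxEr _ 1 1 n).
Qed.

Section cons_measure.
Context (n : nat) (m : {sigma_finite_measure set 'rV[R]_n -> \bar R}).

Definition cons_measure : set 'rV[R]_n.+1 -> \bar R :=
  pushforward (@lebesgue_measure R \x m)%E (@cons_rV n).

HB.instance Definition _ := Measure.copy cons_measure
  (measure_function_pushforward__canonical__measure_function_Measure
    (@lebesgue_measure R \x m)%E (@measurable_cons_rV n)).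

Let cons_measure_sigma_finite : sigma_finite setT cons_measure.
Proof.
have [F FT mF] := prod_sigma_finite (@lebesgue_measure R) m.
pose g (x : 'rV[R]_n.+1) : measurableTypeR R * 'rV[R]_n :=
  (x ord0 ord0, rsubmx (x : 'rV[R]_(1 + n))).
have gK : cancel (@cons_rV n) g.
  move=> [t x]; rewrite /g /cons_rV row_mxKr; congr (_, _).
  have E : @row_mx R 1 1 n (const_mx t) x ord0 (lshift n ord0) = t.
    by rewrite row_mxEl mxE.
  by rewrite -[RHS]E /=; congr (row_mx _ _ _ _); exact/val_inj.
have mg : measurable_fun setT g.
  apply/measurable_fun_pairP; split.
    exact: measurable_coord.
  apply: measurable_fun_rV => i.
  rewrite (_ : (fun _ => _) = (fun x : 'rV[R]_n.+1 => x ord0 (rshift 1 i))).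
    exact: measurable_coord.
  by apply/funext => x; rewrite mxE.
exists (fun i => g @^-1` F i).
  by rewrite -preimage_bigcup -FT preimage_setT.
move=> i; have [mFi Fi] := mF i; split.
  by rewrite -[X in measurable X]setTI; exact: mg.
rewrite /cons_measure /pushforward -comp_preimage.
by rewrite (_ : g \o _ = id) //; apply/funext => z; exact: gK.
Qed.

HB.instance Definition _ := Measure_isSigmaFinite.Build _ _ _ cons_measure
  cons_measure_sigma_finite.

End cons_measure.

Fixpoint lebesgue_rV (n : nat) : {sigma_finite_measure set 'rV[R]_n -> \bar R} :=
  match n with
  | 0 => \d_(0 : 'rV[R]_0)
  | n'.+1 => cons_measure (lebesgue_rV n')
  end.

End lebesgue_rV.

Arguments lebesgue_rV {R}.

Section euclidean.
Context (R : realType) (n : nat).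
Implicit Types (x z : 'rV[R]_n) (rho : 'M[R]_n).

(* The library norm `|x| on 'rV[R]_n is the sup norm. *)
Definition enorm x : R := Num.sqrt (\sum_(i < n) x ord0 i ^+ 2).

Definition eball x (d : R) : set 'rV[R]_n := [set y | enorm (y - x) <= d].

Definition sphere : set 'rV[R]_n := [set z | enorm z = 1].

Lemma measurable_enorm : measurable_fun [set: 'rV[R]_n] enorm.
Proof.
rewrite (_ : enorm = fun x => (\sum_(i < n) x ord0 i ^+ 2) `^ 2^-1).
  apply: (measurableT_comp (measurable_powR _)).
  by apply: measurable_sum => i; apply: measurable_funX; exact: measurable_coord.
by apply/funext => x; rewrite powR12_sqrt// sumr_ge0// => i _; rewrite sqr_ge0.
Qed.

Lemma measurable_eball0 d : measurable (eball 0 d).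
Proof.
rewrite (_ : eball 0 d = setT `&` enorm @^-1` `]-oo, d]).
  exact: measurable_enorm.
by apply/seteqP; split => x /=; rewrite /eball/= subr0 in_itv/=; [|case].
Qed.

(* Junk value: normalize 0 = 0. *)
Definition normalize x : 'rV[R]_n := (enorm x)^-1 *: x.

Lemma measurable_normalize : measurable_fun setT normalize.
Proof.
apply: measurable_fun_rV => i.
rewrite (_ : (fun _ => _) = (fun x => enorm x `^ (-1) * x ord0 i)); last first.
  by apply/funext => x; rewrite mxE powR_inv1// sqrtr_ge0.
apply: measurable_funM; last exact: measurable_coord.
apply: (measurableT_comp (measurable_powR _)); exact: measurable_enorm.
Qed.

(* Normalized surface measure of the unit sphere as the cone measure
   |{x in B(0,1) : x/|x| in E}| / |B(0,1)|; it is carried by the sphere when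
   0 < n. *)
Definition sphere_measure (E : set 'rV[R]_n) : \bar R :=
  ((fine (lebesgue_rV n (eball 0 1)))^-1%:E *
   lebesgue_rV n (normalize @^-1` E `&` eball 0 1))%E.

Let vol_inv_ge0 : 0 <= (fine (lebesgue_rV n (eball 0 1)))^-1.
Proof. by rewrite invr_ge0 fine_ge0. Qed.

HB.instance Definition _ := Measure.copy sphere_measure
  (mscale (NngNum vol_inv_ge0)
    (measure_function_pushforward__canonical__measure_function_Measure
      (mrestr (lebesgue_rV n) (measurable_eball0 1)) measurable_normalize)).

End euclidean.

Arguments enorm {R n}.
Arguments eball {R n}.
Arguments sphere {R n}.
Arguments sphere_measure {R n}.

Section rough_kernel.
Context (R : realType) (n : nat).
Implicit Types (Omega : 'rV[R]_n -> R) (rho : 'M[R]_n).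

Definition homogeneous0 Omega : Prop :=
  forall (t : R) (x : 'rV[R]_n), 0 < t -> Omega (t *: x) = Omega x.

(* Vectors are rows: rho acts by z |-> z *m rho. *)
Definition rotation rho : Prop := rho *m rho^T = 1%:M /\ \det rho = 1.

Definition rotation_size rho : \bar R :=
  ereal_sup [set (enorm (z *m rho - z))%:E | z in sphere].

Definition integral_modulus (r : R) Omega (delta : R) : \bar R :=
  ereal_sup [set 'N[sphere_measure]_(r%:E)[EFin \o (fun z => Omega (z *m rho) - Omega z)%R]%E
            | rho in [set rho | rotation rho /\ (rotation_size rho < delta%:E)%E]].

End rough_kernel.

Section lipschitz_commutator.
Context (R : realType) (n : nat).
Implicit Types (b a Omega : 'rV[R]_n -> R).

Definition lip_norm (beta : R) b : \bar R :=
  ereal_sup [set (`|b xy.1 - b xy.2| / enorm (xy.1 - xy.2) `^ beta)%:E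
            | xy in [set xy : 'rV[R]_n * 'rV[R]_n | xy.1 != xy.2]].

Definition Lip (beta : R) b : Prop := (lip_norm beta b < +oo)%E.

(* An ordinary integral, not a principal value: if b is in Lip_beta, the factor
   b x - b y makes the kernel O(|Omega (x - y)| |x - y|^(beta - n)), which is
   locally integrable, so that for an atom a the integral converges absolutely
   for almost every x. The null set y = x carries the junk value 0^-1 = 0. *)
Definition commutator b Omega a (x : 'rV[R]_n) : R :=
  \int[lebesgue_rV n]_y
    (Omega (x - y) / enorm (x - y) ^+ n * (b x - b y) * a y).

End lipschitz_commutator.

Section distributions.
Context (R : realType) (n : nat).
Implicit Types (phi psi : 'rV[R]_n -> R).

Definition partial (i : 'I_n) phi : 'rV[R]_n -> R :=
  fun x => 'D_(delta_mx ord0 i) phi x.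

Definition partials (g : seq 'I_n) phi : 'rV[R]_n -> R := foldr partial phi g.

Definition smooth phi : Prop :=
  forall (g : seq 'I_n) (x : 'rV[R]_n), differentiable (partials g phi) x.

Definition test_function phi : Prop :=
  smooth phi /\ exists K : R, forall x, phi x != 0 -> eball 0 K x.

(* A distribution is a functional on all functions of which only the values at
   test functions matter. *)
Definition distribution (f : ('rV[R]_n -> R) -> R) : Prop :=
  (forall (c : R) phi psi, test_function phi -> test_function psi ->
     f (fun x => c * phi x + psi x) = c * f phi + f psi) /\
  (forall K : R, exists (C : R) (N : nat), forall phi (M : R),
     test_function phi -> (forall x, phi x != 0 -> eball 0 K x) ->
     (forall (g : seq 'I_n) x, (size g <= N)%N -> `|partials g phi x| <= M) ->
     `|f phi| <= C * M).

End distributions.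

Section hardy_space.
Context (R : realType) (n : nat).
Implicit Types (p l : R) (s : nat) (f : ('rV[R]_n -> R) -> R).

Local Notation mu := (lebesgue_rV n).

(* (p, l)-atoms with vanishing moments up to order s. *)
Definition atom p l s (a : 'rV[R]_n -> R) : Prop :=
  exists (x0 : 'rV[R]_n) (d : R), 0 < d /\
    [/\ measurable_fun [set: 'rV[R]_n] a,
        forall x, a x != 0 -> eball x0 d x,
        ('N[mu]_(l%:E)[EFin \o a] <= mu (eball x0 d) `^ (l^-1 - p^-1))%E &
        forall gamma : {ffun 'I_n -> nat}, (\sum_i gamma i <= s)%N ->
          \int[mu]_x (a x * \prod_i x ord0 i ^+ gamma i) = 0].

Definition atomic_decomposition p l s f
    (lam : nat -> R) (a : nat -> 'rV[R]_n -> R) : Prop :=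
  [/\ forall j, atom p l s (a j),
      (\sum_(0 <= j <oo) (`|lam j| `^ p)%:E < +oo)%E &
      forall phi, test_function phi ->
        (fun N => \sum_(0 <= j < N) lam j * \int[mu]_x (a j x * phi x)) @ \oo
          --> f phi].

Definition hardy p l s f : Prop :=
  distribution f /\ exists lam a, atomic_decomposition p l s f lam a.

Definition hardy_norm p l s f : \bar R :=
  ereal_inf [set e | exists lam a, atomic_decomposition p l s f lam a /\
    e = ((\sum_(0 <= j <oo) (`|lam j| `^ p)%:E) `^ p^-1)%E].

(* F is [b, T_Omega] f: the series obtained from any atomic decomposition of f
   converges to F almost everywhere; this determines F up to a null set. *)
Definition hardy_commutator (b Omega : 'rV[R]_n -> R) p l s f
    (F : 'rV[R]_n -> R) : Prop :=
  measurable_fun [set: 'rV[R]_n] F /\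
  forall lam a, atomic_decomposition p l s f lam a ->
    {ae mu, forall x,
      (fun N => \sum_(0 <= j < N) lam j * commutator b Omega (a j) x) @ \oo
        --> F x}.

End hardy_space.

(* Main.v *)
(* For p = n/(n + beta) < 1 the quasi-norm of weak L1 is p-convex, so a uniform
   weak L1 bound for [b, T] a over all atoms a sums over an atomic
   decomposition. Writing K for the kernel,
     [b, T] a x = (b x - b x0) (K * a) x - (K * ((b - b x0) a)) x
   for an atom a centred at x0. Near the ball of a the size
   |b x - b y| <= L |x - y|^beta gives an L1 bound. Away from it, the first
   term is in L1 because a has mean zero and K satisfies
   int |K (x - y) - K x| |x|^beta dx = O(|y|^beta), and in the second one the
   same estimate allows to replace K (x - y) by K x, which is in weak L1, while
   (b - b x0) a is bounded in L1.

   The smoothness of K comes from the modulus of Omega under rotations: for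
   fixed x, the points of a small cube around x are, up to dilation, images of
   x under Cayley rotations close to 1, and averaging over the parameters of
   these rotations bounds translations of Omega by rotations.

   The sum does not depend on the decomposition. Replace K by an integrable
   truncation K_m. Pairing the sum with a bounded compactly supported h is
   pairing f with the dual function int K_m (x - y) (b x - b y) h x dx, which
   is Lipschitz of order beta with compact support in y. Such a function is
   approximated by test functions which are bounded in Lip_beta and converge
   uniformly, so its pairing with f is determined by f. Hence the sums for K_m
   agree almost everywhere, and m -> oo is controlled by the weak L1 bound for
   the tails of the series. *)
Require Import Defs.
From mathcomp Require Import all_boot all_order all_algebra.
From mathcomp Require Import all_classical all_reals all_analysis measurable_realfun.
From mathcomp Require Import ring lra zify.

Set Implicit Arguments.
Unset Strict Implicit.
Unset Printing Implicit Defensive.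
Import Order.TTheory GRing.Theory Num.Theory.
Import numFieldNormedType.Exports.

Local Open Scope classical_set_scope.
Local Open Scope ring_scope.

(** * Euclidean space and dyadic cells *)

(** The rotation that carries x to x - y up to dilation depends on x, whereas the modulus takes its
    supremum over rotations outside the integral. Averaging over intermediate points removes this
    dependence: once a parameter is fixed, one rotation acts on all x. The averaging cube is
    compared with the parameter box without a Jacobian and without injectivity; it is enough that
    each small dyadic cell contains the image of a box of comparable volume. The weight |x|^beta
    costs 2^(beta k) on the shell where the translation has relative size 2^-k, and the Dini
    integral bounds exactly the sum of 2^(beta k) times the modulus at 2^-k. A distribution is known
    only through its values at test functions, while the commutator is a sum over a decomposition.
    To compare two such sums, all kernel bounds are proved for the kernel times an arbitrary radial
    cutoff, with constants independent of the cutoff. The truncations thus share one weak bound;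
    their L1 norms, for which no uniform bound is claimed, are used only at fixed m. *)

Section euclidean_norm.
Context (R : realType) (n : nat).
Implicit Types (x y : 'rV[R]_n) (c : R).

Definition dotrv x y : R := \sum_(i < n) x ord0 i * y ord0 i.

Lemma dotrvC x y : dotrv x y = dotrv y x.
Proof. by apply: eq_bigr => i _; rewrite mulrC. Qed.

Lemma dotrvDl x y z : dotrv (x + y) z = dotrv x z + dotrv y z.
Proof. by rewrite -big_split; apply: eq_bigr => i _; rewrite mxE mulrDl. Qed.

Lemma dotrvZl c x y : dotrv (c *: x) y = c * dotrv x y.
Proof. by rewrite /dotrv mulr_sumr; apply: eq_bigr => i _; rewrite mxE mulrA. Qed.

Lemma dotrvNl x y : dotrv (- x) y = - dotrv x y.
Proof. by rewrite -scaleN1r dotrvZl mulN1r. Qed.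

Lemma dotrvDr x y z : dotrv x (y + z) = dotrv x y + dotrv x z.
Proof. by rewrite dotrvC dotrvDl !(dotrvC x). Qed.

Lemma dotrvZr c x y : dotrv x (c *: y) = c * dotrv x y.
Proof. by rewrite dotrvC dotrvZl dotrvC. Qed.

Lemma dotrvNr x y : dotrv x (- y) = - dotrv x y.
Proof. by rewrite dotrvC dotrvNl dotrvC. Qed.

Lemma dotrvv_ge0 x : 0 <= dotrv x x.
Proof. by apply: sumr_ge0 => i _; rewrite -expr2 sqr_ge0. Qed.

Lemma enormE x : enorm x = Num.sqrt (dotrv x x).
Proof. by congr Num.sqrt; apply: eq_bigr => i _; rewrite expr2. Qed.

Lemma enorm_sqr x : enorm x ^+ 2 = dotrv x x.
Proof. by rewrite enormE sqr_sqrtr// dotrvv_ge0. Qed.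

Lemma enorm_ge0 x : 0 <= enorm x. Proof. exact: sqrtr_ge0. Qed.

Lemma ler_coord_enorm x i : `|x ord0 i| <= enorm x.
Proof.
rewrite -sqrtr_sqr ler_sqrt ?sumr_ge0// => [|j _]; last exact: sqr_ge0.
by rewrite (bigD1 i)//= lerDl sumr_ge0// => j _; rewrite sqr_ge0.
Qed.

Lemma enorm_eq0 x : (enorm x == 0) = (x == 0).
Proof.
apply/eqP/eqP => [x0|->].
  apply/rowP => i; rewrite mxE; apply/eqP; rewrite -normr_le0 -x0.
  exact: ler_coord_enorm.
by rewrite enormE /dotrv big1 ?sqrtr0// => i _; rewrite mxE mul0r.
Qed.

Lemma enorm0 : enorm (0 : 'rV[R]_n) = 0. Proof. by apply/eqP; rewrite enorm_eq0. Qed.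

Lemma enorm_gt0 x : (0 < enorm x) = (x != 0).
Proof. by rewrite lt_def enorm_eq0 enorm_ge0 andbT. Qed.

Lemma enormZ c x : enorm (c *: x) = `|c| * enorm x.
Proof.
by rewrite !enormE dotrvZl dotrvZr mulrA sqrtrM -?expr2 ?sqr_ge0// sqrtr_sqr.
Qed.

Lemma enormN x : enorm (- x) = enorm x.
Proof. by rewrite -scaleN1r enormZ normrN normr1 mul1r. Qed.

Lemma enormBC x y : enorm (x - y) = enorm (y - x).
Proof. by rewrite -enormN opprB. Qed.

(** Cauchy-Schwarz, from the square of |y| x - |x| y; the zero vectors are split off so that |x| |y|
    can be cancelled. *)
Lemma ler_dotrv x y : dotrv x y <= enorm x * enorm y.
Proof.
have [->|x0] := eqVneq x 0; first by rewrite enorm0 mul0r dotrvC /dotrv big1// => i _; rewrite mxE mulr0.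
have [->|y0] := eqVneq y 0; first by rewrite enorm0 mulr0 /dotrv big1// => i _; rewrite mxE mulr0.
have ex : 0 < enorm x by rewrite enorm_gt0.
have ey : 0 < enorm y by rewrite enorm_gt0.
have := dotrvv_ge0 (enorm y *: x - enorm x *: y).
rewrite dotrvDl !dotrvDr !dotrvNl !dotrvNr !dotrvZl !dotrvZr -!enorm_sqr (dotrvC y x).
have e0 : 0 < enorm x * enorm y by rewrite mulr_gt0.
move=> h; rewrite -(ler_pM2l e0).
nra.
Qed.

Lemma enormD x y : enorm (x + y) <= enorm x + enorm y.
Proof.
rewrite -(@ler_pXn2r _ 2)// ?nnegrE ?addr_ge0 ?enorm_ge0//.
rewrite sqrrD !enorm_sqr dotrvDl !dotrvDr (dotrvC y x).
have := ler_dotrv x y; lra.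
Qed.

Lemma enormB x y : enorm (x - y) <= enorm x + enorm y.
Proof. by rewrite -(enormN y) enormD. Qed.

Lemma enorm_distD z x y : enorm (x - y) <= enorm (x - z) + enorm (z - y).
Proof. by rewrite (_ : x - y = (x - z) + (z - y)) ?enormD// addrA subrK. Qed.

Lemma enorm_dist x y : `|enorm x - enorm y| <= enorm (x - y).
Proof.
rewrite ler_norml; apply/andP; split.
  have := enormD x (y - x); rewrite addrC subrK enormBC; lra.
have := enormD y (x - y); rewrite addrC subrK; lra.
Qed.

Lemma enorm_le_sum x : enorm x <= \sum_(i < n) `|x ord0 i|.
Proof.
rewrite -(@ler_pXn2r _ 2)// ?nnegrE ?enorm_ge0 ?sumr_ge0// enorm_sqr expr2 mulr_suml.
apply: ler_sum => i _; apply: (le_trans (ler_norm _)); rewrite normrM ler_wpM2l//.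
by rewrite (bigD1 i)//= lerDl sumr_ge0.
Qed.

Lemma enorm_le_sup x M : (forall i, `|x ord0 i| <= M) -> enorm x <= n%:R * M.
Proof.
move=> h; apply: (le_trans (enorm_le_sum x)).
apply: (@le_trans _ _ (\sum_(i < n) M)); first exact: ler_sum.
by rewrite sumr_const card_ord mulr_natl.
Qed.

End euclidean_norm.

Section measurability_rV.
Context (R : realType) (n : nat).

Lemma measurable_fun_coord d (T : measurableType d) (f : T -> 'rV[R]_n) i :
  measurable_fun setT f -> measurable_fun setT (fun t => f t ord0 i).
Proof. by move=> mf; exact: (measurableT_comp (@measurable_coord R n i)). Qed.

Lemma measurable_funD_rV d (T : measurableType d) (f g : T -> 'rV[R]_n) :
  measurable_fun setT f -> measurable_fun setT g ->
  measurable_fun setT (fun t => f t + g t).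
Proof.
move=> mf mg; apply: measurable_fun_rV => i.
rewrite (_ : (fun _ => _) = (fun t => f t ord0 i + g t ord0 i)); last first.
  by apply/funext => t; rewrite mxE.
by apply: measurable_funD; exact: measurable_fun_coord.
Qed.

Lemma measurable_funZ_rV d (T : measurableType d) (c : T -> R) (f : T -> 'rV[R]_n) :
  measurable_fun setT c -> measurable_fun setT f ->
  measurable_fun setT (fun t => c t *: f t).
Proof.
move=> mc mf; apply: measurable_fun_rV => i.
rewrite (_ : (fun _ => _) = (fun t => c t * f t ord0 i)); last first.
  by apply/funext => t; rewrite mxE.
by apply: measurable_funM => //; exact: measurable_fun_coord.
Qed.

Lemma measurable_funN_rV d (T : measurableType d) (f : T -> 'rV[R]_n) :
  measurable_fun setT f -> measurable_fun setT (fun t => - f t).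
Proof.
move=> mf; rewrite (_ : (fun _ => _) = (fun t => -1 *: f t)); last first.
  by apply/funext => t; rewrite scaleN1r.
exact: measurable_funZ_rV.
Qed.

Lemma measurable_funB_rV d (T : measurableType d) (f g : T -> 'rV[R]_n) :
  measurable_fun setT f -> measurable_fun setT g ->
  measurable_fun setT (fun t => f t - g t).
Proof. by move=> mf mg; apply: measurable_funD_rV => //; exact: measurable_funN_rV. Qed.

Lemma measurable_fun_enorm d (T : measurableType d) (f : T -> 'rV[R]_n) :
  measurable_fun setT f -> measurable_fun setT (fun t => enorm (f t)).
Proof. by move=> mf; exact: (measurableT_comp (@measurable_enorm R n)). Qed.

Lemma measurable_mulmx (rho : 'M[R]_n) : measurable_fun setT (fun x : 'rV[R]_n => x *m rho).
Proof.
apply: measurable_fun_rV => i.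
rewrite (_ : (fun _ => _) = (fun x : 'rV[R]_n => \sum_j x ord0 j * rho j i)); last first.
  by apply/funext => t; rewrite mxE.
apply: measurable_sum => j; apply: measurable_funM => //; exact: measurable_coord.
Qed.

End measurability_rV.

(** * Half-open boxes and the affine behaviour of Lebesgue measure *)

Section boxes.
Context (R : realType).

Definition rbox n (a b : 'rV[R]_n) : set 'rV[R]_n :=
  [set x | forall i, a ord0 i <= x ord0 i < b ord0 i].

Lemma rboxE n (a b : 'rV[R]_n) : rbox a b =
  \bigcap_(i in [set: 'I_n]) ((fun x : 'rV[R]_n => x ord0 i) @^-1` `[a ord0 i, b ord0 i[).
Proof.
apply/seteqP; split => x /= h i; first by move=> _ /=; rewrite in_itv/=; exact: h.
by have := h i I; rewrite /= in_itv.
Qed.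

Lemma measurable_rbox n (a b : 'rV[R]_n) : measurable (rbox a b).
Proof.
rewrite rboxE; apply: fin_bigcap_measurable => // i _.
by rewrite -[X in measurable X]setTI; exact: measurable_coord.
Qed.

Lemma row_mx_lift n (c : 'rV[R]_1) (x : 'rV[R]_n) (j : 'I_n) :
  row_mx c x ord0 (lift ord0 j) = x ord0 j.
Proof.
by rewrite -[lift _ _](_ : rshift 1 j = _) ?row_mxEr//; exact/val_inj.
Qed.

Lemma row_mx_0 n (c : 'rV[R]_1) (x : 'rV[R]_n) :
  row_mx c x ord0 ord0 = c ord0 ord0.
Proof.
transitivity (row_mx c x ord0 (lshift n ord0)); last by rewrite row_mxEl.
by congr (row_mx _ _ _ _); exact/val_inj.
Qed.

Lemma lebesgue_rbox n (a b : 'rV[R]_n) : (forall i, a ord0 i <= b ord0 i) ->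
  lebesgue_rV n (rbox a b) = (\prod_i (b ord0 i - a ord0 i))%:E.
Proof.
elim: n a b => [|n IH] a b ab.
  by rewrite /= /rbox diracE mem_set ?big_ord0//= => -[].
rewrite /= /cons_measure /pushforward.
have -> : @cons_rV R n @^-1` rbox a b =
    (`[a ord0 ord0, b ord0 ord0[%classic : set (measurableTypeR R)) `*`
    rbox (\row_j a ord0 (lift ord0 j)) (\row_j b ord0 (lift ord0 j)).
  apply/seteqP; split => -[t x] /=.
    move=> h; split; first by have := h ord0; rewrite row_mx_0 mxE/= in_itv.
    by move=> j; have := h (lift ord0 j); rewrite row_mx_lift/= !mxE.
  move=> [/=]; rewrite in_itv/= => h0 h i.
  case: (unliftP ord0 i) => [j|] ->; last by rewrite row_mx_0 mxE.
  by move: (h j); rewrite /cons_rV (row_mx_lift _ x j) !mxE.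
rewrite product_measure1E; [|exact: measurable_itv|exact: measurable_rbox].
rewrite IH => [|i]; last by rewrite !mxE.
have E : lebesgue_measure (`[a ord0 ord0, b ord0 ord0[%classic : set R) =
    (b ord0 ord0 - a ord0 ord0)%:E.
  rewrite lebesgue_measure_itv/= lte_fin; case: ltP => // h.
  by rewrite (_ : b ord0 ord0 = a ord0 ord0) ?subrr//; apply/eqP; rewrite eq_le h ab.
rewrite big_ord_recl EFinM; congr (_ * _)%E; first exact: E.
by congr (_ %:E); apply: eq_bigr => i _; rewrite !mxE.
Qed.

Lemma lebesgue_rbox_neg n (a b : 'rV[R]_n) i : b ord0 i < a ord0 i -> rbox a b = set0.
Proof.
move=> ba; rewrite -subset0 => x /(_ i) /andP[h1 h2].
by have := lt_trans (le_lt_trans h1 h2) ba; rewrite ltxx.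
Qed.

Definition rboxes n : set (set 'rV[R]_n) := [set A | exists a b, A = rbox a b].

Lemma rboxes_setI n : setI_closed (@rboxes n).
Proof.
move=> _ _ [a [b ->]] [a' [b' ->]].
exists (\row_i Num.max (a ord0 i) (a' ord0 i)), (\row_i Num.min (b ord0 i) (b' ord0 i)).
apply/seteqP; split => x /=.
  by move=> [h h'] i; rewrite !mxE ge_max lt_min; move: (h i) (h' i) => /andP[-> ->] /andP[-> ->].
by move=> h; split => i; move: (h i); rewrite !mxE ge_max lt_min =>
  /andP[/andP[h1 h2] /andP[h3 h4]]; apply/andP.
Qed.

Lemma bigcup_rbox n : \bigcup_k (rbox (const_mx (- k%:R)) (const_mx k%:R) : set 'rV[R]_n) = setT.
Proof.
rewrite -subTset => x _; exists (Num.truncn (\sum_i `|x ord0 i|)).+1 => // i.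
rewrite !mxE.
have h : `|x ord0 i| < (Num.truncn (\sum_i `|x ord0 i|)).+1%:R.
  apply: (@le_lt_trans _ _ (\sum_i `|x ord0 i|)).
    by rewrite (bigD1 i)//= lerDl sumr_ge0.
  by rewrite truncnS_gt.
by move: h; rewrite ltr_norml => /andP[/ltW -> ->].
Qed.

(** For the harder inclusion the coordinates must be measurable for the sigma-algebra of boxes: the
    half-space x_i >= c is the union over k of boxes that start at c in direction i and are cut off
    at k or -k otherwise. *)
Lemma measurable_rboxesE n :
  @measurable _ 'rV[R]_n = <<s @rboxes n >>.
Proof.
apply/seteqP; split => [A mA|A]; last first.
  apply: smallest_sub; first exact: sigma_algebra_measurable.
  by move=> _ [a [b ->]]; exact: measurable_rbox.
have mcoord (i : 'I_n) :
    measurable_fun (setT : set (g_sigma_algebraType (@rboxes n)))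
      (fun x : 'rV[R]_n => x ord0 i).
  apply: (measurability _ (RGenCInfty.measurableE R)) => _ [_ [c ->] <-].
  rewrite setTI.
  have -> : (fun x : 'rV[R]_n => x ord0 i) @^-1` `[c, +oo[ =
    \bigcup_k (rbox (\row_j (if j == i then c else - k%:R)) (const_mx k%:R) : set 'rV[R]_n).
    apply/seteqP; split => x /=.
      rewrite in_itv/= andbT => cx.
      have : setT x by [].
      rewrite -bigcup_rbox => -[k _ hk]; exists k => // j.
      have := hk j; rewrite !mxE => /andP[h ->]; rewrite andbT.
      by case: eqP => // ->.
    by move=> [k _ /(_ i)]; rewrite !mxE eqxx in_itv/= andbT => /andP[].
  apply: bigcup_measurable => k _; apply: sub_sigma_algebra.
  by eexists; eexists; reflexivity.
have := @measurable_fun_rV R n _ (g_sigma_algebraType (@rboxes n)) id mcoord measurableT A mA.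
by rewrite setTI.
Qed.

(** Boxes form a generating pi-system, and the space is exhausted by boxes of finite measure. Boxes
    with reversed sides are empty, so the product formula is asked only for ordered corners. *)
Lemma lebesgue_rV_unique n (m : {measure set 'rV[R]_n -> \bar R}) :
  (forall a b : 'rV[R]_n, (forall i, a ord0 i <= b ord0 i) ->
    m (rbox a b) = (\prod_i (b ord0 i - a ord0 i))%:E) ->
  forall A, measurable A -> m A = lebesgue_rV n A.
Proof.
move=> hm A mA.
apply: (measure_unique (@rboxes n) (fun k => rbox (const_mx (- k%:R)) (const_mx k%:R))).
- exact: measurable_rboxesE.
- exact: rboxes_setI.
- by move=> k; do 2 eexists; reflexivity.
- exact: bigcup_rbox.
- move=> _ [a [b ->]].
  have [ab|] := pselect (forall i, a ord0 i <= b ord0 i); first by rewrite hm//; exact/esym/lebesgue_rbox.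
  move=> /existsNP[i /negP]; rewrite -ltNge => ba.
  by rewrite (lebesgue_rbox_neg ba) !measure0.
- move=> k; rewrite hm ?ltry// => i; rewrite !mxE; exact: (@le_trans _ _ 0).
- exact: mA.
Qed.

Lemma measurable_affine n (s : R) (c : 'rV[R]_n) :
  measurable_fun setT (fun x : 'rV[R]_n => s *: x + c).
Proof. by apply: measurable_funD_rV => //; exact: measurable_funZ_rV. Qed.

(** Multiplied by s^n, the pushforward under the affine map gives every box its volume, so it is
    Lebesgue measure by uniqueness. *)
Lemma lebesgue_affine n (s : R) (c : 'rV[R]_n) A : 0 < s -> measurable A ->
  lebesgue_rV n ((fun x : 'rV[R]_n => s *: x + c) @^-1` A) =
  (((s^-1) ^+ n)%:E * lebesgue_rV n A)%E.
Proof.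
move=> s0 mA; have sn : 0 <= s ^+ n by rewrite exprn_ge0// ltW.
pose m1 := measure_function_pushforward__canonical__measure_function_Measure
  (lebesgue_rV n) (measurable_affine s c).
have := @lebesgue_rV_unique n (mscale (NngNum sn) m1) _ A mA.
rewrite /mscale/= /pushforward => <- => [|a b ab].
  by rewrite muleA -EFinM -exprMn mulVf ?gt_eqF// expr1n mul1e.
rewrite /mscale/= /pushforward.
have -> : (fun x : 'rV[R]_n => s *: x + c) @^-1` rbox a b =
    rbox (s^-1 *: (a - c)) (s^-1 *: (b - c)).
  apply/seteqP; split => x /= h i; have := h i; rewrite !mxE.
    by rewrite ler_pdivrMl// ltr_pdivlMl// lerBlDr ltrBrDr.
  by rewrite ler_pdivrMl// ltr_pdivlMl// lerBlDr ltrBrDr.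
rewrite lebesgue_rbox => [|i]; last first.
  by rewrite !mxE ler_pM2l ?invr_gt0// lerD2r.
rewrite -EFinM; congr (_ %:E).
rewrite -[in s ^+ n](card_ord n) -prodr_const -big_split/=; apply: eq_bigr => i _.
rewrite !mxE -mulrBr mulrA divff ?gt_eqF// mul1r; ring.
Qed.

Lemma ge0_integral_affine n (s : R) (c : 'rV[R]_n) D (f : 'rV[R]_n -> \bar R) :
  0 < s -> measurable D -> measurable_fun D f -> (forall x, D x -> (0 <= f x)%E) ->
  (\int[lebesgue_rV n]_(x in (fun x => (s *: x + c)%R) @^-1` D) f (s *: x + c)%R =
   ((s^-1) ^+ n)%:E * \int[lebesgue_rV n]_(x in D) f x)%E.
Proof.
move=> s0 mD mf f0; have sn : 0 <= s^-1 ^+ n by rewrite exprn_ge0// invr_ge0 ltW.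
rewrite -(@ge0_integral_pushforward _ _ _ _ _ _ (measurable_affine s c) (lebesgue_rV n))//; last first.
  by move=> x /set_mem; exact: f0.
rewrite -(@ge0_integral_mscale _ _ _ (lebesgue_rV n) D mD (NngNum sn) f mf f0).
apply: eq_measure_integral => [|? A mA _] /=; first exact: measurable_affine.
by rewrite /mscale/= -(lebesgue_affine c s0 mA).
Qed.

End boxes.

(** * Dyadic cells and the comparison of finite measures *)

Section dyadic.
Context (R : realType) (n : nat).

Definition dyadic_index (k : nat) (x : 'rV[R]_n) : 'rV[int]_n :=
  \row_i Num.floor (2 ^+ k * x ord0 i).

Definition dyadic_cell (k : nat) (d : 'rV[int]_n) : set 'rV[R]_n :=
  [set x | dyadic_index k x = d].

Lemma dyadic_cellE k d : dyadic_cell k d =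
  rbox (\row_i ((d ord0 i)%:~R / 2 ^+ k)) (\row_i ((d ord0 i + 1)%:~R / 2 ^+ k)).
Proof.
have p0 : 0 < 2 ^+ k :> R by rewrite exprn_gt0.
apply/seteqP; split => x /=.
  move=> <- i; rewrite !mxE ler_pdivrMr// ltr_pdivlMr// [x ord0 i * _]mulrC.
  exact: floor_itv.
move=> h; apply/rowP => i; rewrite mxE; have := h i; rewrite !mxE.
by rewrite ler_pdivrMr// ltr_pdivlMr// [x ord0 i * _]mulrC => /floor_def.
Qed.

Lemma measurable_dyadic_cell k d : measurable (dyadic_cell k d).
Proof. by rewrite dyadic_cellE; exact: measurable_rbox. Qed.

(** Integer vectors are countable: [pickle] numbers the cells, and numbers that code no cell of D
    contribute the empty set. *)
Lemma dyadic_preimage_bigcup k (D : set 'rV[int]_n) : exists F : (set 'rV[R]_n)^nat,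
  [/\ dyadic_index k @^-1` D = \bigcup_m F m, trivIset setT F &
    forall m, F m = set0 \/ exists d, F m = dyadic_cell k d].
Proof.
pose F m : set 'rV[R]_n := [set x | D (dyadic_index k x) /\
   pickle (dyadic_index k x) = m].
exists F; split.
- by apply/seteqP; split => [x Dx|x [m _ []//]]; exists (pickle (dyadic_index k x)).
- by move=> i j _ _ [x [[_ <-] [_ <-]]].
- move=> m; have [[x [Dx xm]]|h] := pselect (exists x, F m x).
    right; exists (dyadic_index k x); apply/seteqP; split => y /=.
      by move=> [_]; rewrite -xm => /(pcan_inj (@pickleK _)).
    by rewrite /F /dyadic_cell/= => ->.
  by left; rewrite -subset0 => x Fx; apply: h; exists x.
Qed.

Lemma measurable_dyadic_preimage k D : measurable (dyadic_index k @^-1` D).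
Proof.
have [F [-> _ hF]] := dyadic_preimage_bigcup k D.
apply: bigcup_measurable => m _; have [->//|[d ->]] := hF m.
exact: measurable_dyadic_cell.
Qed.

(** The generations are nested because m <= floor (2^k z) is equivalent to m 2^(k' - k) <= floor
    (2^k' z), so the finer floor determines the coarser one. *)
Lemma dyadic_index_coarse k k' x y : (k <= k')%N ->
  dyadic_index k' x = dyadic_index k' y -> dyadic_index k x = dyadic_index k y.
Proof.
move=> kk' h; apply/rowP => i; rewrite !mxE.
have {}h : Num.floor (2 ^+ k' * x ord0 i) = Num.floor (2 ^+ k' * y ord0 i).
  by move/rowP : h => /(_ i); rewrite !mxE.
have key (z : 'rV[R]_n) (m : int) :
    (m <= Num.floor (2 ^+ k * z ord0 i)) =
    (m * 2 ^+ (k' - k) <= Num.floor (2 ^+ k' * z ord0 i)).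
  rewrite !floor_ge_int rmorphM rmorphXn/= -{2}(subnK kk') exprD.
  by rewrite [m%:~R * _]mulrC -mulrA ler_pM2l// exprn_gt0.
by apply/eqP; rewrite eq_le key -h -key lexx key h -key lexx.
Qed.

Lemma dyadic_preimage_fine k k' (D : set 'rV[int]_n) : (k <= k')%N ->
  exists D', dyadic_index k @^-1` D = dyadic_index k' @^-1` D'.
Proof.
move=> kk'; exists (dyadic_index k' @` (dyadic_index k @^-1` D)).
apply/seteqP; split => [x Dx|x [y Dy yx]]; first by exists x.
by rewrite /preimage/= -(dyadic_index_coarse kk' yx).
Qed.

Lemma mono_measure (m : {measure set 'rV[R]_n -> \bar R}) A B :
  measurable A -> measurable B -> A `<=` B -> (m A <= m B)%E.
Proof. by move=> mA mB AB; apply: le_measure; rewrite ?inE. Qed.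

Section approximation.
Variables (m : {measure set 'rV[R]_n -> \bar R}) (k0 : nat).
Hypothesis mfin : (m setT < +oo)%E.

(** The generation has to be at least [k0] because the measures will be compared only on
    sufficiently small cells. *)
Definition dyadic_approx : set (set 'rV[R]_n) := [set S | measurable S /\
  forall e : R, 0 < e -> exists k D, [/\ (k0 <= k)%N,
   (m (S `\` dyadic_index k @^-1` D) < e%:E)%E &
   (m (dyadic_index k @^-1` D `\` S) < e%:E)%E]].

Lemma dyadic_approx_exact k D : (k0 <= k)%N -> dyadic_approx (dyadic_index k @^-1` D).
Proof.
move=> k0k; split; first exact: measurable_dyadic_preimage.
by move=> e e0; exists k, D; rewrite setDv measure0 lte_fin e0.
Qed.

Lemma dyadic_approxC S : dyadic_approx S -> dyadic_approx (~` S).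
Proof.
move=> [mS h]; split; first exact: measurableC.
move=> e /h[k [D [k0k h1 h2]]]; exists k, (~` D); split => //.
  by rewrite preimage_setC setDE setCK setIC -setDE.
by rewrite preimage_setC setDE setCK setIC -setDE.
Qed.

Lemma dyadic_approxU S T : dyadic_approx S -> dyadic_approx T -> dyadic_approx (S `|` T).
Proof.
move=> [mS hS] [mT hT]; split; first exact: measurableU.
move=> e e0; have e20 : 0 < e / 2 by rewrite divr_gt0.
have [k [D [k0k h1 h2]]] := hS _ e20; have [k' [D' [k0k' h1' h2']]] := hT _ e20.
have [E EE] := @dyadic_preimage_fine k (maxn k k') D (leq_maxl _ _).
have [E' EE'] := @dyadic_preimage_fine k' (maxn k k') D' (leq_maxr _ _).
exists (maxn k k'), (E `|` E'); rewrite preimage_setU -EE -EE'.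
have mD := measurable_dyadic_preimage k D; have mD' := measurable_dyadic_preimage k' D'.
split; first by rewrite leq_max k0k.
  apply: (@le_lt_trans _ _ (m ((S `\` dyadic_index k @^-1` D) `|` (T `\` dyadic_index k' @^-1` D')))).
    apply: mono_measure; [| |].
    - by apply: measurableD; exact: measurableU.
    - by apply: measurableU; exact: measurableD.
    - by move=> x [[Sx|Tx] /not_orP[? ?]]; [left|right].
  apply: (le_lt_trans (measureU2 _ _ _)); [exact: measurableD|exact: measurableD|].
  by rewrite (splitr e) EFinD lteD.
apply: (@le_lt_trans _ _ (m ((dyadic_index k @^-1` D `\` S) `|` (dyadic_index k' @^-1` D' `\` T)))).
  apply: mono_measure; [| |].
  - by apply: measurableD; exact: measurableU.
  - by apply: measurableU; exact: measurableD.
  - by move=> x [[Sx|Tx] /not_orP[? ?]]; [left|right].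
apply: (le_lt_trans (measureU2 _ _ _)); [exact: measurableD|exact: measurableD|].
by rewrite (splitr e) EFinD lteD.
Qed.

(** Finiteness of [m] gives continuity from above, so some finite partial union misses less than e/2
    of the whole; that partial union is then approximated by cells. *)
Lemma dyadic_approx_bigcup (S : (set 'rV[R]_n)^nat) :
  (forall i, dyadic_approx (S i)) -> dyadic_approx (\bigcup_i S i).
Proof.
move=> hS; have mS i : measurable (S i) by have [] := hS i.
have mbS : measurable (\bigcup_i S i) by exact: bigcup_measurable.
have hU N : dyadic_approx (\big[setU/set0]_(i < N) S i).
  elim: N => [|N IH]; last by rewrite big_ord_recr/=; exact: dyadic_approxU.
  by rewrite big_ord0 -(preimage_set0 (dyadic_index k0)); exact: dyadic_approx_exact.
have mU N : measurable (\big[setU/set0]_(i < N) S i) by have [] := hU N.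
split => // e e0; have e20 : 0 < e / 2 by rewrite divr_gt0.
pose F N := \bigcup_i S i `\` \big[setU/set0]_(i < N) S i.
have cvF : m \o F @ \oo --> m (\bigcap_N F N).
  apply: nonincreasing_cvg_mu.
  - by apply: le_lt_trans mfin; apply: mono_measure => //; exact: measurableD.
  - by move=> i; exact: measurableD.
  - by apply: bigcap_measurable => // i _; exact: measurableD.
  - move=> i j ij; apply/subsetPset => x [Sx nU]; split => // hx; apply: nU.
    by move: x {Sx} hx; exact: subset_bigsetU.
have F0 : \bigcap_N F N = set0.
  rewrite -subset0 => x hx; have [[i _ Six] _] := hx 0%N I.
  have [_] := hx i.+1 I; apply; rewrite big_ord_recr/=; by right.
rewrite F0 measure0 in cvF.
have [N hN] : exists N, (m (F N) < (e / 2)%:E)%E.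
  have : \forall N \near \oo, (m (F N) < (e / 2)%:E)%E.
    apply: (cvF [set u | (u < (e / 2)%:E)%E]); apply: open_ereal_lt'.
    by rewrite lte_fin.
  by move=> [N _ hN]; exists N; exact: hN (leqnn N).
have [_ /(_ _ e20)[k [D [k0k h1 h2]]]] := hU N.
have mD := measurable_dyadic_preimage k D.
exists k, D; split => //.
  apply: (@le_lt_trans _ _ (m (F N `|` (\big[setU/set0]_(i < N) S i `\` dyadic_index k @^-1` D)))).
    apply: mono_measure; [exact: measurableD| |].
      by apply: measurableU; exact: measurableD.
    move=> x [Sx Dx]; have [Ux|Ux] := pselect ((\big[setU/set0]_(i < N) S i) x).
      by right.
    by left.
  apply: (le_lt_trans (measureU2 _ _ _)); [exact: measurableD|exact: measurableD|].
  by rewrite (splitr e) EFinD lteD.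
apply: (@le_lt_trans _ _ (m (dyadic_index k @^-1` D `\` \big[setU/set0]_(i < N) S i))).
  apply: mono_measure; [exact: measurableD|exact: measurableD|].
  move=> x [Dx Sx]; split => // Ux; apply: Sx.
  move: Ux; rewrite -bigcup_mkord => -[i _ Six]; by exists i.
by apply: (lt_trans h2); rewrite lte_fin ltr_pdivrMr// ltr_pMr// ltr1n.
Qed.

Lemma dyadic_approx_sigma : sigma_algebra setT dyadic_approx.
Proof.
split.
- by rewrite -(preimage_set0 (dyadic_index k0)); exact: dyadic_approx_exact.
- by move=> A hA; rewrite setTD; exact: dyadic_approxC.
- exact: dyadic_approx_bigcup.
Qed.

Lemma dyadic_approx_measurable S : measurable S -> dyadic_approx S.
Proof.
suff : g_sigma_preimage (@rV_coord R n) `<=` dyadic_approx by apply.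
apply: smallest_sub; first exact: dyadic_approx_sigma.
rewrite -bigcup_seq/= => B [i _ [C mC <-]] /=; rewrite setTI.
have [s0 sC sU] := dyadic_approx_sigma.
suff : @measurable _ (measurableTypeR R) `<=` [set C | dyadic_approx (rV_coord i @^-1` C)] by apply.
rewrite RGenCInfty.measurableE; apply: smallest_sub.
  split => /=.
  - by rewrite preimage_set0.
  - by move=> A hA; rewrite setTD preimage_setC; exact: dyadic_approxC.
  - by move=> F hF; rewrite preimage_bigcup; exact: sU.
move=> _ [c ->] /=.
(* The complement x_i < c is exhausted by cells of generation at least [k0] whose upper face does
   not exceed c. *)
have -> : rV_coord i @^-1` `[c, +oo[ = ~` \bigcup_k
    (dyadic_index (k0 + k) @^-1` [set d : 'rV[int]_n | (d ord0 i + 1)%:~R <= 2 ^+ (k0 + k) * c]).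
  apply/seteqP; split => x /=.
    rewrite in_itv/= andbT /rV_coord => cx [k _ /=]; rewrite mxE => h.
    have p0 : 0 < 2 ^+ (k0 + k) :> R by rewrite exprn_gt0.
    have := floorD1_gt (2 ^+ (k0 + k) * x ord0 i).
    by rewrite ltNge => /negP; apply; apply: (le_trans h); rewrite ler_pM2l.
  rewrite in_itv/= andbT /rV_coord => hx; rewrite leNgt; apply/negP => xc; apply: hx.
  (* A generation whose side is below c - x_i, so that the cell of x stays below c. *)
  pose k := (Num.truncn (c - x ord0 i)^-1).+1.
  exists k => //=; rewrite mxE.
  have hk : (c - x ord0 i)^-1 < 2 ^+ (k0 + k).
    apply: (@lt_le_trans _ _ k%:R); first exact: truncnS_gt.
    rewrite -natrX ler_nat (leq_trans (ltnW (ltn_expl k (ltnSn 1))))//.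
    by rewrite leq_exp2l// leq_addl.
  rewrite intrD; apply: (@le_trans _ _ (2 ^+ (k0 + k) * x ord0 i + 1)).
    by rewrite lerD2r floor_le.
  rewrite -lerBrDl -mulrBr -ler_pdivrMr ?subr_gt0// mul1r; exact: ltW.
apply: dyadic_approxC; apply: dyadic_approx_bigcup => k.
by apply: dyadic_approx_exact; rewrite leq_addr.
Qed.

End approximation.

(* The sets that are unions of dyadic cells of one generation form an algebra
   that approximates every Borel set, so comparing two finite measures on small
   cells is enough. *)
Lemma dyadic_measure_le (nu kap : {measure set 'rV[R]_n -> \bar R}) (C : R) (k0 : nat) :
  0 <= C -> (nu setT < +oo)%E -> (kap setT < +oo)%E ->
  (forall k d, (k0 <= k)%N -> nu (dyadic_cell k d) <= C%:E * kap (dyadic_cell k d))%E ->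
  forall S, measurable S -> (nu S <= C%:E * kap S)%E.
Proof.
move=> C0 nufin kapfin h S mS.
have hD k D : (k0 <= k)%N ->
    (nu (dyadic_index k @^-1` D) <= C%:E * kap (dyadic_index k @^-1` D))%E.
  move=> k0k; have [F [-> tF hF]] := dyadic_preimage_bigcup k D.
  have mF i : measurable (F i).
    by have [->//|[d ->]] := hF i; exact: measurable_dyadic_cell.
  rewrite !measure_bigcup// -nneseriesZl//; apply: lee_nneseries => // i _.
  by have [->|[d ->]] := hF i; [rewrite !measure0 mule0|exact: h].
have mfin : (measure_add nu kap setT < +oo)%E by rewrite measure_addE lte_add_pinfty.
have [_ hS] := dyadic_approx_measurable k0 mfin mS.
have fk A : measurable A -> kap A \is a fin_num.
  move=> mA; rewrite ge0_fin_numE//; apply: le_lt_trans kapfin; exact: mono_measure.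
apply/lee_addgt0Pr => e e0.
pose e' := e / (C + 1).
have e'0 : 0 < e' by rewrite divr_gt0// ltr_wpDl.
have [k [D [k0k h1 h2]]] := hS _ e'0.
have mD := measurable_dyadic_preimage k D.
have {}h1 : (measure_add nu kap (S `\` dyadic_index k @^-1` D) < e'%:E)%E := h1.
have {}h2 : (measure_add nu kap (dyadic_index k @^-1` D `\` S) < e'%:E)%E := h2.
rewrite measure_addE in h1; rewrite measure_addE in h2.
have n1 : (nu (S `\` dyadic_index k @^-1` D) <= e'%:E)%E.
  by apply: le_trans (ltW h1); rewrite leeDl.
have n2 : (kap (dyadic_index k @^-1` D `\` S) <= e'%:E)%E.
  by apply: le_trans (ltW h2); rewrite leeDr.
apply: (@le_trans _ _ (nu (dyadic_index k @^-1` D) + e'%:E)%E).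
  apply: (@le_trans _ _ (nu (dyadic_index k @^-1` D `|` (S `\` dyadic_index k @^-1` D)))).
    apply: mono_measure => //; first by apply: measurableU => //; exact: measurableD.
    by move=> x Sx; have [?|?] := pselect ((dyadic_index k @^-1` D) x); [left|right].
  apply: (le_trans (measureU2 _ _ _)) => //; first exact: measurableD.
  exact: leeD.
apply: (@le_trans _ _ (C%:E * (kap S + e'%:E) + e'%:E)%E).
  rewrite leeD2r//; apply: (le_trans (hD _ _ k0k)); apply: lee_pmul => //.
  apply: (@le_trans _ _ (kap (S `|` (dyadic_index k @^-1` D `\` S)))).
    apply: mono_measure => //; first by apply: measurableU => //; exact: measurableD.
    by move=> x Dx; have [?|?] := pselect (S x); [left|right].
  apply: (le_trans (measureU2 _ _ _)) => //; first exact: measurableD.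
  exact: leeD.
rewrite -(fineK (fk _ mS)) -EFinD -!EFinM -!EFinD lee_fin /e'.
rewrite mulrDr -addrA lerD2l -[X in _ + X]mul1r -mulrDl mulrC divfK//.
by rewrite gt_eqF// ltr_wpDl.
Qed.

End dyadic.

(** * Series in weak L1 *)

Section nonneg_series.
Context (R : realType).
Implicit Types (u v : (\bar R)^nat) (M q : R).

Lemma nneseries_ge_term u k : (forall i, 0 <= u i)%E -> (u k <= \sum_(0 <= i <oo) u i)%E.
Proof.
move=> u0; apply: (le_trans _ (nneseries_lim_ge k.+1 (fun i _ _ => u0 i))).
by rewrite big_nat_recr//= leeDr// sume_ge0.
Qed.

Lemma geometric_eseries M q : 0 <= q -> q < 1 ->
  (\sum_(0 <= k <oo) (M * q ^+ k)%:E = (M / (1 - q))%:E)%E.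
Proof.
move=> q0 q1; have cv := @cvg_geometric_series R M q _.
have nq : `|q| < 1 by rewrite ger0_norm.
transitivity (limn (EFin \o series (geometric M q))).
  by congr (limn _); apply/funext => k /=; rewrite sumEFin.
rewrite EFin_lim; last by apply: is_cvg_geometric_series.
by rewrite (cvg_lim _ (cv nq)).
Qed.

End nonneg_series.

Section nonneg_integral.
Context d (T : measurableType d) (R : realType) (mu : {measure set T -> \bar R}).
Local Open Scope ereal_scope.

Lemma measure_gt_le_integral (f : T -> \bar R) (a : R) : measurable_fun setT f ->
  (forall x, 0 <= f x) -> (0 < a)%R ->
  mu [set x | a%:E < f x] <= (a^-1)%:E * \int[mu]_x f x.
Proof.
move=> mf f0 a0; have mA : measurable [set x | a%:E < f x].
  by rewrite -[X in measurable X]setTI; exact: emeasurable_fun_o_infty.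
rewrite -lee_pdivrMl ?invr_gt0// invrK.
rewrite -[X in _ * mu X]setIT -integral_indic//.
rewrite -ge0_integralZl//=; [|exact/measurable_EFinP|by rewrite lee_fin ltW].
apply: ge0_le_integral => //=.
- by move=> x _; rewrite mule_ge0// lee_fin// ltW.
- by apply: measurable_funeM; exact/measurable_EFinP.
- move=> x _; rewrite indicE; case: (boolP (x \in _)) => [|_].
    by rewrite inE/= mule1 => /ltW.
  by rewrite mule0.
Qed.

(** Only points where f is nonzero need to be covered. This will leave out the origin, which lies in
    no dyadic shell. *)
Lemma ge0_integral_cover (D : set T) (E : (set T)^nat) (f : T -> \bar R) :
  measurable D -> (forall k, measurable (E k)) ->
  measurable_fun setT f -> (forall x, 0 <= f x) ->
  (forall x, D x -> f x != 0 -> exists k, E k x) ->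
  \int[mu]_(x in D) f x <= \sum_(0 <= k <oo) \int[mu]_(x in E k) f x.
Proof.
move=> mD mE mf f0 DE.
rewrite integral_mkcond.
under eq_eseriesr => k _ do rewrite integral_mkcond.
have mfE A : measurable A -> measurable_fun setT (f \_ A).
  by move=> mA; apply/(measurable_restrictT _ mA); exact: measurable_funTS.
have fE A x : 0 <= (f \_ A) x by apply: erestrict_ge0.
rewrite -integral_nneseries//; last by move=> k; exact: mfE.
apply: ge0_le_integral => //; first exact: mfE.
  by apply: ge0_emeasurable_sum => [k x _ _|k _]; [exact: fE|exact: mfE].
move=> x _; rewrite {1}/patch; case: ifPn => [/set_mem Dx|_]; last exact: nneseries_ge0.
have [->|fx0] := eqVneq (f x) 0; first exact: nneseries_ge0.
have [k Ekx] := DE x Dx fx0.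
apply: le_trans (nneseries_ge_term k (fun i => fE (E i) x)).
by rewrite /patch mem_set.
Qed.

Lemma geometric_integral_cover (D : set T) (E : (set T)^nat) (f : T -> \bar R) (M q : R) :
  measurable D -> (forall k, measurable (E k)) ->
  measurable_fun setT f -> (forall x, 0 <= f x) ->
  (forall x, D x -> f x != 0 -> exists k, E k x) ->
  (0 <= q)%R -> (q < 1)%R ->
  (forall k, \int[mu]_(x in E k) f x <= (M * q ^+ k)%:E) ->
  \int[mu]_(x in D) f x <= (M / (1 - q))%:E.
Proof.
move=> mD mE mf f0 DE q0 q1 h.
apply: (le_trans (ge0_integral_cover mD mE mf f0 DE)).
rewrite -geometric_eseries//; apply: lee_nneseries => // k _ _.
exact: integral_ge0.
Qed.

End nonneg_integral.

Section dyadic_scale.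
Context (R : realType).

Lemma expr2_unbounded (x : R) : exists k : nat, x < 2 ^+ k.
Proof.
exists (Num.truncn x).+1; apply: (lt_trans (truncnS_gt x)).
by rewrite -natrX ltr_nat ltn_expl.
Qed.

Lemma dyadic_scale_up (rho t : R) : 0 < rho -> rho < t ->
  exists k : nat, rho * 2 ^+ k < t <= rho * 2 ^+ k.+1.
Proof.
move=> r0 rt; have [k0 hk0] := expr2_unbounded (t / rho).
have ex : exists k, t <= rho * 2 ^+ k.
  by exists k0; rewrite mulrC -ler_pdivrMr// ltW.
have := ex_minnP ex; case=> -[|k] hk hmin.
  by move: hk; rewrite expr0 mulr1 leNgt rt.
exists k; rewrite hk andbT ltNge; apply/negP => /hmin; by rewrite ltnn.
Qed.

Lemma dyadic_scale_down (rho t : R) : 0 < t -> t <= rho ->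
  exists k : nat, rho / 2 ^+ k.+1 < t <= rho / 2 ^+ k.
Proof.
move=> t0 tr; have [k0 hk0] := expr2_unbounded (rho / t).
have ex : exists k, rho / 2 ^+ k < t.
  by exists k0; rewrite ltr_pdivrMr ?exprn_gt0// mulrC -ltr_pdivrMr.
have := ex_minnP ex; case=> -[|k] hk hmin.
  by move: hk; rewrite expr0 divr1 ltNge tr.
exists k; rewrite hk/= leNgt; apply/negP => /hmin; by rewrite ltnn.
Qed.

End dyadic_scale.

Lemma ler_of_eq (R : realType) (x y : R) : x = y -> x <= y.
Proof. by move=> ->. Qed.

Lemma powRD_gt0 (R : realType) (x r s : R) : 0 < x -> x `^ (r + s) = x `^ r * x `^ s.
Proof. by move=> x0; rewrite powRD// (gt_eqF x0) implybT. Qed.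

Lemma powR_expr (R : realType) (x r : R) k : 0 <= x -> (x ^+ k) `^ r = (x `^ r) ^+ k.
Proof.
move=> x0; elim: k => [|k IH]; first by rewrite !expr0 powR1.
by rewrite !exprS powRM ?exprn_ge0// IH.
Qed.

(* For [0 < p < 1] the quasi-norm of weak L1 is p-convex up to this constant. *)
Definition weak_const (R : realType) (p : R) : R :=
  1 + 4 * 2 `^ ((1 - p) / p) / (1 - 2^-1 `^ ((1 - p) / p)).

Section weak_series.
Context d (T : measurableType d) (R : realType) (mu : {measure set T -> \bar R}).
Variables (u : (T -> \bar R)^nat) (c : R^nat) (p S : R).
Hypotheses (p0 : 0 < p) (p1 : p < 1) (S0 : 0 < S).
Hypotheses (mu_ : forall j, measurable_fun setT (u j)) (u0 : forall j x, (0 <= u j x)%E).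
Hypotheses (c0 : forall j, 0 <= c j).
Hypothesis uc : forall j (t : R), 0 < t -> (mu [set x | (t%:E < u j x)%E] <= (c j / t)%:E)%E.
Hypothesis cS : (\sum_(0 <= j <oo) (c j `^ p)%:E <= S%:E)%E.

Let theta : R := (1 - p) / p.
Let theta0 : 0 < theta. Proof. by rewrite divr_gt0// subr_gt0. Qed.
Let q : R := 2^-1 `^ theta.
Let q0 : 0 <= q. Proof. exact: powR_ge0. Qed.
Let q1 : q < 1.
Proof.
have : 2^-1 `^ theta < 1 `^ theta.
  by rewrite gt0_ltr_powR ?nnegrE ?invr_ge0// invf_lt1// ltr1n.
by rewrite powR1.
Qed.

Let Stheta : S `^ theta * S = S `^ p^-1.
Proof.
have -> : p^-1 = theta + 1 by rewrite /theta; field; rewrite gt_eqF.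
by rewrite powRD_gt0// powRr1 ?ltW.
Qed.

Let y j := c j `^ p.
Let y0 j : 0 <= y j. Proof. exact: powR_ge0. Qed.

Let yS j : y j <= S.
Proof.
rewrite -lee_fin; apply: le_trans cS.
by apply: (@nneseries_ge_term _ (fun j => (c j `^ p)%:E)) => i; rewrite lee_fin powR_ge0.
Qed.

Let cE j : c j = y j * y j `^ theta.
Proof.
rewrite /y -powRrM mulrC /theta mulrC mulrCA divff ?gt_eqF// mulr1.
have := c0 j; rewrite le_eqVlt => /predU1P[<-|cj].
  by rewrite [in RHS]powR0 ?gt_eqF// mul0r.
by rewrite -powRD_gt0// addrCA subrr addr0 powRr1 ?ltW.
Qed.

Let eps (t : R) j := y j * (t / (2 * S)).

(** A layer of the middle range: where t / 2^(k+1) < u_j <= t / 2^k it is at least u_j. Layers whose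
    top is at most [eps t j] are dropped. *)
Let z (t : R) j k (x : T) : \bar R :=
  if eps t j < t / 2 ^+ k then ((t / 2 ^+ k)%:E * (\1_[set x | ((t / 2 ^+ k.+1)%:E < u j x)%E] x)%:E)%E
  else 0%E.

Let mA (a : R) j : measurable [set x | (a%:E < u j x)%E].
Proof. by rewrite -[X in measurable X]setTI; exact: emeasurable_fun_o_infty. Qed.

Let mz t j k : measurable_fun setT (z t j k).
Proof.
rewrite /z; case: (eps t j < _) => //.
by apply: measurable_funeM; apply/measurable_EFinP; exact: measurable_indic.
Qed.

Let z0 t j k x : 0 < t -> (0 <= z t j k x)%E.
Proof.
move=> t0; rewrite /z; case: ifP => // _.
by rewrite mule_ge0 ?lee_fin// divr_ge0 ?ltW// exprn_gt0.
Qed.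

(** The weak bound alone gives 2 c_j for every layer. The guard [eps t j < t / 2^k] says y_j < 2 S /
    2^k; inserted into one factor of c_j = y_j y_j^theta, it makes the bound geometric in k, so no
    logarithm is lost. *)
Let integral_z t j k : 0 < t ->
  (\int[mu]_x z t j k x <= (2 * y j * (2 * S) `^ theta * q ^+ k)%:E)%E.
Proof.
move=> t0; have p2 : 0 < 2 ^+ k :> R by rewrite exprn_gt0.
have rhs0 : 0 <= 2 * y j * (2 * S) `^ theta * q ^+ k.
  by rewrite !mulr_ge0// ?powR_ge0// exprn_ge0.
rewrite /z; case h : (eps t j < _); last by rewrite integral0 lee_fin.
rewrite ge0_integralZl//; last 2 first.
- by apply/measurable_EFinP; exact: measurable_indic.
- by rewrite lee_fin divr_ge0 ?ltW.
rewrite integral_indic// setIT.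
apply: (@le_trans _ _ ((t / 2 ^+ k)%:E * (c j / (t / 2 ^+ k.+1))%:E)%E).
  apply: lee_pmul => //; first by rewrite lee_fin divr_ge0 ?ltW.
  by apply: uc; rewrite divr_gt0// exprn_gt0.
rewrite -EFinM lee_fin (_ : t / 2 ^+ k * (c j / (t / 2 ^+ k.+1)) = 2 * c j); last first.
  by rewrite exprS; field; rewrite !gt_eqF.
rewrite cE -!mulrA ler_pM2l// ler_wpM2l//.
rewrite /q -powR_expr ?invr_ge0// -powRM; last 2 first.
- by rewrite mulr_ge0// ltW.
- by rewrite exprn_ge0// invr_ge0.
apply: ge0_ler_powR; rewrite ?nnegrE; [exact: ltW|exact: y0| |].
  by rewrite !mulr_ge0 ?exprn_ge0 ?invr_ge0// ltW.
move: h; rewrite /eps mulrCA ltr_pM2l// ltr_pdivrMr ?mulr_gt0// exprVn.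
by rewrite [_ * (2 * S)]mulrC => /ltW.
Qed.

(** Each u_j is cut at two heights. Where some u_j exceeds t, the union bound costs sum c_j / t <=
    S^(1/p) / t. The parts below [eps t j], which are proportional to y_j = c_j^p, add up to at most
    t/2. What lies in between is dominated by the layers [z], whose total integral enters Markov's
    inequality at level t/2. *)
Lemma weak_series (t : R) : 0 < t ->
  (mu [set x | (t%:E < \sum_(0 <= j <oo) u j x)%E] <= (weak_const p * S `^ p^-1 / t)%:E)%E.
Proof.
move=> t0.
pose f x := (\sum_(0 <= j <oo) \sum_(0 <= k <oo) z t j k x)%E.
have f0 x : (0 <= f x)%E by apply: nneseries_ge0 => j _ _; apply: nneseries_ge0 => k _ _; exact: z0.
have mzj j : measurable_fun setT (fun x => \sum_(0 <= k <oo) z t j k x)%E.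
  by apply: ge0_emeasurable_sum => [k x _ _|k _]; [exact: z0|exact: mz].
have zj0 j x : (0 <= \sum_(0 <= k <oo) z t j k x)%E by apply: nneseries_ge0 => k _ _; exact: z0.
have mf : measurable_fun setT f.
  by apply: ge0_emeasurable_sum => [j x _ _|j _]; [exact: zj0|exact: mzj].
have intf : (\int[mu]_x f x <= (2 * (2 * S) `^ theta / (1 - q) * S)%:E)%E.
  rewrite integral_nneseries//.
  apply: (@le_trans _ _ (\sum_(0 <= j <oo) ((2 * (2 * S) `^ theta / (1 - q))%:E * (y j)%:E))%E).
    apply: lee_nneseries => [j _ _|j _]; first exact: integral_ge0.
    rewrite integral_nneseries//; last by move=> k x _; exact: z0.
    apply: (@le_trans _ _ (\sum_(0 <= k <oo) (2 * y j * (2 * S) `^ theta * q ^+ k)%:E)%E).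
      apply: lee_nneseries => [k _ _|k _]; last exact: integral_z.
      by apply: integral_ge0 => x _; exact: z0.
    rewrite geometric_eseries// -EFinM lee_fin; apply: ler_of_eq; ring.
  rewrite nneseriesZl; last by move=> j _; rewrite lee_fin.
  rewrite [X in (_ <= X)%E]EFinM; apply: lee_pmul => //.
    by rewrite lee_fin !mulr_ge0// ?powR_ge0// invr_ge0 subr_ge0 ltW.
  by apply: nneseries_ge0 => j _ _; rewrite lee_fin.
have mU : measurable (\bigcup_j [set x | (t%:E < u j x)%E]) by exact: bigcup_measurable.
have mF : measurable [set x | ((t / 2)%:E < f x)%E].
  by rewrite -[X in measurable X]setTI; exact: emeasurable_fun_o_infty.
apply: (@le_trans _ _ (mu ((\bigcup_j [set x | (t%:E < u j x)%E]) `|` [set x | ((t / 2)%:E < f x)%E]))).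
  apply: le_measure; rewrite ?inE.
  - rewrite -[X in measurable X]setTI; apply: emeasurable_fun_o_infty => //.
    exact: ge0_emeasurable_sum.
  - exact: measurableU.
  move=> x /= tx; have [[j tuj]|nE] := pselect (exists j, (t%:E < u j x)%E).
    by left; exists j.
  right; have ut j : (u j x <= t%:E)%E by rewrite leNgt; apply/negP => h; apply: nE; exists j.
  have uz j : (u j x <= (eps t j)%:E + \sum_(0 <= k <oo) z t j k x)%E.
    have ufin : u j x \is a fin_num.
      by rewrite ge0_fin_numE// (le_lt_trans (ut j))// ltry.
    have [ue|eu] := leP (u j x) (eps t j)%:E; first by rewrite (le_trans ue)// leeDl.
    rewrite -(fineK ufin) in eu; have := ut j; rewrite -(fineK ufin) !lee_fin => urt.
    rewrite lte_fin in eu.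
    have e0 : 0 <= eps t j by rewrite mulr_ge0// divr_ge0 ?mulr_ge0 ?ltW.
    have [k /andP[k1 k2]] := dyadic_scale_down (le_lt_trans e0 eu) urt.
    apply: (@le_trans _ _ (\sum_(0 <= k <oo) z t j k x)%E); last by rewrite leeDr// lee_fin.
    apply: (@le_trans _ _ (z t j k x)); last first.
      by apply: (@nneseries_ge_term _ (fun k => z t j k x)) => i; exact: z0.
    rewrite /z ifT ?(lt_le_trans eu)// indicE mem_set ?mule1 ?lee_fin//=.
    by rewrite -(fineK ufin) lte_fin.
  have sum_eps : (\sum_(0 <= j <oo) (eps t j)%:E <= (t / 2)%:E)%E.
    rewrite (_ : (fun n => _) = (fun n => \sum_(0 <= j < n) ((t / (2 * S))%:E * (y j)%:E))%E); last first.
      by apply/funext => n; apply: eq_bigr => j _; rewrite -EFinM mulrC.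
    rewrite nneseriesZl; last by move=> j _; rewrite lee_fin.
    apply: (@le_trans _ _ ((t / (2 * S))%:E * S%:E)%E).
      apply: lee_pmul => //; first by rewrite lee_fin divr_ge0 ?mulr_ge0 ?ltW.
      by apply: nneseries_ge0 => j _ _; rewrite lee_fin.
    rewrite -EFinM lee_fin; apply: ler_of_eq; field; rewrite gt_eqF//.
  have : (t%:E < (t / 2)%:E + f x)%E.
    apply: (lt_le_trans tx); apply: (@le_trans _ _ (\sum_(0 <= j <oo) ((eps t j)%:E + \sum_(0 <= k <oo) z t j k x))%E).
      by apply: lee_nneseries.
    rewrite nneseriesD//; first by rewrite leeD2r.
    by move=> j _; rewrite lee_fin mulr_ge0// divr_ge0 ?mulr_ge0 ?ltW.
  case: (f x) (f0 x) => [r _|_ _|//]; last by rewrite ltry.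
  by rewrite -EFinD !lte_fin => h; lra.
apply: (le_trans (measureU2 _ mU mF)).
have b1 : (mu (\bigcup_j [set x | (t%:E < u j x)%E]) <= (S `^ p^-1 / t)%:E)%E.
  apply: (@le_trans _ _ (\sum_(0 <= j <oo) mu [set x | (t%:E < u j x)%E])%E).
    exact: measure_sigma_subadditive.
  apply: (@le_trans _ _ (\sum_(0 <= j <oo) ((S `^ theta / t)%:E * (y j)%:E))%E).
    apply: lee_nneseries => // j _; apply: (le_trans (uc j t0)).
    rewrite -EFinM lee_fin [leRHS]mulrAC ler_pM2r ?invr_gt0// cE mulrC ler_wpM2r//.
    by apply: ge0_ler_powR; rewrite ?nnegrE//; exact: ltW.
  rewrite nneseriesZl; last by move=> j _; rewrite lee_fin.
  rewrite -Stheta [_ * S / t]mulrAC [X in (_ <= X)%E]EFinM; apply: lee_pmul => //.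
    by rewrite lee_fin divr_ge0 ?powR_ge0 ?ltW.
  by apply: nneseries_ge0 => j _ _; rewrite lee_fin.
have b2 : (mu [set x | ((t / 2)%:E < f x)%E] <= (4 * 2 `^ theta / (1 - q) * S `^ p^-1 / t)%:E)%E.
  apply: (le_trans (measure_gt_le_integral _ mf f0 _)); first by rewrite divr_gt0.
  apply: (@le_trans _ _ ((t / 2)^-1%:E * (2 * (2 * S) `^ theta / (1 - q) * S)%:E)%E).
    by apply: lee_pmul; rewrite ?integral_ge0// lee_fin invr_ge0 divr_ge0// ltW.
  rewrite -EFinM lee_fin -Stheta; apply: ler_of_eq; rewrite powRM ?ltW//.
  by field; rewrite !gt_eqF// subr_gt0.
apply: (le_trans (leeD b1 b2)); rewrite -EFinD lee_fin /weak_const -/theta -/q.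
by apply: ler_of_eq; field; rewrite !gt_eqF// subr_gt0.
Qed.

End weak_series.

(** * Balls and the sphere measure *)

Section integral_bounds.
Context d (T : measurableType d) (R : realType) (mu : {measure set T -> \bar R}).

Lemma integral_le_cst_mul (E B : set T) (f g : T -> R) (c : R) :
  measurable E -> measurable B -> E `<=` B -> 0 <= c ->
  measurable_fun setT f -> measurable_fun setT g ->
  (forall x, 0 <= f x) -> (forall x, 0 <= g x) ->
  (forall x, E x -> f x <= c * g x) ->
  (\int[mu]_(x in E) (f x)%:E <= c%:E * \int[mu]_(x in B) (g x)%:E)%E.
Proof.
move=> mE mB EB c0 mf mg f0 g0 fg.
apply: (@le_trans _ _ (c%:E * \int[mu]_(x in E) (g x)%:E)%E); last first.
  apply: lee_pmul => //; first by apply: integral_ge0 => x _; rewrite lee_fin.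
  apply: ge0_subset_integral => //.
    by apply: measurable_funTS; exact/measurable_EFinP.
  by move=> x _; rewrite lee_fin.
rewrite -ge0_integralZl//; last 2 first.
- by apply: measurable_funTS; exact/measurable_EFinP.
- by move=> x _; rewrite lee_fin.
apply: ge0_le_integral => //.
- by move=> x _; rewrite lee_fin.
- by apply: measurable_funTS; exact/measurable_EFinP.
- by apply: measurable_funTS; apply: measurable_funeM; exact/measurable_EFinP.
Qed.

Lemma integral_le_mono (E : set T) (f g : T -> R) :
  measurable E -> measurable_fun setT f -> measurable_fun setT g ->
  (forall x, 0 <= f x) -> (forall x, E x -> f x <= g x) ->
  (\int[mu]_(x in E) (f x)%:E <= \int[mu]_(x in E) (g x)%:E)%E.
Proof.
move=> mE mf mg f0 fg; apply: ge0_le_integral => //.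
- by move=> x _; rewrite lee_fin.
- by apply: measurable_funTS; exact/measurable_EFinP.
- by apply: measurable_funTS; exact/measurable_EFinP.
Qed.

Lemma ge0_integral_mrestr (D : set T) (mD : measurable D) (f : T -> \bar R) :
  measurable_fun setT f -> (forall x, 0 <= f x)%E ->
  (\int[mrestr mu mD]_x f x = \int[mu]_(x in D) f x)%E.
Proof.
move=> mf f0; rewrite -(setUv D) ge0_integral_setU//; last 3 first.
- exact: measurableC.
- by rewrite setUv.
- exact/disj_setPCl.
rewrite [X in (_ + X)%E](_ : _ = 0%E) ?adde0.
  by apply: eq_measure_integral => A mA AD; rewrite /= /mrestr (setIidl AD).
rewrite -[RHS](@integral_measure_zero _ _ _ (~` D) f); apply: eq_measure_integral => A mA AD.
rewrite /= /mrestr /mzero (_ : A `&` D = set0) ?measure0//.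
by rewrite -subset0 => x [/AD].
Qed.

End integral_bounds.

Section euclidean_balls.
Context (R : realType) (n : nat).
Local Notation mu := (@lebesgue_rV R n).

Lemma measurable_enorm_itv (i : interval R) : measurable [set x : 'rV[R]_n | enorm x \in i].
Proof.
rewrite -[X in measurable X]setTI.
exact: (@measurable_enorm R n measurableT _ (measurable_itv i)).
Qed.

Lemma measurable_eball (x0 : 'rV[R]_n) (r : R) : measurable (eball x0 r).
Proof.
have mf : measurable_fun setT (fun y : 'rV[R]_n => enorm (y - x0)).
  by apply: measurable_fun_enorm; exact: measurable_funB_rV.
rewrite (_ : eball x0 r = setT `&` (fun y => enorm (y - x0)) @^-1` `]-oo, r]); last first.
  by rewrite setTI; apply/seteqP; split => x; rewrite /eball/= in_itv.
exact: mf.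
Qed.

Lemma lebesgue_eball (x0 : 'rV[R]_n) (r : R) : 0 < r ->
  mu (eball x0 r) = ((r ^+ n)%:E * mu (eball 0 1))%E.
Proof.
move=> r0; have := lebesgue_affine x0 r0 (measurable_eball x0 r).
have -> : (fun x => r *: x + x0) @^-1` eball x0 r = eball 0 1.
  apply/seteqP; split => x; rewrite /eball/= addrK subr0 enormZ gtr0_norm//.
    by rewrite -ler_pdivlMl// mulVf ?gt_eqF.
  by rewrite -ler_pdivlMl// mulVf ?gt_eqF.
by move=> ->; rewrite muleA -EFinM -exprMn divff ?gt_eqF// expr1n mul1e.
Qed.

Lemma lebesgue_eball1_lty : (mu (eball 0%R 1%R) < +oo)%E.
Proof.
apply: (@le_lt_trans _ _ (mu (rbox (const_mx (-2)) (const_mx 2)))).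
  apply: mono_measure; [exact: measurable_eball|exact: measurable_rbox|].
  move=> x; rewrite /eball/= subr0 => x1 i; rewrite !mxE.
  have := le_trans (ler_coord_enorm x i) x1; rewrite ler_norml => /andP[h1 h2].
  by apply/andP; split; [apply: le_trans h1; lra|apply: (le_lt_trans h2); lra].
by rewrite lebesgue_rbox ?ltry// => i; rewrite !mxE; lra.
Qed.

Lemma lebesgue_eball1_gt0 : (0 < n)%N -> (0 < mu (eball 0%R 1%R))%E.
Proof.
move=> n0; have n0' : 0 < n%:R^-1 :> R by rewrite invr_gt0 ltr0n.
apply: (@lt_le_trans _ _ (mu (rbox 0 (const_mx n%:R^-1)))).
  rewrite lebesgue_rbox => [|i]; last by rewrite !mxE ltW.
  by rewrite lte_fin prodr_gt0// => i _; rewrite !mxE subr0.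
apply: mono_measure; [exact: measurable_rbox|exact: measurable_eball|].
move=> x h; rewrite /eball/= subr0.
apply: (le_trans (@enorm_le_sup _ _ x n%:R^-1 _)) => [i|].
  by have := h i; rewrite !mxE => /andP[x0 /ltW]; rewrite ger0_norm.
by rewrite divff// pnatr_eq0 -lt0n.
Qed.

Definition ball_vol : R := fine (mu (eball 0 1)).

Lemma ball_volE : (mu (eball 0 1) = ball_vol%:E)%E.
Proof. by rewrite fineK// ge0_fin_numE// lebesgue_eball1_lty. Qed.

Lemma ball_vol_gt0 : (0 < n)%N -> 0 < ball_vol.
Proof. by move=> n0; rewrite -lte_fin -ball_volE lebesgue_eball1_gt0. Qed.

Lemma ball_vol_ge0 : 0 <= ball_vol. Proof. exact: fine_ge0. Qed.

Lemma eball_vol (x0 : 'rV[R]_n) (r : R) : 0 < r -> mu (eball x0 r) = (r ^+ n * ball_vol)%:E.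
Proof. by move=> r0; rewrite lebesgue_eball// ball_volE. Qed.

End euclidean_balls.

(** * Power weights against functions with growth rho^n on balls *)

Section morrey.
Context (R : realType) (n : nat).
Local Notation mu := (@lebesgue_rV R n).
Variables (g : 'rV[R]_n -> R) (M : R).
Hypotheses (n0 : (0 < n)%N) (mg : measurable_fun setT g) (g0 : forall x, 0 <= g x).

(** A Morrey-type bound on balls centred at the origin. Functions of degree 0 satisfy it, and it
    takes the place of polar coordinates. *)
Definition morrey := forall rho : R, 0 < rho ->
  (\int[mu]_(x in eball 0%R rho) (g x)%:E <= (M * rho ^+ n)%:E)%E.

Hypothesis gM : morrey.

Let measurable_weight gam :
  measurable_fun setT (fun x : 'rV[R]_n => g x * ((enorm x ^+ n)^-1 * enorm x `^ gam)).
Proof.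
apply: measurable_funM => //; apply: measurable_funM.
  rewrite (_ : (fun _ => _) = (fun x : 'rV[R]_n => (enorm x ^+ n) `^ (-1))).
    by apply: (measurableT_comp (measurable_powR _)); apply: measurable_funX; exact: measurable_enorm.
  by apply/funext => x; rewrite powR_inv1// exprn_ge0// enorm_ge0.
by apply: (measurableT_comp (measurable_powR _)); exact: measurable_enorm.
Qed.

Let weight_ge0 gam (x : 'rV[R]_n) : 0 <= g x * ((enorm x ^+ n)^-1 * enorm x `^ gam).
Proof. by rewrite mulr_ge0// mulr_ge0 ?powR_ge0// invr_ge0 exprn_ge0// enorm_ge0. Qed.

(** On the shell from rho 2^k to rho 2^(k+1) the weight is at most its value at the inner radius,
    while the mass of g is controlled by the n-th power of the outer one. This leaves a geometric
    series of ratio 2^(-gam) and the factor 2^n. *)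
Lemma morrey_tail (gam rho : R) : 0 < gam -> 0 < rho ->
  (\int[mu]_(x in [set x | (rho < enorm x)%R])
     (g x * ((enorm x ^+ n)^-1 * enorm x `^ (- gam)))%:E <=
   (2 ^+ n * M * rho `^ (- gam) / (1 - 2 `^ (- gam)))%:E)%E.
Proof.
move=> gam0 rho0.
apply: (@geometric_integral_cover _ _ _ _ _ (fun k => [set x | enorm x \in `]rho * 2 ^+ k, rho * 2 ^+ k.+1]])).
- rewrite (_ : [set x | _] = [set x | enorm x \in `]rho, +oo[]); first exact: measurable_enorm_itv.
  by apply/seteqP; split => x /=; rewrite in_itv/= andbT.
- by move=> k; exact: measurable_enorm_itv.
- exact/measurable_EFinP.
- by move=> x; rewrite lee_fin.
- move=> x /= rx _; have [k hk] := dyadic_scale_up rho0 rx.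
  by exists k; rewrite /= in_itv.
- exact: powR_ge0.
- rewrite powRN invf_lt1 ?powR_gt0//.
  have : 1 `^ gam < 2 `^ gam :> R by rewrite gt0_ltr_powR ?nnegrE// ltr1n.
  by rewrite powR1.
move=> k; have p0 : 0 < rho * 2 ^+ k by rewrite mulr_gt0// exprn_gt0.
have p1 : 0 < rho * 2 ^+ k.+1 by rewrite mulr_gt0// exprn_gt0.
apply: (@le_trans _ _ ((((rho * 2 ^+ k) ^+ n)^-1 * (rho * 2 ^+ k) `^ (- gam))%:E *
    \int[mu]_(x in eball 0%R (rho * 2 ^+ k.+1)%R) (g x)%:E)%E).
  apply: integral_le_cst_mul => //.
  - exact: measurable_enorm_itv.
  - exact: measurable_eball.
  - by move=> x /=; rewrite in_itv/= /eball/= subr0 => /andP[].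
  - by rewrite mulr_ge0 ?powR_ge0// invr_ge0 exprn_ge0// ltW.
  move=> x /=; rewrite in_itv/= => /andP[h1 h2]; rewrite mulrC ler_wpM2r//.
  have x0 : 0 < enorm x by exact: lt_trans h1.
  rewrite ler_pM ?powR_ge0 ?invr_ge0 ?exprn_ge0 ?enorm_ge0//.
    by rewrite lef_pV2 ?posrE ?exprn_gt0// ler_pXn2r ?nnegrE ?ltW.
  rewrite !powRN lef_pV2 ?posrE ?powR_gt0//.
  by apply: ge0_ler_powR; rewrite ?nnegrE; exact: ltW.
apply: (@le_trans _ _ ((((rho * 2 ^+ k) ^+ n)^-1 * (rho * 2 ^+ k) `^ (- gam))%:E *
   (M * (rho * 2 ^+ k.+1) ^+ n)%:E)%E).
  apply: lee_pmul => //; last exact: gM.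
    by rewrite lee_fin mulr_ge0 ?powR_ge0// invr_ge0 exprn_ge0// ltW.
  by apply: integral_ge0 => x _; rewrite lee_fin.
rewrite -EFinM lee_fin; apply: ler_of_eq; rewrite powRM ?ltW ?exprn_gt0// powR_expr// exprS mulrCA !exprMn.
have q0 : 0 < (2 ^+ k) ^+ n :> R by rewrite !exprn_gt0.
have q1 : 0 < rho ^+ n :> R by rewrite !exprn_gt0.
field.
by rewrite !gt_eqF.
Qed.

(** The shells now run inwards. At the origin, which they miss, the integrand is 0: for n > 0 the
    inverse of 0^n has the junk value 0. *)
Lemma morrey_local (gam rho : R) : 0 < gam -> 0 < rho ->
  (\int[mu]_(x in eball 0%R rho)
     (g x * ((enorm x ^+ n)^-1 * enorm x `^ gam))%:E <=
   (2 ^+ n * M * rho `^ gam / (1 - 2 `^ (- gam)))%:E)%E.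
Proof.
move=> gam0 rho0.
apply: (@geometric_integral_cover _ _ _ _ _ (fun k => [set x | enorm x \in `]rho / 2 ^+ k.+1, rho / 2 ^+ k]])).
- exact: measurable_eball.
- by move=> k; exact: measurable_enorm_itv.
- exact/measurable_EFinP.
- by move=> x; rewrite lee_fin.
- move=> x; rewrite /eball/= subr0 => rx fx.
  have x0 : 0 < enorm x.
    rewrite lt_def enorm_ge0 andbT; apply/eqP => x0; move: fx.
    by rewrite x0 expr0n gtn_eqF//= invr0 mul0r mulr0 eqxx.
  by have [k hk] := dyadic_scale_down x0 rx; exists k; rewrite /= in_itv.
- exact: powR_ge0.
- rewrite powRN invf_lt1 ?powR_gt0//.
  have : 1 `^ gam < 2 `^ gam :> R by rewrite gt0_ltr_powR ?nnegrE// ltr1n.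
  by rewrite powR1.
move=> k; have p0 : 0 < rho / 2 ^+ k by rewrite divr_gt0// exprn_gt0.
have p1 : 0 < rho / 2 ^+ k.+1 by rewrite divr_gt0// exprn_gt0.
apply: (@le_trans _ _ ((((rho / 2 ^+ k.+1) ^+ n)^-1 * (rho / 2 ^+ k) `^ gam)%:E *
    \int[mu]_(x in eball 0%R (rho / 2 ^+ k)%R) (g x)%:E)%E).
  apply: integral_le_cst_mul => //.
  - exact: measurable_enorm_itv.
  - exact: measurable_eball.
  - by move=> x /=; rewrite in_itv/= /eball/= subr0 => /andP[].
  - by rewrite mulr_ge0 ?powR_ge0// invr_ge0 exprn_ge0// ltW.
  move=> x /=; rewrite in_itv/= => /andP[h1 h2]; rewrite mulrC ler_wpM2r//.
  have x0 : 0 < enorm x by exact: lt_trans h1.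
  rewrite ler_pM ?powR_ge0 ?invr_ge0 ?exprn_ge0 ?enorm_ge0//.
    by rewrite lef_pV2 ?posrE ?exprn_gt0// ler_pXn2r ?nnegrE ?ltW.
  by apply: ge0_ler_powR; rewrite ?nnegrE//; exact: ltW.
apply: (@le_trans _ _ ((((rho / 2 ^+ k.+1) ^+ n)^-1 * (rho / 2 ^+ k) `^ gam)%:E *
   (M * (rho / 2 ^+ k) ^+ n)%:E)%E).
  apply: lee_pmul => //; last exact: gM.
    by rewrite lee_fin mulr_ge0 ?powR_ge0// invr_ge0 exprn_ge0// ltW.
  by apply: integral_ge0 => x _; rewrite lee_fin.
have e2 : (2 ^+ k)^-1 `^ gam = (2 `^ (- gam)) ^+ k :> R.
  rewrite -exprVn powR_expr ?invr_ge0//; congr (_ ^+ k).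
  by rewrite -[2^-1]powR_inv1// -powRrM mulN1r.
rewrite -EFinM lee_fin; apply: ler_of_eq; rewrite powRM ?ltW ?invr_gt0 ?exprn_gt0// e2 exprS !exprMn.
have q0 : 0 < (2 ^+ k) ^+ n :> R by rewrite !exprn_gt0.
have q1 : 0 < rho ^+ n :> R by rewrite !exprn_gt0.
rewrite !invfM !exprVn !exprMn [2^-1 ^+ n]exprVn [(2 ^- k) ^+ n]exprVn.
field.
by rewrite !gt_eqF// exprn_gt0.
Qed.

End morrey.

Section sphere_integrals.
Context (R : realType) (n : nat).
Local Notation mu := (@lebesgue_rV R n).
Hypothesis n0 : (0 < n)%N.
Variable g : 'rV[R]_n -> R.
Hypotheses (mg : measurable_fun setT g) (g0 : forall x, 0 <= g x) (hg : homogeneous0 g).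

Lemma homogeneous0_normalize (x : 'rV[R]_n) : g (normalize x) = g x.
Proof.
have [->|x0] := eqVneq x 0; first by rewrite /normalize scaler0.
by rewrite /normalize hg// invr_gt0 enorm_gt0.
Qed.

(** The sphere measure is the normalized image of the unit ball under [normalize], and a function of
    degree 0 does not see that map. *)
Lemma integral_sphere : (\int[sphere_measure]_z (g z)%:E =
  ((ball_vol R n)^-1)%:E * \int[mu]_(x in eball 0%R 1%R) (g x)%:E)%E.
Proof.
have V0 : 0 <= (ball_vol R n)^-1 by rewrite invr_ge0 ball_vol_ge0.
have mgE : measurable_fun setT (EFin \o g) by exact/measurable_EFinP.
pose nu := measure_function_pushforward__canonical__measure_function_Measure
  (mrestr (lebesgue_rV n) (@measurable_eball0 R n 1)) (@measurable_normalize R n).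
transitivity (((ball_vol R n)^-1)%:E * \int[nu]_z (g z)%:E)%E.
  rewrite -(@ge0_integral_mscale _ _ _ nu setT measurableT (NngNum V0) (EFin \o g) mgE)//.
  by move=> x _; rewrite lee_fin.
congr (_ * _)%E.
rewrite ge0_integral_pushforward//; last first.
- by move=> x _; rewrite lee_fin.
- exact: measurable_normalize.
rewrite preimage_setT.
rewrite (eq_integral (EFin \o g)); last by move=> x _ /=; rewrite homogeneous0_normalize.
by rewrite ge0_integral_mrestr//= => x; rewrite lee_fin.
Qed.

Lemma homogeneous0_integral_eball (rho : R) : 0 < rho ->
  (\int[mu]_(x in eball 0%R rho) (g x)%:E =
   (rho ^+ n)%:E * \int[mu]_(x in eball 0%R 1%R) (g x)%:E)%E.
Proof.
move=> r0.
have := @ge0_integral_affine R n rho 0 (eball 0 rho) (EFin \o g) r0 (measurable_eball _ _).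
have -> : (fun x => rho *: x + 0) @^-1` eball 0 rho = (eball 0 1 : set 'rV[R]_n).
  apply/seteqP; split => x; rewrite /eball/= addr0 !subr0 enormZ gtr0_norm//.
    by rewrite -ler_pdivlMl// mulVf ?gt_eqF.
  by rewrite -ler_pdivlMl// mulVf ?gt_eqF.
move=> h; rewrite [in RHS](eq_integral (fun x : 'rV[R]_n => (g (rho *: x + 0)%R)%:E)); last first.
  by move=> x _; rewrite addr0 hg.
rewrite h; last 2 first.
- by apply: measurable_funTS; exact/measurable_EFinP.
- by move=> x _; rewrite lee_fin.
by rewrite muleA -EFinM -exprMn divff ?gt_eqF// expr1n mul1e.
Qed.

Lemma homogeneous0_morrey (I : R) : (\int[sphere_measure]_z (g z)%:E <= I%:E)%E ->
  morrey g (ball_vol R n * I).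
Proof.
move=> gI rho r0; rewrite homogeneous0_integral_eball// mulrC EFinM.
apply: lee_pmul => //; first by rewrite lee_fin exprn_ge0// ltW.
  by apply: integral_ge0 => x _; rewrite lee_fin.
rewrite EFinM -lee_pdivrMl ?ball_vol_gt0// -integral_sphere//.
Qed.

End sphere_integrals.

Lemma sphere_measureT (R : realType) (n : nat) : (0 < n)%N ->
  (sphere_measure [set: 'rV[R]_n] = 1)%E.
Proof.
move=> n0; rewrite /sphere_measure preimage_setT setTI -/(ball_vol R n) ball_volE.
by rewrite -EFinM mulVf// gt_eqF// ball_vol_gt0.
Qed.

(** Hoelder against the constant 1 on a space of mass 1. *)
Lemma Lnorm_sphere_ge (R : realType) (n : nat) (r : R) (g : 'rV[R]_n -> R) :
  (0 < n)%N -> 1 < r -> measurable_fun setT g ->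
  (\int[sphere_measure]_z `|g z|%:E <= 'N[sphere_measure]_(r%:E)[EFin \o g])%E.
Proof.
move=> n0 r1 mg; have r0 : 0 < r by apply: lt_trans r1.
pose q := r / (r - 1).
have q0 : 0 < q by rewrite divr_gt0// subr_gt0.
have := @hoelder _ _ _ (@sphere_measure R n) g (cst 1) r q mg (measurable_cst _) r0 q0 _.
rewrite Lnorm1 => h; apply: le_trans (le_trans (h _) _); last 2 first.
- by rewrite /q; field; rewrite !gt_eqF// subr_gt0.
- rewrite (_ : EFin \o cst 1 = cst 1%E)// Lnorm_cst1.
  rewrite [X in (X `^ _)%E](_ : _ = 1%E); last exact: sphere_measureT.
  by rewrite poweR1r mule1.
by under [leRHS]eq_integral => x _ do rewrite /= mulr1.
Qed.

(** * From rotations to translations *)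

Section cayley.
Context (R : realType) (n : nat).
Implicit Types (x y u v w t : 'rV[R]_n) (A : 'M[R]_n).

Lemma dotrvE x y : dotrv x y = (x *m y^T) ord0 ord0.
Proof. by rewrite mxE; apply: eq_bigr => i _; rewrite mxE. Qed.

Lemma dotrv_mulmx x y A : dotrv (x *m A) y = dotrv x (y *m A^T).
Proof. by rewrite !dotrvE trmx_mul trmxK mulmxA. Qed.

Lemma dotrv_antisym A w : A^T = - A -> dotrv (w *m A) w = 0.
Proof.
move=> hA; have := dotrv_mulmx w w A; rewrite hA mulmxN dotrvNr dotrvC => h; lra.
Qed.

(** For antisymmetric A the vector w A is orthogonal to w, hence |w + w A|^2 = |w|^2 + |w A|^2. *)
Lemma enorm_antisym_ge A w : A^T = - A -> enorm w <= enorm (w *m (1%:M + A)).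
Proof.
move=> hA; rewrite mulmxDr mulmx1 -(@ler_pXn2r _ 2)// ?nnegrE ?enorm_ge0// !enorm_sqr.
rewrite dotrvDl !dotrvDr (dotrvC w (w *m A)) (dotrv_antisym w hA).
have := dotrvv_ge0 (w *m A); lra.
Qed.

Lemma antisym_unitmx A : A^T = - A -> 1%:M + A \in unitmx.
Proof.
move=> hA; rewrite -row_free_unit; apply: inj_row_free => v v0.
apply/eqP; rewrite -enorm_eq0 eq_le enorm_ge0 andbT.
by rewrite (le_trans (enorm_antisym_ge v hA))// v0 enorm0.
Qed.

Definition cayley A : 'M[R]_n := invmx (1%:M + A) *m (1%:M - A).

(** The matrices 1 + A and 1 - A commute and are transposes of each other, which gives
    orthogonality; their equal determinants cancel. *)
Lemma cayley_rotation A : A^T = - A -> rotation (cayley A).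
Proof.
move=> hA; have uS := antisym_unitmx hA.
have trS : (1%:M + A)^T = 1%:M - A by rewrite linearD/= trmx1 hA.
have uT : 1%:M - A \in unitmx by rewrite -trS unitmx_tr.
split.
  rewrite /cayley trmx_mul -trS trmxK trmx_inv trS.
  have comm : (1%:M - A) *m (1%:M + A) = (1%:M + A) *m (1%:M - A).
    by rewrite mulmxDr mulmxBr !mulmx1 mulmxBl mulmxDl !mul1mx addrA subrK opprD addrA addrK.
  rewrite -mulmxA (mulmxA (1%:M - A)) comm -mulmxA mulmxV// mulmx1.
  by rewrite mulVmx.
by rewrite /cayley det_mulmx det_inv -trS det_tr mulVr// -unitmxE.
Qed.

Lemma enorm_rotation (rho : 'M[R]_n) x : rotation rho -> enorm (x *m rho) = enorm x.
Proof. by move=> [h _]; rewrite !enormE dotrv_mulmx -mulmxA h mulmx1. Qed.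

(** Here w is the midpoint of x = w (1 + A) and its image w (1 - A). Computing with w avoids the
    inverse matrix from now on. *)
Lemma mulmx_cayley A x w : A^T = - A -> w *m (1%:M + A) = x ->
  x *m cayley A = x - 2 *: (w *m A) /\ enorm w <= enorm x.
Proof.
move=> hA wS; split; last by rewrite -wS enorm_antisym_ge.
rewrite /cayley mulmxA -[in LHS]wS mulmxK ?antisym_unitmx// -[in RHS]wS.
rewrite mulmxBr mulmxDr mulmx1 scaler_nat mulr2n.
by rewrite opprD addrA addrK.
Qed.

Lemma cayley_midpoint A x : A^T = - A -> exists w, w *m (1%:M + A) = x.
Proof.
by move=> hA; exists (x *m invmx (1%:M + A)); rewrite mulmxKV// antisym_unitmx.
Qed.

Variable i : 'I_n.

(** The component of t orthogonal to e_i. The i-th coordinate of t is reserved for the dilation. *)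
Definition off t : 'rV[R]_n := locked (t - t ord0 i *: delta_mx ord0 i).

Lemma offE t j : off t ord0 j = if j == i then 0 else t ord0 j.
Proof.
rewrite /off -lock !mxE eqxx/=; case: eqVneq => [->|_]; first by rewrite mulr1 subrr.
by rewrite mulr0 subr0.
Qed.

(** The infinitesimal rotation in the plane of e_i and [off t]. Together with the dilation, the n
    coordinates of t give as many degrees of freedom as a point has. *)
Definition plane_mx t : 'M[R]_n :=
  (delta_mx ord0 i)^T *m off t - (off t)^T *m delta_mx ord0 i.

Lemma plane_mx_antisym t : (plane_mx t)^T = - plane_mx t.
Proof. by rewrite /plane_mx linearB/= !trmx_mul !trmxK opprB. Qed.

Lemma dotrv_delta x : dotrv x (delta_mx ord0 i) = x ord0 i.
Proof.
rewrite /dotrv (bigD1 i)//= mxE !eqxx mulr1 big1 ?addr0// => j ji.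
by rewrite mxE eqxx (negbTE ji) mulr0.
Qed.

Lemma mul_plane_mx w t :
  w *m plane_mx t = w ord0 i *: off t - dotrv w (off t) *: delta_mx ord0 i.
Proof.
have h (a b : 'rV[R]_n) : w *m (a^T *m b) = dotrv w a *: b.
  rewrite mulmxA [w *m a^T]mx11_scalar -dotrvE; exact: mul_scalar_mx.
by rewrite /plane_mx mulmxBr !h dotrv_delta.
Qed.

Lemma offB t t' : off (t - t') = off t - off t'.
Proof.
by apply/rowP => j; rewrite !mxE !offE !mxE; case: eqP => _; rewrite ?subr0.
Qed.

Lemma plane_mxB t t' : plane_mx (t - t') = plane_mx t - plane_mx t'.
Proof.
rewrite /plane_mx offB mulmxBr linearB/= mulmxBl.
by apply/matrixP => a b; rewrite !mxE; ring.
Qed.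

Lemma plane_mx_coord w t j : j != i -> (w *m plane_mx t) ord0 j = w ord0 i * t ord0 j.
Proof.
by move=> ji; rewrite mul_plane_mx !mxE offE (negbTE ji) andbF mulr0 subr0.
Qed.

Lemma enorm_delta : enorm (delta_mx ord0 i : 'rV[R]_n) = 1.
Proof. by rewrite enormE dotrv_delta mxE !eqxx sqrtr1. Qed.

Lemma ler_norm_dotrv x y : `|dotrv x y| <= enorm x * enorm y.
Proof.
rewrite ler_norml ler_dotrv andbT lerNl -dotrvNl -(enormN x); exact: ler_dotrv.
Qed.

Lemma enorm_plane w t : enorm (w *m plane_mx t) <= 2 * enorm w * enorm (off t).
Proof.
rewrite mul_plane_mx (le_trans (enormB _ _))// !enormZ enorm_delta mulr1.
have := ler_norm_dotrv w (off t).
have := ler_wpM2r (enorm_ge0 (off t)) (ler_coord_enorm w i); lra.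
Qed.

(* The conformal maps used to move a point: the first factor, a dilation, is
   invisible to homogeneous functions. *)
Definition conf t x : 'rV[R]_n := (1 + t ord0 i) *: (x *m cayley (plane_mx t)).

(** Solves w (1 + A) = x explicitly; c is the i-th coordinate of the midpoint w. The outcome is
    rational in x and t with positive denominator, which makes joint measurability visible. *)
Lemma confE t x : let c := (x ord0 i + dotrv x (off t)) / (1 + dotrv (off t) (off t)) in
  x *m cayley (plane_mx t) = x + (2 * (c - x ord0 i)) *: delta_mx ord0 i - (2 * c) *: off t.
Proof.
move=> c; have hA := plane_mx_antisym t.
have d0 : 1 + dotrv (off t) (off t) != 0 by rewrite gt_eqF// ltr_wpDr// dotrvv_ge0.
pose w := x - c *: off t + (c - x ord0 i) *: delta_mx ord0 i.
have wi : w ord0 i = c by rewrite /w !mxE !eqxx mulr1 offE eqxx mulr0 subr0 addrC subrK.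
have oi : off t ord0 i = 0 by rewrite offE eqxx.
have wo : dotrv w (off t) = c - x ord0 i.
  rewrite /w dotrvDl dotrvDl dotrvNl !dotrvZl [dotrv (delta_mx _ _) _]dotrvC dotrv_delta oi mulr0 addr0.
  by rewrite /c; field.
have wS : w *m (1%:M + plane_mx t) = x.
  rewrite mulmxDr mulmx1 mul_plane_mx wi wo /w.
  by apply/rowP => j; rewrite !mxE; ring.
have [-> _] := mulmx_cayley hA wS.
rewrite mul_plane_mx wi wo scalerBr !scalerA.
by apply/rowP => j; rewrite !mxE; ring.
Qed.

(** The midpoints satisfy (w - w') (1 + A') = w (A' - A), and 1 + A' does not shrink vectors, so
    they differ by at most 2 n h |x|. The rotated points differ by twice as much; a dilation of at
    most 2 turns this into 8 n h |x|, and the change of the dilation adds h |x|. *)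
Lemma conf_dist t t' x h : `|t' ord0 i| <= 1 ->
  (forall j, `|t ord0 j - t' ord0 j| <= h) ->
  enorm (conf t x - conf t' x) <= (1 + 8 * n%:R) * enorm x * h.
Proof.
move=> ti htt; have hA := plane_mx_antisym t; have hA' := plane_mx_antisym t'.
have h0 : 0 <= h by apply: le_trans (htt i).
have [w wS] := cayley_midpoint x hA; have [xw wx] := mulmx_cayley hA wS.
have [w' wS'] := cayley_midpoint x hA'; have [xw' wx'] := mulmx_cayley hA' wS'.
have Bn : enorm (off t' - off t) <= n%:R * h.
  apply: enorm_le_sup => j; rewrite !mxE !offE.
  by case: eqVneq => [_|_]; rewrite ?subrr ?normr0// distrC.
have dw : enorm (w - w') <= 2 * enorm x * (n%:R * h).
  apply: (le_trans (enorm_antisym_ge (w - w') hA')).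
  have -> : (w - w') *m (1%:M + plane_mx t') = w *m (plane_mx (t' - t)).
    by rewrite mulmxBl wS' -[X in _ - X]wS -mulmxBr opprD addrACA subrr add0r plane_mxB.
  apply: (le_trans (enorm_plane _ _)).
  rewrite -!mulrA ler_pM2l//; apply: ler_pM; rewrite ?enorm_ge0//.
  by rewrite offB.
have rw : x *m cayley (plane_mx t) - x *m cayley (plane_mx t') = 2 *: (w - w').
  have e1 : w *m plane_mx t = x - w by rewrite -[in RHS]wS mulmxDr mulmx1 addrC addKr.
  have e2 : w' *m plane_mx t' = x - w' by rewrite -[in RHS]wS' mulmxDr mulmx1 addrC addKr.
  by rewrite xw xw' e1 e2; apply/rowP => j; rewrite !mxE; ring.
have -> : conf t x - conf t' x = (t ord0 i - t' ord0 i) *: (x *m cayley (plane_mx t)) +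
    (1 + t' ord0 i) *: (2 *: (w - w')).
  rewrite -rw /conf; move: (x *m cayley _) (x *m cayley _) => X Y.
  by apply/rowP => j; rewrite !mxE; ring.
apply: (le_trans (enormD _ _)); rewrite !enormZ (enorm_rotation x (cayley_rotation hA)).
have b1 : `|t ord0 i - t' ord0 i| * enorm x <= h * enorm x by rewrite ler_wpM2r ?enorm_ge0.
have b2 : `|1 + t' ord0 i| * (`|2| * enorm (w - w')) <= 2 * (2 * (2 * enorm x * (n%:R * h))).
  apply: ler_pM => //; first by rewrite mulr_ge0 ?enorm_ge0.
    by rewrite (le_trans (ler_normD _ _))// normr1; lra.
  by rewrite ger0_norm// ler_pM2l.
apply: (le_trans (lerD b1 b2)); apply: ler_of_eq; ring.
Qed.

(** As z has the length of x, the vector x - z is orthogonal to the midpoint w of x and z. The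
    choice of t makes w A equal to (x - z) / 2 in every coordinate but the i-th. Since w A is
    orthogonal to w too and w_i is nonzero, the i-th coordinate agrees as well. *)
Lemma conf_onto x u : x != 0 -> u != 0 ->
  let z := (enorm x / enorm u) *: u in x ord0 i + z ord0 i != 0 ->
  conf (\row_j (if j == i then enorm u / enorm x - 1
                else (x ord0 j - z ord0 j) / (x ord0 i + z ord0 i))) x = u.
Proof.
move=> x0 u0 z xz; set t := \row_j _.
have nx : enorm x != 0 by rewrite enorm_eq0.
have nu : enorm u != 0 by rewrite enorm_eq0.
have hA := plane_mx_antisym t.
have ez : enorm z = enorm x.
  by rewrite /z enormZ ger0_norm ?divr_ge0 ?enorm_ge0// divfK.
pose w := 2^-1 *: (x + z).
have wi : w ord0 i = (x ord0 i + z ord0 i) / 2 by rewrite !mxE mulrC.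
have hB (a b : 'rV[R]_n) k : (a - b) ord0 k = a ord0 k - b ord0 k by rewrite !mxE.
have hV (a b : 'rV[R]_n) k : (2^-1 *: (a - b)) ord0 k = (a ord0 k - b ord0 k) / 2.
  by rewrite !mxE mulrC.
have wA j : j != i -> (w *m plane_mx t) ord0 j = (x ord0 j - z ord0 j) / 2.
  by move=> ji; rewrite plane_mx_coord// wi [t ord0 j]mxE (negbTE ji); field.
have wAV : w *m plane_mx t = 2^-1 *: (x - z).
  have e1 := dotrv_antisym w hA.
  have e2 : dotrv (2^-1 *: (x - z)) w = 0.
    rewrite /w dotrvZl dotrvZr dotrvDr !dotrvDl !dotrvNl (dotrvC z x) -!enorm_sqr ez; ring.
  have e3 : dotrv (w *m plane_mx t - 2^-1 *: (x - z)) w = 0.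
    by rewrite dotrvDl dotrvNl e1 e2 subrr.
  apply/rowP => j; have [->|ji] := eqVneq j i; last first.
    by rewrite wA// hV.
  move: e3; rewrite /dotrv (bigD1 i)//= big1 ?addr0 => [|k ki]; last first.
    by rewrite hB wA// hV subrr mul0r.
  rewrite wi => /eqP; rewrite mulf_eq0 mulf_eq0 (negbTE xz)/= invr_eq0 pnatr_eq0/= orbF.
  by rewrite hB subr_eq0 => /eqP.
have wS : w *m (1%:M + plane_mx t) = x.
  rewrite mulmxDr mulmx1 wAV /w -scalerDr addrACA subrr addr0 -mulr2n -[x *+ 2]scaler_nat.
  by rewrite scalerA mulVf ?scale1r.
have [xc _] := mulmx_cayley hA wS.
rewrite /conf xc wAV scalerA divff// scale1r opprB [x + _]addrC subrK.
rewrite mxE eqxx addrC subrK /z scalerA.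
by rewrite mulrA divfK// divff// scale1r.
Qed.

End cayley.

(** * Averages over the parameters of the rotations *)

Section conf_average.
Context (R : realType) (n : nat).
Hypothesis n0 : (0 < n)%N.
Implicit Types (x y u t : 'rV[R]_n).

Lemma rowB_coord x y j : (x - y) ord0 j = x ord0 j - y ord0 j.
Proof. by rewrite !mxE. Qed.

Lemma measurable_dotrv d (T : measurableType d) (f g : T -> 'rV[R]_n) :
  measurable_fun setT f -> measurable_fun setT g ->
  measurable_fun setT (fun z => dotrv (f z) (g z)).
Proof.
move=> mf mg; apply: measurable_sum => j.
by apply: measurable_funM; exact: measurable_fun_coord.
Qed.

Lemma measurable_conf d (T : measurableType d) (f g : T -> 'rV[R]_n) i :
  measurable_fun setT f -> measurable_fun setT g ->
  measurable_fun setT (fun z => conf i (f z) (g z)).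
Proof.
move=> mf mg.
have mo : measurable_fun setT (fun z => off i (f z)).
  rewrite (_ : (fun z => _) = (fun z => f z - f z ord0 i *: delta_mx ord0 i)); last first.
    by apply/funext => z; rewrite /off -lock.
  by apply: measurable_funB_rV => //; apply: measurable_funZ_rV => //; exact: measurable_fun_coord.
have mfi : measurable_fun setT (fun z => f z ord0 i) by exact: measurable_fun_coord.
have mgi : measurable_fun setT (fun z => g z ord0 i) by exact: measurable_fun_coord.
have mc : measurable_fun setT (fun z => (g z ord0 i + dotrv (g z) (off i (f z))) /
    (1 + dotrv (off i (f z)) (off i (f z)))).
  apply: measurable_funM.
    by apply: measurable_funD => //; exact: measurable_dotrv.
  rewrite (_ : (fun z => _) = (fun z => (1 + dotrv (off i (f z)) (off i (f z))) `^ (-1))).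
    apply: (measurableT_comp (measurable_powR _)); apply: measurable_funD => //.
    exact: measurable_dotrv.
  by apply/funext => z; rewrite powR_inv1// addr_ge0// dotrvv_ge0.
rewrite /conf; apply: measurable_funZ_rV; first by apply: measurable_funD.
rewrite (_ : (fun z => _) = (fun z => g z + (2 * ((g z ord0 i + dotrv (g z) (off i (f z))) /
    (1 + dotrv (off i (f z)) (off i (f z))) - g z ord0 i)) *: delta_mx ord0 i -
   (2 * ((g z ord0 i + dotrv (g z) (off i (f z))) /
    (1 + dotrv (off i (f z)) (off i (f z))))) *: off i (f z))); last first.
  by apply/funext => z; rewrite confE.
apply: measurable_funB_rV.
  apply: measurable_funD_rV => //; apply: measurable_funZ_rV => //.
  by apply: measurable_funM => //; exact: measurable_funB.
by apply: measurable_funZ_rV => //; exact: measurable_funM.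
Qed.

(** Selects the direction e_i for the rotations at x: the parameters in [conf_onto] have the
    denominator x_i + z_i, which must stay away from 0. *)
Lemma big_coord x : 2^-1 <= enorm x -> exists i, (4 * n%:R)^-1 <= `|x ord0 i|.
Proof.
move=> hx; apply: contrapT => /forallNP h.
have := @enorm_le_sup _ _ x (4 * n%:R)^-1 _.
have nn : n%:R != 0 :> R by rewrite pnatr_eq0 -lt0n.
rewrite (_ : n%:R * _ = 4^-1 :> R); last by field; rewrite nn.
have hh j : `|x ord0 j| <= (4 * n%:R)^-1.
  by rewrite leNgt; apply/negP => /ltW; exact: h.
by move=> /(_ hh); lra.
Qed.

(** With eta = 2 n delta, a bound for |c - x|, the rescaled point z satisfies |x - z| <= 2 eta, and
    the smallness of delta keeps |x_i + z_i| above 1 / (4 n). The quotients of [conf_onto] are then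
    at most 2 eta times 4 n, that is 16 n^2 delta. *)
Lemma conf_parameter i x (c : 'rV[R]_n) (delta : R) : 0 <= delta -> 32 * n%:R ^+ 2 * delta <= 1 ->
  2^-1 <= enorm x -> (4 * n%:R)^-1 <= `|x ord0 i| ->
  (forall j, `|c ord0 j - x ord0 j| <= 2 * delta) ->
  exists t, conf i t x = c /\ forall j, `|t ord0 j| <= 16 * n%:R ^+ 2 * delta.
Proof.
move=> d0 d1 hx hxi hc.
have nn : 1 <= n%:R :> R by rewrite ler1n.
have n00 : 0 < n%:R :> R by lra.
pose eta := n%:R * (2 * delta).
have eta0 : 0 <= eta by rewrite /eta !mulr_ge0.
have heta : 16 * n%:R * eta <= 1.
  by apply: le_trans d1; apply: ler_of_eq; rewrite /eta; ring.
have eta1 : eta <= 16^-1.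
  by rewrite -(@ler_pM2l _ 16)// divff//; apply: le_trans heta; rewrite ler_wpM2r//; lra.
have cx : enorm (c - x) <= eta by apply: enorm_le_sup => j; rewrite !mxE.
have dcx : `|enorm c - enorm x| <= eta by apply: le_trans (enorm_dist _ _) cx.
have x00 : 0 < enorm x by lra.
have c00 : 0 < enorm c by move: dcx; rewrite ler_norml => /andP[]; lra.
pose z := (enorm x / enorm c) *: c.
have zc : enorm (z - c) <= eta.
  rewrite (_ : z - c = (enorm x / enorm c - 1) *: c); last by rewrite scalerBl scale1r.
  rewrite enormZ -{2}(gtr0_norm c00) -normrM mulrBl divfK ?gt_eqF// mul1r distrC//.
have zx : enorm (x - z) <= 2 * eta.
  by rewrite enormBC (le_trans (enorm_distD c _ _))//; lra.
have zi j : `|x ord0 j - z ord0 j| <= 2 * eta.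
  by have := le_trans (ler_coord_enorm (x - z) j) zx; rewrite !mxE.
have big : (4 * n%:R)^-1 <= `|x ord0 i + z ord0 i|.
  have h2 : 2 * `|x ord0 i| <= `|x ord0 i + z ord0 i| + `|x ord0 i - z ord0 i|.
    rewrite -[2 in leLHS]ger0_norm// -normrM (_ : 2 * _ = (x ord0 i + z ord0 i) + (x ord0 i - z ord0 i)).
      exact: ler_normD.
    by ring.
  have h3 : 2 * eta <= (8 * n%:R)^-1.
    rewrite -(@ler_pM2l _ (8 * n%:R)); last by rewrite mulr_gt0.
    rewrite divff ?gt_eqF ?mulr_gt0//; apply: le_trans heta; apply: ler_of_eq; ring.
  have h4 : (8 * n%:R)^-1 = (4 * n%:R)^-1 / 2 :> R by field; rewrite gt_eqF.
  have := zi i; have p4 : 0 < (4 * n%:R)^-1 :> R by rewrite invr_gt0 mulr_gt0.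
  lra.
have p4 : 0 < (4 * n%:R)^-1 :> R by rewrite invr_gt0 mulr_gt0.
have xz : x ord0 i + z ord0 i != 0 by rewrite -normr_gt0 (lt_le_trans p4).
have x0 : x != 0 by rewrite -enorm_gt0.
have c0 : c != 0 by rewrite -enorm_gt0.
eexists; split; first exact: (conf_onto x0 c0 xz).
move=> j; rewrite mxE -/z; case: eqP => [_|_].
  rewrite (_ : _ - 1 = (enorm c - enorm x) / enorm x); last by field; rewrite gt_eqF.
  rewrite normrM normfV (gtr0_norm x00).
  rewrite ler_pdivrMr//; apply: (le_trans dcx).
  apply: (@le_trans _ _ (16 * n%:R ^+ 2 * delta * 2^-1)); last first.
    by rewrite ler_wpM2l// !mulr_ge0.
  rewrite /eta (_ : _ * 2^-1 = n%:R * (2 * delta) * (4 * n%:R)); last by field.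
  by rewrite ler_peMr//; lra.
rewrite normrM normfV ler_pdivrMr ?(lt_le_trans p4)//.
apply: (le_trans (zi j)); apply: (@le_trans _ _ (16 * n%:R ^+ 2 * delta * (4 * n%:R)^-1)).
  by apply: ler_of_eq; rewrite /eta; field; rewrite gt_eqF.
by rewrite ler_wpM2l// !mulr_ge0.
Qed.

Definition cbox (c : 'rV[R]_n) (h : R) := rbox (c - const_mx h) (c + const_mx h).

Lemma cboxP c h y : cbox c h y <-> forall j, - h <= y ord0 j - c ord0 j < h.
Proof.
split => hy j; have := hy j; rewrite !mxE.
  by move=> /andP[h1 h2]; apply/andP; split; lra.
by move=> /andP[h1 h2]; apply/andP; split; lra.
Qed.

Lemma lebesgue_cbox c h : 0 <= h -> lebesgue_rV n (cbox c h) = ((2 * h) ^+ n)%:E.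
Proof.
move=> h0; rewrite lebesgue_rbox => [|j]; last by rewrite !mxE; lra.
congr (_ %:E); rewrite -[in RHS](card_ord n) -prodr_const; apply: eq_bigr => j _.
by rewrite !mxE; ring.
Qed.

(** The constant of [conf_dist] for |x| <= 4. *)
Definition lipc : R := 4 * (1 + 8 * n%:R).

(** The image of Lebesgue measure on the parameter box dominates a multiple of Lebesgue measure on
    the cube. On small cells this is elementary: a cell that meets the cube has its centre at conf
    t0 x for some t0, and by the Lipschitz bound it contains the image of a box around t0 whose side
    is shorter only by the factor 2 [lipc]. *)
Lemma conf_average i x (delta : R) (g : 'rV[R]_n -> R) :
  0 < delta -> 32 * n%:R ^+ 2 * delta <= 1 ->
  2^-1 <= enorm x -> enorm x <= 4 -> (4 * n%:R)^-1 <= `|x ord0 i| ->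
  measurable_fun setT g -> (forall u, 0 <= g u) ->
  (\int[lebesgue_rV n]_(u in cbox x delta) (g u)%:E <=
   ((2 * lipc) ^+ n)%:E *
   \int[lebesgue_rV n]_(t in cbox 0 (32 * n%:R ^+ 2 * delta)%R) (g (conf i t x))%:E)%E.
Proof.
move=> d0 d1 hx hx4 hxi mg g0.
have nn : 1 <= n%:R :> R by rewrite ler1n.
have L0 : 1 <= lipc by rewrite /lipc; lra.
have LL : 0 < 4 * lipc by rewrite mulr_gt0//; lra.
(* Twice the bound 16 n^2 delta for the parameter of a cell centre, which leaves room for the box
   around it. *)
pose tau := 32 * n%:R ^+ 2 * delta.
have tau0 : 0 <= tau by rewrite !mulr_ge0 ?exprn_ge0// ltW.
have mB : measurable (cbox x delta) by exact: measurable_rbox.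
have mT : measurable (cbox 0 tau) by exact: measurable_rbox.
have mphi : measurable_fun setT (fun t => conf i t x) by exact: measurable_conf.
pose nu : {measure set 'rV[R]_n -> \bar R} := mrestr (lebesgue_rV n) mB.
pose kap : {measure set 'rV[R]_n -> \bar R} :=
  measure_function_pushforward__canonical__measure_function_Measure
    (mrestr (lebesgue_rV n) mT) mphi.
have C0 : 0 <= (2 * lipc) ^+ n by rewrite exprn_ge0// mulr_ge0//; lra.
(* From generation [k0] on, cells have side at most delta. *)
have [k0 hk0] := expr2_unbounded delta^-1.
have key S : measurable S -> (nu S <= ((2 * lipc) ^+ n)%:E * kap S)%E.
  apply: (@dyadic_measure_le R n nu kap _ k0) => //.
  - by rewrite /nu/= /mrestr setTI lebesgue_cbox ?ltry// ltW.
  - by rewrite /kap/= /pushforward/mrestr preimage_setT setTI lebesgue_cbox ?ltry.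
  move=> k d k0k; have p2 : 0 < 2 ^+ k :> R by rewrite exprn_gt0.
  have kd : (2 ^+ k)^-1 <= delta.
    rewrite invf_ple ?posrE//; apply: (le_trans (ltW hk0)).
    by rewrite ler_weXn2l// ler1n.
  have mQ := @measurable_dyadic_cell R n k d.
  have [[y [Qy By]]|nQB] := pselect (exists y, dyadic_cell k d y /\ cbox x delta y); last first.
    rewrite /nu/= /mrestr (_ : _ `&` _ = set0) ?measure0 ?mule_ge0//.
    by rewrite -subset0 => y [Qy By]; apply: nQB; exists y.
  pose c : 'rV[R]_n := \row_j (((d ord0 j)%:~R + 2^-1) / 2 ^+ k).
  have hQ (v : 'rV[R]_n) : (forall j, - (2 * 2 ^+ k)^-1 <= v ord0 j - c ord0 j < (2 * 2 ^+ k)^-1) -> dyadic_cell k d v.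
    rewrite dyadic_cellE => hv j; have := hv j; rewrite !mxE intrD.
    rewrite (_ : (2 * 2 ^+ k)^-1 = 2^-1 / 2 ^+ k); last by rewrite invfM.
    by rewrite !mulrDl; lra.
  have cy j : `|c ord0 j - y ord0 j| <= delta.
    apply: (@le_trans _ _ (2 * 2 ^+ k)^-1); last first.
      rewrite invfM (le_trans _ kd)// ler_piMl ?invr_ge0 ?ltW// invf_lt1// ltr1n//.
    move: Qy; rewrite dyadic_cellE => /(_ j); rewrite !mxE intrD.
    rewrite (_ : (2 * 2 ^+ k)^-1 = 2^-1 / 2 ^+ k); last by rewrite invfM.
    by rewrite !mulrDl ler_norml; lra.
  have cx j : `|c ord0 j - x ord0 j| <= 2 * delta.
    move/cboxP : By => /(_ j) h; have := cy j; rewrite !ler_norml; lra.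
  have [t0 [t0c t0d]] := conf_parameter (ltW d0) d1 hx hxi cx.
  (* Images of this box deviate from the centre by at most a quarter of the side of the cell. This
     is strictly less than half of it, so the missing faces of the half-open cell do no harm. *)
  pose r := (2 ^+ k * (4 * lipc))^-1.
  have r0 : 0 < r by rewrite invr_gt0 mulr_gt0.
  have rd : r <= delta.
    apply: le_trans kd; rewrite /r invfM ler_piMr ?invr_ge0 ?(ltW p2)// invf_le1//; lra.
  have n2 : 1 <= n%:R ^+ 2 :> R by rewrite exprn_ege1.
  have dn : delta <= n%:R ^+ 2 * delta by rewrite ler_peMl// ltW.
  have sub : cbox t0 r `<=` (fun t => conf i t x) @^-1` dyadic_cell k d `&` cbox 0 tau.
    move=> t /cboxP ht; split; last first.
      apply/cboxP => j; rewrite !mxE subr0; have := ht j; have := t0d j; rewrite ler_norml.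
      rewrite /tau -!mulrA; lra.
    apply: hQ => j; have h1 : enorm (conf i t x - conf i t0 x) <= (1 + 8 * n%:R) * enorm x * r.
      apply: conf_dist => [|q]; first by apply: (le_trans (t0d i)); lra.
      by have := ht q; rewrite ler_norml; lra.
    have h2 := le_trans (ler_coord_enorm _ j) h1.
    have h3 : (1 + 8 * n%:R) * enorm x * r <= (4 * 2 ^+ k)^-1.
      apply: (@le_trans _ _ (lipc * r)).
        rewrite ler_wpM2r ?(ltW r0)// /lipc mulrC ler_wpM2r//; lra.
      by apply: ler_of_eq; rewrite /r; field; rewrite !gt_eqF//; lra.
    have h4 : (4 * 2 ^+ k)^-1 < (2 * 2 ^+ k)^-1 :> R.
      by rewrite ltf_pV2 ?posrE ?mulr_gt0// ltr_pM2r// ltr_nat.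
    move: h2; rewrite t0c rowB_coord ler_norml => /andP[h5 h6].
    by apply/andP; split; lra.
  apply: (@le_trans _ _ (((2 ^+ k)^-1 ^+ n)%:E)).
    apply: (@le_trans _ _ (lebesgue_rV n (dyadic_cell k d))).
      by apply: mono_measure => //; exact: measurableI.
    rewrite dyadic_cellE lebesgue_rbox => [|j]; last first.
      by rewrite !mxE ler_pM2r ?invr_gt0// ler_int lerDl.
    rewrite lee_fin -[in leRHS](card_ord n) -prodr_const.
    by apply: ler_of_eq; apply: eq_bigr => j _; rewrite !mxE intrD -mulrBl addrC addKr mul1r.
  apply: (@le_trans _ _ (((2 * lipc) ^+ n)%:E * lebesgue_rV n (cbox t0 r))%E); last first.
    apply: lee_pmul => //; apply: mono_measure => //; first exact: measurable_rbox.
    by apply: measurableI => //; have := mphi measurableT _ mQ; rewrite setTI.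
  rewrite (lebesgue_cbox _ (ltW r0)) -EFinM lee_fin -exprMn; apply: ler_of_eq; congr (_ ^+ n).
  by rewrite /r; field; rewrite !gt_eqF//; lra.
have mgE : measurable_fun setT (EFin \o g) by exact/measurable_EFinP.
have gE0 u : (0 <= (EFin \o g) u)%E by rewrite lee_fin.
rewrite -(ge0_integral_mrestr _ mB mgE gE0).
rewrite -(ge0_integral_mrestr _ mT); last 2 first.
- by apply/measurable_EFinP; exact: measurableT_comp mg mphi.
- by move=> t; rewrite lee_fin.
apply: (@le_trans _ _ (\int[mscale (NngNum C0) kap]_u (EFin \o g) u)%E).
  by apply: ge0_le_measure_integral => // S mS; exact: key.
rewrite ge0_integral_mscale// ge0_integral_pushforward// preimage_setT//.
Qed.

End conf_average.

Section tonelli.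
Context d1 d2 (T1 : measurableType d1) (T2 : measurableType d2) (R : realType).
Variables (m1 : {sigma_finite_measure set T1 -> \bar R})
  (m2 : {sigma_finite_measure set T2 -> \bar R}) (f : T1 * T2 -> R).
Hypotheses (mf : measurable_fun setT f) (f0 : forall z, 0 <= f z).

Lemma measurable_fun_slice1 x : measurable_fun setT (fun y => f (x, y)).
Proof. by apply: measurableT_comp => //; exact: measurable_pair1. Qed.

Lemma measurable_fun_slice2 y : measurable_fun setT (fun x => f (x, y)).
Proof. by apply: measurableT_comp => //; exact: measurable_pair2. Qed.

Let mfE : measurable_fun setT (EFin \o f). Proof. exact/measurable_EFinP. Qed.

Lemma measurable_fun_integral2 : measurable_fun setT (fun x => \int[m2]_y (f (x, y))%:E)%E.
Proof. exact: (@measurable_fun_fubini_tonelli_F _ _ _ _ _ m2 (EFin \o f)). Qed.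

Lemma measurable_fun_integral1 : measurable_fun setT (fun y => \int[m1]_x (f (x, y))%:E)%E.
Proof. exact: (@measurable_fun_fubini_tonelli_G _ _ _ _ _ m1 (EFin \o f)). Qed.

Lemma tonelli_real :
  (\int[m1]_x \int[m2]_y (f (x, y))%:E = \int[m2]_y \int[m1]_x (f (x, y))%:E)%E.
Proof. exact: (@fubini_tonelli _ _ _ _ _ m1 m2 (EFin \o f)). Qed.

End tonelli.

Section tonelli_dom.
Context d1 d2 (T1 : measurableType d1) (T2 : measurableType d2) (R : realType).
Variables (m1 : {sigma_finite_measure set T1 -> \bar R})
  (m2 : {sigma_finite_measure set T2 -> \bar R}) (f : T1 * T2 -> R).
Hypotheses (mf : measurable_fun setT f) (f0 : forall z, 0 <= f z).
Variables (A : set T1) (B : set T2).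
Hypotheses (mA : measurable A) (mB : measurable B).

Lemma integral_EFin_indic d (T : measurableType d) (mu : {measure set T -> \bar R})
    (g : T -> R) (D : set T) :
  (\int[mu]_(x in D) (g x)%:E = \int[mu]_x (g x * \1_D x)%:E)%E.
Proof.
rewrite integral_mkcond epatch_indic; apply: eq_integral => x _ /=.
by rewrite EFinM.
Qed.

Let fAB (z : T1 * T2) := f z * \1_A z.1 * \1_B z.2.
Let mfAB : measurable_fun setT fAB.
Proof.
apply: measurable_funM; first apply: measurable_funM => //.
  by apply: measurableT_comp => //; exact: measurable_fst.
by apply: measurableT_comp => //; exact: measurable_snd.
Qed.
Let fAB0 z : 0 <= fAB z. Proof. by rewrite /fAB !mulr_ge0. Qed.

Lemma measurable_fun_integral2_dom :
  measurable_fun setT (fun x => \int[m2]_(y in B) (f (x, y))%:E)%E.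
Proof.
under eq_fun do rewrite integral_EFin_indic.
apply: (@measurable_fun_integral2 _ _ _ _ _ m2 (fun z => f z * \1_B z.2)) => //.
  by apply: measurable_funM => //; apply: measurableT_comp => //; exact: measurable_snd.
by move=> z; rewrite mulr_ge0.
Qed.

Lemma tonelli_dom :
  (\int[m1]_(x in A) \int[m2]_(y in B) (f (x, y))%:E =
   \int[m2]_(y in B) \int[m1]_(x in A) (f (x, y))%:E)%E.
Proof.
transitivity (\int[m1]_x \int[m2]_y (fAB (x, y))%:E)%E.
  rewrite integral_mkcond; apply: eq_integral => x _.
  rewrite /patch; case: ifPn => xA.
    rewrite integral_EFin_indic; apply: eq_integral => y _.
    by rewrite /fAB/= [\1_A x]indicE xA mulr1.
  rewrite integral0_eq// => y _; by rewrite /fAB/= [\1_A x]indicE (negbTE xA) mulr0 mul0r.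
rewrite tonelli_real//; rewrite [RHS]integral_mkcond; apply: eq_integral => y _.
rewrite /patch; case: ifPn => yB.
  rewrite [RHS]integral_EFin_indic; apply: eq_integral => x _.
  by rewrite /fAB/= [\1_B y]indicE yB mulr1.
by rewrite integral0_eq// => x _; rewrite /fAB/= [\1_B y]indicE (negbTE yB) mulr0.
Qed.

End tonelli_dom.

Section translation_modulus.
Context (R : realType) (n : nat).
Hypothesis n0 : (0 < n)%N.
Local Notation mu := (@lebesgue_rV R n).
Variable Om : 'rV[R]_n -> R.
Hypotheses (mOm : measurable_fun setT Om) (hOm : homogeneous0 Om).

Lemma integral_cst_cbox (c : 'rV[R]_n) (h k : R) : 0 <= h ->
  (\int[mu]_(u in cbox c h) k%:E = (k * (2 * h) ^+ n)%:E)%E.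
Proof.
move=> h0; rewrite integral_cst; last exact: measurable_rbox.
by rewrite EFinM; congr (_ * _)%E; exact: lebesgue_cbox.
Qed.

Lemma measurable_comp_rV d (T : measurableType d) (f : T -> 'rV[R]_n) :
  measurable_fun setT f -> measurable_fun setT (fun z => Om (f z)).
Proof. by move=> mf; exact: (measurableT_comp mOm). Qed.

Lemma measurable_dist_comp d (T : measurableType d) (f g : T -> 'rV[R]_n) :
  measurable_fun setT f -> measurable_fun setT g ->
  measurable_fun setT (fun z => `|Om (f z) - Om (g z)|).
Proof.
move=> mf mg; apply: (measurableT_comp (@normr_measurable R setT)).
by apply: measurable_funB; exact: measurable_comp_rV.
Qed.

(** The increment under a fixed rotation is again homogeneous of degree 0, so its integral over the
    sphere controls its integral over balls. *)
Lemma rotation_modulus_eball (rho : 'M[R]_n) (w r : R) : 0 < r ->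
  (\int[sphere_measure]_z `|Om (z *m rho) - Om z|%:E <= w%:E)%E ->
  (\int[mu]_(x in eball 0%R r) `|Om (x *m rho) - Om x|%:E <= (ball_vol R n * w * r ^+ n)%:E)%E.
Proof.
move=> r0 h.
apply: (@homogeneous0_morrey R n n0 (fun x => `|Om (x *m rho) - Om x|) _ _ _ w h r r0) => //.
- by apply: measurable_dist_comp => //; exact: measurable_mulmx.
- by move=> t x t0; rewrite -scalemxAl !hOm.
Qed.

(** Parameters of size at most 64 n^2 delta give a rotation of size at most 256 n^3 delta; one more
    unit makes the inequality strict. *)
Definition rotc : R := 257 * n%:R ^+ 3.
(** From the inside out: the ball of radius 3, the volume ratio of parameter box and averaging cube,
    the n coordinate directions, the loss in [conf_average], and the two halves of a triangle
    inequality. *)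
Definition transc : R :=
  2 * ((2 * lipc R n) ^+ n * (n%:R * ((64 * n%:R ^+ 2) ^+ n * (ball_vol R n * 3 ^+ n)))).

Lemma transc_ge0 : 0 <= transc.
Proof.
have lip0 : 0 <= lipc R n by rewrite /lipc mulr_ge0// addr_ge0// mulr_ge0.
by rewrite /transc !mulr_ge0 ?exprn_ge0 ?mulr_ge0 ?ball_vol_ge0 ?exprn_ge0.
Qed.

Variables (delta w : R).
Hypotheses (d0 : 0 < delta) (d1 : 128 * n%:R ^+ 2 * delta <= 1) (w0 : 0 <= w).
Hypothesis rotw : forall rho : 'M[R]_n, rotation rho ->
  (rotation_size rho < (rotc * delta)%:E)%E ->
  (\int[sphere_measure]_z `|Om (z *m rho) - Om z|%:E <= w%:E)%E.

Let nn : 1 <= n%:R :> R. Proof. by rewrite ler1n. Qed.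
Let tau : R := 32 * n%:R ^+ 2 * (2 * delta).
Let tauE : tau = 64 * n%:R ^+ 2 * delta. Proof. by rewrite /tau; ring. Qed.
Let tau1 : tau <= 2^-1. Proof.
rewrite tauE (_ : _ * delta = 2^-1 * (128 * n%:R ^+ 2 * delta)); last by field.
by rewrite -[leRHS]mulr1 ler_pM2l.
Qed.

Let conf_rotation_size i (t : 'rV[R]_n) : cbox 0 tau t ->
  (rotation_size (cayley (plane_mx i t)) < (rotc * delta)%:E)%E.
Proof.
move=> /cboxP ht; have hA := plane_mx_antisym i t.
have n2 : 1 <= n%:R ^+ 2 :> R by rewrite exprn_ege1.
have tau0 : 0 <= tau by rewrite tauE !mulr_ge0// ltW.
have off_le : enorm (off i t) <= n%:R * tau.
  apply: enorm_le_sup => j; rewrite offE; case: eqP => _; first by rewrite normr0.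
  by have := ht j; rewrite mxE subr0 ler_norml => /andP[-> /ltW].
apply: (@le_lt_trans _ _ (4 * (n%:R * tau))%:E); last first.
  rewrite lte_fin tauE /rotc (_ : 4 * _ = 256 * n%:R ^+ 3 * delta); last by ring.
  by rewrite ltr_pM2r// ltr_pM2r ?exprn_gt0 ?ltr0n// ltr_nat.
apply: ge_ereal_sup => _ [z z1 <-]; rewrite lee_fin.
have [x xS] := cayley_midpoint z hA; have [-> xz] := mulmx_cayley hA xS.
rewrite addrC addKr enormN enormZ ger0_norm//.
have hz : enorm z = 1 by exact: z1.
have := enorm_plane i x t; rewrite hz in xz.
have : enorm x * enorm (off i t) <= n%:R * tau.
  by apply: le_trans off_le; rewrite ler_piMl// enorm_ge0.
lra.
Qed.

Let F (xu : 'rV[R]_n * 'rV[R]_n) := `|Om xu.1 - Om xu.2|.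
(** The oscillation of [Om] around x. With half-side 2 delta, the cubes around x and around x - y
    both contain the cube of half-side delta around x. *)
Let G (x : 'rV[R]_n) : \bar R := (\int[mu]_(u in cbox x (2 * delta)) (F (x, u))%:E)%E.
Let F0 z : 0 <= F z. Proof. exact: normr_ge0. Qed.
Let mcb : measurable (cbox (0 : 'rV[R]_n) tau). Proof. exact: measurable_rbox. Qed.
(** Large enough to contain x - y when 1 <= |x| <= 2 and |y| <= 1/2. *)
Let shell' := [set x : 'rV[R]_n | enorm x \in `[2^-1, 3]].

Let mF : measurable_fun setT F.
Proof. by apply: measurable_dist_comp; [exact: measurable_fst|exact: measurable_snd]. Qed.

Let mG : measurable_fun setT G.
Proof.
pose f (z : 'rV[R]_n * 'rV[R]_n) := F z * \1_(cbox 0 (2 * delta)) (z.2 - z.1).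
have -> : G = fun x => (\int[mu]_u (f (x, u))%:E)%E.
  apply/funext => x; rewrite /G integral_EFin_indic; apply: eq_integral => u _.
  rewrite /f/=; congr (_ * _)%:E; rewrite !indicE; congr (_ _)%:R.
  apply/idP/idP => /set_mem/cboxP h; apply/mem_set/cboxP => j; have := h j.
    by rewrite !mxE subr0.
  by rewrite !mxE subr0.
apply: measurable_fun_integral2; last by move=> z; rewrite /f mulr_ge0// /F.
apply: measurable_funM => //.
apply: (measurableT_comp (f := (\1_(cbox 0 (2 * delta)) : 'rV[R]_n -> R))).
  by apply: measurable_indic; exact: measurable_rbox.
by apply: measurable_funB_rV; [exact: measurable_snd|exact: measurable_fst].
Qed.

Let G0 x : (0 <= G x)%E.
Proof. by apply: integral_ge0 => u _; rewrite lee_fin /F. Qed.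

Let Fconf i t x : cbox 0 tau t -> F (x, conf i t x) = `|Om (x *m cayley (plane_mx i t)) - Om x|.
Proof.
(* The dilation factor 1 + t_i is positive because tau <= 1/2, so homogeneity removes it. *)
move=> /cboxP ht; rewrite /F/= distrC /conf hOm//.
apply: (@lt_le_trans _ _ (1 - tau)).
  by rewrite subr_gt0 (le_lt_trans tau1)// invf_lt1// ltr1n.
by rewrite lerD2l; have := ht i; rewrite mxE subr0 => /andP[].
Qed.

Let mFconf i : measurable_fun setT (fun z : 'rV[R]_n * 'rV[R]_n => F (z.1, conf i z.2 z.1)).
Proof.
apply: measurable_dist_comp; first exact: measurable_fst.
by apply: measurable_conf; [exact: measurable_snd|exact: measurable_fst].
Qed.

Let inner i (x : 'rV[R]_n) : \bar R := (\int[mu]_(t in cbox 0%R tau) (F (x, conf i t x))%:E)%E.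

Let minner i : measurable_fun setT (inner i).
Proof.
exact: (@measurable_fun_integral2_dom _ _ _ _ _ mu
  (fun z => F (z.1, conf i z.2 z.1)) (mFconf i) (fun z => F0 _) (cbox 0 tau) mcb).
Qed.

Let inner0 i x : (0 <= inner i x)%E.
Proof. by apply: integral_ge0 => t _; rewrite lee_fin /F. Qed.

Let mshell' : measurable shell'. Proof. exact: measurable_enorm_itv. Qed.

(** The direction chosen by [big_coord] depends on x; the sum over all directions does not and can
    be integrated. *)
Let G_le x : shell' x -> (G x <= ((2 * lipc R n) ^+ n)%:E * \sum_(i < n) inner i x)%E.
Proof.
rewrite /shell'/= in_itv/= => /andP[x1 x3].
have [i xi] := big_coord n0 x1.
have lip0 : 0 <= lipc R n by rewrite /lipc mulr_ge0// addr_ge0// mulr_ge0.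
apply: (@le_trans _ _ (((2 * lipc R n) ^+ n)%:E * inner i x)%E).
  apply: (@conf_average R n n0 i x (2 * delta) (fun u => F (x, u))) => //.
  - by rewrite mulr_gt0.
  - by move: d1; rewrite (_ : 32 * _ * _ = 64 * n%:R ^+ 2 * delta); [lra|ring].
  - by apply: (le_trans x3); rewrite ler_nat.
  - exact: measurable_fun_slice1.
apply: lee_pmul => //; first by rewrite lee_fin exprn_ge0// mulr_ge0.
rewrite (bigD1 i)//=; apply: leeDl; apply: sume_ge0 => j _; exact: inner0.
Qed.

(** After the interchange of integrals the rotation is fixed while x varies, so the hypothesis on
    the modulus applies for each t. *)
Let integral_inner i :
  (\int[mu]_(x in shell') inner i x <= ((2 * tau) ^+ n * (ball_vol R n * w * 3 ^+ n))%:E)%E.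
Proof.
have tau0 : 0 <= tau by rewrite tauE !mulr_ge0 ?exprn_ge0// ltW.
have W0 : 0 <= ball_vol R n * w * 3 ^+ n by rewrite !mulr_ge0 ?ball_vol_ge0 ?exprn_ge0.
rewrite (@tonelli_dom _ _ _ _ _ mu mu (fun z => F (z.1, conf i z.2 z.1)) (mFconf i)
  (fun z => F0 _) shell' (cbox 0 tau) mshell' mcb).
apply: (@le_trans _ _ (\int[mu]_(t in cbox 0%R tau) (ball_vol R n * w * 3 ^+ n)%:E)%E); last first.
  by rewrite integral_cst_cbox// lee_fin mulrC.
apply: ge0_le_integral => //.
- by move=> t _; apply: integral_ge0 => x _; rewrite lee_fin /F.
- apply: measurable_funTS.
  under eq_fun do rewrite integral_EFin_indic.
  apply: (@measurable_fun_integral1 _ _ _ _ _ mu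
    (fun z => F (z.1, conf i z.2 z.1) * \1_shell' z.1)) => //.
    apply: measurable_funM; first exact: mFconf.
    by apply: measurableT_comp => //; exact: measurable_fst.
  by move=> z; rewrite mulr_ge0// /F.
move=> t tt; apply: (@le_trans _ _ (\int[mu]_(x in eball 0%R 3%R)
    `|Om (x *m cayley (plane_mx i t)) - Om x|%:E)%E).
  under eq_integral do rewrite /= Fconf//.
  apply: ge0_subset_integral => //.
  - exact: measurable_eball.
  - apply: measurable_funTS; apply/measurable_EFinP; apply: measurable_dist_comp => //.
    exact: measurable_mulmx.
  - by move=> x; rewrite /shell'/eball/= in_itv/= subr0 => /andP[].
apply: rotation_modulus_eball => //; apply: rotw; last exact: conf_rotation_size.
by apply: cayley_rotation; exact: plane_mx_antisym.
Qed.

Let P : R := (2 * lipc R n) ^+ n * (n%:R * ((2 * tau) ^+ n * (ball_vol R n * w * 3 ^+ n))).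

Let integral_G : (\int[mu]_(x in shell') G x <= P%:E)%E.
Proof.
have lip0 : 0 <= lipc R n by rewrite /lipc mulr_ge0// addr_ge0// mulr_ge0.
apply: (@le_trans _ _ (\int[mu]_(x in shell') (((2 * lipc R n) ^+ n)%:E * \sum_(i < n) inner i x))%E).
  apply: ge0_le_integral => //.
  - exact: measurable_funTS.
  - apply: measurable_funTS; apply: measurable_funeM; apply: emeasurable_sum => i.
    exact: minner.
rewrite ge0_integralZl//; last 3 first.
- by apply: measurable_funTS; apply: emeasurable_sum => i; exact: minner.
- by move=> x _; apply: sume_ge0.
- by rewrite lee_fin exprn_ge0// mulr_ge0.
rewrite /P EFinM; apply: lee_pmul => //.
- by rewrite lee_fin exprn_ge0// mulr_ge0.
- by apply: integral_ge0 => x _; apply: sume_ge0.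
rewrite ge0_integral_sum//; last by move=> i; apply: measurable_funTS.
apply: (@le_trans _ _ (\sum_(i < n) ((2 * tau) ^+ n * (ball_vol R n * w * 3 ^+ n))%:E)%E).
  by apply: lee_sum => i _; exact: integral_inner.
by rewrite sumEFin lee_fin sumr_const card_ord; apply: ler_of_eq; rewrite [RHS]mulr_natl.
Qed.

(** An intermediate point u is inserted and averaged over the cube of half-side delta around x. This
    bounds (2 delta)^n |Om (x - y) - Om x| by G (x - y) + G x, and each of the two has integral at
    most [P]. *)
Lemma translation_modulus (y : 'rV[R]_n) : enorm y <= delta ->
  (\int[mu]_(x in [set x : 'rV[R]_n | (enorm x \in `[1, 2])%R]) `|Om (x - y) - Om x|%:E <= (transc * w)%:E)%E.
Proof.
move=> yd; pose D := [set x : 'rV[R]_n | enorm x \in `[1, 2]].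
have mD : measurable D by exact: measurable_enorm_itv.
have msub : measurable_fun setT (fun x : 'rV[R]_n => x - y).
  by apply: measurable_funB_rV.
have n2 : 1 <= n%:R ^+ 2 :> R by rewrite exprn_ege1.
have dhalf : delta <= 2^-1.
  have : delta <= n%:R ^+ 2 * delta by rewrite ler_peMl// ltW.
  by move: d1; rewrite -mulrA; lra.
have p2 : 0 < (2 * delta) ^+ n by rewrite exprn_gt0// mulr_gt0.
have key x : D x -> (((2 * delta) ^+ n * `|Om (x - y) - Om x|)%:E <= G (x - y)%R + G x)%E.
  move=> Dx; have mc := measurable_rbox (x - const_mx delta) (x + const_mx delta).
  have mF1 z : measurable_fun setT (fun u => (F (z, u))%:E).
    by apply/measurable_EFinP; exact: measurable_fun_slice1.
  have FE0 z : (0 <= (F z)%:E)%E by rewrite lee_fin.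
  apply: (@le_trans _ _ (\int[mu]_(u in cbox x delta) (F ((x - y)%R, u) + F (x, u))%:E)%E).
    apply: (@le_trans _ _ (\int[mu]_(u in cbox x delta) `|Om (x - y) - Om x|%:E)%E).
      by rewrite (integral_cst_cbox _ _ (ltW d0)) mulrC.
    apply: integral_le_mono => //.
      by apply: measurable_funD; exact: measurable_fun_slice1.
    move=> u _; rewrite /F/= (_ : Om (x - y) - Om x = (Om (x - y) - Om u) + (Om u - Om x)).
      by rewrite [`|Om x - _|]distrC ler_normD.
    by rewrite addrA subrK.
  under eq_integral do rewrite EFinD.
  rewrite ge0_integralD//; try by apply: measurable_funTS.
  apply: leeD; apply: ge0_subset_integral => //; try exact: measurable_rbox; try by apply: measurable_funTS.
    move=> u /cboxP hu; apply/cboxP => j; have := hu j; rewrite rowB_coord.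
    have := le_trans (ler_coord_enorm y j) yd; rewrite ler_norml; lra.
  by move=> u /cboxP hu; apply/cboxP => j; have := hu j; lra.
have mGy : measurable_fun setT (fun x : 'rV[R]_n => G (x - y)) by exact: (measurableT_comp mG).
have step : (\int[mu]_(x in D) ((2 * delta) ^+ n * `|Om (x - y) - Om x|)%:E <= (2 * P)%:E)%E.
  apply: (@le_trans _ _ (\int[mu]_(x in D) (G (x - y)%R + G x))%E).
    apply: ge0_le_integral => //.
    - by move=> x _; rewrite lee_fin mulr_ge0// ltW.
    - apply: measurable_funTS; apply/measurable_EFinP; apply: measurable_funM => //.
      exact: measurable_dist_comp.
    - by apply: measurable_funTS; exact: emeasurable_funD.
  rewrite ge0_integralD//; try by apply: measurable_funTS.
  rewrite (_ : 2 * P = P + P); last by ring.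
  rewrite EFinD; apply: leeD.
    have := @ge0_integral_affine R n 1 (- y) shell' G ltr01 mshell' (measurable_funTS mG) (fun x _ => G0 x).
    rewrite invr1 expr1n mul1e => h.
    apply: le_trans integral_G; rewrite -h.
    rewrite (_ : (fun x : 'rV[R]_n => G (1 *: x - y)) = (fun x => G (x - y))); last first.
      by apply/funext => x; rewrite scale1r.
    apply: ge0_subset_integral => //.
    - by have := @measurable_affine R n 1 (- y) measurableT _ mshell'; rewrite setTI.
    - exact: measurable_funTS.
    move=> x; rewrite /D/shell'/= !in_itv/= scale1r => /andP[x1 x2].
    by have := enorm_dist x y; have := enormB x y; have := enorm_dist (x - y) x;
      rewrite addrAC subrr add0r enormN !ler_norml; lra.
  apply: le_trans integral_G; apply: ge0_subset_integral => //; first exact: measurable_funTS.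
  by move=> x; rewrite /D/shell'/= !in_itv/=; lra.
have {}step : (((2 * delta) ^+ n)%:E * \int[mu]_(x in D) `|Om (x - y) - Om x|%:E <= (2 * P)%:E)%E.
  rewrite -ge0_integralZl//.
  - by apply: measurable_funTS; apply/measurable_EFinP; exact: measurable_dist_comp.
  - by rewrite lee_fin ltW.
rewrite -lee_pdivlMl// in step; apply: (le_trans step).
rewrite -EFinM lee_fin /P /transc (_ : 2 * tau = (64 * n%:R ^+ 2) * (2 * delta)); last first.
  by rewrite tauE; ring.
rewrite [(64 * _ * _) ^+ n]exprMn; apply: ler_of_eq.
move: ((2 * delta) ^+ n) p2 ((2 * lipc R n) ^+ n) ((64 * n%:R ^+ 2) ^+ n) (3 ^+ n) => a a0 b c e.
by field; rewrite gt_eqF.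
Qed.

End translation_modulus.

(** * Kernel estimates *)

Definition kernel (R : realType) (n : nat) (Om : 'rV[R]_n -> R) (z : 'rV[R]_n) : R :=
  Om z / enorm z ^+ n.

(** A Hoermander-type class. The weight |x|^beta, both in the size bound at the origin and in the
    smoothness bound away from it, pays for the increments of b. *)
Record singular_kernel (R : realType) (n : nat) (beta A C1 C2 C3 : R) (k : 'rV[R]_n -> R) : Prop := {
  singular_kernel_measurable : measurable_fun setT k ;
  singular_kernel_local : forall rho : R, 0 < rho ->
    (\int[lebesgue_rV n]_(x in eball 0%R rho) (`|k x| * enorm x `^ beta)%:E <=
     (C1 * rho `^ beta)%:E)%E ;
  singular_kernel_smooth : forall (d : R) (y : 'rV[R]_n), 0 < d -> enorm y <= d ->
    (\int[lebesgue_rV n]_(x in [set x | (A * d < enorm x)%R])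
       (enorm x `^ beta * `|k (x - y) - k x|)%:E <= (C2 * d `^ beta)%:E)%E ;
  singular_kernel_weak : forall t : R, 0 < t ->
    (lebesgue_rV n [set x | (t < `|k x|)%R] <= (C3 / t)%:E)%E }.

(* The radial factors used: the constant 1, and cutoffs of the kernel away from 0 and infinity. *)
Record cutoff (R : realType) (chi : R -> R) : Prop := {
  cutoff_measurable : measurable_fun setT chi ;
  cutoff_ge0 : forall t, 0 <= chi t ;
  cutoff_le1 : forall t, chi t <= 1 ;
  cutoff_lip : forall s t, 0 < s -> 0 < t ->
    `|chi s - chi t| <= 2 * `|s - t| / Num.min s t }.

Lemma ge0_integral_translate (R : realType) (n : nat) (D : set 'rV[R]_n) (g : 'rV[R]_n -> \bar R)
    (y : 'rV[R]_n) :
  measurable D -> measurable_fun D g -> (forall x, D x -> (0 <= g x)%E) ->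
  (\int[lebesgue_rV n]_(x in [set x | D (x - y)%R]) g (x - y)%R = \int[lebesgue_rV n]_(x in D) g x)%E.
Proof.
move=> mD mg g0; have := ge0_integral_affine (- y) ltr01 mD mg g0.
rewrite invr1 expr1n mul1e => <-.
rewrite (_ : (fun x => (1 *: x - y)%R) = (fun x => x - y)); last first.
  by apply/funext => x; rewrite scale1r.
by apply: eq_integral => x _; rewrite scale1r.
Qed.

Lemma integral_translate_le (R : realType) (n : nat) (D E : set 'rV[R]_n) (g : 'rV[R]_n -> R)
    (y : 'rV[R]_n) :
  measurable_fun setT g -> (forall x, 0 <= g x) -> measurable D -> measurable E ->
  (forall x, E x -> D (x - y)) ->
  (\int[lebesgue_rV n]_(x in E) (g (x - y))%:E <= \int[lebesgue_rV n]_(x in D) (g x)%:E)%E.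
Proof.
move=> mg g0 mD mE ED.
have mgE : measurable_fun setT (EFin \o g) by exact/measurable_EFinP.
have msub : measurable_fun setT (fun x : 'rV[R]_n => x - y) by exact: measurable_funB_rV.
rewrite -(@ge0_integral_translate _ _ D (EFin \o g) y)//; last 2 first.
- exact: measurable_funTS.
- by move=> x _; rewrite lee_fin.
apply: ge0_subset_integral => //.
- by have := msub measurableT _ mD; rewrite setTI.
- apply: measurable_funTS; exact: (measurableT_comp mgE msub).
- by move=> x _; rewrite lee_fin.
Qed.

Section kernel_estimates.
Context (R : realType) (n : nat).
Hypothesis n0 : (0 < n)%N.
Local Notation mu := (@lebesgue_rV R n).
Variables (Om : 'rV[R]_n -> R) (beta r Mr W : R) (w : nat -> R).
Hypotheses (mOm : measurable_fun setT Om) (hOm : homogeneous0 Om).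
Hypotheses (beta0 : 0 < beta) (beta1 : beta < 1) (r1 : 1 < r).
Hypothesis OmMr : morrey (fun x => `|Om x| `^ r) Mr.
Hypothesis w0 : forall k, 0 <= w k.
Hypothesis rotw : forall k (rho : 'M[R]_n), rotation rho ->
  (rotation_size rho < (2 ^- k.+1)%:E)%E ->
  (\int[sphere_measure]_z `|Om (z *m rho) - Om z|%:E <= (w k)%:E)%E.
Hypothesis wW : (\sum_(0 <= k <oo) ((2 `^ beta) ^+ k * w k)%:E <= W%:E)%E.

Let nn : 1 <= n%:R :> R. Proof. by rewrite ler1n. Qed.
Let r0 : 0 < r. Proof. exact: lt_trans r1. Qed.

Let mnOm : measurable_fun setT (fun x => `|Om x|).
Proof. exact: (measurableT_comp (@normr_measurable R setT)). Qed.

Let mOmr : measurable_fun setT (fun x => `|Om x| `^ r).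
Proof. exact: (measurableT_comp (measurable_powR _)). Qed.

Definition kernM : R := ball_vol R n + Mr.

(** From |Om| <= 1 + |Om|^r; the constant 1 accounts for the ball volume in [kernM]. *)
Lemma morrey_abs : morrey (fun x => `|Om x|) kernM.
Proof.
move=> rho rho0; apply: (@le_trans _ _ (\int[mu]_(x in eball 0%R rho) (1 + `|Om x| `^ r)%:E)%E).
  apply: integral_le_mono => //; first exact: measurable_eball.
    by apply: measurable_funD.
  move=> x _; have [x1|x1] := leP `|Om x| 1; first by rewrite (le_trans x1)// lerDl powR_ge0.
  by rewrite (le_trans (le1r_powR (ltW x1) (ltW r1)))// lerDr.
under eq_integral do rewrite EFinD.
rewrite ge0_integralD//; last 2 first.
- exact: measurable_eball.
- by apply: measurable_funTS; exact/measurable_EFinP.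
rewrite integral_cst//; last exact: measurable_eball.
rewrite mul1e /kernM mulrDl EFinD; apply: leeD; last exact: OmMr.
by have := @eball_vol R n 0 rho rho0; rewrite mulrC => <-.
Qed.

(** Dilation by rho turns the shell into 1 <= |x| <= 2 and the translation into one by y / rho. *)
Lemma translation_modulus_scaled (delta v rho : R) (y : 'rV[R]_n) :
  0 < delta -> 128 * n%:R ^+ 2 * delta <= 1 -> 0 <= v ->
  (forall rot : 'M[R]_n, rotation rot ->
    (rotation_size rot < (rotc R n * delta)%:E)%E ->
    (\int[sphere_measure]_z `|Om (z *m rot) - Om z|%:E <= v%:E)%E) ->
  0 < rho -> enorm y <= delta * rho ->
  (\int[mu]_(x in [set x : 'rV[R]_n | (enorm x \in `[rho, 2 * rho])%R])
     `|Om (x - y) - Om x|%:E <= (transc R n * v * rho ^+ n)%:E)%E.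
Proof.
move=> d0 d1 v0 hv rho0 yd.
have mf : measurable_fun setT (fun x : 'rV[R]_n => (`|Om (x - y) - Om x|)%:E).
  apply/measurable_EFinP; apply: measurable_dist_comp => //.
  by apply: measurable_funB_rV.
have mD : measurable [set x : 'rV[R]_n | enorm x \in `[rho, 2 * rho]] by exact: measurable_enorm_itv.
have h0 (x : 'rV[R]_n) : [set x : 'rV[R]_n | enorm x \in `[rho, 2 * rho]] x -> (0 <= `|Om (x - y) - Om x|%:E)%E by rewrite lee_fin.
have h := ge0_integral_affine 0 rho0 mD (measurable_funTS mf) h0.
rewrite (_ : (fun x => (rho *: x + 0)%R) @^-1` _ = [set x : 'rV[R]_n | enorm x \in `[1, 2]]) in h; last first.
  apply/seteqP; split => x /=; rewrite addr0 enormZ gtr0_norm// !in_itv/=.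
    by rewrite ler_pMr// [2 * _]mulrC ler_pM2l.
  by rewrite ler_pMr// [2 * _]mulrC ler_pM2l.
have rn : 0 < rho^-1 ^+ n by rewrite exprn_gt0// invr_gt0.
suff : ((rho^-1 ^+ n)%:E * \int[mu]_(x in [set x : 'rV[R]_n | (enorm x \in `[rho, 2 * rho])%R])
     `|Om (x - y) - Om x|%:E <= (transc R n * v)%:E)%E.
  rewrite -lee_pdivlMl// => /le_trans; apply.
  by rewrite -EFinM lee_fin mulrC exprVn invrK.
rewrite -h; rewrite (eq_integral (fun x : 'rV[R]_n => (`|Om (x - rho^-1 *: y) - Om x|)%:E)).
  apply: (translation_modulus n0 mOm hOm d0 d1 v0 hv).
  by rewrite enormZ gtr0_norm ?invr_gt0// ler_pdivrMl// mulrC.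
move=> x _; congr (`| _ |%:E); rewrite addr0 hOm//; congr (_ - _).
by rewrite -[RHS](hOm _ rho0) scalerBr scalerA divff ?gt_eqF// scale1r.
Qed.

(** With this radius the translation on the j-th shell corresponds to rotations of size below
    2^-(j+1), which are the points where the modulus is sampled. *)
Definition kernA : R := 2 * rotc R n.

Let rotc1 : 1 <= rotc R n.
Proof.
have : 1 <= n%:R ^+ 3 :> R by rewrite exprn_ege1.
by rewrite /rotc => h; apply: (le_trans h); rewrite ler_peMl ?ler1n// exprn_ge0.
Qed.

Let A2 : 2 <= kernA. Proof. rewrite -[leLHS]mulr1 /kernA; exact: (ler_wpM2l (ltW (ltr0Sn R 1)) rotc1). Qed.

Let A0 : 0 < kernA. Proof. exact: lt_le_trans A2. Qed.

Variable chi : R -> R.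
Hypothesis hchi : cutoff chi.

Let k (z : 'rV[R]_n) := kernel (fun z => Om z * chi (enorm z)) z.

Let kE z : k z = Om z * (chi (enorm z) / enorm z ^+ n).
Proof. by rewrite /k/kernel mulrA. Qed.

Let measurable_invn : measurable_fun setT (fun x : 'rV[R]_n => (enorm x ^+ n)^-1).
Proof.
rewrite (_ : (fun _ => _) = (fun x : 'rV[R]_n => (enorm x ^+ n) `^ (-1))).
  by apply: (measurableT_comp (measurable_powR _)); apply: measurable_funX; exact: measurable_enorm.
by apply/funext => x; rewrite powR_inv1// exprn_ge0// enorm_ge0.
Qed.

Let mk : measurable_fun setT k.
Proof.
apply: measurable_funM => //; apply: measurable_funM => //.
by apply: (measurableT_comp (cutoff_measurable hchi)); exact: measurable_enorm.
Qed.

Let mpow (g : R) : measurable_fun setT (fun x : 'rV[R]_n => enorm x `^ g).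
Proof. by apply: (measurableT_comp (measurable_powR _)); exact: measurable_enorm. Qed.

Let k_le z : `|k z| <= `|Om z| / enorm z ^+ n.
Proof.
rewrite kE !normrM ler_wpM2l// normfV ger0_norm ?(cutoff_ge0 hchi)//.
rewrite ger0_norm ?exprn_ge0 ?enorm_ge0// ler_piMl ?(cutoff_le1 hchi)//.
by rewrite invr_ge0 exprn_ge0 ?enorm_ge0.
Qed.

Lemma kernel_local (rho : R) : 0 < rho ->
  (\int[mu]_(x in eball 0%R rho) (`|k x| * enorm x `^ beta)%:E <=
     (2 ^+ n * kernM / (1 - 2 `^ (- beta)) * rho `^ beta)%:E)%E.
Proof.
move=> rho0; have := morrey_local n0 mnOm (fun x => normr_ge0 _) morrey_abs beta0 rho0.
rewrite (_ : _ / _ * _ = 2 ^+ n * kernM * rho `^ beta / (1 - 2 `^ (- beta))); last by ring.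
apply: le_trans; apply: integral_le_mono.
- exact: measurable_eball.
- by apply: measurable_funM => //; exact: (measurableT_comp (@normr_measurable R setT)).
- by apply: measurable_funM => //; exact: measurable_funM.
- by move=> x; rewrite mulr_ge0// powR_ge0.
- by move=> x _; rewrite mulrA ler_wpM2r ?powR_ge0.
Qed.

Definition kernC3 : R := ball_vol R n + 2 ^+ n * Mr / (1 - 2 `^ (- (n%:R * (r - 1)))).

Let f (x : 'rV[R]_n) := `|Om x| / enorm x ^+ n.

Let mf : measurable_fun setT f. Proof. by apply: measurable_funM. Qed.

Let mfgt (t : R) : measurable [set x | t < f x].
Proof.
rewrite (_ : [set x | _] = setT `&` f @^-1` `]t, +oo[); first exact: mf.
by rewrite setTI; apply/seteqP; split => x /=; rewrite in_itv/= andbT.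
Qed.

(** The unit ball is counted in full. Outside it f > 1 implies f <= f^r, and |Om|^r |x|^(-n r) is
    integrable there because r > 1. *)
Let f_gt1 : (mu [set x | (1 < f x)%R] <= kernC3%:E)%E.
Proof.
have m1 : measurable [set x : 'rV[R]_n | 1 < enorm x].
  rewrite (_ : [set x | _] = [set x : 'rV[R]_n | enorm x \in `]1, +oo[]); first exact: measurable_enorm_itv.
  by apply/seteqP; split => x /=; rewrite in_itv/= andbT.
have mI : measurable ([set x : 'rV[R]_n | 1 < enorm x] `&` [set x | 1 < f x]).
  exact: measurableI.
apply: (@le_trans _ _ (mu (eball 0 1 `|` ([set x : 'rV[R]_n | 1 < enorm x] `&` [set x | 1 < f x])))).
  apply: mono_measure => //.
    by apply: measurableU => //; exact: measurable_eball.
  move=> x fx; have [x1|x1] := leP (enorm x) 1; [left|right] => //.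
  by rewrite /eball/= subr0.
apply: (le_trans (measureU2 _ _ mI)); first exact: measurable_eball.
rewrite /kernC3 EFinD; apply: leeD.
  have h := @eball_vol R n 0 1 ltr01; rewrite expr1n mul1r in h.
  by apply: (le_trans (y := (ball_vol R n)%:E)) => //; rewrite -h.
rewrite [leLHS](_ : _ = \int[mu]_x (\1_([set x : 'rV[R]_n | 1 < enorm x] `&` [set x | 1 < f x]) x)%:E)%E; last first.
  by rewrite integral_indic// setIT.
have g0 : 0 < n%:R * (r - 1) by rewrite mulr_gt0 ?subr_gt0// ltr0n.
have := morrey_tail n0 mOmr (fun x => powR_ge0 _ _) OmMr g0 ltr01.
rewrite powR1 mulr1; apply: le_trans.
rewrite [leRHS]integral_EFin_indic; apply: integral_le_mono => //.
- apply: measurable_funM => //; apply: measurable_funM => //.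
  exact: measurable_funM.
move=> x _; rewrite !indicE; have [|_] := boolP (x \in _ `&` _); last first.
  by rewrite !mulr_ge0// ?powR_ge0// invr_ge0 exprn_ge0// enorm_ge0.
move=> /set_mem[x1 fx]; rewrite mem_set//= mulr1.
have e0 : 0 < enorm x by apply: lt_trans x1.
have -> : `|Om x| `^ r * (enorm x ^- n * enorm x `^ (- (n%:R * (r - 1)))) = f x `^ r.
  rewrite /f powRM ?invr_ge0 ?exprn_ge0 ?enorm_ge0//; congr (_ * _).
  rewrite -powR_inv1 ?exprn_ge0 ?enorm_ge0// -powR_mulrn ?enorm_ge0// -!powRrM.
  by rewrite -powRD_gt0//; congr (_ `^ _); ring.
by apply: (le_trans (ltW fx)); apply: le1r_powR; exact: ltW.
Qed.

Lemma kernel_weak (t : R) : 0 < t -> (mu [set x | (t < `|k x|)%R] <= (kernC3 / t)%:E)%E.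
Proof.
move=> t0; apply: (@le_trans _ _ (mu [set x | (t < f x)%R])).
  apply: mono_measure => //.
    rewrite (_ : [set x | _] = setT `&` (fun x => `|k x|) @^-1` `]t, +oo[).
      by have := measurableT_comp (@normr_measurable R setT) mk; apply.
    by rewrite setTI; apply/seteqP; split => x /=; rewrite in_itv/= andbT.
  by move=> x /= h; rewrite (lt_le_trans h)// k_le.
(* Unlike the kernel with its cutoff, f is homogeneous of degree -n, so dilation by t^(-1/n) reduces
   level t to level 1. *)
pose s := t `^ (- n%:R^-1).
have s0 : 0 < s by rewrite powR_gt0.
have sn : s ^+ n = t^-1.
  rewrite /s -powR_expr ?ltW// -powR_mulrn ?ltW// -powRrM mulrN divff; last by rewrite pnatr_eq0 -lt0n.
  by rewrite powR_inv1// ltW.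
have := lebesgue_affine 0 s0 (mfgt t).
have -> : (fun x : 'rV[R]_n => s *: x + 0) @^-1` [set x | t < f x] = [set x | 1 < f x].
  have fs x : f (s *: x) = t * f x.
    by rewrite /f hOm// enormZ (gtr0_norm s0) exprMn sn invfM invrK mulrCA.
  by apply/seteqP; split => x /=; rewrite addr0 fs ltr_pMr.
rewrite exprVn sn invrK => h.
rewrite [_ / t]mulrC EFinM -lee_pdivrMl ?invr_gt0// invrK -h; exact: f_gt1.
Qed.

Lemma exprB_le (a b m : R) p : 0 <= a -> 0 <= b -> a <= m -> b <= m ->
  `|a ^+ p - b ^+ p| <= p%:R * `|a - b| * m ^+ p.-1.
Proof.
move=> a0 b0 am bm; rewrite subrXX normrM mulrAC mulrC ler_wpM2r//.
apply: (le_trans (ler_norm_sum _ _ _)).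
apply: (@le_trans _ _ (\sum_(i < p) m ^+ p.-1)); last by rewrite sumr_const card_ord mulr_natl.
apply: ler_sum => i _; rewrite normrM !normrX !ger0_norm//.
have -> : m ^+ p.-1 = m ^+ (p.-1 - i) * m ^+ i.
  by rewrite -exprD subnK// -ltnS prednK// (leq_ltn_trans _ (ltn_ord i)).
by apply: ler_pM; rewrite ?exprn_ge0//; apply: lerXn2r; rewrite ?nnegrE// (le_trans a0).
Qed.

Let c1 : R := 2 * (2 ^+ n * (4 + n%:R)).

(** The radii are within a factor 2 of each other. The increment splits into that of the n-th power
    of the inverse radius and that of the cutoff, whose Lipschitz constant is of order 1 / s; they
    produce the terms n and 4 in [c1]. The outer factor 2 there comes from t^beta <= 2 s^beta. *)
Let radial_diff (d s t : R) : 0 < d -> 2 * d <= t -> `|s - t| <= d ->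
  t `^ beta * `|chi s / s ^+ n - chi t / t ^+ n| <= c1 * d * ((s ^+ n)^-1 * s `^ (- (1 - beta))).
Proof.
move=> d0 dt st.
have t0 : 0 < t by lra.
have [s1 s2] : t / 2 <= s /\ s / 2 <= t by move: st; rewrite ler_norml => /andP[h1 h2]; split; lra.
have s0 : 0 < s by lra.
have tb : t `^ beta <= 2 * s `^ beta.
  apply: (@le_trans _ _ ((2 * s) `^ beta)).
    apply: ge0_ler_powR; rewrite ?nnegrE ?(ltW beta0) ?(ltW t0) ?mulr_ge0 ?(ltW s0)//.
    by rewrite mulrC -ler_pdivrMr.
  rewrite powRM// ?(ltW s0)// ler_wpM2r ?powR_ge0//.
  by rewrite -[leRHS]powRr1//; apply: ler_powR; [rewrite ler1n|exact: ltW].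
have sn0 : 0 < s ^+ n by rewrite exprn_gt0.
have tn0 : 0 < t ^+ n by rewrite exprn_gt0.
have key : `|chi s / s ^+ n - chi t / t ^+ n| <= 2 ^+ n * (4 + n%:R) * d * ((s ^+ n)^-1 * s^-1).
  rewrite (_ : chi s / s ^+ n - chi t / t ^+ n =
    chi s * (s^-1 ^+ n - t^-1 ^+ n) + (chi s - chi t) * t^-1 ^+ n); last first.
    by rewrite !exprVn; ring.
  have ti : t^-1 <= 2 / s by rewrite -(invf_div s 2) lef_pV2 ?posrE ?divr_gt0.
  have ti0 : 0 <= t^-1 by rewrite invr_ge0 ltW.
  have si0 : 0 < s^-1 by rewrite invr_gt0.
  have tin : t^-1 ^+ n <= 2 ^+ n * s^-1 ^+ n.
    by rewrite -exprMn; apply: lerXn2r; rewrite ?nnegrE// divr_ge0// ltW.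
  have b1 : `|chi s * (s^-1 ^+ n - t^-1 ^+ n)| <= 2 ^+ n * n%:R * d * (s^-1 ^+ n * s^-1).
    rewrite normrM (ger0_norm (cutoff_ge0 hchi _)).
    apply: (@le_trans _ _ `|s^-1 ^+ n - t^-1 ^+ n|).
      by rewrite ler_piMl// (cutoff_le1 hchi).
    have si2 : s^-1 <= 2 / s by rewrite ler_peMl ?ler1n// ltW.
    apply: (le_trans (exprB_le n (ltW si0) ti0 si2 ti)).
    have dst : `|s^-1 - t^-1| <= 2 * d * (s^-1 * s^-1).
      rewrite (_ : s^-1 - t^-1 = (t - s) * (s^-1 * t^-1)); last first.
        by field; rewrite !gt_eqF.
      rewrite normrM distrC (ger0_norm (mulr_ge0 (ltW si0) ti0)).
      rewrite [2 * d]mulrC -mulrA; apply: ler_pM => //; first by rewrite mulr_ge0// ltW.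
      by rewrite mulrCA ler_pM2l// .
    apply: (@le_trans _ _ (n%:R * (2 * d * (s^-1 * s^-1)) * (2 / s) ^+ n.-1)).
      rewrite ler_wpM2r ?exprn_ge0 ?divr_ge0 ?(ltW s0)// ler_wpM2l//.
    apply: ler_of_eq; rewrite -(prednK n0) /= !exprS exprMn; ring.
  have b2 : `|(chi s - chi t) * t^-1 ^+ n| <= 2 ^+ n * 4 * d * (s^-1 ^+ n * s^-1).
    rewrite normrM (ger0_norm (exprn_ge0 n ti0)).
    have m0 : s / 2 <= Num.min s t by rewrite le_min s2 andbT ler_pdivrMr// ler_peMr ?(ltW s0) ?ler1n.
    have hc : `|chi s - chi t| <= 4 * d * s^-1.
      apply: (le_trans (cutoff_lip hchi s0 t0)).
      apply: (@le_trans _ _ (2 * d / (s / 2))); last by apply: ler_of_eq; field; rewrite gt_eqF.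
      apply: ler_pM; rewrite ?mulr_ge0// ?invr_ge0 ?le_min ?(ltW s0) ?(ltW t0)//.
        by rewrite ler_pM2l.
      by rewrite lef_pV2 ?posrE ?lt_min ?s0 ?divr_gt0.
    apply: (@le_trans _ _ (4 * d * s^-1 * (2 ^+ n * s^-1 ^+ n))).
      by apply: ler_pM; rewrite ?exprn_ge0.
    by apply: ler_of_eq; ring.
  apply: (le_trans (ler_normD _ _)); apply: (le_trans (lerD b1 b2)).
  by apply: ler_of_eq; rewrite exprVn; ring.
apply: (le_trans (ler_pM (powR_ge0 _ _) (normr_ge0 _) tb key)).
apply: ler_of_eq; rewrite opprB powRD_gt0// powR_inv1 ?(ltW s0)// /c1; ring.
Qed.

Definition kernC2 : R := c1 * (2 ^+ n * kernM / (1 - 2 `^ (- (1 - beta)))) +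
  2 `^ beta * transc R n * kernA `^ beta * W.

(** The increment of k is a radial increment times Om (x - y) plus an increment of Om times the
    radial factor. With the weight, the first decays like |x - y|^(-n - (1 - beta)), which is a tail
    because beta < 1, and it is integrated in x - y. The second is summed over shells, where the sum
    over the sampled modulus enters. *)
Lemma kernel_smooth (d : R) (y : 'rV[R]_n) : 0 < d -> enorm y <= d ->
  (\int[mu]_(x in [set x | (kernA * d < enorm x)%R])
       (enorm x `^ beta * `|k (x - y) - k x|)%:E <= (kernC2 * d `^ beta)%:E)%E.
Proof.
move=> d0 yd.
have Ad0 : 0 < kernA * d by rewrite mulr_gt0.
have mout a : measurable [set x : 'rV[R]_n | a < enorm x].
  rewrite (_ : [set x | _] = [set x : 'rV[R]_n | enorm x \in `]a, +oo[]); first exact: measurable_enorm_itv.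
  by apply/seteqP; split => x /=; rewrite in_itv/= andbT.
have msub : measurable_fun setT (fun x : 'rV[R]_n => x - y) by exact: measurable_funB_rV.
pose g v := `|Om v| * ((enorm v ^+ n)^-1 * enorm v `^ (- (1 - beta))).
have g0 v : 0 <= g v by rewrite !mulr_ge0// ?powR_ge0// invr_ge0 exprn_ge0// enorm_ge0.
have mg : measurable_fun setT g by apply: measurable_funM => //; exact: measurable_funM.
have mgy : measurable_fun setT (fun x : 'rV[R]_n => g (x - y)) by exact: (measurableT_comp mg).
pose h (x : 'rV[R]_n) := (enorm x ^+ n)^-1 * enorm x `^ beta * `|Om (x - y) - Om x|.
have h0 x : 0 <= h x by rewrite !mulr_ge0// ?powR_ge0// invr_ge0 exprn_ge0// enorm_ge0.
have mh : measurable_fun setT h.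
  by apply: measurable_funM; [exact: measurable_funM|exact: measurable_dist_comp].
have c10 : 0 <= c1 by rewrite /c1 !mulr_ge0 ?exprn_ge0// addr_ge0.
apply: (@le_trans _ _ (\int[mu]_(x in [set x | (kernA * d < enorm x)%R])
   (c1 * d * g (x - y)%R + h x)%:E)%E).
  apply: integral_le_mono => //.
  - apply: measurable_funM => //; apply: (measurableT_comp (@normr_measurable R setT)).
    by apply: measurable_funB => //; exact: (measurableT_comp mk).
  - by apply: measurable_funD => //; apply: measurable_funM.
  - by move=> x; rewrite mulr_ge0// powR_ge0.
  move=> x /= xA; have d2x : 2 * d <= enorm x.
    by apply: le_trans (ltW xA); apply: ler_wpM2r; rewrite ?(ltW d0).
  have yx : `|enorm (x - y) - enorm x| <= d.
    by apply: (le_trans (enorm_dist _ _)); rewrite addrAC subrr add0r enormN.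
  rewrite (_ : k (x - y) - k x =
      Om (x - y) * (chi (enorm (x - y)) / enorm (x - y) ^+ n - chi (enorm x) / enorm x ^+ n) +
      (Om (x - y) - Om x) * (chi (enorm x) / enorm x ^+ n)); last by rewrite !kE; ring.
  apply: (@le_trans _ _ (enorm x `^ beta * (`|Om (x - y)| *
       `|chi (enorm (x - y)) / enorm (x - y) ^+ n - chi (enorm x) / enorm x ^+ n| +
      `|Om (x - y) - Om x| * (enorm x ^+ n)^-1))).
    rewrite ler_wpM2l ?powR_ge0//; apply: (le_trans (ler_normD _ _)).
    rewrite !normrM lerD2l ler_wpM2l// normfV (ger0_norm (cutoff_ge0 hchi _)).
    rewrite ger0_norm ?exprn_ge0 ?enorm_ge0// ler_piMl ?(cutoff_le1 hchi)//.
    by rewrite invr_ge0 exprn_ge0 ?enorm_ge0.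
  rewrite mulrDr; apply: lerD; last by rewrite /h; apply: ler_of_eq; ring.
  rewrite mulrCA /g [leRHS]mulrCA; apply: ler_wpM2l => //; exact: radial_diff.
under eq_integral do rewrite EFinD.
rewrite ge0_integralD//; last 4 first.
- by move=> x _; rewrite lee_fin mulr_ge0 ?g0// mulr_ge0// ltW.
- by apply: measurable_funTS; apply/measurable_EFinP; apply: measurable_funM.
- by move=> x _; rewrite lee_fin.
- by apply: measurable_funTS; exact/measurable_EFinP.
rewrite /kernC2 mulrDl EFinD; apply: leeD.
  under eq_integral do rewrite EFinM.
  rewrite ge0_integralZl//; last 3 first.
  - by apply: measurable_funTS; exact/measurable_EFinP.
  - by move=> x _; rewrite lee_fin.
  - by rewrite lee_fin mulr_ge0// ltW.
  have tail := morrey_tail n0 mnOm (fun x => normr_ge0 _) morrey_abs.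
  have b10 : 0 < 1 - beta by rewrite subr_gt0.
  have {tail}tail := tail _ _ b10 d0.
  apply: (@le_trans _ _ ((c1 * d)%:E * \int[mu]_(x in [set x | (d < enorm x)%R]) (g x)%:E)%E).
    apply: lee_wpmul2l; first by rewrite lee_fin mulr_ge0// ltW.
    apply: (integral_translate_le mg g0 (mout _) (mout _)) => x /= xA.
    have := enorm_dist x y.
    have : 2 * d <= kernA * d by rewrite ler_wpM2r// ltW.
    by rewrite ler_norml => h1 /andP[_ h2]; lra.
  apply: (@le_trans _ _ ((c1 * d)%:E * (2 ^+ n * kernM * d `^ (- (1 - beta)) / (1 - 2 `^ (- (1 - beta))))%:E)%E).
    by apply: lee_wpmul2l => //; rewrite lee_fin mulr_ge0// ltW.
  rewrite -EFinM lee_fin; apply: ler_of_eq.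
  have -> : d `^ beta = d * d `^ (- (1 - beta)).
    by rewrite opprB powRD_gt0// powR_inv1 ?(ltW d0)// mulrCA divff ?mulr1// gt_eqF.
  ring.
apply: (le_trans (@ge0_integral_cover _ _ _ mu _
   (fun j => [set x : 'rV[R]_n | enorm x \in `]kernA * d * 2 ^+ j, kernA * d * 2 ^+ j.+1]]) _ _ _ _ _ _)).
- exact: mout.
- by move=> j; exact: measurable_enorm_itv.
- exact/measurable_EFinP.
- by move=> x; rewrite lee_fin.
- move=> x /= xA _; have [j hj] := dyadic_scale_up Ad0 xA.
  by exists j; rewrite in_itv.
pose K := 2 `^ beta * transc R n * kernA `^ beta * d `^ beta.
have K0 : 0 <= K := mulr_ge0 (mulr_ge0 (mulr_ge0 (powR_ge0 _ _) (transc_ge0 R n)) (powR_ge0 _ _)) (powR_ge0 _ _).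
apply: (@le_trans _ _ (\sum_(0 <= j <oo) (K%:E * ((2 `^ beta) ^+ j * w j)%:E))%E); last first.
  rewrite nneseriesZl; last by move=> j _; rewrite lee_fin mulr_ge0// exprn_ge0// powR_ge0.
  rewrite (_ : _ * W * _ = K * W); last by rewrite /K; ring.
  by rewrite [leRHS]EFinM; apply: lee_wpmul2l => //; rewrite lee_fin.
apply: lee_nneseries => [j _ _|j _]; first by apply: integral_ge0 => x _; rewrite lee_fin.
pose rho := kernA * d * 2 ^+ j.
have rho0 : 0 < rho by rewrite mulr_gt0// exprn_gt0.
(* The ratio d / rho on this shell; [rotc R n * delta] is then exactly 2^-(j+1). *)
pose delta := (kernA * 2 ^+ j)^-1.
have delta0 : 0 < delta by rewrite invr_gt0 mulr_gt0// exprn_gt0.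
have scaled : (\int[mu]_(x in [set x : 'rV[R]_n | (enorm x \in `[rho, 2 * rho])%R])
     `|Om (x - y) - Om x|%:E <= (transc R n * w j * rho ^+ n)%:E)%E.
  apply: (@translation_modulus_scaled delta) => //.
  - rewrite /delta ler_pdivrMr ?mul1r; last by rewrite mulr_gt0// exprn_gt0.
    apply: (@le_trans _ _ kernA); last by rewrite ler_peMr ?(ltW A0)// exprn_ege1// ler1n.
    have n23 : n%:R ^+ 2 <= n%:R ^+ 3 :> R by rewrite ler_weXn2l.
    have n20 : 0 <= n%:R ^+ 2 :> R by rewrite exprn_ge0.
    by rewrite /kernA /rotc; lra.
  - move=> rot hrot hsize; apply: rotw => //.
    rewrite (_ : rotc R n * delta = 2 ^- j.+1) in hsize => //.
    have rc0 : rotc R n != 0 by rewrite gt_eqF// (lt_le_trans _ rotc1).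
    have p20 : 2 ^+ j != 0 :> R by rewrite gt_eqF// exprn_gt0.
    by rewrite /delta /kernA exprS; move: (2 ^+ j) (rotc R n) p20 rc0 => a c a0 cc0; field; apply/andP; split.
  - rewrite (_ : delta * rho = d)// /delta /rho; field.
    by rewrite !gt_eqF// exprn_gt0.
apply: (@le_trans _ _ (((rho ^+ n)^-1 * (2 * rho) `^ beta)%:E *
   \int[mu]_(x in [set x : 'rV[R]_n | (enorm x \in `[rho, 2 * rho])%R]) `|Om (x - y) - Om x|%:E)%E).
  apply: integral_le_cst_mul => //.
  - exact: measurable_enorm_itv.
  - exact: measurable_enorm_itv.
  - move=> x /=; rewrite !in_itv/= => /andP[x1 x2]; rewrite (ltW x1)/=.
    by apply: (le_trans x2); apply: ler_of_eq; rewrite /rho exprS; ring.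
  - by rewrite mulr_ge0 ?powR_ge0// invr_ge0 exprn_ge0// ltW.
  - exact: measurable_dist_comp.
  move=> x /=; rewrite in_itv/= => /andP[x1 x2]; rewrite /h ler_wpM2r//.
  have x00 : 0 < enorm x by apply: lt_trans x1.
  apply: ler_pM; rewrite ?powR_ge0 ?invr_ge0 ?exprn_ge0 ?enorm_ge0//.
    by rewrite lef_pV2 ?posrE ?exprn_gt0// lerXn2r// ?nnegrE ltW.
  apply: ge0_ler_powR; rewrite ?nnegrE ?enorm_ge0 ?(ltW beta0)// ?(mulr_ge0 _ (ltW rho0))//.
  by apply: (le_trans x2); apply: ler_of_eq; rewrite /rho exprS; ring.
apply: (@le_trans _ _ (((rho ^+ n)^-1 * (2 * rho) `^ beta)%:E * (transc R n * w j * rho ^+ n)%:E)%E).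
  apply: lee_wpmul2l => //.
  by rewrite lee_fin mulr_ge0 ?powR_ge0// invr_ge0 exprn_ge0// ltW.
rewrite -!EFinM lee_fin; apply: ler_of_eq.
have p2 : 0 <= 2 ^+ j :> R by rewrite exprn_ge0.
have e : (2 * rho) `^ beta = 2 `^ beta * (kernA `^ beta * d `^ beta * (2 `^ beta) ^+ j).
  by rewrite powRM ?(ltW rho0)// /rho powRM ?(ltW Ad0)// powRM ?(ltW A0) ?(ltW d0)// powR_expr.
rewrite e /K; have rn : rho ^+ n != 0 by rewrite gt_eqF// exprn_gt0.
move: (rho ^+ n) rn => q q0; by field.
Qed.

Lemma kernel_singular : singular_kernel beta kernA
  (2 ^+ n * kernM / (1 - 2 `^ (- beta))) kernC2 kernC3 k.
Proof.
by split; [exact: mk|exact: kernel_local|exact: kernel_smooth|exact: kernel_weak].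
Qed.

End kernel_estimates.

(** * Commutators of atoms *)

Lemma integrable_norm_lty d (T : measurableType d) (R : realType)
    (mu : {measure set T -> \bar R}) (f : T -> R) :
  measurable_fun setT f -> (\int[mu]_x `|f x|%:E < +oo)%E ->
  mu.-integrable setT (EFin \o f).
Proof. by move=> mf fy; apply/integrableP; split; [exact/measurable_EFinP|]. Qed.

(* The junk value of a divergent integral is 0. *)
Lemma normr_Rintegral_le d (T : measurableType d) (R : realType)
    (mu : {measure set T -> \bar R}) (f : T -> R) :
  measurable_fun setT f -> (`|\int[mu]_x f x|%:E <= \int[mu]_x `|f x|%:E)%E.
Proof.
move=> mf; rewrite /Rintegral; apply: (@le_trans _ _ `|\int[mu]_x (f x)%:E|%E).
  by case: (\int[mu]_x _)%E => [r| |]//=; rewrite normr0 leey.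
by apply: (le_abse_integral mu measurableT); exact/measurable_EFinP.
Qed.

Lemma measure_gt_le_integral_dom d (T : measurableType d) (R : realType)
    (mu : {measure set T -> \bar R}) (D : set T) (f : T -> \bar R) (a : R) :
  measurable D -> measurable_fun setT f -> (forall x, (0 <= f x)%E) -> 0 < a ->
  (mu (D `&` [set x | a%:E < f x]) <= (a^-1)%:E * \int[mu]_(x in D) f x)%E.
Proof.
move=> mD mf f0 a0; rewrite integral_mkcond.
have mfD : measurable_fun setT (f \_ D).
  by apply/(measurable_restrictT f mD); exact: measurable_funTS.
have fD0 x : (0 <= (f \_ D) x)%E by rewrite /patch; case: ifP.
apply: le_trans (measure_gt_le_integral mu mfD fD0 a0).
apply: le_measure; rewrite ?inE.
- apply: measurableI => //; rewrite -[X in measurable X]setTI.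
  exact: emeasurable_fun_o_infty.
- by rewrite -[X in measurable X]setTI; exact: emeasurable_fun_o_infty.
- by move=> x [Dx fx]; rewrite /= /patch mem_set.
Qed.

Section holder.
Context (R : realType) (n : nat).
Implicit Types (b : 'rV[R]_n -> R) (L beta : R).

Definition holder L beta b : Prop :=
  forall x y, `|b x - b y| <= L * enorm (x - y) `^ beta.

Lemma lip_norm_holder beta b : (0 < n)%N -> 0 < beta -> Lip beta b ->
  exists2 L, 0 <= L & lip_norm beta b = L%:E /\ holder L beta b.
Proof.
move=> n0 beta0 bL.
have ub (x y : 'rV[R]_n) : x != y -> ((`|b x - b y| / enorm (x - y) `^ beta)%:E <= lip_norm beta b)%E.
  by move=> xy; apply: ereal_sup_ubound; exists (x, y).
(* Two distinct points exist because n > 0; over the empty set the supremum would be -oo. *)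
have e0 : const_mx 1 != 0 :> 'rV[R]_n.
  apply/eqP => /matrixP/(_ ord0 (Ordinal n0)); rewrite !mxE => /eqP.
  by rewrite oner_eq0.
have L0 : (0 <= lip_norm beta b)%E.
  by apply: le_trans (ub _ _ e0); rewrite lee_fin mulr_ge0// invr_ge0 powR_ge0.
have Lfin : lip_norm beta b \is a fin_num by rewrite ge0_fin_numE.
exists (fine (lip_norm beta b)); first exact: fine_ge0.
split; first by rewrite fineK.
move=> x y; have [->|xy] := eqVneq x y.
  by rewrite !subrr normr0 enorm0 powR0 ?gt_eqF// mulr0.
have xy0 : 0 < enorm (x - y) `^ beta by rewrite powR_gt0// enorm_gt0 subr_eq0.
by rewrite -ler_pdivrMr// -lee_fin fineK// ub.
Qed.

(** The sigma-algebra is generated by the coordinates, so continuity is used through approximation: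
    f is the limit of its values at the lower corners of dyadic cells, and these depend on a
    countable index. *)
Lemma modulus_measurable (f : 'rV[R]_n -> R) :
  (forall x e, 0 < e -> exists2 d, 0 < d & forall y, enorm (y - x) < d -> `|f y - f x| < e) ->
  measurable_fun setT f.
Proof.
move=> fc; pose c k (x : 'rV[R]_n) : 'rV[R]_n := \row_i ((dyadic_index k x ord0 i)%:~R / 2 ^+ k).
apply: (@measurable_fun_cvg _ _ _ _ (fun k x => f (c k x))).
  move=> k _ Y mY; rewrite setTI.
  pose D : set 'rV[int]_n := [set i | Y (f (\row_j ((i ord0 j)%:~R / 2 ^+ k)))].
  by rewrite (_ : _ @^-1` _ = dyadic_index k @^-1` D)//; exact: measurable_dyadic_preimage.
move=> x _; apply/cvgrPdist_lt => e e0.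
have [d d0 fd] := fc x e e0.
have : \forall k \near \oo, n%:R * 2 ^- k < d :> R.
  have : (fun k => n%:R * 2 ^- k : R) @ \oo --> n%:R * (0 : R).
    apply: cvgMr; rewrite (_ : (fun k => 2 ^- k) = (fun k => 2^-1 ^+ k)).
      by apply: cvg_expr; rewrite ger0_norm// invf_lt1// ltr1n.
    by apply/funext => k; rewrite exprVn.
  rewrite mulr0 => /cvgrPdist_lt/(_ _ d0); apply: filterS => k.
  by rewrite sub0r normrN; apply: le_lt_trans; exact: ler_norm.
apply: filterS => k kd; rewrite distrC; apply: fd; apply: le_lt_trans kd.
apply: (le_trans (enorm_le_sum _)); 
apply: (@le_trans _ _ (\sum_(i < n) 2 ^- k)); last by rewrite sumr_const card_ord mulr_natl.
apply: ler_sum => i _; rewrite !mxE.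
have k0 : 0 < 2 ^+ k :> R by rewrite exprn_gt0.
have -> : (Num.floor (2 ^+ k * x ord0 i))%:~R / 2 ^+ k - x ord0 i =
    - ((2 ^+ k * x ord0 i - (Num.floor (2 ^+ k * x ord0 i))%:~R) / 2 ^+ k).
  by field; rewrite gt_eqF.
rewrite normrN normrM (ger0_norm (_ : 0 <= (2 ^+ k)^-1)) ?invr_ge0 ?(ltW k0)// ler_piMl ?invr_ge0 ?(ltW k0)//.
by have /andP[h1 h2] := mem_rg1_floor (2 ^+ k * x ord0 i); rewrite ger0_norm; lra.
Qed.

Lemma holder_measurable L beta b : 0 < beta -> holder L beta b -> measurable_fun setT b.
Proof.
move=> beta0 bL; apply: modulus_measurable => x e e0.
have [M M0 LM] : exists2 M, 0 < M & L <= M.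
  by exists (`|L| + 1); [rewrite ltr_wpDl|rewrite (le_trans (ler_norm L))// lerDl].
exists ((e / M) `^ beta^-1); first by apply: powR_gt0; rewrite divr_gt0.
move=> y yx; apply: (le_lt_trans (bL y x)).
apply: (@le_lt_trans _ _ (M * enorm (y - x) `^ beta)).
  by rewrite ler_wpM2r ?powR_ge0.
rewrite mulrC -ltr_pdivlMr//.
have -> : e / M = ((e / M) `^ beta^-1) `^ beta.
  by rewrite -powRrM mulVf ?gt_eqF// powRr1// divr_ge0// ltW.
by apply: gt0_ltr_powR => //; rewrite nnegrE ?enorm_ge0 ?powR_ge0.
Qed.

End holder.

Section bump.
Context (R : realType) (n : nat).
Local Notation mu := (@lebesgue_rV R n).
Implicit Types (a b k : 'rV[R]_n -> R).

(** An atom seen in L1. The power d^(-beta) cancels the d^beta contributed by the oscillation of b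
    over the ball, so that the final bounds are free of d. *)
Record bump (beta C : R) (x0 : 'rV[R]_n) (d : R) a : Prop := {
  bump_measurable : measurable_fun setT a ;
  bump_support : forall x, a x != 0 -> eball x0 d x ;
  bump_integral : (\int[mu]_x `|a x|%:E <= (C * d `^ (- beta))%:E)%E ;
  bump_mean : \int[mu]_x a x = 0 }.

(** Hoelder against the indicator of the ball gives its volume to the power 1/l - 1/p + 1/q = 1 -
    1/p = -beta/n, whatever l is. The mean is the moment of the zero multi-index. *)
Lemma atom_bump beta p l s a : (0 < n)%N -> 0 < beta -> p = n%:R / (n%:R + beta) -> 1 < l ->
  atom p l s a -> exists x0 d, 0 < d /\ bump beta (ball_vol R n `^ (- (beta / n%:R))) x0 d a.
Proof.
move=> n0 beta0 pE l1 [x0 [d [d0 [ma sa na momenta]]]]; exists x0, d; split => //.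
have l0 : 0 < l by exact: lt_trans l1.
have nn : 0 < n%:R :> R by rewrite ltr0n.
have mB := measurable_eball x0 d.
split => //; last first.
  have := momenta [ffun => 0%N]; rewrite big1; last by move=> i _; rewrite ffunE.
  move=> /(_ (leq0n _)) <-; apply: eq_Rintegral => x _.
  by rewrite big1 ?mulr1// => i _; rewrite ffunE expr0.
pose q := l / (l - 1).
have q0 : 0 < q by rewrite divr_gt0// subr_gt0.
have mI : measurable_fun setT (\1_(eball x0 d) : 'rV[R]_n -> R) by exact: measurable_indic.
have := @hoelder _ _ _ mu a (\1_(eball x0 d)) l q ma mI l0 q0.
have l1n : l - 1 != 0 by rewrite subr_eq0 gt_eqF.
have ln : l != 0 by rewrite gt_eqF.
have lq : l^-1 + q^-1 = 1 by rewrite /q; field; apply/andP.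
move=> /(_ lq); rewrite Lnorm1 => h.
have -> : (\int[mu]_x `|a x|%:E = \int[mu]_x `|(EFin \o (a \* \1_(eball x0 d))%R) x|)%E.
  apply: eq_integral => x _; rewrite /= indicE; case: (boolP (x \in _)) => xB; first by rewrite mulr1.
  rewrite mulr0; have [->//|/sa] := eqVneq (a x) 0.
  by move=> /mem_set; rewrite (negbTE xB).
apply: (le_trans h).
have Nq : ('N[mu]_(q%:E)[EFin \o \1_(eball x0 d)] = mu (eball x0 d) `^ q^-1)%E.
  rewrite unlock; congr (_ `^ _)%E.
  rewrite -[RHS]/(mu (eball x0 d)) -[eball x0 d in RHS]setIT -integral_indic//.
  apply: eq_integral => x _ /=; rewrite indicE; case: (x \in _) => /=.
    by rewrite normr1 powR1.
  by rewrite normr0 powR0// gt_eqF.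
rewrite Nq; apply: (@le_trans _ _ (mu (eball x0 d) `^ (l^-1 - p^-1) * mu (eball x0 d) `^ q^-1)%E).
  by apply: lee_wpmul2r => //; exact: poweR_ge0.
have v0 := ball_vol_gt0 R n0.
have -> : mu (eball x0 d) = (d ^+ n * ball_vol R n)%:E by exact: eball_vol.
rewrite !poweR_EFin -EFinM lee_fin; apply: ler_of_eq.
have V0 : 0 < d ^+ n * ball_vol R n by rewrite mulr_gt0// exprn_gt0.
rewrite -powRD_gt0//.
have -> : l^-1 - p^-1 + q^-1 = - (beta / n%:R).
  have -> : q^-1 = 1 - l^-1 by rewrite -lq addrC addKr.
  have nb : n%:R + beta != 0 by rewrite gt_eqF// addr_gt0.
  have n0' : n%:R != 0 :> R by rewrite gt_eqF.
  by rewrite pE; field; rewrite ?n0' ?nb ?ln.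
rewrite powRM ?exprn_ge0 ?(ltW v0) ?(ltW d0)// mulrC; congr (_ * _).
rewrite -powR_mulrn ?(ltW d0)// -powRrM; congr (_ `^ _).
by field; rewrite gt_eqF.
Qed.

(** The commutator integral for an arbitrary kernel, so that truncations are covered; at [kernel Om]
    it unfolds to [commutator]. *)
Definition cint b k a (x : 'rV[R]_n) : R :=
  \int[mu]_y (k (x - y) * (b x - b y) * a y).

Lemma measurable_sub2 : measurable_fun setT (fun z : 'rV[R]_n * 'rV[R]_n => z.1 - z.2).
Proof. by apply: measurable_funB_rV; [exact: measurable_fst|exact: measurable_snd]. Qed.

Lemma measurable_kernel_sub k : measurable_fun setT k ->
  measurable_fun setT (fun z : 'rV[R]_n * 'rV[R]_n => k (z.1 - z.2)).
Proof. by move=> mk; exact: (measurableT_comp mk measurable_sub2). Qed.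

Section measurable_cint.
Variables (b k a : 'rV[R]_n -> R).
Hypotheses (mb : measurable_fun setT b) (mk : measurable_fun setT k) (ma : measurable_fun setT a).

Lemma measurable_cint_integrand :
  measurable_fun setT (fun z : 'rV[R]_n * 'rV[R]_n => k (z.1 - z.2) * (b z.1 - b z.2) * a z.2).
Proof.
apply: measurable_funM; last by apply: (measurableT_comp ma); exact: measurable_snd.
apply: measurable_funM; first exact: measurable_kernel_sub.
apply: measurable_funB; first by apply: (measurableT_comp mb); exact: measurable_fst.
by apply: (measurableT_comp mb); exact: measurable_snd.
Qed.

(** In terms of positive and negative parts, Tonelli gives measurability in x without
    integrability. *)
Lemma measurable_cint : measurable_fun setT (cint b k a).
Proof.
pose f (z : 'rV[R]_n * 'rV[R]_n) := k (z.1 - z.2) * (b z.1 - b z.2) * a z.2.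
have mf : measurable_fun setT f by exact: measurable_cint_integrand.
have -> : cint b k a = fun x => fine (\int[mu]_y (Num.max (f (x, y)) 0)%:E -
                                    \int[mu]_y (Num.max (- f (x, y)) 0)%:E)%E.
  apply/funext => x; rewrite /cint /Rintegral integralE; congr (fine (_ - _)).
  - by apply: eq_integral => y _; rewrite funeposE /= -EFin_max.
  - by apply: eq_integral => y _; rewrite funenegE /= -EFin_max.
apply: (measurableT_comp (fine_measurable measurableT)) => //.
apply: emeasurable_funB.
  apply: (@measurable_fun_integral2 _ _ _ _ _ _ (fun z => Num.max (f z) 0)).
    by apply: measurable_maxr.
  by move=> z; rewrite le_max lexx orbT.
apply: (@measurable_fun_integral2 _ _ _ _ _ _ (fun z => Num.max (- f z) 0)).
  by apply: measurable_maxr => //; exact: measurable_funN.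
by move=> z; rewrite le_max lexx orbT.
Qed.

End measurable_cint.

Section cint_bound.
Variables (beta A C1 C2 C3 : R) (k : 'rV[R]_n -> R).
Hypotheses (beta0 : 0 < beta) (A1 : 1 <= A).
Hypotheses (C10 : 0 <= C1) (C20 : 0 <= C2) (C30 : 0 <= C3).
Hypothesis hk : singular_kernel beta A C1 C2 C3 k.
Variables (b a : 'rV[R]_n -> R) (L C d : R) (x0 : 'rV[R]_n).
Hypotheses (L0 : 0 <= L) (bL : holder L beta b) (C0 : 0 <= C) (d0 : 0 < d).
Hypothesis ha : bump beta C x0 d a.

Let mk := singular_kernel_measurable hk.
Let ma := bump_measurable ha.
Let mb : measurable_fun setT b. Proof. exact: holder_measurable bL. Qed.
Let A0 : 0 < A. Proof. exact: lt_le_trans A1. Qed.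
Let Ad0 : 0 < A * d. Proof. exact: mulr_gt0. Qed.

Let near := eball x0 (A * d).
Let mnear : measurable near. Proof. exact: measurable_eball. Qed.
Let mfar : measurable (~` near). Proof. exact: measurableC. Qed.

Let w (z : 'rV[R]_n * 'rV[R]_n) := `|b z.1 - b z.2| * `|a z.2|.
Let w0 z : 0 <= w z. Proof. exact: mulr_ge0. Qed.
Let mw : measurable_fun setT w.
Proof.
have mn := @normr_measurable R setT.
apply: measurable_funM; apply: (measurableT_comp mn).
  apply: measurable_funB; first by apply: (measurableT_comp mb); exact: measurable_fst.
  by apply: (measurableT_comp mb); exact: measurable_snd.
by apply: (measurableT_comp ma); exact: measurable_snd.
Qed.

Let Fn (z : 'rV[R]_n * 'rV[R]_n) := `|k (z.1 - z.2)| * w z.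
Let Ff (z : 'rV[R]_n * 'rV[R]_n) := `|k (z.1 - z.2) - k (z.1 - x0)| * w z.

Let Fn0 z : 0 <= Fn z. Proof. exact: mulr_ge0. Qed.
Let Ff0 z : 0 <= Ff z. Proof. exact: mulr_ge0. Qed.

Let mFn : measurable_fun setT Fn.
Proof.
apply: measurable_funM => //; apply: (measurableT_comp (@normr_measurable R setT)).
exact: measurable_kernel_sub.
Qed.

Let mFf : measurable_fun setT Ff.
Proof.
apply: measurable_funM => //; apply: (measurableT_comp (@normr_measurable R setT)).
apply: measurable_funB; first exact: measurable_kernel_sub.
apply: (measurableT_comp mk); apply: measurable_funB_rV => //; exact: measurable_fst.
Qed.

Let a_ball y : a y != 0 -> enorm (y - x0) <= d.
Proof. by move=> /(bump_support ha). Qed.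

(** For y in the support, x - y stays in the ball of radius (A + 1) d, and the increment of b
    supplies the weight |x - y|^beta. *)
Let near_slice y : (\int[mu]_(x in near) (Fn (x, y))%:E <=
  (L * (C1 * ((A + 1) * d) `^ beta) * `|a y|)%:E)%E.
Proof.
have [ay|ay] := eqVneq (a y) 0.
  rewrite ay normr0 mulr0 integral0_eq// => x _.
  by rewrite /Fn /w/= ay normr0 !mulr0.
pose g x := `|k x| * enorm x `^ beta.
have mg : measurable_fun setT g.
  apply: measurable_funM; first exact: (measurableT_comp (@normr_measurable R setT)).
  by apply: (measurableT_comp (measurable_powR _)); exact: measurable_enorm.
have g0 x : 0 <= g x by rewrite mulr_ge0// powR_ge0.
have msub : measurable_fun setT (fun x : 'rV[R]_n => x - y) by exact: measurable_funB_rV.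
apply: (@le_trans _ _ ((L * `|a y|)%:E * \int[mu]_(x in near) (g (x - y))%:E)%E).
  have La0 : 0 <= L * `|a y| by exact: mulr_ge0.
  have gy0 (x : 'rV[R]_n) : 0 <= g (x - y) by exact: g0.
  apply: (integral_le_cst_mul _ mnear mnear (@subset_refl _ _) La0 (measurable_fun_slice2 mFn y) (measurableT_comp mg msub)
     (fun x => Fn0 (x, y)) gy0).
  move=> x _; rewrite /Fn /w/= /g.
  rewrite (_ : L * _ * _ = `|k (x - y)| * ((L * enorm (x - y) `^ beta) * `|a y|)); last by ring.
  by rewrite ler_wpM2l// ler_wpM2r.
rewrite (_ : L * _ * `|a y| = (L * `|a y|) * (C1 * ((A + 1) * d) `^ beta)); last by ring.
rewrite [leRHS]EFinM; apply: lee_wpmul2l; first by rewrite lee_fin mulr_ge0.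
have r0 : 0 < (A + 1) * d by rewrite mulr_gt0// addr_gt0.
apply: le_trans (singular_kernel_local hk r0).
apply: (integral_translate_le mg g0 (measurable_eball _ _) mnear) => x.
rewrite /near /eball/= subr0 => xA; apply: (le_trans (enorm_distD x0 _ _)).
by rewrite mulrDl mul1r lerD// enormBC a_ball.
Qed.

(** Away from the ball |x - y| <= 2 |x - x0|, whence the factor 2^beta and a weight in x - x0 alone,
    as the smoothness bound requires. *)
Let far_slice y : (\int[mu]_(x in ~` near) (Ff (x, y))%:E <=
  (L * (2 `^ beta * (C2 * d `^ beta)) * `|a y|)%:E)%E.
Proof.
have [ay|ay] := eqVneq (a y) 0.
  rewrite ay normr0 mulr0 integral0_eq// => x _.
  by rewrite /Ff /w/= ay normr0 !mulr0.
have yd := a_ball ay.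
pose g x := enorm x `^ beta * `|k (x - (y - x0)) - k x|.
have mg : measurable_fun setT g.
  apply: measurable_funM.
    by apply: (measurableT_comp (measurable_powR _)); exact: measurable_enorm.
  apply: (measurableT_comp (@normr_measurable R setT)); apply: measurable_funB => //.
  by apply: (measurableT_comp mk); exact: measurable_funB_rV.
have g0 x : 0 <= g x by rewrite mulr_ge0// powR_ge0.
have msub : measurable_fun setT (fun x : 'rV[R]_n => x - x0) by exact: measurable_funB_rV.
apply: (@le_trans _ _ ((L * 2 `^ beta * `|a y|)%:E * \int[mu]_(x in ~` near) (g (x - x0))%:E)%E).
  apply: integral_le_cst_mul => //.
  - by rewrite !mulr_ge0// powR_ge0.
  - exact: (measurable_fun_slice2 mFf).
  - exact: (measurableT_comp mg msub).
  move=> x /negP; rewrite -ltNge => xA; rewrite /Ff /w/= /g.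
  have -> : x - x0 - (y - x0) = x - y by rewrite opprB addrA subrK.
  have xy : enorm (x - y) <= 2 * enorm (x - x0).
    apply: (le_trans (enorm_distD x0 _ _)); rewrite [enorm (x0 - y)]enormBC mulr_natl mulr2n lerD2l.
    by apply: (le_trans yd); apply: le_trans (ltW xA); rewrite ler_peMl// ltW.
  rewrite (_ : L * _ * _ * _ = `|k (x - y) - k (x - x0)| * ((L * (2 `^ beta * enorm (x - x0) `^ beta)) * `|a y|)); last by ring.
  rewrite ler_wpM2l// ler_wpM2r// (le_trans (bL _ _))// ler_wpM2l//.
  rewrite -powRM ?enorm_ge0//; apply: ge0_ler_powR => //; rewrite ?nnegrE ?(ltW beta0) ?enorm_ge0//.
  by rewrite mulr_ge0// enorm_ge0.
rewrite (_ : L * (2 `^ beta * (C2 * d `^ beta)) * `|a y| = (L * 2 `^ beta * `|a y|) * (C2 * d `^ beta)); last by ring.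
rewrite [leRHS]EFinM; apply: lee_wpmul2l; first by rewrite lee_fin !mulr_ge0// powR_ge0.
apply: le_trans (singular_kernel_smooth hk d0 yd).
apply: (integral_translate_le mg g0) => //.
  rewrite (_ : [set x | _] = [set x : 'rV[R]_n | enorm x \in `]A * d, +oo[]); first exact: measurable_enorm_itv.
  by apply/seteqP; split => x /=; rewrite in_itv/= andbT.
by move=> x /negP; rewrite -ltNge.
Qed.

Let double_bound (E : set 'rV[R]_n) (F : 'rV[R]_n * 'rV[R]_n -> R) (K : R) :
  measurable E -> measurable_fun setT F -> (forall z, 0 <= F z) -> 0 <= K ->
  (forall y, (\int[mu]_(x in E) (F (x, y))%:E <= (K * `|a y|)%:E)%E) ->
  (\int[mu]_(x in E) \int[mu]_y (F (x, y))%:E <= (K * (C * d `^ (- beta)))%:E)%E.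
Proof.
move=> mE mF F0 K0 FK; rewrite (tonelli_dom _ _ mF F0 mE measurableT).
have mna : measurable_fun setT (fun y => `|a y|) by exact: (measurableT_comp (@normr_measurable R setT)).
apply: (@le_trans _ _ (\int[mu]_y (K * `|a y|)%:E)%E).
  apply: ge0_le_integral => //.
  - by move=> y _; apply: integral_ge0 => x _; rewrite lee_fin.
  - have := @measurable_fun_integral2_dom _ _ _ _ _ mu (fun z => F (z.2, z.1)) _ _ E mE.
    apply => [|z]; last exact: F0.
    by apply: (measurableT_comp mF); exact: measurable_swap.
  - by apply/measurable_EFinP; exact: measurable_funM.
under eq_integral do rewrite EFinM.
rewrite ge0_integralZl//; last exact/measurable_EFinP.
by rewrite [leRHS]EFinM; apply: lee_wpmul2l; [rewrite lee_fin|exact: bump_integral ha].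
Qed.

Let dd (c : R) : c * d `^ beta * (C * d `^ (- beta)) = c * C.
Proof.
rewrite -mulrA [C * _]mulrC [d `^ beta * _]mulrA -powRD_gt0// subrr powRr0; ring.
Qed.

Let near_L1 : (\int[mu]_(x in near) \int[mu]_y (Fn (x, y))%:E <=
  (C1 * (A + 1) `^ beta * L * C)%:E)%E.
Proof.
rewrite -(dd (C1 * (A + 1) `^ beta * L)) (_ : _ * d `^ beta = L * (C1 * ((A + 1) * d) `^ beta)).
  apply: (double_bound mnear mFn Fn0 _ near_slice).
  by rewrite !mulr_ge0// powR_ge0.
by rewrite powRM ?(ltW d0) ?addr_ge0 ?(ltW A0)//; ring.
Qed.

Let far_L1 : (\int[mu]_(x in ~` near) \int[mu]_y (Ff (x, y))%:E <=
  (2 `^ beta * C2 * L * C)%:E)%E.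
Proof.
rewrite -(dd (2 `^ beta * C2 * L)) (_ : _ * d `^ beta = L * (2 `^ beta * (C2 * d `^ beta))); last by ring.
apply: (double_bound mfar mFf Ff0 _ far_slice).
by rewrite !mulr_ge0// powR_ge0.
Qed.

Lemma cint_local_L1 : (\int[mu]_(x in eball x0 (A * d))
  \int[mu]_y (`|k (x - y)| * (`|b x - b y| * `|a y|))%:E <= (C1 * (A + 1) `^ beta * L * C)%:E)%E.
Proof. exact: near_L1. Qed.

Let mint x : measurable_fun setT (fun y : 'rV[R]_n => k (x - y) * (b x - b y) * a y).
Proof.
apply: measurable_funM; last exact: ma.
apply: measurable_funM; last exact: measurable_funB.
by apply: (measurableT_comp mk); apply: measurable_funB_rV.
Qed.

Let near_pointwise x : (`|cint b k a x|%:E <= \int[mu]_y (Fn (x, y))%:E)%E.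
Proof.
apply: (le_trans (normr_Rintegral_le _ (mint x))).
rewrite (_ : (fun y => `|_|%:E) = (fun y => (Fn (x, y))%:E))//.
by apply/funext => y; rewrite /Fn /w/= !normrM mulrA.
Qed.

Let ia : mu.-integrable setT (EFin \o a).
Proof.
apply: integrable_norm_lty; first exact: ma.
by apply: le_lt_trans (bump_integral ha) _; rewrite ltry.
Qed.

Let J y := (b x0 - b y) * a y.

Let mJ : measurable_fun setT J.
Proof. by apply: measurable_funM; [exact: measurable_funB|exact: ma]. Qed.

Let J_le : (\int[mu]_y `|J y|%:E <= (L * C)%:E)%E.
Proof.
have mna : measurable_fun setT (fun y => `|a y|) by exact: (measurableT_comp (@normr_measurable R setT)).
have mnJ : measurable_fun setT (fun y => `|J y|) by exact: (measurableT_comp (@normr_measurable R setT)).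
apply: (@le_trans _ _ ((L * d `^ beta)%:E * \int[mu]_y `|a y|%:E)%E).
  apply: integral_le_cst_mul => //.
    by rewrite mulr_ge0// powR_ge0.
  move=> y _; rewrite /J normrM.
  have [->|/a_ball yd] := eqVneq (a y) 0; first by rewrite normr0 !mulr0.
  rewrite ler_wpM2r// (le_trans (bL _ _))// ler_wpM2l//.
  by rewrite enormBC; apply: ge0_ler_powR => //; rewrite ?nnegrE ?(ltW beta0) ?(ltW d0) ?enorm_ge0.
rewrite -(dd L) [leRHS]EFinM; apply: lee_wpmul2l; last exact: bump_integral ha.
by rewrite lee_fin mulr_ge0// powR_ge0.
Qed.

Let iJ : mu.-integrable setT (EFin \o J).
Proof.
by apply: integrable_norm_lty; [exact: mJ|apply: le_lt_trans J_le _; rewrite ltry].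
Qed.

Let far_pointwise x :
  (`|cint b k a x|%:E <= \int[mu]_y (Ff (x, y))%:E + (L * C * `|k (x - x0)|)%:E)%E.
Proof.
(* An infinite right side makes the claim trivial; otherwise f1 is integrable and the integral may
   be split. *)
have [fin|] := ltP (\int[mu]_y (Ff (x, y))%:E)%E +oo%E; last first.
  by rewrite leye_eq => /eqP ->; rewrite addye ?leey.
pose f1 y := (k (x - y) - k (x - x0)) * (b x - b y) * a y.
pose c1 := k (x - x0) * (b x - b x0); pose c2 := k (x - x0).
have mf1 : measurable_fun setT f1.
  apply: measurable_funM; last exact: ma.
  apply: measurable_funM; last exact: measurable_funB.
  apply: measurable_funB => //; apply: (measurableT_comp mk).
  by apply: measurable_funB_rV.
have f1E y : `|f1 y| = Ff (x, y) by rewrite /f1 /Ff /w/= !normrM mulrA.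
have if1 : mu.-integrable setT (EFin \o f1).
  apply: integrable_norm_lty; first exact: mf1.
  by under eq_integral do rewrite f1E.
have iZ c (f : 'rV[R]_n -> R) : mu.-integrable setT (EFin \o f) ->
    mu.-integrable setT (EFin \o (fun y => c * f y)) by move=> h; exact: (integrableZl measurableT c h).
(* k (x - x0) is subtracted from and added to k (x - y), and in the added term b x - b y passes
   through b x0. The part with b x - b x0 will vanish by the mean of a. *)
have -> : cint b k a x = \int[mu]_y f1 y + (c1 * \int[mu]_y a y + c2 * \int[mu]_y J y).
  have h1 := iZ c1 a ia; have h2 := iZ c2 J iJ.
  have h3 : mu.-integrable setT (EFin \o (fun y => c1 * a y + c2 * J y)).
    exact: (integrableD measurableT h1 h2).
  rewrite -!RintegralZl// -!RintegralD//.
  by apply: eq_Rintegral => y _; rewrite /f1 /J /c1 /c2; ring.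
rewrite (bump_mean ha) mulr0 add0r.
apply: (@le_trans _ _ (`|\int[mu]_y f1 y|%:E + `|c2 * \int[mu]_y J y|%:E)%E).
  by rewrite -EFinD lee_fin ler_normD.
apply: leeD.
  apply: (le_trans (normr_Rintegral_le _ mf1)).
  by under eq_integral do rewrite f1E.
rewrite normrM mulrC lee_fin ler_wpM2r// -lee_fin.
exact: (le_trans (normr_Rintegral_le _ mJ) J_le).
Qed.

(** The two terms away from the ball are each tested at level t/2, hence the factors 2. *)
Definition cint_const : R := C1 * (A + 1) `^ beta + 2 * (2 `^ beta * C2) + 2 * C3.

Lemma cint_weak (t : R) : 0 < t ->
  (mu [set x | (t < `|cint b k a x|)%R] <= (cint_const * L * C / t)%:E)%E.
Proof.
move=> t0; have t20 : 0 < t / 2 by rewrite divr_gt0.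
pose Hn x := (\int[mu]_y (Fn (x, y))%:E)%E; pose Hf x := (\int[mu]_y (Ff (x, y))%:E)%E.
have mHn : measurable_fun setT Hn by exact: measurable_fun_integral2.
have mHf : measurable_fun setT Hf by exact: measurable_fun_integral2.
have Hn0 x : (0 <= Hn x)%E by apply: integral_ge0 => y _; rewrite lee_fin.
have Hf0 x : (0 <= Hf x)%E by apply: integral_ge0 => y _; rewrite lee_fin.
have mset (f : 'rV[R]_n -> \bar R) (s : R) : measurable_fun setT f -> measurable [set x | (s%:E < f x)%E].
  by move=> mf; rewrite -[X in measurable X]setTI; exact: emeasurable_fun_o_infty.
have mK : measurable_fun setT (fun x : 'rV[R]_n => (L * C * `|k (x - x0)|)).
  apply: measurable_funM => //; apply: (measurableT_comp (@normr_measurable R setT)).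
  by apply: (measurableT_comp mk); exact: measurable_funB_rV.
pose E1 := near `&` [set x | (t%:E < Hn x)%E].
pose E2 := ~` near `&` [set x | ((t / 2)%:E < Hf x)%E].
pose E3 := [set x | t / 2 < L * C * `|k (x - x0)|].
have mE1 : measurable E1 by apply: measurableI => //; exact: mset.
have mE2 : measurable E2 by apply: measurableI => //; exact: mset.
have mE3 : measurable E3.
  by have := mset (EFin \o (fun x => L * C * `|k (x - x0)|)) (t / 2); apply; exact/measurable_EFinP.
apply: (@le_trans _ _ (mu ((E1 `|` E2) `|` E3))).
  apply: mono_measure.
  - have mc := measurable_cint mb mk ma.
    have := mset (EFin \o (fun x => `|cint b k a x|)) t; apply.
    by apply/measurable_EFinP; exact: (measurableT_comp (@normr_measurable R setT)).
  - by apply: measurableU => //; exact: measurableU.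
  move=> x /= tx; have [xn|xf] := pselect (near x).
    by left; left; split => //=; apply: lt_le_trans (near_pointwise x); rewrite lte_fin.
  have [h|h] := ltP (t / 2) (L * C * `|k (x - x0)|); first by right.
  left; right; split => //=; rewrite ltNge; apply/negP => h2.
  have := le_trans (far_pointwise x) (leeD h2 (h : ((L * C * `|k (x - x0)|)%:E <= (t / 2)%:E)%E)).
  by rewrite -EFinD lee_fin -splitr leNgt tx.
apply: (le_trans (measureU2 _ _ mE3)); first exact: measurableU.
have -> : cint_const * L * C / t = t^-1 * (C1 * (A + 1) `^ beta * L * C) + (t / 2)^-1 * (2 `^ beta * C2 * L * C)
    + C3 * (L * C) / (t / 2).
  by rewrite /cint_const; field; rewrite gt_eqF.
rewrite !EFinD; apply: leeD; last first.
  (* The level is divided by L C below; if this vanishes, the set is empty. *)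
  have [LC0|LC0] := eqVneq (L * C) 0.
    rewrite (_ : E3 = set0) ?measure0 ?lee_fin ?LC0 ?mulr0 ?mul0r//.
    by apply/seteqP; split => x //=; rewrite /E3/= LC0 mul0r ltNge ltW.
  have {}LC0 : 0 < L * C by rewrite lt_neqAle eq_sym LC0 mulr_ge0.
  have s0 : 0 < t / 2 / (L * C) by rewrite divr_gt0.
  have mD : measurable [set x | t / 2 / (L * C) < `|k x|].
    have := mset (EFin \o (fun x => `|k x|)) (t / 2 / (L * C)); apply.
    by apply/measurable_EFinP; exact: (measurableT_comp (@normr_measurable R setT)).
  have := lebesgue_affine (- x0) ltr01 mD; rewrite invr1 expr1n mul1e.
  rewrite (_ : _ @^-1` _ = E3); last first.
    have e v : (t / 2 / (L * C) < v) = (t / 2 < L * C * v) by rewrite ltr_pdivrMr// [v * _]mulrC.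
    by apply/seteqP; split => x; rewrite /E3/= scale1r e.
  move=> h; apply: (le_trans (y := mu [set x | (t / 2 / (L * C) < `|k x|)%R])); first by rewrite -h.
  apply: (le_trans (singular_kernel_weak hk s0)).
  by rewrite lee_fin; apply: ler_of_eq; rewrite invfM invrK; ring.
apply: (le_trans (measureU2 _ mE1 mE2)); apply: leeD.
  apply: (le_trans (measure_gt_le_integral_dom _ mnear mHn Hn0 t0)).
  by rewrite [leRHS]EFinM; apply: lee_wpmul2l => //; rewrite lee_fin invr_ge0 ltW.
apply: (le_trans (measure_gt_le_integral_dom _ mfar mHf Hf0 t20)).
by rewrite [leRHS]EFinM; apply: lee_wpmul2l => //; rewrite lee_fin invr_ge0 ltW.
Qed.

(** For an integrable kernel the term with k (x - x0) is in L1 and not just in weak L1, so the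
    commutator can be paired with bounded functions. *)
Lemma cint_L1 (kap : R) : (\int[mu]_x `|k x|%:E <= kap%:E)%E ->
  (\int[mu]_x `|cint b k a x|%:E <=
    ((C1 * (A + 1) `^ beta + 2 `^ beta * C2 + kap) * L * C)%:E)%E.
Proof.
move=> kkap.
have mc : measurable_fun setT (fun x => `|cint b k a x|).
  by apply: (measurableT_comp (@normr_measurable R setT)); exact: measurable_cint.
have mcE : measurable_fun setT (fun x => `|cint b k a x|%:E) by exact/measurable_EFinP.
have mka : measurable_fun setT (fun x => `|k x|).
  exact: (measurableT_comp (@normr_measurable R setT)).
have mkx : measurable_fun setT (fun x : 'rV[R]_n => `|k (x - x0)|).
  by apply: (measurableT_comp mka); exact: measurable_funB_rV.
have mHn : measurable_fun setT (fun x => (\int[mu]_y (Fn (x, y))%:E)%E) by exact: measurable_fun_integral2.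
have mHf : measurable_fun setT (fun x => (\int[mu]_y (Ff (x, y))%:E)%E) by exact: measurable_fun_integral2.
have kE : (\int[mu]_x (L * C * `|k (x - x0)|)%:E <= (kap * L * C)%:E)%E.
  under eq_integral do rewrite EFinM.
  rewrite ge0_integralZl//; last 2 first.
  - exact/measurable_EFinP.
  - by rewrite lee_fin mulr_ge0.
  rewrite (_ : kap * L * C = L * C * kap); last by ring.
  rewrite [leRHS]EFinM; apply: lee_wpmul2l; first by rewrite lee_fin mulr_ge0.
  apply: le_trans kkap.
  exact: (@integral_translate_le _ _ setT setT _ x0 mka (fun x => normr_ge0 _)).
rewrite -(setUv near) ge0_integral_setU//; last first.
- exact/disj_setPCl.
- exact: measurable_funTS.
rewrite (_ : (_ + _ + _) * L * C = C1 * (A + 1) `^ beta * L * C + (2 `^ beta * C2 * L * C + kap * L * C)); last by ring.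
rewrite EFinD; apply: leeD.
  apply: le_trans near_L1; apply: ge0_le_integral => //.
  - exact: measurable_funTS.
  - exact: measurable_funTS.
apply: (@le_trans _ _ (\int[mu]_(x in ~` near) (\int[mu]_y (Ff (x, y))%:E + (L * C * `|k (x - x0)|)%:E))%E).
  apply: ge0_le_integral => //.
  - exact: measurable_funTS.
  - apply: measurable_funTS; apply: emeasurable_funD => //.
    by apply/measurable_EFinP; exact: measurable_funM.
have Hf0 x : (~` near) x -> (0 <= \int[mu]_y (Ff (x, y))%:E)%E by move=> _; apply: integral_ge0 => y _; rewrite lee_fin.
have kx0 x : (~` near) x -> (0 <= (L * C * `|k (x - x0)|)%:E)%E by move=> _; rewrite lee_fin !mulr_ge0.
rewrite (ge0_integralD mu mfar Hf0 (measurable_funTS mHf) kx0); last first.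
  by apply: measurable_funTS; apply/measurable_EFinP; exact: measurable_funM.
rewrite EFinD; apply: leeD; first exact: far_L1.
apply: le_trans kE; apply: ge0_subset_integral => //.
- by apply/measurable_EFinP; exact: measurable_funM.
- by move=> x _; rewrite lee_fin !mulr_ge0.
Qed.

End cint_bound.

End bump.

(** * Absolutely convergent sums and truncated kernels *)

Section absolutely_convergent_sum.
Context (R : realType).
Implicit Types v : nat -> R.

(* The sum of an absolutely convergent series, in a form that is visibly
   measurable when the terms depend measurably on a parameter. *)
Definition asum v : R :=
  fine (\sum_(0 <= j <oo) (Num.max (v j) 0)%:E)%E -
  fine (\sum_(0 <= j <oo) (Num.max (- v j) 0)%:E)%E.

Lemma nneseries_cvg_fine v : (forall j, 0 <= v j) -> (\sum_(0 <= j <oo) (v j)%:E < +oo)%E ->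
  (fun N => \sum_(0 <= j < N) v j) @ \oo --> fine (\sum_(0 <= j <oo) (v j)%:E)%E.
Proof.
move=> v0 voo.
have s0 : (0 <= \sum_(0 <= j <oo) (v j)%:E)%E by apply: nneseries_ge0 => j _ _; rewrite lee_fin.
have sfin : (\sum_(0 <= j <oo) (v j)%:E)%E \is a fin_num by rewrite ge0_fin_numE.
have : (fun N => \sum_(0 <= j < N) (v j)%:E)%E @ \oo --> (fine (\sum_(0 <= j <oo) (v j)%:E)%E)%:E.
  by rewrite fineK//; apply: is_cvg_nneseries => j _ _; rewrite lee_fin.
move=> /fine_cvg; apply: cvg_trans; apply: near_eq_cvg; apply: nearW => N /=.
by rewrite sumEFin.
Qed.

Lemma asum_cvg v : (\sum_(0 <= j <oo) `|v j|%:E < +oo)%E ->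
  (fun N => \sum_(0 <= j < N) v j) @ \oo --> asum v.
Proof.
move=> voo.
have le_lty (w : nat -> R) : (forall j, 0 <= w j) -> (forall j, w j <= `|v j|) ->
    (\sum_(0 <= j <oo) (w j)%:E < +oo)%E.
  move=> w0 wv; apply: le_lt_trans voo; apply: lee_nneseries => [j _ _|j _]; rewrite lee_fin//.
have p0 j : 0 <= Num.max (v j) 0 by rewrite le_max lexx orbT.
have n0 j : 0 <= Num.max (- v j) 0 by rewrite le_max lexx orbT.
have p1 j : Num.max (v j) 0 <= `|v j| by rewrite ge_max ler_norm normr_ge0.
have n1 j : Num.max (- v j) 0 <= `|v j| by rewrite ge_max -normrN ler_norm normr_ge0.
have c : (fun N => \sum_(0 <= j < N) Num.max (v j) 0 - \sum_(0 <= j < N) Num.max (- v j) 0) @ \oo --> asum v.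
  exact: cvgB (nneseries_cvg_fine p0 (le_lty _ p0 p1)) (nneseries_cvg_fine n0 (le_lty _ n0 n1)).
apply: cvg_trans c; apply: near_eq_cvg; apply: nearW => N /=.
rewrite -sumrB; apply: eq_bigr => j _.
by rewrite /Num.max; case: ltP => h1; case: ltP => h2; lra.
Qed.

(** This holds for every sequence: if the series does not converge absolutely, the right side is
    infinite and the junk value of [asum] does no harm. *)
Lemma asum_tail v N :
  (`|asum v - \sum_(0 <= j < N) v j|%:E <= \sum_(N <= j <oo) `|v j|%:E)%E.
Proof.
have v0 j : (0 <= `|v j|%:E)%E by rewrite lee_fin.
have t0 : (0 <= \sum_(N <= j <oo) `|v j|%:E)%E by apply: nneseries_ge0.
have [toofin|] := ltP (\sum_(N <= j <oo) `|v j|%:E)%E +oo%E; last first.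
  by rewrite leye_eq => /eqP ->; rewrite leey.
have voo : (\sum_(0 <= j <oo) `|v j|%:E < +oo)%E.
  rewrite (nneseries_split 0 N)// add0n lte_add_pinfty//.
  by rewrite sumEFin ltry.
have tfin : (\sum_(N <= j <oo) `|v j|%:E)%E \is a fin_num by rewrite ge0_fin_numE.
rewrite -(fineK tfin) lee_fin.
have cvgs := asum_cvg voo.
have : (fun M => `|\sum_(0 <= j < M) v j - \sum_(0 <= j < N) v j|) @ \oo -->
    `|asum v - \sum_(0 <= j < N) v j|.
  by apply: cvg_norm; apply: cvgB => //; exact: cvg_cst.
move=> cn; rewrite -(cvg_lim _ cn)//; apply: limr_le; first by apply/cvg_ex; eexists; exact: cn.
near=> M; have NM : (N <= M)%N by near: M; exact: nbhs_infty_ge.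
rewrite (big_cat_nat (leq0n N) NM)/= [X in `|X|]addrAC subrr add0r.
apply: (le_trans (ler_norm_sum _ _ _)).
rewrite -lee_fin (fineK tfin) -sumEFin; exact: nneseries_lim_ge.
Unshelve. all: by end_near. Qed.

Lemma asum_le v : (`|asum v|%:E <= \sum_(0 <= j <oo) `|v j|%:E)%E.
Proof. by have := asum_tail v 0; rewrite big_geq// subr0. Qed.

End absolutely_convergent_sum.

Section asum_integral.
Context d (T : measurableType d) (R : realType) (mu : {measure set T -> \bar R}).
Variable u : nat -> T -> R.
Hypothesis mu_u : forall j, measurable_fun setT (u j).

Lemma measurable_asum : measurable_fun setT (fun x => asum (u ^~ x)).
Proof.
have m (f : nat -> T -> R) : (forall j, measurable_fun setT (f j)) -> (forall j x, 0 <= f j x) ->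
    measurable_fun setT (fun x : T => fine (\sum_(0 <= j <oo) (f j x)%:E)%E : R).
  move=> mf f0; apply: (measurableT_comp (fine_measurable measurableT)) => //.
  apply: ge0_emeasurable_sum => [j x _ _|j _]; first by rewrite lee_fin.
  exact/measurable_EFinP.
apply: measurable_funB; apply: m => [j|j x]; rewrite ?le_max ?lexx ?orbT//.
  exact: measurable_maxr.
by apply: measurable_maxr => //; exact: measurable_funN.
Qed.

(** As |h| <= 1, the error after N terms is at most the tail of the series of L1 norms. *)
Lemma asum_Rintegral (h : T -> R) : measurable_fun setT h -> (forall x, `|h x| <= 1) ->
  (\sum_(0 <= j <oo) \int[mu]_x `|u j x|%:E < +oo)%E ->
  (fun N => \sum_(0 <= j < N) \int[mu]_x (u j x * h x)) @ \oo -->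
    \int[mu]_x (asum (u ^~ x) * h x).
Proof.
move=> mh h1 uoo.
have mnu j : measurable_fun setT (fun x => `|u j x|) by exact: (measurableT_comp (@normr_measurable R setT)).
have mnuE j : measurable_fun setT (fun x => `|u j x|%:E) by exact/measurable_EFinP.
have i0 j : (0 <= \int[mu]_x `|u j x|%:E)%E by apply: integral_ge0 => x _; rewrite lee_fin.
have tail N : (\int[mu]_x \sum_(N <= j <oo) `|u j x|%:E = \sum_(N <= j <oo) \int[mu]_x `|u j x|%:E)%E.
  rewrite -(nneseries_addn _ i0).
  under eq_integral do rewrite -nneseries_addn//.
  by rewrite integral_nneseries.
have mtail N : measurable_fun setT (fun x => \sum_(N <= j <oo) `|u j x|%:E)%E.
  rewrite (_ : (fun _ => _) = (fun x => \sum_(0 <= j <oo) `|u (j + N)%N x|%:E)%E).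
    by apply: ge0_emeasurable_sum => [j x _ _|j _].
  by apply/funext => x; rewrite -nneseries_addn.
have mul_le a x : `|a * h x| <= `|a| by rewrite normrM ler_piMr.
have iu j : mu.-integrable setT (EFin \o (fun x => u j x * h x)).
  apply: integrable_norm_lty; first exact: measurable_funM.
  apply: (@le_lt_trans _ _ (\int[mu]_x `|u j x|%:E)%E).
    apply: ge0_le_integral => //.
    - apply/measurable_EFinP; apply: (measurableT_comp (@normr_measurable R setT)).
      exact: measurable_funM.
    - by move=> x _; rewrite lee_fin.
  apply: le_lt_trans uoo; apply: (le_trans _ (nneseries_lim_ge j.+1 _)) => //.
  by rewrite big_nat_recr//= leeDr// sume_ge0.
have ia : mu.-integrable setT (EFin \o (fun x => asum (u ^~ x) * h x)).
  have mah : measurable_fun setT (fun x => asum (u ^~ x) * h x).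
    by apply: measurable_funM => //; exact: measurable_asum.
  apply: integrable_norm_lty => //; apply: le_lt_trans uoo; rewrite -tail.
  apply: ge0_le_integral => //.
  - apply/measurable_EFinP; exact: (measurableT_comp (@normr_measurable R setT)).
  - by move=> x _; apply: le_trans (asum_le _); rewrite lee_fin.
have isum N : mu.-integrable setT (EFin \o (fun x => \sum_(0 <= j < N) (u j x * h x))) /\
    \int[mu]_x (\sum_(0 <= j < N) (u j x * h x)) = \sum_(0 <= j < N) \int[mu]_x (u j x * h x).
  elim: N => [|N [IH1 IH2]].
    have E : (fun x => \sum_(0 <= j < 0) (u j x * h x)) = cst 0 by apply/funext => x; rewrite big_geq.
    rewrite E; split; first exact: integrable0.
    by rewrite big_geq// /Rintegral integral0.
  have E : (fun x => \sum_(0 <= j < N.+1) (u j x * h x)) =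
      (fun x => \sum_(0 <= j < N) (u j x * h x) + u N x * h x).
    by apply/funext => x; rewrite big_nat_recr.
  rewrite E; split; first exact: (integrableD measurableT IH1 (iu N)).
  by rewrite RintegralD// IH2 big_nat_recr.
have tcvg := nneseries_tail_cvg uoo (fun k _ => i0 k).
apply/cvgrPdist_le => e e0.
have /fine_cvgP[_ /cvgrPdist_le/(_ _ e0)] := tcvg; apply: filterS => N /=.
rewrite sub0r normrN => tN.
have [IH1 IH2] := isum N.
rewrite -IH2 -RintegralB// -lee_fin.
have mdiff : measurable_fun setT (fun x => asum (u ^~ x) * h x - \sum_(0 <= j < N) (u j x * h x)).
  apply: measurable_funB; first by apply: measurable_funM => //; exact: measurable_asum.
  by apply: measurable_sum => j; exact: measurable_funM.
apply: (le_trans (normr_Rintegral_le _ mdiff)).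
apply: (@le_trans _ _ (\sum_(N <= j <oo) \int[mu]_x `|u j x|%:E)%E).
  rewrite -tail; apply: ge0_le_integral => //.
  - apply/measurable_EFinP; exact: (measurableT_comp (@normr_measurable R setT)).
  - move=> x _; apply: le_trans (asum_tail _ _).
    by rewrite lee_fin -mulr_suml -mulrBl.
have tfin : (\sum_(N <= j <oo) \int[mu]_x `|u j x|%:E)%E \is a fin_num.
  rewrite ge0_fin_numE; last by apply: nneseries_ge0.
  apply: le_lt_trans uoo; rewrite (nneseries_split 0 N)// add0n leeDr//.
  by rewrite sume_ge0.
by rewrite -(fineK tfin) lee_fin (le_trans (ler_norm _)).
Qed.

End asum_integral.

Lemma Rintegral_dominated d (T : measurableType d) (R : realType) (mu : {measure set T -> \bar R})
    (f_ : nat -> T -> R) (f g : T -> R) :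
  (forall m, measurable_fun setT (f_ m)) -> (forall x, (fun m => f_ m x) @ \oo --> f x) ->
  mu.-integrable setT (EFin \o g) -> (forall m x, `|f_ m x| <= g x) ->
  (fun m => \int[mu]_x f_ m x) @ \oo --> \int[mu]_x f x.
Proof.
move=> mf ff ig fg.
have mf' : measurable_fun setT f by apply: (@measurable_fun_cvg _ _ _ _ f_) => // x _; exact: ff.
have [if1 _ c] : [/\ mu.-integrable setT (EFin \o f),
  [sequence \int[mu]_x (`|(EFin \o f_ n) x - (EFin \o f) x|)]_n @ \oo --> 0%E &
  [sequence \int[mu]_x ((EFin \o f_ n) x)]_n @ \oo --> \int[mu]_x ((EFin \o f) x)]%E.
  apply: (@dominated_convergence _ _ _ mu setT measurableT (fun n => EFin \o f_ n) (EFin \o f) (EFin \o g)).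
  - by move=> m; exact/measurable_EFinP.
  - exact/measurable_EFinP.
  - by apply: aeW => x _; apply: cvg_EFin; [exact: filterE|exact: ff].
  - exact: ig.
  - by apply: aeW => x m _; rewrite /= lee_fin.
rewrite /Rintegral; apply: fine_cvg; rewrite fineK; first exact: c.
exact: integrable_fin_num.
Qed.

(** A larger A only shrinks the domain in the smoothness bound. It makes the local L1 bound for
    commutators available on balls of any size. *)
Lemma singular_kernel_widen (R : realType) (n : nat) (beta A A' C1 C2 C3 : R) (k : 'rV[R]_n -> R) :
  A <= A' -> singular_kernel beta A C1 C2 C3 k -> singular_kernel beta A' C1 C2 C3 k.
Proof.
move=> AA' [mk kl ks kw]; split => // d y d0 yd; apply: le_trans (ks d y d0 yd).
have mout (c : R) : measurable [set x : 'rV[R]_n | c < enorm x].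
  rewrite (_ : [set x | _] = [set x : 'rV[R]_n | enorm x \in `]c, +oo[]); first exact: measurable_enorm_itv.
  by apply/seteqP; split => x /=; rewrite in_itv/= andbT.
apply: ge0_subset_integral => //.
- apply: measurable_funTS; apply/measurable_EFinP; apply: measurable_funM.
    by apply: (measurableT_comp (measurable_powR _)); exact: measurable_enorm.
  apply: (measurableT_comp (@normr_measurable R setT)); apply: measurable_funB => //.
  by apply: (measurableT_comp mk); exact: measurable_funB_rV.
- by move=> x _; rewrite lee_fin mulr_ge0// powR_ge0.
- by move=> x /=; apply: le_lt_trans; rewrite ler_pM2r.
Qed.

(** * Radial cutoffs *)

Section cutoffs.
Context (R : realType).
Implicit Types e s t u v : R.

Lemma cutoff1 : cutoff (fun _ : R => 1 : R).
Proof.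
split => // s t s0 t0; rewrite subrr normr0 divr_ge0 ?mulr_ge0// le_min.
by rewrite (ltW s0) ltW.
Qed.

(** The first factor is of order t / e at the origin, the second vanishes from 1 / e on. The
    increments of either factor are at most |s - t| / min s t, uniformly in e. *)
Definition trunc e t : R :=
  Num.max t 0 / (Num.max t 0 + e) * Num.max 0 (1 - e * Num.max t 0).

Lemma trunc_cutoff e : 0 < e -> cutoff (trunc e).
Proof.
move=> e0.
have m0 t : 0 <= Num.max t 0 by rewrite le_max lexx orbT.
have q0 u : 0 <= u -> 0 <= u / (u + e) <= 1.
  move=> u0; have ue : 0 < u + e by rewrite ltr_wpDl.
  by rewrite divr_ge0 ?(ltW ue)//= ler_pdivrMr// mul1r lerDl ltW.
have r0 u : 0 <= u -> 0 <= Num.max 0 (1 - e * u) <= 1.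
  move=> u0; rewrite le_max lexx/= ge_max ler01/= gerBl.
  by rewrite mulr_ge0// ltW.
split.
- have mm : measurable_fun setT (fun t : R => Num.max t 0).
    by apply: measurable_maxr => //; exact: measurable_cst.
  apply: measurable_funM.
    apply: measurable_funM => //.
    rewrite (_ : (fun _ => _) = (fun t => (Num.max t 0 + e) `^ (-1))).
      by apply: (measurableT_comp (measurable_powR _)); exact: measurable_funD.
    by apply/funext => t; rewrite powR_inv1// addr_ge0// ltW.
  apply: measurable_maxr => //; apply: measurable_funB => //.
  exact: measurable_funM.
- move=> t; have /andP[q1 q2] := q0 _ (m0 t); have /andP[r1 r2] := r0 _ (m0 t).
  exact: mulr_ge0.
- move=> t; have /andP[q1 q2] := q0 _ (m0 t); have /andP[r1 r2] := r0 _ (m0 t).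
  exact: mulr_ile1.
move=> s t s0 t0; rewrite /trunc (max_l (ltW s0)) (max_l (ltW t0)).
have mn0 : 0 < Num.min s t by rewrite lt_min s0.
have se : 0 < s + e by rewrite addr_gt0.
have te : 0 < t + e by rewrite addr_gt0.
have /andP[q1 q2] := q0 _ (ltW s0); have /andP[q3 q4] := q0 _ (ltW t0).
have /andP[r1 r2] := r0 _ (ltW s0); have /andP[r3 r4] := r0 _ (ltW t0).
have A1 : `|s / (s + e) - t / (t + e)| <= `|s - t| / Num.min s t.
  rewrite (_ : s / (s + e) - t / (t + e) = (s - t) * (e / (s + e) * (t + e)^-1)); last first.
    by field; rewrite !gt_eqF.
  rewrite normrM ler_wpM2l// ger0_norm; last by rewrite !mulr_ge0 ?invr_ge0// ltW.
  apply: (@le_trans _ _ (1 * t^-1)).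
    apply: ler_pM; rewrite ?invr_ge0 ?divr_ge0 ?(ltW e0) ?(ltW se) ?(ltW te)//.
      by rewrite ler_pdivrMr// mul1r lerDr ltW.
    by rewrite lef_pV2 ?posrE// lerDl ltW.
  by rewrite mul1r lef_pV2 ?posrE// ge_min lexx orbT.
have A2 : `|Num.max 0 (1 - e * s) - Num.max 0 (1 - e * t)| <= `|s - t| / Num.min s t.
  have lip : `|Num.max 0 (1 - e * s) - Num.max 0 (1 - e * t)| <= e * `|s - t|.
    have -> : e * `|s - t| = `|e * s - e * t| by rewrite -mulrBr normrM (gtr0_norm e0).
    move: (e * s) (e * t) => a c; rewrite /Num.max.
    have h1 := ler_norm (a - c); have h2 := ler_norm (c - a); rewrite distrC in h2.
    have h3 := normr_ge0 (a - c); move: (`|a - c|) h1 h2 h3 => v h1 h2 h3.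
    by case: ltP => h4; case: ltP => h5; rewrite ler_norml; apply/andP; split; lra.
  (* In the first case the Lipschitz constant e is at most 1 / min s t; in the second both values
     are 0. *)
  have [h|h] := lerP (e * Num.min s t) 1.
    apply: (le_trans lip); rewrite ler_pdivlMr// mulrAC.
    by rewrite ler_piMl.
  have hs : 1 - e * s <= 0.
    by rewrite subr_le0 (le_trans (ltW h))// ler_pM2l// ge_min lexx.
  have ht : 1 - e * t <= 0.
    by rewrite subr_le0 (le_trans (ltW h))// ler_pM2l// ge_min lexx orbT.
  by rewrite !max_l// subrr normr0 divr_ge0// ltW.
rewrite (_ : s / (s + e) * _ - _ = (s / (s + e) - t / (t + e)) * Num.max 0 (1 - e * s) +
  t / (t + e) * (Num.max 0 (1 - e * s) - Num.max 0 (1 - e * t))); last by ring.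
apply: (le_trans (ler_normD _ _)); rewrite [X in X + _]normrM [X in _ + X]normrM (ger0_norm r1) (ger0_norm q3).
rewrite -mulrA mulr_natl mulr2n; apply: lerD.
  by apply: le_trans A1; rewrite ler_piMr.
by apply: le_trans A2; rewrite ler_piMl.
Qed.

Lemma trunc_eq0 e t : 0 < e -> e^-1 <= t -> trunc e t = 0.
Proof.
move=> e0 et; have t0 : 0 <= t by apply: le_trans et; rewrite invr_ge0 ltW.
rewrite /trunc max_l// [Num.max 0 _]max_l ?mulr0// subr_le0.
by rewrite -ler_pdivrMl// mulr1.
Qed.

(** This power of t makes the truncated kernel integrable at the origin. *)
Lemma trunc_le e t beta : 0 < e -> 0 <= t -> 0 < beta -> beta < 1 -> trunc e t <= (t / e) `^ beta.
Proof.
move=> e0 t0 b0 b1; have te : 0 < t + e by rewrite ltr_wpDl.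
apply: (@le_trans _ _ (t / (t + e))).
  rewrite /trunc max_l// ler_piMr ?divr_ge0 ?(ltW te)// ge_max ler01/= gerBl.
  by rewrite mulr_ge0// ltW.
have [h|h] := leP (t / e) 1.
  apply: (@le_trans _ _ (t / e)).
    by rewrite ler_wpM2l// lef_pV2 ?posrE// lerDr.
  have [->|tn0] := eqVneq t 0; first by rewrite mul0r powR_ge0.
  have te0 : 0 < t / e by rewrite divr_gt0// lt_neqAle eq_sym tn0.
  by apply: ger1_powR; rewrite ?te0// ltW.
apply: (@le_trans _ _ 1); first by rewrite ler_pdivrMr// mul1r lerDl ltW.
rewrite -(powRr0 (t / e)); apply: ler_powR; exact: ltW.
Qed.

Lemma trunc_cvg t : 0 < t -> (fun m => trunc m.+1%:R^-1 t) @ \oo --> (1 : R).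
Proof.
move=> t0.
have low e : 0 < e -> 1 - e * (t + t^-1) <= trunc e t.
  move=> e0; have te : 0 < t + e by rewrite addr_gt0.
  have et : 0 < e * t by rewrite mulr_gt0.
  have h1 : 1 - e * t^-1 <= t / (t + e).
    rewrite ler_pdivlMr// (_ : _ * (t + e) = t - e * e / t); last by field; rewrite gt_eqF.
    by rewrite gerBl divr_ge0 ?(ltW t0)// mulr_ge0// ltW.
  have q0 : 0 <= t / (t + e) by rewrite divr_ge0// ltW.
  have q1 : t / (t + e) <= 1 by rewrite ler_pdivrMr// mul1r lerDl ltW.
  rewrite /trunc max_l ?(ltW t0)//; apply: (@le_trans _ _ (t / (t + e) * (1 - e * t))).
    by rewrite [e * _]mulrDr; move: h1 q0 q1 et; move: (t / (t + e)) (e * t^-1) (e * t) => q z w; nra.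
  by rewrite ler_wpM2l// le_max lexx orbT.
apply: (@squeeze_cvgr _ _ _ _ (fun m => 1 - m.+1%:R^-1 * (t + t^-1)) (fun=> 1)).
- apply: nearW => m; rewrite low ?invr_gt0 ?ltr0n//=.
  by apply: (cutoff_le1 (trunc_cutoff _)); rewrite invr_gt0.
- rewrite -[X in _ --> X]subr0 -(mul0r (t + t^-1)); apply: cvgB; first exact: cvg_cst.
  by apply: cvgMl; exact: cvg_harmonic.
- exact: cvg_cst.
Qed.

End cutoffs.

Section truncated_kernel.
Context (R : realType) (n : nat).
Hypothesis n0 : (0 < n)%N.
Local Notation mu := (@lebesgue_rV R n).
Variables (beta A C1 C2 C3 : R) (Om : 'rV[R]_n -> R).
Hypotheses (beta0 : 0 < beta) (beta1 : beta < 1) (A1 : 1 <= A) (C10 : 0 <= C1) (C20 : 0 <= C2) (C30 : 0 <= C3).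
Hypothesis hOm : forall chi, cutoff chi ->
  singular_kernel beta A C1 C2 C3 (kernel (fun z => Om z * chi (enorm z))).

Definition tkernel (m : nat) : 'rV[R]_n -> R :=
  kernel (fun z => Om z * trunc m.+1%:R^-1 (enorm z)).

Let e0 m : 0 < m.+1%:R^-1 :> R. Proof. by rewrite invr_gt0. Qed.

Lemma kernel_singular1 : singular_kernel beta A C1 C2 C3 (kernel Om).
Proof.
have := hOm (cutoff1 R); rewrite (_ : (fun z => _) = Om)//.
by apply/funext => z; rewrite mulr1.
Qed.

Lemma tkernel_singular m : singular_kernel beta A C1 C2 C3 (tkernel m).
Proof. exact: hOm (trunc_cutoff (e0 m)). Qed.

Lemma tkernelE m z : tkernel m z = kernel Om z * trunc m.+1%:R^-1 (enorm z).
Proof. by rewrite /tkernel /kernel mulrAC. Qed.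

Lemma tkernel_le m z : `|tkernel m z| <= `|kernel Om z|.
Proof.
have c := trunc_cutoff (e0 m).
by rewrite tkernelE normrM ler_piMr// ger0_norm ?(cutoff_ge0 c)// (cutoff_le1 c).
Qed.

Lemma tkernel_eq0 m z : m.+1%:R <= enorm z -> tkernel m z = 0.
Proof. by move=> h; rewrite tkernelE trunc_eq0 ?mulr0// invrK. Qed.

Lemma tkernel_cvg z : (fun m => tkernel m z) @ \oo --> kernel Om z.
Proof.
(* At the origin every kernel has the junk value 0, as n > 0. *)
have [->|z0] := eqVneq z 0.
  have E m : tkernel m 0 = kernel Om 0.
    by rewrite /tkernel /kernel enorm0 expr0n eqn0Ngt n0/= invr0 !mulr0.
  by under eq_fun do rewrite E; exact: cvg_cst.
under eq_fun do rewrite tkernelE.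
have h : (fun m => trunc m.+1%:R^-1 (enorm z)) @ \oo --> (1 : R).
  by apply: trunc_cvg; rewrite enorm_gt0.
have c : (fun m : nat => kernel Om z : R) @ \oo --> kernel Om z by exact: cvg_cst.
by have := cvgM c h; rewrite mulr1; apply.
Qed.

(** The kernel vanishes outside the ball of radius m + 1; inside, the cutoff contributes a multiple
    of |x|^beta and the local bound applies. *)
Lemma tkernel_L1 m : exists2 kap, 0 <= kap & (\int[mu]_x `|tkernel m x|%:E <= kap%:E)%E.
Proof.
have mk := singular_kernel_measurable (tkernel_singular m).
have mk1 := singular_kernel_measurable kernel_singular1.
have mnk : measurable_fun setT (fun x => `|tkernel m x|).
  exact: (measurableT_comp (@normr_measurable R setT)).
pose M : R := m.+1%:R; have M0 : 0 < M by rewrite /M.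
exists (M `^ beta * (C1 * M `^ beta)); first by rewrite !mulr_ge0// powR_ge0.
have -> : (\int[mu]_x `|tkernel m x|%:E = \int[mu]_(x in eball 0%R M) `|tkernel m x|%:E)%E.
  rewrite [RHS]integral_mkcond; apply: eq_integral => x _; rewrite /patch; case: ifPn => //.
  move=> /negP; rewrite inE /eball/= subr0 => /negP; rewrite -ltNge => h.
  by rewrite tkernel_eq0 ?normr0// ltW.
apply: (@le_trans _ _ ((M `^ beta)%:E * \int[mu]_(x in eball 0%R M) (`|kernel Om x| * enorm x `^ beta)%:E)%E).
  apply: integral_le_cst_mul => //.
  - exact: measurable_eball.
  - exact: measurable_eball.
  - exact: powR_ge0.
  - apply: measurable_funM; first exact: (measurableT_comp (@normr_measurable R setT)).
    by apply: (measurableT_comp (measurable_powR _)); exact: measurable_enorm.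
  - by move=> x; rewrite mulr_ge0// powR_ge0.
  move=> x _; rewrite tkernelE normrM mulrCA ler_wpM2l//.
  have c := trunc_cutoff (e0 m).
  rewrite ger0_norm ?(cutoff_ge0 c)// -powRM ?enorm_ge0 ?(ltW M0)//.
  by rewrite mulrC; have := trunc_le (e0 m) (enorm_ge0 x) beta0 beta1; rewrite invrK.
rewrite EFinM; apply: lee_wpmul2l; first by rewrite lee_fin powR_ge0.
exact: singular_kernel_local kernel_singular1 _ M0.
Qed.

Variables (b a : 'rV[R]_n -> R) (L C d : R) (x0 : 'rV[R]_n).
Hypotheses (L0 : 0 <= L) (bL : holder L beta b) (C0 : 0 <= C) (d0 : 0 < d).
Hypothesis ha : bump beta C x0 d a.

(** The integral in y is locally integrable in x: A may be replaced by A + i in the local bound, and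
    these balls exhaust the space. *)
Lemma cint_absolutely_convergent :
  {ae mu, forall x, (\int[mu]_y (`|kernel Om (x - y)| * (`|b x - b y| * `|a y|))%:E < +oo)%E}.
Proof.
have mb : measurable_fun setT b := holder_measurable beta0 bL.
have mk1 := singular_kernel_measurable kernel_singular1.
have ma := bump_measurable ha.
have mn := @normr_measurable R setT.
pose F (z : 'rV[R]_n * 'rV[R]_n) := `|kernel Om (z.1 - z.2)| * (`|b z.1 - b z.2| * `|a z.2|).
have mF : measurable_fun setT F.
  apply: measurable_funM; first by apply: (measurableT_comp mn); exact: measurable_kernel_sub.
  apply: measurable_funM; apply: (measurableT_comp mn).
    by apply: measurable_funB; apply: (measurableT_comp mb); [exact: measurable_fst|exact: measurable_snd].
  by apply: (measurableT_comp ma); exact: measurable_snd.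
have F0 z : 0 <= F z by rewrite !mulr_ge0.
have mI : measurable_fun setT (fun x => \int[mu]_y (F (x, y))%:E)%E by exact: measurable_fun_integral2.
have onball (i : nat) : {ae mu, forall x, eball x0 ((A + i%:R) * d) x -> (\int[mu]_y (F (x, y))%:E < +oo)%E}.
  have AA : A <= A + i%:R by rewrite lerDl.
  have iI : mu.-integrable (eball x0 ((A + i%:R) * d)) (fun x => \int[mu]_y (F (x, y))%:E)%E.
    apply/integrableP; split; first exact: measurable_funTS.
    rewrite (eq_integral (fun x => \int[mu]_y (F (x, y))%:E)%E); last first.
      by move=> x _; rewrite gee0_abs// integral_ge0// => y _; rewrite lee_fin.
    have := cint_local_L1 beta0 (le_trans A1 AA) C10 (singular_kernel_widen AA kernel_singular1) L0 bL d0 ha.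
    by move=> /le_lt_trans; apply; rewrite ltry.
  have := integrable_ae (measurable_eball _ _) iI; apply: filterS => x h /h.
  by rewrite ge0_fin_numE// integral_ge0// => y _; rewrite lee_fin.
have := ae_foralln onball; apply: filterS => x h.
have [i hi] : exists i : nat, enorm (x - x0) / d <= i%:R.
  by exists (Num.truncn (enorm (x - x0) / d)).+1; rewrite ltW// truncnS_gt.
apply: (h i); rewrite /eball/= mulrDl.
apply: (@le_trans _ _ (i%:R * d)); first by rewrite -ler_pdivrMr.
by rewrite lerDr mulr_ge0 ?(ltW d0)// (le_trans ler01 A1).
Qed.

Lemma cint_tkernel_cvg x :
  (\int[mu]_y (`|kernel Om (x - y)| * (`|b x - b y| * `|a y|))%:E < +oo)%E ->
  (fun m => cint b (tkernel m) a x) @ \oo --> cint b (kernel Om) a x.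
Proof.
move=> fin.
have mb : measurable_fun setT b := holder_measurable beta0 bL.
have mk1 := singular_kernel_measurable kernel_singular1.
have mk m := singular_kernel_measurable (tkernel_singular m).
have ma := bump_measurable ha.
have mn := @normr_measurable R setT.
have msub : measurable_fun setT (fun y : 'rV[R]_n => x - y) by exact: measurable_funB_rV.
apply: (@Rintegral_dominated _ _ _ mu _ _ (fun y => `|kernel Om (x - y)| * (`|b x - b y| * `|a y|))).
- move=> m; apply: measurable_funM; last exact: ma.
  by apply: measurable_funM; [exact: (measurableT_comp (mk m) msub)|exact: measurable_funB].
- move=> y; apply: cvgMl; apply: cvgMl; exact: tkernel_cvg.
- apply: integrable_norm_lty.
    apply: measurable_funM; first exact: (measurableT_comp mn (measurableT_comp mk1 msub)).
    apply: measurable_funM; last exact: (measurableT_comp mn).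
    by apply: (measurableT_comp mn); exact: measurable_funB.
  by under eq_integral do rewrite ger0_norm ?mulr_ge0//.
- by move=> m y; rewrite normrM [X in X * _]normrM mulrA; do 2 apply: ler_wpM2r => //; exact: tkernel_le.
Qed.

End truncated_kernel.

(** * Test functions and approximation of Lipschitz functions *)

Section smooth_step.
Context (R : realType).
Implicit Types (f g : R -> R) (k : nat).

(** Differentiability k times, by exhibiting one derivative after the other. In this form closure
    under products and inverses is an induction on k. *)
Fixpoint Ck k f : Prop :=
  if k is k'.+1 then exists g, (forall x : R, is_derive x 1 f (g x)) /\ Ck k' g else True.

Lemma CkW k f : Ck k.+1 f -> Ck k f.
Proof. by elim: k f => // k IH f [g [fg cg]]; exists g; split=> //; exact: IH. Qed.

Lemma Ck_cst k (c : R) : Ck k (fun=> c).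
Proof.
elim: k c => // k IH c; exists (fun=> 0); split => // x.
exact: is_derive_cst.
Qed.

Lemma CkD k f g : Ck k f -> Ck k g -> Ck k (fun x => f x + g x).
Proof.
elim: k f g => // k IH f g [f' [ff' cf]] [g' [gg' cg]].
exists (fun x => f' x + g' x); split; last exact: IH.
by move=> x; exact: is_deriveD.
Qed.

Lemma CkM k f g : Ck k f -> Ck k g -> Ck k (fun x => f x * g x).
Proof.
elim: k f g => // k IH f g cf cg.
have [cf1 cg1] := (CkW cf, CkW cg).
case: cf => f' [ff' cf]; case: cg => g' [gg' cg].
exists (fun x => f x * g' x + g x * f' x); split; last by apply: CkD; exact: IH.
by move=> x; exact: is_deriveM.
Qed.

Lemma CkV k f : (forall x, f x != 0) -> Ck k f -> Ck k (fun x => (f x)^-1).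
Proof.
move=> f0; elim: k => // k IH cf; have cfV := IH (CkW cf).
case: cf => f' [ff' cf]; exists (fun x => - ((f x)^-1 * (f x)^-1 * f' x)); split.
  move=> x; have := @is_deriveV _ f x (f' x) 1 (f0 x) (ff' x).
  by rewrite /GRing.scale/= mulNr expr2 invfM.
rewrite (_ : (fun _ => _) = (fun x => -1 * ((f x)^-1 * (f x)^-1 * f' x))).
  by apply: CkM; [exact: Ck_cst|apply: CkM => //; exact: CkM].
by apply/funext => x; rewrite mulN1r.
Qed.

Lemma Ck_affine k f (c e : R) : Ck k f -> Ck k (fun x => f (c * x + e)).
Proof.
elim: k f => // k IH f [f' [ff' cf]].
exists (fun x => f' (c * x + e) * c); split; last by apply: CkM; [exact: IH|exact: Ck_cst].
move=> x; apply: (@is_derive1_comp _ f (fun x => c * x + e)).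
have : is_derive x 1 (fun x => c * x + e) (c *: 1 + 0).
  by apply: is_deriveD; have := @is_deriveZ _ _ _ (@id R) c x 1 1 (is_derive_id _ _).
by rewrite addr0 /GRing.scale/= mulr1.
Qed.

Definition smooth1 f := forall k, Ck k f.

Lemma smooth1_derivable f x : smooth1 f -> derivable f x 1.
Proof. by move=> /(_ 1%N)[g [fg _]]; exact: (ex_derive (is_derive := fg x)). Qed.

Lemma smooth1_derive f : smooth1 f -> smooth1 (fun x => 'D_1 f x).
Proof.
move=> sf k; have [g [fg cg]] := sf k.+1.
by rewrite (_ : (fun _ => _) = g)//; apply/funext => x; exact: (derive_val (is_derive := fg x)).
Qed.

(** The derivatives of members of this family are linear combinations of members, which carries the
    induction for smoothness. *)
Definition bump_exp k (t : R) : R := if t <= 0 then 0 else t^-1 ^+ k * expR (- t^-1).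

Lemma bump_exp_ge0 k t : 0 <= bump_exp k t.
Proof.
rewrite /bump_exp; case: ifPn => //; rewrite -ltNge => t0.
by rewrite mulr_ge0 ?expR_ge0// exprn_ge0// invr_ge0 ltW.
Qed.

(** exp (1/t) is at least its Taylor term of order k + 1. The bound yields the derivative 0 at the
    origin. *)
Lemma bump_exp_le k t : bump_exp k t <= k.+1`!%:R * `|t| .
Proof.
rewrite /bump_exp; case: ifPn => [_|]; first by rewrite mulr_ge0.
rewrite -ltNge => t0; rewrite gtr0_norm//.
have := @expR_ge1Dxn _ t^-1 k; rewrite invr_ge0 (ltW t0) => /(_ isT) h.
rewrite expRN ler_pdivrMr ?expR_gt0// mulrAC -ler_pdivrMr//.
have {}h : t^-1 ^+ k.+1 / k.+1`!%:R <= expR t^-1 by apply: le_trans h; rewrite lerDr.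
rewrite mulrC -ler_pdivrMl ?ltr0n ?fact_gt0// mulrC.
by apply: le_trans h; rewrite [X in _ <= X]mulrC exprSr.
Qed.

Lemma is_derive_bump_exp k (t : R) :
  is_derive t 1 (bump_exp k) (bump_exp k.+2 t - k%:R * bump_exp k.+1 t).
Proof.
have [t0|t0|->] := ltgtP t 0.
- rewrite {2 3}/bump_exp (ltW t0) mulr0 subr0.
  apply: (near_eq_is_derive _ (is_derive_cst (0 : R) t 1)).
  by near=> x; rewrite /bump_exp ifT// ltW//; near: x; exact: lt_nbhsl.
- rewrite {2 3}/bump_exp leNgt t0/=.
  have tn0 : t != 0 by rewrite gt_eqF.
  have iV : is_derive t 1 (fun x : R => x^-1) (- t^-1 ^+ 2).
    have := @is_deriveV _ id t 1 1 tn0 (is_derive_id _ _).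
    by rewrite /GRing.scale/= mulr1 exprVn.
  have iX : is_derive t 1 ((fun x : R => x^-1) ^+ k) ((k%:R * t^-1 ^+ k.-1) *: (- t^-1 ^+ 2)).
    exact: is_deriveX.
  have iN : is_derive t 1 (fun x : R => - x^-1) (t^-1 ^+ 2).
    by have := is_deriveN iV; rewrite opprK.
  have iE : is_derive t 1 (fun x : R => expR (- x^-1)) (expR (- t^-1) * t^-1 ^+ 2).
    exact: (@is_derive1_comp _ expR (fun x : R => - x^-1)).
  have := is_deriveM iX iE.
  have -> : (fun x : R => x^-1) ^+ k * (fun x : R => expR (- x^-1)) = (fun x => x^-1 ^+ k * expR (- x^-1)).
    by rewrite exprfctE.
  move=> h; have {}h : is_derive t 1 (fun x => x^-1 ^+ k * expR (- x^-1))
      (t^-1 ^+ k.+2 * expR (- t^-1) - k%:R * (t^-1 ^+ k.+1 * expR (- t^-1))).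
    apply: is_derive_eq h _.
    rewrite /GRing.scale/= exprfctE; case: k {iX} => [|k] /=; first by rewrite !expr0 expr2; ring.
    by rewrite !exprS; ring.
  apply: (near_eq_is_derive _ h).
  by near=> x; rewrite /bump_exp ifF// leNgt; apply/negbTE/negPn; near: x; exact: lt_nbhsr.
(* At 0 the difference quotient of one member is the next member, which is of order |h|. *)
rewrite {2 3}/bump_exp lexx mulr0 subr0.
have c : (fun h : R => h^-1 *: ((bump_exp k \o shift 0) (h *: 1) - bump_exp k 0)) @ 0^' --> (0 : R).
  apply: (@squeeze_cvgr _ _ _ _ (fun=> 0) (fun h => k.+2`!%:R * `|h|)).
  - near=> h; have h0 : h != 0 by near: h; exact: nbhs_dnbhs_neq.
    have -> : h^-1 *: ((bump_exp k \o shift 0) (h *: 1) - bump_exp k 0) = bump_exp k.+1 h.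
      rewrite /= addr0 {2}/bump_exp lexx subr0 /GRing.scale/= mulr1 /bump_exp.
      by case: ifP => _; rewrite ?mulr0// exprS mulrA.
    by rewrite bump_exp_ge0 bump_exp_le.
  - exact: cvg_cst.
  - rewrite -[X in _ --> X](mulr0 (k.+2`!%:R)) -[X in _ * X](normr0 R).
    apply: cvgM; first exact: cvg_cst.
    by apply: cvg_norm; apply: cvg_within_filter; exact: cvg_id.
by apply: DeriveDef; [apply/cvg_ex; exists 0|exact: cvg_lim].
Unshelve. all: by end_near. Qed.

Lemma bump_exp_smooth k : smooth1 (bump_exp k).
Proof.
move=> m; elim: m k => // m IH k.
exists (fun t => bump_exp k.+2 t + (- k%:R) * bump_exp k.+1 t); split.
  by move=> x; rewrite mulNr; exact: is_derive_bump_exp.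
by apply: CkD => //; apply: CkM => //; exact: Ck_cst.
Qed.

(** The denominator never vanishes, as t and 1 - t are not both nonpositive. *)
Definition step (t : R) : R := bump_exp 0 t / (bump_exp 0 t + bump_exp 0 (1 - t)).

Let e_gt0 t : 0 < t -> 0 < bump_exp 0 t.
Proof. by move=> t0; rewrite /bump_exp leNgt t0/= mul1r expR_gt0. Qed.

Let den_gt0 t : 0 < bump_exp 0 t + bump_exp 0 (1 - t).
Proof.
have [t0|t0] := ltP 0 t; first by rewrite ltr_pwDl ?e_gt0// bump_exp_ge0.
by rewrite ltr_wpDl ?bump_exp_ge0// e_gt0// subr_gt0 (le_lt_trans t0).
Qed.

Lemma step_ge0 t : 0 <= step t.
Proof. by rewrite divr_ge0 ?bump_exp_ge0// ltW. Qed.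

Lemma step_eq0 t : t <= 0 -> step t = 0.
Proof. by move=> t0; rewrite /step {1}/bump_exp t0 mul0r. Qed.

Lemma step_eq1 t : 1 <= t -> step t = 1.
Proof.
move=> t1; have e0 : bump_exp 0 (1 - t) = 0 by rewrite /bump_exp subr_le0 t1.
have := den_gt0 t; rewrite /step e0 addr0 => h.
by rewrite divff// gt_eqF.
Qed.

Lemma step_le1 t : step t <= 1.
Proof. by rewrite ler_pdivrMr// mul1r lerDl bump_exp_ge0. Qed.

Lemma step_smooth : smooth1 step.
Proof.
move=> k; have e := bump_exp_smooth 0 k.
apply: CkM => //; apply: CkV => [t|]; first by rewrite gt_eqF.
apply: CkD => //; rewrite (_ : (fun t => _) = (fun t => bump_exp 0 ((-1) * t + 1))).
  exact: Ck_affine.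
by apply/funext => t; rewrite mulN1r addrC.
Qed.

(** The derivative is continuous and so bounded on [0, 1]. Clipping both arguments to this interval
    keeps the values of [step] and does not increase the distance. *)
Lemma step_lipschitz : exists2 M, 0 <= M & forall s t, `|step s - step t| <= M * `|s - t|.
Proof.
have [g [fg cg]] := step_smooth 2.
have dg x : derivable g x 1 by case: cg => g' [gg' _]; exact: (ex_derive (is_derive := gg' x)).
have cng : {within `[0, 1], continuous (fun x => `|g x|)}.
  apply: continuous_subspaceT => x; apply: (@continuous_comp _ _ _ g Num.norm); last exact: norm_continuous.
  exact/differentiable_continuous/derivable1_diffP.
have [c _ hc] := EVT_max ler01 cng.
exists `|g c|; first exact: normr_ge0.
have cst : continuous step.
  by move=> x; apply/differentiable_continuous/derivable1_diffP; exact: (ex_derive (is_derive := fg x)).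
have inside s t : 0 <= s -> s <= t -> t <= 1 -> `|step t - step s| <= `|g c| * (t - s).
  move=> s0 st t1; have [z] := MVT_segment st (fun x _ => fg x) (continuous_subspaceT cst).
  rewrite in_itv/= => /andP[sz zt] ->; rewrite normrM [X in _ * X]ger0_norm ?subr_ge0//.
  by rewrite ler_wpM2r ?subr_ge0// hc// in_itv/= (le_trans s0 sz) (le_trans zt).
pose cl t : R := Num.max 0 (Num.min t 1).
have clE t : step t = step (cl t).
  rewrite /cl; have [t0|t0] := leP t 0; first by rewrite max_l ?step_eq0// ge_min t0.
  rewrite max_r; last by rewrite le_min ltW//= ler01.
  by have [//|t1] := leP t 1; rewrite !step_eq1// ltW.
have cl0 t : 0 <= cl t by rewrite le_max lexx.
have cl1 t : cl t <= 1 by rewrite ge_max ler01 ge_min lexx orbT.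
have main s t : s <= t -> `|step t - step s| <= `|g c| * (t - s).
  move=> st; have clst : cl s <= cl t.
    by rewrite /cl ge_max !le_max lexx/= le_min !ge_min st lexx !orbT.
  rewrite [step t]clE [step s]clE; apply: (le_trans (inside _ _ (cl0 s) clst (cl1 t))).
  rewrite ler_wpM2l// /cl /Num.max /Num.min.
  by case: (ltP t 1) => h1; case: (ltP s 1) => h2; do ?[case: ltP => ?]; lra.
move=> s t; have [st|/ltW st] := leP s t.
  by rewrite distrC [`|s - t|]distrC [X in _ * X]ger0_norm ?subr_ge0//; exact: main.
by rewrite [X in _ * X]ger0_norm ?subr_ge0//; exact: main.
Qed.

End smooth_step.

Section test_functions.
Context (R : realType) (n : nat).
Implicit Types (h : 'I_n -> R -> R) (phi psi : 'rV[R]_n -> R).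

(** A partial derivative changes one factor only, so smoothness reduces to one variable. *)
Definition prodfun h : 'rV[R]_n -> R := fun x => \prod_i h i (x ord0 i).

Lemma differentiable_prodfun h x : (forall j, smooth1 (h j)) -> differentiable (prodfun h) x.
Proof.
move=> sh; rewrite /prodfun; elim: (index_enum _) => [|j s IH].
  rewrite (_ : (fun _ => _) = cst 1); first exact: differentiable_cst.
  by apply/funext => y; rewrite big_nil.
rewrite (_ : (fun _ => _) = (fun y : 'rV[R]_n => h j (y ord0 j)) * (fun y => \prod_(i <- s) h i (y ord0 i))).
  apply: differentiableM => //; apply: (@differentiable_comp _ _ _ _ (fun y : 'rV[R]_n => y ord0 j) (h j)).
    exact: differentiable_coord.
  by apply/derivable1_diffP; exact: smooth1_derivable.
by apply/funext => y; rewrite big_cons.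
Qed.

Lemma partial_prodfun i h : (forall j, smooth1 (h j)) ->
  partial i (prodfun h) = prodfun (fun j => if j == i then (fun t => 'D_1 (h j) t) else h j).
Proof.
move=> sh; apply/funext => x; rewrite /partial.
pose c := \prod_(j | j != i) h j (x ord0 j).
have dh : is_derive (x ord0 i) 1 (c \*: h i) (c *: 'D_1 (h i) (x ord0 i)).
  by apply: is_deriveZ; apply: derivableP; exact: smooth1_derivable.
transitivity ('D_1 (c \*: h i) (x ord0 i)).
  rewrite /derive; suff -> : (fun s : R => s^-1 *: ((prodfun h \o shift x) (s *: delta_mx ord0 i) - prodfun h x)) =
     (fun s => s^-1 *: (((c \*: h i) \o shift (x ord0 i)) (s *: 1) - (c \*: h i) (x ord0 i))) by [].
  apply/funext => s; congr (_ *: (_ - _)); last by rewrite /prodfun (bigD1 i)//= mulrC.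
  rewrite /= /prodfun (bigD1 i)//= mulrC /GRing.scale/=.
  congr (_ * _); last by congr (h i _); rewrite !mxE !eqxx.
  apply: eq_bigr => j ji; congr (h j _).
  by rewrite !mxE (negbTE ji) andbF mulr0 add0r.
rewrite (derive_val (is_derive := dh)) /GRing.scale/= mulrC /prodfun (bigD1 i)//= eqxx.
by congr (_ * _); apply: eq_bigr => j /negbTE ->.
Qed.

Lemma partials_prodfun g h : (forall j, smooth1 (h j)) ->
  exists2 h', (forall j, smooth1 (h' j)) & partials g (prodfun h) = prodfun h'.
Proof.
move=> sh; elim: g => [|i g [h' sh' E]]; first by exists h.
exists (fun j => if j == i then (fun t => 'D_1 (h' j) t) else h' j).
  by move=> j; case: ifP => // _; exact: smooth1_derive.
by rewrite -partial_prodfun// -E.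
Qed.

Lemma test_function_prodfun h (M : R) : (forall j, smooth1 (h j)) ->
  (forall j t, h j t != 0 -> `|t| <= M) -> test_function (prodfun h).
Proof.
move=> sh hM; split=> [g x|].
  by have [h' sh' ->] := partials_prodfun g sh; exact: differentiable_prodfun.
exists (\sum_(i < n) M) => x; rewrite /prodfun => /prodf_neq0 xh.
rewrite /eball/= subr0; apply: (le_trans (enorm_le_sum _)).
by apply: ler_sum => i _; apply: (hM i); exact: xh.
Qed.

Lemma partialsD g (c : R) phi psi : smooth phi -> smooth psi ->
  partials g (fun x => c * phi x + psi x) = (fun x => c * partials g phi x + partials g psi x).
Proof.
move=> sphi spsi; elim: g => [//|i g IH] /=; rewrite IH; apply/funext => x; rewrite /partial.
have d1 : is_derive x (delta_mx ord0 i) (partials g phi) ('D_(delta_mx ord0 i) (partials g phi) x).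
  by apply: derivableP; apply: diff_derivable; exact: sphi.
have d2 : is_derive x (delta_mx ord0 i) (partials g psi) ('D_(delta_mx ord0 i) (partials g psi) x).
  by apply: derivableP; apply: diff_derivable; exact: spsi.
have d3 := is_deriveD (is_deriveZ c d1) d2.
exact: (derive_val (is_derive := d3)).
Qed.

Lemma test_functionD (c : R) phi psi : test_function phi -> test_function psi ->
  test_function (fun x => c * phi x + psi x).
Proof.
move=> [sphi [K1 k1]] [spsi [K2 k2]]; split.
  move=> g x; rewrite partialsD//.
  by apply: differentiableD; [exact: (@differentiableZ _ _ _ (partials g phi) c x (sphi g x))|exact: spsi].
exists (Num.max K1 K2) => x; rewrite /eball/=.
have [p0|/k1] := eqVneq (phi x) 0; last by rewrite /eball/= le_max => ->.
by rewrite p0 mulr0 add0r => /k2; rewrite /eball/= le_max => ->; rewrite orbT.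
Qed.

Lemma test_function_sum (I : Type) (s : seq I) (c : I -> R) (phi : I -> 'rV[R]_n -> R) :
  (forall i, test_function (phi i)) -> test_function (fun x => \sum_(i <- s) c i * phi i x).
Proof.
move=> tphi; elim: s => [|i s IH].
  rewrite (_ : (fun _ => _) = (fun=> 0)); last by apply/funext => x; rewrite big_nil.
  split; last by exists 0 => x; rewrite eqxx.
  move=> g x; rewrite (_ : partials g _ = cst 0); first exact: differentiable_cst.
  elim: g => [//|i g /= ->]; apply/funext => y; exact: derive_cst.
rewrite (_ : (fun _ => _) = (fun x => c i * phi i x + \sum_(i <- s) c i * phi i x)).
  exact: test_functionD.
by apply/funext => x; rewrite big_cons.
Qed.

End test_functions.

Lemma prod_diff_le (R : realType) (I : Type) (s : seq I) (a c : I -> R) :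
  (forall i, 0 <= a i <= 1) -> (forall i, 0 <= c i <= 1) ->
  `|\prod_(i <- s) a i - \prod_(i <- s) c i| <= \sum_(i <- s) `|a i - c i|.
Proof.
move=> a01 c01; elim: s => [|i s IH]; first by rewrite !big_nil subrr normr0.
rewrite !big_cons.
rewrite (_ : _ - _ = (a i - c i) * \prod_(j <- s) a j + c i * (\prod_(j <- s) a j - \prod_(j <- s) c j)); last by ring.
have /andP[p0 p1] : 0 <= \prod_(j <- s) a j <= 1.
  apply: (big_ind (fun x : R => 0 <= x <= 1)) => //; first by rewrite ler01 lexx.
  by move=> x y /andP[x0 x1] /andP[y0 y1]; rewrite mulr_ge0//= mulr_ile1.
have /andP[c0 c1] := c01 i.
apply: (le_trans (ler_normD _ _)); apply: lerD; rewrite normrM.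
  by rewrite (ger0_norm p0) ler_piMr.
by rewrite (ger0_norm c0); apply: le_trans IH; rewrite ler_piMl.
Qed.

(** * A smooth partition of unity on a grid of mesh 1 / (N + 1) *)

Section grid.
Context (R : realType) (n : nat).
Variables (q N : nat).

Let nu : R := N.+1%:R.
Let M := (N.+1 * q.+1)%N.
Let K := (2 * M).+1.
Let nu0 : 0 < nu. Proof. by rewrite /nu. Qed.

(** A difference of consecutive steps, so that the sum over k telescopes. It lives within one mesh
    width of the node (k - M) / nu. *)
Definition hat (k : nat) (t : R) : R :=
  step (nu * t + M%:R - k%:R + 1) - step (nu * t + M%:R - k%:R).

Lemma hat_ge0 k t : 0 <= hat k t.
Proof.
rewrite /hat; have [u0|u0] := leP (nu * t + M%:R - k%:R) 0.
  by rewrite (step_eq0 u0) subr0 step_ge0.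
by rewrite (@step_eq1 _ (_ + 1)) ?lerDr ?(ltW u0)// subr_ge0 step_le1.
Qed.

Lemma hat_le1 k t : hat k t <= 1.
Proof. by rewrite /hat lerBlDr (le_trans (step_le1 _))// lerDl step_ge0. Qed.

Lemma hat_neq0 k t : hat k t != 0 -> `|nu * t + M%:R - k%:R| < 1.
Proof.
apply: contra_neqT; rewrite -leNgt /hat ler_normr => /orP[u1|u1].
  by rewrite !step_eq1 ?subrr// (le_trans u1)// lerDl.
by rewrite !step_eq0 ?subrr//; lra.
Qed.

Lemma hat_smooth k : smooth1 (hat k).
Proof.
move=> m; rewrite (_ : hat k = fun t => step (nu * t + (M%:R - k%:R + 1)) + (-1) * step (nu * t + (M%:R - k%:R))).
  apply: CkD; first by apply: Ck_affine; exact: step_smooth.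
  by apply: CkM; [exact: Ck_cst|apply: Ck_affine; exact: step_smooth].
by apply/funext => t; rewrite /hat mulN1r !addrA.
Qed.

Lemma sum_hat t : \sum_(k < K) hat k t = step (nu * t + M%:R + 1) - step (nu * t - M%:R).
Proof.
rewrite -(big_mkord xpredT (hat ^~ t)) -[RHS]opprB.
pose G (k : nat) : R := step (nu * t + M%:R - k%:R + 1).
rewrite (eq_bigr (fun k => - (G k.+1 - G k))); last first.
  move=> k _; rewrite opprB /hat /G; congr (_ - step _).
  by rewrite -natr1; ring.
rewrite sumrN telescope_sumr//; congr (- (step _ - step _)); last by rewrite subr0.
by rewrite /K -natr1 natrM; ring.
Qed.

Definition gridf (f : {ffun 'I_n -> 'I_K}) : 'rV[R]_n -> R := prodfun (fun i => hat (f i)).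

Definition gridp (f : {ffun 'I_n -> 'I_K}) : 'rV[R]_n := \row_i (((f i)%:R - M%:R) / nu).

Lemma gridf_test f : test_function (gridf f).
Proof.
apply: (@test_function_prodfun _ _ _ ((K + M).+1%:R / nu)) => [j|j t]; first exact: hat_smooth.
move=> /hat_neq0; rewrite ltr_norml => /andP[h1 h2].
have fj : (f j)%:R <= K%:R :> R by rewrite ler_nat ltnW.
have fj0 : 0 <= (f j)%:R :> R by [].
have K0 : 0 <= K%:R :> R by [].
have M0 : 0 <= M%:R :> R by [].
rewrite ler_pdivlMr// mulrC -(gtr0_norm nu0) -normrM.
by rewrite -natr1 natrD ler_norml; apply/andP; split; lra.
Qed.

Lemma gridf_ge0 f x : 0 <= gridf f x.
Proof. by apply: prodr_ge0 => i _; exact: hat_ge0. Qed.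

Lemma gridf_near f x i : gridf f x != 0 -> `|nu * x ord0 i + M%:R - (f i)%:R| < 1.
Proof. by move=> /prodf_neq0 h; apply: hat_neq0; exact: h. Qed.

Lemma sum_gridf x : \sum_f gridf f x =
  \prod_i (step (nu * x ord0 i + M%:R + 1) - step (nu * x ord0 i - M%:R)).
Proof. by under [RHS]eq_bigr do rewrite -sum_hat; rewrite bigA_distr_bigA. Qed.

Lemma sum_gridf_le1 x : 0 <= \sum_f gridf f x <= 1.
Proof.
rewrite sumr_ge0 => [|f _]; last exact: gridf_ge0.
rewrite sum_gridf; apply: prodr_ile1 => i _.
rewrite -sum_hat sumr_ge0 => [|k _]; last exact: hat_ge0.
by rewrite sum_hat lerBlDr (le_trans (step_le1 _))// lerDl step_ge0.
Qed.

Lemma sum_gridf_eq1 (x : 'rV[R]_n) : (forall i, `|x ord0 i| <= q.+1%:R) -> \sum_f gridf f x = 1.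
Proof.
move=> xq; rewrite sum_gridf big1// => i _.
have : `|nu * x ord0 i| <= M%:R by rewrite normrM (gtr0_norm nu0) natrM ler_pM2l.
rewrite ler_norml => /andP[h1 h2].
by rewrite step_eq1 ?step_eq0 ?subr0//; lra.
Qed.

Lemma gridp_dist (f : {ffun 'I_n -> 'I_K}) (x : 'rV[R]_n) (c : R) : 0 <= c -> (forall i, `|nu * x ord0 i + M%:R - (f i)%:R| <= c) ->
  enorm (gridp f - x) <= n%:R * c / nu.
Proof.
move=> c0 h; apply: (le_trans (enorm_le_sum _)).
apply: (@le_trans _ _ (\sum_(i < n) c / nu)); last by rewrite sumr_const card_ord -mulrA mulr_natl.
apply: ler_sum => i _; rewrite rowB_coord mxE.
rewrite (_ : _ - x ord0 i = - ((nu * x ord0 i + M%:R - (f i)%:R) / nu)); last by field; rewrite gt_eqF.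
by rewrite normrN normrM normfV (gtr0_norm nu0) ler_pM2r ?invr_gt0.
Qed.

(** The integers in question are among the five consecutive ones that start at the truncation of u -
    2. *)
Lemma count_near (u : R) : \sum_(k < K) (`|u - k%:R| < 2)%R%:R <= 5 :> R.
Proof.
pose m := Num.truncn (u - 2).
have h (k : nat) : `|u - k%:R| < 2 -> (m <= k < m + 5)%N.
  rewrite ltr_norml => /andP[h1 h2]; apply/andP; split.
    rewrite -(ler_nat R); have [u2|u2] := leP 0 (u - 2); last first.
      have -> : m = 0%N by apply/truncn0Pn; rewrite -ltNge; lra.
      by [].
    have : m%:R <= u - 2 by rewrite truncn_le.
    lra.
  rewrite -(ltr_nat R) natrD; have := truncnS_gt (u - 2); rewrite -/m -natr1; lra.
apply: (@le_trans _ _ (\sum_(k < K) (m <= k < m + 5)%N)%:R).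
  rewrite natr_sum; apply: ler_sum => k _; rewrite ler_nat.
  by case: (boolP (`|u - k%:R| < 2)) => // /h ->.
rewrite (ler_nat R _ 5) -(big_mkord xpredT (fun k => nat_of_bool (m <= k < m + 5)%N)).
suff E k : (\sum_(0 <= j < k) (m <= j < m + 5) = minn k (m + 5) - m)%N.
  by rewrite E leq_subLR geq_minr.
elim: k => [|k IH]; first by rewrite big_geq// min0n sub0n.
by rewrite big_nat_recr//= IH /minn; do ?[case: ltnP => ?]; lia.
Qed.

(** The indicator of nodes less than two mesh widths from x in each coordinate. It covers every node
    active at x or at a point y with nu |x - y| <= 1. *)
Definition nearf (f : {ffun 'I_n -> 'I_K}) (x : 'rV[R]_n) : R :=
  \prod_i (`|nu * x ord0 i + M%:R - (f i)%:R| < 2)%R%:R.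

Lemma sum_nearf x : \sum_f nearf f x <= 5 ^+ n.
Proof.
rewrite /nearf -(bigA_distr_bigA (fun i (k : 'I_K) => (`|nu * x ord0 i + M%:R - k%:R| < 2)%R%:R)).
apply: (@le_trans _ _ (\prod_(i < n) 5)); last by rewrite prodr_const card_ord.
apply: ler_prod => i _; rewrite count_near andbT sumr_ge0//.
Qed.

Section hat_lipschitz.
Variable Lam : R.
Hypotheses (Lam0 : 0 <= Lam) (stepL : forall s t : R, `|step s - step t| <= Lam * `|s - t|).

Lemma hat_lipschitz k s t : `|hat k s - hat k t| <= 2 * Lam * nu * `|s - t|.
Proof.
rewrite /hat (_ : _ - _ - _ = (step (nu * s + M%:R - k%:R + 1) - step (nu * t + M%:R - k%:R + 1)) -
  (step (nu * s + M%:R - k%:R) - step (nu * t + M%:R - k%:R))); last by ring.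
apply: (le_trans (ler_normB _ _)).
have e : 2 * Lam * nu * `|s - t| = Lam * `|nu * s - nu * t| + Lam * `|nu * s - nu * t|.
  by rewrite -mulrBr normrM (gtr0_norm nu0); ring.
rewrite e; apply: lerD; apply: (le_trans (stepL _ _)); apply: ler_of_eq; congr (_ * `|_|); ring.
Qed.

(** Unless the node is near x, both values vanish. Otherwise the difference of two products of
    factors in [0, 1] is at most the sum of the n differences. *)
Lemma gridf_diff (f : {ffun 'I_n -> 'I_K}) (x y : 'rV[R]_n) : nu * enorm (x - y) <= 1 ->
  `|gridf f x - gridf f y| <= n%:R * (2 * Lam * (nu * enorm (x - y))) * nearf f x.
Proof.
move=> xy.
have c i : `|nu * (x ord0 i - y ord0 i)| <= 1.
  rewrite normrM (gtr0_norm nu0); apply: le_trans xy; rewrite ler_pM2l//.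
  by rewrite -rowB_coord ler_coord_enorm.
have [h|/forallPn[i hi]] := boolP [forall i, `|nu * x ord0 i + M%:R - (f i)%:R| < 2].
  have -> : nearf f x = 1 by rewrite /nearf big1// => i _; move/forallP: h => /(_ i) ->.
  rewrite mulr1; apply: (le_trans (prod_diff_le _ _ _)) => [i|i|]; rewrite ?hat_ge0 ?hat_le1//.
  apply: (@le_trans _ _ (\sum_(i < n) (2 * Lam * (nu * enorm (x - y))))); last by rewrite sumr_const card_ord [leRHS]mulr_natl.
  apply: ler_sum => i _; apply: (le_trans (hat_lipschitz _ _ _)).
  by rewrite -!mulrA !ler_wpM2l ?(ltW nu0)// -rowB_coord ler_coord_enorm.
have hx : gridf f x = 0.
  apply/eqP/negPn/negP => /(@gridf_near f x i) h; move: hi; rewrite -leNgt => hi; lra.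
have hy : gridf f y = 0.
  apply/eqP/negPn/negP => /(@gridf_near f y i); rewrite ltr_norml => /andP[h1 h2].
  move: (c i) hi; rewrite -leNgt mulrBr ler_norml => /andP[h3 h4]; rewrite ler_normr => /orP[]; lra.
by rewrite hx hy subrr normr0 !mulr_ge0 ?enorm_ge0 ?(ltW nu0)// prodr_ge0.
Qed.

End hat_lipschitz.

End grid.

Arguments gridf {R n} q N f x.
Arguments gridp {R n} q N f.
Arguments nearf {R n} q N f x.

Section holder_approximation.
Context (R : realType) (n : nat) (beta Kp rho : R) (phi : 'rV[R]_n -> R).
Hypotheses (beta0 : 0 < beta) (beta1 : beta < 1) (Kp0 : 0 <= Kp) (hphi : holder Kp beta phi).
Hypothesis sphi : forall x, phi x != 0 -> enorm x <= rho.

(** psi combines the values of phi at the nodes. Active nodes are within n / nu of x, which gives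
    uniform closeness. In the Hoelder bound, increments with nu |x - y| >= 1 are settled by this
    closeness; shorter ones use the Lipschitz bound of the partition after phi x is subtracted, and
    nu |x - y| <= (nu |x - y|)^beta makes the constant independent of N. *)
Lemma holder_approx : exists2 C, 0 <= C & forall N : nat, exists psi : 'rV[R]_n -> R,
  [/\ test_function psi, forall x, `|psi x - phi x| <= C * (N.+1%:R `^ beta)^-1 & holder C beta psi].
Proof.
have [Lam Lam0 stepL] := step_lipschitz R.
(* phi vanishes beyond q, while the partition sums to 1 up to q + 1 in each coordinate; the margin
   serves points y with |x - y| < 1. *)
pose q := (Num.truncn rho).+1.
have rq : rho <= q%:R by rewrite ltW// truncnS_gt.
pose C1 := Kp * n%:R `^ beta.
pose C2 := n%:R * (2 * Lam) * 5 ^+ n * (Kp * (2 * n%:R) `^ beta).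
have C10 : 0 <= C1 by rewrite mulr_ge0// powR_ge0.
have C20 : 0 <= C2 by rewrite !mulr_ge0 ?exprn_ge0 ?powR_ge0.
exists (2 * C1 + Kp + C2); first by rewrite !addr_ge0// mulr_ge0.
move=> N; set nu : R := N.+1%:R.
have nu0 : 0 < nu by rewrite /nu.
pose W f (x : 'rV[R]_n) : R := @gridf R n q N f x; pose p f := @gridp R n q N f.
pose psi x := \sum_f phi (p f) * W f x.
have out (x : 'rV[R]_n) i : q%:R < `|x ord0 i| -> phi x = 0.
  move=> xi; apply/eqP/negPn/negP => /sphi xr.
  by have := le_lt_trans (le_trans (ler_coord_enorm x i) (le_trans xr rq)) xi; rewrite ltxx.
have W0 f x : 0 <= W f x by exact: gridf_ge0.
(* Where the partition may fail to sum to 1, phi x is 0, so the identity holds everywhere. *)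
have sub x : psi x - phi x = \sum_f W f x * (phi (p f) - phi x).
  have -> : \sum_f W f x * (phi (p f) - phi x) = psi x - (\sum_f W f x) * phi x.
    by rewrite /psi mulr_suml -sumrB; apply: eq_bigr => f _; ring.
  have [h|/forallPn[i hi]] := boolP [forall i, `|x ord0 i| <= q.+1%:R].
    by rewrite sum_gridf_eq1 ?mul1r//; exact/forallP.
  rewrite (@out x i) ?mulr0//; move: hi; rewrite -ltNge; apply: lt_trans.
  by rewrite ltr_nat.
have close x : `|psi x - phi x| <= C1 * (nu `^ beta)^-1.
  rewrite sub; apply: (le_trans (ler_norm_sum _ _ _)).
  apply: (@le_trans _ _ (\sum_f W f x * (C1 * (nu `^ beta)^-1))).
    apply: ler_sum => f _; rewrite normrM (ger0_norm (W0 _ _)).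
    have [->|Wf] := eqVneq (W f x) 0; first by rewrite !mul0r.
    rewrite ler_wpM2l//; apply: (le_trans (hphi _ _)).
    rewrite /C1 -mulrA ler_wpM2l//.
    apply: (@le_trans _ _ ((n%:R / nu) `^ beta)).
      apply: ge0_ler_powR; rewrite ?nnegrE ?(ltW beta0) ?enorm_ge0 ?divr_ge0 ?(ltW nu0)//.
      have := @gridp_dist R n q N f x 1 ler01 (fun i => ltW (gridf_near i Wf)).
      by rewrite mulr1.
    by rewrite powRM ?invr_ge0 ?(ltW nu0)// -(powR_inv1 (ltW nu0)) powRAC powR_inv1 ?powR_ge0.
  have /andP[s0 s1] := sum_gridf_le1 q N x.
  by rewrite -mulr_suml ler_piMl// mulr_ge0// invr_ge0 powR_ge0.
have nb0 : 0 < nu `^ beta by rewrite powR_gt0.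
exists psi; split.
- by apply: test_function_sum => f; exact: gridf_test.
- move=> x; apply: (le_trans (close x)); apply: ler_wpM2r; rewrite ?invr_ge0 ?(ltW nb0)//.
  by rewrite mulr_natl mulr2n -!addrA lerDl !addr_ge0.
move=> x y; set dl := enorm (x - y); have dl0 : 0 <= dl by exact: enorm_ge0.
have [far|near] := leP 1 (nu * dl).
  have db : (nu `^ beta)^-1 <= dl `^ beta.
    rewrite -[leLHS]mul1r ler_pdivrMr// -powRM ?(ltW nu0)// [dl * nu]mulrC.
    rewrite (_ : 1 = 1 `^ beta :> R); last by rewrite powR1.
    by apply: ge0_ler_powR; rewrite ?nnegrE ?(ltW beta0)// mulr_ge0// ltW.
  rewrite (_ : psi x - psi y = (psi x - phi x) + (phi x - phi y) - (psi y - phi y)); last by ring.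
  apply: (le_trans (ler_normB _ _)).
  apply: (@le_trans _ _ (C1 * dl `^ beta + Kp * dl `^ beta + C1 * dl `^ beta)).
    apply: lerD; last by apply: (le_trans (close y)); rewrite ler_wpM2l.
    apply: (le_trans (ler_normD _ _)); apply: lerD; last exact: hphi.
    by apply: (le_trans (close x)); rewrite ler_wpM2l.
  rewrite -!mulrDl; apply: ler_wpM2r; first exact: powR_ge0.
  by rewrite mulr_natl mulr2n [C1 + Kp + C1]addrAC lerDl.
have diff : psi x - psi y = \sum_f (W f x - W f y) * (phi (p f) - phi x).
  have -> : \sum_f (W f x - W f y) * (phi (p f) - phi x) =
      psi x - psi y - (\sum_f W f x - \sum_f W f y) * phi x.
    by rewrite /psi mulrBl !mulr_suml -!sumrB; apply: eq_bigr => f _; ring.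
  have [->|px] := eqVneq (phi x) 0; first by rewrite mulr0 subr0.
  have xr i : `|x ord0 i| <= q%:R.
    by rewrite leNgt; apply/negP => /out h; rewrite h eqxx in px.
  have yr i : `|y ord0 i| <= q.+1%:R.
    rewrite -natr1; have -> : y ord0 i = x ord0 i - (x ord0 i - y ord0 i) by ring.
    apply: (le_trans (ler_normB _ _)); apply: lerD => //.
    rewrite -rowB_coord; apply: (le_trans (ler_coord_enorm _ _)).
    apply: le_trans (ltW near); rewrite ler_peMl// ler1n//.
  rewrite !sum_gridf_eq1 ?subrr ?mul0r ?subr0// => i.
  by apply: (le_trans (xr i)); rewrite ler_nat.
rewrite diff; apply: (le_trans (ler_norm_sum _ _ _)).
apply: (@le_trans _ _ (\sum_f nearf q N f x * (n%:R * (2 * Lam * (nu * dl)) * (Kp * ((2 * n%:R) / nu) `^ beta)))).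
  apply: ler_sum => f _; rewrite normrM.
  apply: (@le_trans _ _ (n%:R * (2 * Lam * (nu * dl)) * nearf q N f x * `|phi (p f) - phi x|)).
    by rewrite ler_wpM2r//; apply: gridf_diff => //; exact: ltW.
  have [->|nf] := eqVneq (nearf q N f x) 0; first by rewrite mulr0 !mul0r.
  rewrite [X in X * _]mulrC -[leLHS]mulrA; apply: ler_wpM2l; first exact: prodr_ge0.
  apply: ler_wpM2l; first by rewrite !mulr_ge0// ltW.
  apply: (le_trans (hphi _ _)); rewrite ler_wpM2l//.
  apply: ge0_ler_powR; rewrite ?nnegrE ?(ltW beta0) ?enorm_ge0 ?divr_ge0 ?mulr_ge0 ?(ltW nu0)//.
  rewrite [2 * _]mulrC; apply: gridp_dist => // i.
  by move/prodf_neq0: nf => /(_ i isT); rewrite pnatr_eq0 eqb0 negbK => /ltW.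
rewrite -mulr_suml; apply: (@le_trans _ _ (5 ^+ n * (n%:R * (2 * Lam * (nu * dl)) * (Kp * (2 * n%:R / nu) `^ beta)))).
  by rewrite ler_wpM2r ?sum_nearf// !mulr_ge0 ?powR_ge0 ?(ltW nu0).
apply: (@le_trans _ _ (C2 * dl `^ beta)); last first.
  by apply: ler_wpM2r; [exact: powR_ge0|rewrite lerDr addr_ge0// mulr_ge0].
have e : (2 * n%:R / nu) `^ beta = (2 * n%:R) `^ beta * (nu `^ beta)^-1.
  have inv : nu^-1 `^ beta = (nu `^ beta)^-1.
    by rewrite -(powR_inv1 (ltW nu0)) powRAC powR_inv1// powR_ge0.
  by rewrite -inv -powRM// ?mulr_ge0// invr_ge0 ltW.
rewrite e (_ : 5 ^+ n * _ = C2 * (nu * dl * (nu `^ beta)^-1)); last by rewrite /C2; ring.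
rewrite ler_wpM2l// ler_pdivrMr// mulrC -powRM ?(ltW nu0)//.
have [->|dn0] := eqVneq dl 0; first by rewrite mul0r powR_ge0.
by apply: ger1_powR; [rewrite [dl * nu]mulrC mulr_gt0 ?(ltW near)// lt_neqAle eq_sym dn0|exact: ltW].
Qed.

End holder_approximation.

(** * Duality *)

Section bump_pairing.
Context (R : realType) (n : nat).
Local Notation mu := (@lebesgue_rV R n).
Variables (beta L C d : R) (x0 : 'rV[R]_n) (b a : 'rV[R]_n -> R).
Hypotheses (beta0 : 0 < beta) (L0 : 0 <= L) (bL : holder L beta b) (d0 : 0 < d).
Hypothesis ha : bump beta C x0 d a.

Let mb : measurable_fun setT b. Proof. exact: holder_measurable bL. Qed.
Let ma := bump_measurable ha.

Lemma bump_integrable : mu.-integrable setT (EFin \o a).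
Proof.
apply: integrable_norm_lty; first exact: ma.
by apply: le_lt_trans (bump_integral ha) _; rewrite ltry.
Qed.

Let J y := a y * (b y - b x0).
Let mJ : measurable_fun setT J.
Proof. by apply: measurable_funM; [exact: ma|exact: measurable_funB]. Qed.

Let J_le : (\int[mu]_y `|J y|%:E <= (L * C)%:E)%E.
Proof.
have mn := @normr_measurable R setT.
have mna : measurable_fun setT (fun y => `|a y|) by exact: (measurableT_comp mn ma).
have mnJ : measurable_fun setT (fun y => `|J y|) by exact: (measurableT_comp mn mJ).
apply: (@le_trans _ _ ((L * d `^ beta)%:E * \int[mu]_y `|a y|%:E)%E).
  apply: integral_le_cst_mul => //.
    by rewrite mulr_ge0// powR_ge0.
  move=> y _; rewrite /J normrM mulrC.
  have [->|/(bump_support ha) yd] := eqVneq (a y) 0; first by rewrite normr0 !mulr0.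
  rewrite ler_wpM2r// (le_trans (bL _ _))// ler_wpM2l//.
  by apply: ge0_ler_powR => //; rewrite ?nnegrE ?(ltW beta0) ?(ltW d0) ?enorm_ge0.
have -> : L * C = (L * d `^ beta) * (C * d `^ (- beta)).
  rewrite (_ : _ * _ * _ = L * C * (d `^ beta * d `^ (- beta))); last by ring.
  by rewrite -powRD_gt0// subrr powRr0 mulr1.
rewrite [leRHS]EFinM; apply: lee_wpmul2l; last exact: bump_integral ha.
by rewrite lee_fin mulr_ge0// powR_ge0.
Qed.

Let iJ : mu.-integrable setT (EFin \o J).
Proof.
by apply: integrable_norm_lty; [exact: mJ|apply: le_lt_trans J_le _; rewrite ltry].
Qed.

Let iba : mu.-integrable setT (EFin \o (fun y => b x0 * a y)).
Proof. exact: (integrableZl measurableT (b x0) bump_integrable). Qed.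

Let abE : (fun y => a y * b y) = (fun y => J y + b x0 * a y).
Proof. by apply/funext => y; rewrite /J; ring. Qed.

Lemma bump_mul_integrable : mu.-integrable setT (EFin \o (fun y => a y * b y)).
Proof. rewrite abE; exact: (integrableD measurableT iJ iba). Qed.

(** The mean zero of a lets b x0 be subtracted from b, and the remainder is at most L d^beta on the
    ball. *)
Lemma bump_pairing_le : `|\int[mu]_y (a y * b y)| <= L * C.
Proof.
rewrite abE RintegralD// RintegralZl//; last exact: bump_integrable.
rewrite (bump_mean ha) mulr0 addr0 -lee_fin.
exact: (le_trans (normr_Rintegral_le _ mJ) J_le).
Qed.

End bump_pairing.

Section series_limits.
Context (R : realType).

(** One index J, beyond which the majorant sums to at most e/3, handles the tails of all the series
    at once. *)
Lemma asum_dominated (u : nat -> nat -> R) (v g : nat -> R) :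
  (forall j, (fun N => u N j) @ \oo --> v j) -> (forall N j, `|u N j| <= g j) ->
  (\sum_(0 <= j <oo) (g j)%:E < +oo)%E -> (fun N => asum (u N)) @ \oo --> asum v.
Proof.
move=> uv ug goo.
have g0 j : 0 <= g j by rewrite (le_trans _ (ug 0%N j)).
have g0E j : (0 <= (g j)%:E)%E by rewrite lee_fin.
have vg j : `|v j| <= g j.
  have cn : (fun N => `|u N j|) @ \oo --> `|v j| by apply: cvg_norm; exact: uv.
  rewrite -(cvg_lim _ cn)//; apply: limr_le; first by apply/cvg_ex; eexists; exact: cn.
  by apply: nearW => N; exact: ug.
apply/cvgrPdist_le => e e0; have e3 : 0 < e / 3 by rewrite divr_gt0.
have tcvg := nneseries_tail_cvg goo (fun k _ => g0E k).
have [J tJ] : exists J, (\sum_(J <= j <oo) (g j)%:E <= (e / 3)%:E)%E.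
  have /fine_cvgP[[A _ hA] /cvgrPdist_le/(_ _ e3)[B _ hB]] := tcvg.
  exists (maxn A B); rewrite -(fineK (hA _ _)) /= ?leq_maxl// lee_fin.
  by have := hB (maxn A B) (leq_maxr _ _); rewrite /= sub0r normrN; apply: le_trans; exact: ler_norm.
have tail w : (forall j, `|w j| <= g j) -> `|asum w - \sum_(0 <= j < J) w j| <= e / 3.
  move=> wg; rewrite -lee_fin; apply: (le_trans (asum_tail _ _)); apply: le_trans tJ.
  by apply: lee_nneseries => [j _ _|j _]; rewrite lee_fin.
have : (fun N => \sum_(0 <= j < J) u N j) @ \oo --> \sum_(0 <= j < J) v j.
  elim: J {tJ tail} => [|J IH].
    under eq_fun do rewrite big_geq//; rewrite big_geq//; exact: cvg_cst.
  under eq_fun do rewrite big_nat_recr//=; rewrite big_nat_recr//=; exact: cvgD.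
move=> /cvgrPdist_le/(_ _ e3); apply: filterS => N h.
rewrite (_ : asum v - asum (u N) = (asum v - \sum_(0 <= j < J) v j) +
  (\sum_(0 <= j < J) v j - \sum_(0 <= j < J) u N j) - (asum (u N) - \sum_(0 <= j < J) u N j)); last by ring.
have -> : e = e / 3 + e / 3 + e / 3 by field.
apply: (le_trans (ler_normB _ _)); apply: lerD; last exact: tail.
by apply: (le_trans (ler_normD _ _)); apply: lerD => //; exact: tail.
Qed.

(** The p-th powers are bounded by their sum, so |lam_j| = |lam_j|^(1 - p) |lam_j|^p is at most a
    constant times |lam_j|^p. *)
Lemma summable_powR (lam : nat -> R) (p : R) : 0 < p -> p < 1 ->
  (\sum_(0 <= j <oo) (`|lam j| `^ p)%:E < +oo)%E -> (\sum_(0 <= j <oo) `|lam j|%:E < +oo)%E.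
Proof.
move=> p0 p1 lamoo.
have l0 j : (0 <= (`|lam j| `^ p)%:E)%E by rewrite lee_fin powR_ge0.
have s0 : (0 <= \sum_(0 <= j <oo) (`|lam j| `^ p)%:E)%E by apply: nneseries_ge0.
have sfin : (\sum_(0 <= j <oo) (`|lam j| `^ p)%:E)%E \is a fin_num by rewrite ge0_fin_numE.
move: (fineK sfin) (fine_ge0 s0); set S := fine _ => SE S0.
have term j : `|lam j| `^ p <= S.
  by rewrite -lee_fin SE; exact: (@nneseries_ge_term _ (fun j => (`|lam j| `^ p)%:E)).
pose B := (S `^ p^-1) `^ (1 - p).
have lB j : `|lam j| <= B * `|lam j| `^ p.
  have [->|l1] := eqVneq (lam j) 0; first by rewrite normr0 powR0 ?gt_eqF// mulr0.
  have lj0 : 0 < `|lam j| by rewrite normr_gt0.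
  rewrite -{1}[`|lam j|]powRr1// (_ : 1 = (1 - p) + p); last by ring.
  rewrite powRD_gt0// ler_wpM2r ?powR_ge0//.
  apply: ge0_ler_powR; rewrite ?nnegrE ?powR_ge0 ?subr_ge0 ?(ltW p1)//.
  rewrite -[leLHS]powRr1// -(mulfV (lt0r_neq0 p0)) powRrM.
  by apply: ge0_ler_powR; rewrite ?nnegrE ?powR_ge0 ?invr_ge0 ?(ltW p0).
apply: (@le_lt_trans _ _ (\sum_(0 <= j <oo) (B%:E * (`|lam j| `^ p)%:E))%E).
  by apply: lee_nneseries => [j _ _|j _]; rewrite ?lee_fin// -EFinM lee_fin.
by rewrite nneseriesZl// -SE -EFinM ltry.
Qed.

End series_limits.

Section bump_series.
Context (R : realType) (n : nat).
Local Notation mu := (@lebesgue_rV R n).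
Variables (beta C p : R).
Hypotheses (beta0 : 0 < beta) (beta1 : beta < 1) (C0 : 0 <= C) (p0 : 0 < p) (p1 : p < 1).

Definition bump_series (lam : nat -> R) (a : nat -> 'rV[R]_n -> R) : Prop :=
  (forall j, exists x0 d, 0 < d /\ bump beta C x0 d (a j)) /\
  (\sum_(0 <= j <oo) (`|lam j| `^ p)%:E < +oo)%E.

(** At the test functions psi N, f is the sum of the pairings. Their common Hoelder constant gives
    these sums the majorant K' C |lam_j|, so the limit is taken term by term. *)
Lemma pairing_cvg (lam : nat -> R) (a : nat -> 'rV[R]_n -> R) (f : ('rV[R]_n -> R) -> R)
    (Kp K' : R) (phi : 'rV[R]_n -> R) (psi : nat -> 'rV[R]_n -> R) :
  bump_series lam a ->
  (forall phi, test_function phi ->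
     (fun N => \sum_(0 <= j < N) lam j * \int[mu]_x (a j x * phi x)) @ \oo --> f phi) ->
  0 <= Kp -> holder Kp beta phi -> 0 <= K' ->
  (forall N, [/\ test_function (psi N), forall x, `|psi N x - phi x| <= K' * (N.+1%:R `^ beta)^-1
     & holder K' beta (psi N)]) ->
  (fun N => f (psi N)) @ \oo --> asum (fun j => lam j * \int[mu]_x (a j x * phi x)).
Proof.
move=> [ha lamp] hf Kp0 hphi K'0 hpsi.
have lamoo := summable_powR p0 p1 lamp.
pose u N j := lam j * \int[mu]_x (a j x * psi N x).
have ule N j : `|u N j| <= K' * C * `|lam j|.
  have [x0 [d [d0 hj]]] := ha j; have [_ _ hp] := hpsi N.
  by rewrite /u normrM mulrC ler_wpM2r// (bump_pairing_le beta0 K'0 hp d0 hj).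
have goo : (\sum_(0 <= j <oo) (K' * C * `|lam j|)%:E < +oo)%E.
  under eq_eseriesr do rewrite EFinM.
  rewrite nneseriesZl; last by move=> j _; rewrite lee_fin.
  by rewrite lte_mul_pinfty// lee_fin mulr_ge0.
have fE N : f (psi N) = asum (u N).
  have [tp _ _] := hpsi N; apply: (cvg_unique _ (hf _ tp)) => //.
  apply: asum_cvg; apply: le_lt_trans goo.
  by apply: lee_nneseries => [j _ _|j _]; rewrite lee_fin//; exact: (ule N j).
under eq_fun do rewrite fE.
apply: (asum_dominated _ ule goo) => j.
have [x0 [d [d0 hj]]] := ha j.
suff c : (fun N => \int[mu]_x (a j x * psi N x)) @ \oo --> \int[mu]_x (a j x * phi x).
  have cl : (fun _ : nat => lam j) @ \oo --> lam j by exact: cvg_cst.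
  exact: cvgM cl c.
have dl : (fun N => K' * (N.+1%:R `^ beta)^-1 : R) @ \oo --> (0 : R).
  have c0 : (fun N => (N.+1%:R^-1) `^ beta : R) @ \oo --> (0 : R).
    apply/cvgrPdist_lt => e e0; have eb : 0 < e `^ beta^-1 by rewrite powR_gt0.
    have : (fun N => N.+1%:R^-1 : R) @ \oo --> (0 : R) by exact: cvg_harmonic.
    move=> /cvgrPdist_lt/(_ _ eb); apply: filterS => N.
    rewrite !sub0r !normrN [X in X < _]ger0_norm ?invr_ge0// [X in _ -> X < _]ger0_norm ?powR_ge0// => h.
    have -> : e = (e `^ beta^-1) `^ beta by rewrite -powRrM mulVf ?gt_eqF// powRr1// ltW.
    by apply: gt0_ltr_powR; rewrite ?nnegrE ?invr_ge0 ?powR_ge0.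
  rewrite -(mulr0 K'); have ck : (fun _ : nat => K') @ \oo --> K' by exact: cvg_cst.
  rewrite (_ : (fun N : nat => K' * (N.+1%:R `^ beta)^-1) = (fun N : nat => K' * N.+1%:R^-1 `^ beta)).
    exact: cvgM ck c0.
  apply/funext => N; congr (_ * _); have N0 : 0 <= N.+1%:R :> R by [].
  by rewrite -(powR_inv1 N0) powRAC powR_inv1// powR_ge0.
have mphi : measurable_fun setT phi := holder_measurable beta0 hphi.
have maj := bump_measurable hj.
have iaj := bump_integrable hj.
apply: (@Rintegral_dominated _ _ _ mu _ _ (fun x => `|a j x * phi x| + K' * `|a j x|)).
- move=> N; have [_ _ hp] := hpsi N; apply: measurable_funM; first exact: maj.
  exact: holder_measurable hp.
- move=> x; suff h : (fun N => psi N x) @ \oo --> phi x.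
    have cl : (fun _ : nat => a j x) @ \oo --> a j x by exact: cvg_cst.
    exact: cvgM cl h.
  apply/cvgrPdist_le => e e0; move/cvgrPdist_le: dl => /(_ _ e0); apply: filterS => N.
  rewrite sub0r normrN => h; rewrite distrC; have [_ hc _] := hpsi N.
  by apply: (le_trans (hc x)); apply: le_trans h; exact: ler_norm.
- have i1 := integrable_abse (bump_mul_integrable beta0 Kp0 hphi d0 hj).
  have i2 := integrableZl measurableT K' (integrable_abse iaj).
  exact: (integrableD measurableT i1 i2).
move=> N x; have [_ hc _] := hpsi N.
rewrite (_ : a j x * psi N x = a j x * phi x + (psi N x - phi x) * a j x); last by ring.
apply: (le_trans (ler_normD _ _)); rewrite lerD2l normrM ler_wpM2r//.
apply: (le_trans (hc x)); rewrite ler_piMr// invf_le1 ?powR_gt0//.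
rewrite -[leLHS](_ : 1 `^ beta = 1 :> R); last by rewrite powR1.
by apply: ge0_ler_powR; rewrite ?nnegrE ?(ltW beta0)// ler1n.
Qed.

End bump_series.

Section fubini_weight.
Context d1 d2 (T1 : measurableType d1) (T2 : measurableType d2) (R : realType).
Variables (m1 : {sigma_finite_measure set T1 -> \bar R})
  (m2 : {sigma_finite_measure set T2 -> \bar R}) (F : T1 * T2 -> R) (h : T1 -> R).
Hypotheses (mF : measurable_fun setT F) (mh : measurable_fun setT h) (h1 : forall x, `|h x| <= 1).
Hypothesis Foo : (\int[m2]_y \int[m1]_x `|F (x, y)|%:E < +oo)%E.

(** The inner integrals are finite only almost everywhere, so the real-valued iterated integrals are
    compared with the extended ones up to null sets. *)
Lemma Rintegral_fubini_weight :
  \int[m1]_x ((\int[m2]_y F (x, y)) * h x) = \int[m2]_y \int[m1]_x (F (x, y) * h x).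
Proof.
pose G (z : T1 * T2) := F z * h z.1.
have mG : measurable_fun setT G.
  by apply: measurable_funM => //; apply: (measurableT_comp mh); exact: measurable_fst.
have mFE : measurable_fun setT (EFin \o F) by exact/measurable_EFinP.
have mGE : measurable_fun setT (EFin \o G) by exact/measurable_EFinP.
have mnF : measurable_fun setT (fun z => `|F z|) by exact: (measurableT_comp (@normr_measurable R setT)).
have mnG : measurable_fun setT (fun z => `|G z|) by exact: (measurableT_comp (@normr_measurable R setT)).
have iF : (m1 \x m2)%E.-integrable setT (EFin \o F).
  by apply/(integrable21ltyP _ _ mFE).
have iG : (m1 \x m2)%E.-integrable setT (EFin \o G).
  apply: (le_integrable measurableT mGE _ iF) => z _.
  by rewrite /= lee_fin /G normrM ler_piMr.
have mI := measurable_fubini_F iF; have mJ := measurable_fubini_G iG.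
have aeF := ae_integrable1 iF; have aeG := ae_integrable2 iG.
rewrite /Rintegral; congr fine.
transitivity (\int[m1]_x \int[m2]_y (G (x, y))%:E)%E.
  apply: ae_eq_integral => //.
  - apply/measurable_EFinP; apply: measurable_funM => //.
    exact: (measurableT_comp (fine_measurable measurableT) mI).
  - exact: (measurable_fubini_F iG).
  apply: filterS aeF => x iFx _.
  have fx : (\int[m2]_y (F (x, y))%:E)%E \is a fin_num by exact: integrable_fin_num iFx.
  rewrite EFinM fineK// muleC -integralZl//.
  by apply: eq_integral => y _; rewrite -EFinM mulrC.
rewrite (Fubini iG); apply: ae_eq_integral => //.
- apply/measurable_EFinP; exact: (measurableT_comp (fine_measurable measurableT) mJ).
- by apply: filterS aeG => y iGy _; rewrite fineK//; exact: integrable_fin_num iGy.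
Qed.

End fubini_weight.

Section dual_kernel.
Context (R : realType) (n : nat).
Local Notation mu := (@lebesgue_rV R n).
Variables (beta A C1 C2 C3 kap m rho L : R) (k b h : 'rV[R]_n -> R).
Hypotheses (beta0 : 0 < beta) (A1 : 1 <= A) (C10 : 0 <= C1) (C20 : 0 <= C2) (kap0 : 0 <= kap) (m0 : 0 <= m).
Hypothesis hk : singular_kernel beta A C1 C2 C3 k.
Hypothesis k_L1 : (\int[mu]_x `|k x|%:E <= kap%:E)%E.
Hypothesis k_support : forall z, m <= enorm z -> k z = 0.
Hypotheses (L0 : 0 <= L) (bL : holder L beta b).
Hypotheses (mh : measurable_fun setT h) (h1 : forall x, `|h x| <= 1).
Hypothesis h_support : forall x, h x != 0 -> enorm x <= rho.

(** The transpose of a |-> [cint b k a], applied to h. *)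
Definition dual (y : 'rV[R]_n) : R := \int[mu]_x (k (x - y) * (b x - b y) * h x).

Let mk := singular_kernel_measurable hk.
Let mb : measurable_fun setT b. Proof. exact: holder_measurable bL. Qed.
Let mn := @normr_measurable R setT.
Let mnk : measurable_fun setT (fun x => `|k x|). Proof. exact: (measurableT_comp mn mk). Qed.

Let msub (y : 'rV[R]_n) : measurable_fun setT (fun x : 'rV[R]_n => x - y).
Proof. exact: measurable_funB_rV. Qed.

Let mky (y : 'rV[R]_n) : measurable_fun setT (fun x : 'rV[R]_n => k (x - y)).
Proof. exact: (measurableT_comp mk (msub y)). Qed.

Let mf (y : 'rV[R]_n) : measurable_fun setT (fun x : 'rV[R]_n => k (x - y) * (b x - b y) * h x).
Proof. by apply: measurable_funM => //; apply: measurable_funM => //; exact: measurable_funB. Qed.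

Let kb_le x y : `|k (x - y) * (b x - b y)| <= L * m `^ beta * `|k (x - y)|.
Proof.
have [h2|h2] := leP m (enorm (x - y)); first by rewrite k_support// mul0r normr0 mulr0.
rewrite normrM mulrC ler_wpM2r// (le_trans (bL _ _))// ler_wpM2l//.
by apply: ge0_ler_powR; rewrite ?nnegrE ?enorm_ge0// ltW.
Qed.

Let weight x (c : R) : `|c * h x| <= `|c|.
Proof. by rewrite normrM ler_piMr. Qed.

Let k_translate (y : 'rV[R]_n) : (\int[mu]_x `|k (x - y)|%:E <= kap%:E)%E.
Proof.
apply: le_trans k_L1.
exact: (@integral_translate_le _ _ setT setT _ y mnk (fun x => normr_ge0 _)).
Qed.

Let kb_L1 (y : 'rV[R]_n) : (\int[mu]_x `|k (x - y) * (b x - b y)|%:E <= (L * m `^ beta * kap)%:E)%E.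
Proof.
have Lm0 : 0 <= L * m `^ beta by rewrite mulr_ge0// powR_ge0.
apply: (@le_trans _ _ ((L * m `^ beta)%:E * \int[mu]_x `|k (x - y)|%:E)%E).
  apply: integral_le_cst_mul => //.
  - by apply: (measurableT_comp mn); apply: measurable_funM => //; exact: measurable_funB.
  - exact: (measurableT_comp mn).
by rewrite [leRHS]EFinM; apply: lee_wpmul2l.
Qed.

Let iF y : mu.-integrable setT (EFin \o (fun x => k (x - y) * (b x - b y) * h x)).
Proof.
apply: integrable_norm_lty => //.
apply: (@le_lt_trans _ _ (\int[mu]_x `|k (x - y) * (b x - b y)|%:E)%E).
  apply: integral_le_mono => //.
  - exact: (measurableT_comp mn).
  - by apply: (measurableT_comp mn); apply: measurable_funM => //; exact: measurable_funB.
by apply: le_lt_trans (kb_L1 y) _; rewrite ltry.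
Qed.

Lemma dual_support y : dual y != 0 -> enorm y <= rho + m.
Proof.
apply: contra_neqT; rewrite -ltNge => yr; rewrite /dual /Rintegral integral0_eq// => x _.
have [->|/h_support xr] := eqVneq (h x) 0; first by rewrite mulr0.
rewrite k_support ?mul0r//; have := enorm_distD x y 0; rewrite !subr0 [enorm (y - x)]enormBC; lra.
Qed.

Lemma dual_pairing a C x0 d : 0 <= C -> 0 < d -> bump beta C x0 d a ->
  \int[mu]_x (cint b k a x * h x) = \int[mu]_y (a y * dual y).
Proof.
move=> C0 d0 ha; have ma := bump_measurable ha.
have mF := measurable_cint_integrand mb mk ma.
rewrite /cint (@Rintegral_fubini_weight _ _ _ _ _ mu mu _ h mF mh h1).
  apply: eq_Rintegral => y _; rewrite /dual -RintegralZl//.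
  by apply: eq_Rintegral => x _ /=; ring.
pose H (z : 'rV[R]_n * 'rV[R]_n) := `|k (z.1 - z.2) * (b z.1 - b z.2) * a z.2|.
have mH : measurable_fun setT H by exact: (measurableT_comp mn mF).
have H0 z : 0 <= H z by exact: normr_ge0.
apply: (@le_lt_trans _ _ (\int[mu]_y ((L * m `^ beta * kap) * `|a y|)%:E)%E).
  apply: ge0_le_integral => //.
  - by move=> y _; apply: integral_ge0 => x _; rewrite lee_fin.
  - exact: (measurable_fun_integral1 mu mH H0).
  - apply/measurable_EFinP; apply: measurable_funM => //; exact: (measurableT_comp mn ma).
  move=> y _ /=; under eq_integral do rewrite normrM mulrC EFinM.
  rewrite ge0_integralZl//; last first.
    apply/measurable_EFinP; apply: (measurableT_comp mn); apply: measurable_funM => //.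
    exact: measurable_funB.
  by rewrite mulrC EFinM; apply: lee_wpmul2l.
under eq_integral do rewrite EFinM.
rewrite ge0_integralZl//; last 2 first.
- by apply/measurable_EFinP; exact: (measurableT_comp mn ma).
- by rewrite lee_fin !mulr_ge0// powR_ge0.
apply: (@le_lt_trans _ _ ((L * m `^ beta * kap)%:E * (C * d `^ (- beta))%:E)%E).
  by apply: lee_wpmul2l; [rewrite lee_fin !mulr_ge0// powR_ge0|exact: bump_integral ha].
by rewrite -EFinM ltry.
Qed.

Let c0 : R := 2 * (C1 * (A + 1) `^ beta) + C2 + kap.
Let c00 : 0 <= c0. Proof. by rewrite /c0 !addr_ge0// !mulr_ge0// powR_ge0. Qed.

Let near_bound (E : set 'rV[R]_n) (y : 'rV[R]_n) (dl : R) : 0 < dl -> measurable E ->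
  (forall x, E x -> enorm (x - y) <= (A + 1) * dl) ->
  (\int[mu]_(x in E) (`|k (x - y)| * enorm (x - y) `^ beta)%:E <= (C1 * (A + 1) `^ beta * dl `^ beta)%:E)%E.
Proof.
move=> dl0 mE hE.
have Adl : 0 < (A + 1) * dl by rewrite mulr_gt0// addr_gt0// (lt_le_trans ltr01 A1).
have := singular_kernel_local hk Adl; rewrite powRM ?(ltW dl0) ?addr_ge0 ?(le_trans ler01 A1)// mulrA.
apply: le_trans.
apply: (@integral_translate_le _ _ (eball 0 ((A + 1) * dl)) E (fun x => `|k x| * enorm x `^ beta)) => //.
- apply: measurable_funM => //.
  by apply: (measurableT_comp (measurable_powR _)); exact: measurable_enorm.
- by move=> x; rewrite mulr_ge0// powR_ge0.
- exact: measurable_eball.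
- by move=> x Ex; rewrite /eball/= subr0; exact: hE.
Qed.

(** Within A |y - y'| of y the two integrands are bounded separately by the local estimate. Further
    out the increment is (k (x - y) - k (x - y')) (b x - b y) + k (x - y') (b y' - b y): the first
    part is the smoothness bound, the second costs the L1 norm of k. The constant may thus depend on
    the truncation, which is fixed here. *)
Lemma dual_holder : holder (L * c0) beta dual.
Proof.
move=> y y'; set dl := enorm (y - y').
have [yy|yy] := eqVneq y y'; first by rewrite /dl yy !subrr normr0 mulr_ge0 ?powR_ge0 ?mulr_ge0.
have dl0 : 0 < dl by rewrite enorm_gt0 subr_eq0.
have Adl0 : 0 < A * dl by rewrite mulr_gt0// (lt_le_trans ltr01 A1).
rewrite /dual -RintegralB// -lee_fin.
pose F x := k (x - y) * (b x - b y) * h x - k (x - y') * (b x - b y') * h x.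
have mF : measurable_fun setT F by exact: measurable_funB.
apply: (le_trans (normr_Rintegral_le _ mF)).
pose near := eball y (A * dl).
have mnear : measurable near by exact: measurable_eball.
have mfar : measurable (~` near) by exact: measurableC.
have mnF : measurable_fun setT (fun x => `|F x|) by exact: (measurableT_comp mn).
have mpow (z : 'rV[R]_n) : measurable_fun setT (fun x : 'rV[R]_n => enorm (x - z) `^ beta).
  by apply: (measurableT_comp (measurable_powR _)); exact: (measurable_fun_enorm (msub z)).
have mke (z : 'rV[R]_n) : measurable_fun setT (fun x : 'rV[R]_n => `|k (x - z)| * enorm (x - z) `^ beta).
  by apply: measurable_funM => //; exact: (measurableT_comp mn).
have ke0 (x z : 'rV[R]_n) : 0 <= `|k (x - z)| * enorm (x - z) `^ beta by rewrite mulr_ge0// powR_ge0.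
rewrite (_ : L * c0 * dl `^ beta = L * (C1 * (A + 1) `^ beta * dl `^ beta + C1 * (A + 1) `^ beta * dl `^ beta) +
  L * (C2 * dl `^ beta + dl `^ beta * kap)); last by rewrite /c0; ring.
rewrite -(setUv near) ge0_integral_setU//; last first.
- exact/disj_setPCl.
- by apply: measurable_funTS; exact/measurable_EFinP.
rewrite EFinD; apply: leeD.
  apply: (@le_trans _ _ (L%:E * \int[mu]_(x in near) (`|k (x - y)| * enorm (x - y) `^ beta +
       `|k (x - y')| * enorm (x - y') `^ beta)%:E)%E).
    apply: integral_le_cst_mul => //.
    - exact: measurable_funD.
    - by move=> x; exact: addr_ge0.
    move=> x _; apply: (le_trans (ler_normB _ _)).
    rewrite [leRHS]mulrDr; apply: lerD; apply: (le_trans (weight _ _)).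
      by rewrite normrM mulrCA ler_wpM2l.
    by rewrite normrM mulrCA ler_wpM2l.
  rewrite [leRHS]EFinM; apply: lee_wpmul2l; first by rewrite lee_fin.
  under eq_integral do rewrite EFinD.
  have kE0 (z x : 'rV[R]_n) : near x -> (0 <= (`|k (x - z)| * enorm (x - z) `^ beta)%:E)%E by rewrite lee_fin.
  rewrite (ge0_integralD mu mnear (kE0 y) _ (kE0 y')); last 2 first.
  - by apply: measurable_funTS; exact/measurable_EFinP.
  - by apply: measurable_funTS; exact/measurable_EFinP.
  rewrite EFinD; apply: leeD; apply: near_bound => // x; rewrite /near/eball/= => xA.
    by apply: (le_trans xA); rewrite ler_wpM2r ?(ltW dl0)// lerDl.
  by apply: (le_trans (enorm_distD y _ _)); rewrite mulrDl mul1r lerD.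
pose g x := enorm x `^ beta * `|k (x - (y' - y)) - k x|.
have mg : measurable_fun setT g.
  apply: measurable_funM.
    by apply: (measurableT_comp (measurable_powR _)); exact: measurable_enorm.
  by apply: (measurableT_comp mn); exact: measurable_funB.
have mgy : measurable_fun setT (fun x : 'rV[R]_n => g (x - y)) by exact: (measurableT_comp mg (msub y)).
have g0 x : 0 <= g x by rewrite mulr_ge0// powR_ge0.
have mk' : measurable_fun setT (fun x : 'rV[R]_n => dl `^ beta * `|k (x - y')|).
  by apply: measurable_funM => //; exact: (measurableT_comp mn).
have k'0 (x : 'rV[R]_n) : 0 <= dl `^ beta * `|k (x - y')| by rewrite mulr_ge0// powR_ge0.
apply: (@le_trans _ _ (L%:E * \int[mu]_(x in ~` near) (g (x - y) + dl `^ beta * `|k (x - y')|)%:E)%E).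
  apply: integral_le_cst_mul => //.
  - exact: measurable_funD.
  - by move=> x; exact: addr_ge0.
  move=> x _; rewrite (_ : F x = (k (x - y) - k (x - y')) * (b x - b y) * h x + k (x - y') * (b y' - b y) * h x); last first.
    by rewrite /F; ring.
  apply: (le_trans (ler_normD _ _)).
  rewrite [leRHS]mulrDr; apply: lerD; apply: (le_trans (weight _ _)); rewrite normrM.
    rewrite /g (_ : x - y - (y' - y) = x - y'); last by rewrite opprB addrA subrK.
    by rewrite mulrA mulrC [`|k (x - y') - _|]distrC ler_wpM2r.
  rewrite mulrA mulrC; apply: ler_wpM2r; first exact: normr_ge0.
  by rewrite /dl enormBC; exact: bL.
rewrite [leRHS]EFinM; apply: lee_wpmul2l; first by rewrite lee_fin.
under eq_integral do rewrite EFinD.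
have gy0 (x : 'rV[R]_n) : (~` near) x -> (0 <= (g (x - y))%:E)%E by rewrite lee_fin.
have k'0E (x : 'rV[R]_n) : (~` near) x -> (0 <= (dl `^ beta * `|k (x - y')|)%:E)%E by rewrite lee_fin.
rewrite ge0_integralD//; last 2 first.
- by apply: measurable_funTS; exact/measurable_EFinP.
- by apply: measurable_funTS; exact/measurable_EFinP.
rewrite EFinD; apply: leeD.
  have yy' : enorm (y' - y) <= dl by rewrite enormBC.
  apply: le_trans (singular_kernel_smooth hk dl0 yy').
  apply: (integral_translate_le mg g0) => //.
    rewrite (_ : [set x | _] = [set x : 'rV[R]_n | enorm x \in `]A * dl, +oo[]); first exact: measurable_enorm_itv.
    by apply/seteqP; split => x /=; rewrite in_itv/= andbT.
  by move=> x /negP; rewrite -ltNge.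
apply: (@le_trans _ _ (\int[mu]_x (dl `^ beta * `|k (x - y')|)%:E)%E).
  apply: ge0_subset_integral => //.
  - exact/measurable_EFinP.
  - by move=> x _; rewrite lee_fin.
under eq_integral do rewrite EFinM.
rewrite ge0_integralZl//; last 2 first.
- by apply/measurable_EFinP; exact: (measurableT_comp mn).
- by rewrite lee_fin powR_ge0.
rewrite [leRHS]EFinM; apply: lee_wpmul2l => //; by rewrite lee_fin powR_ge0.
Qed.

End dual_kernel.

(** * Independence of the decomposition *)

Lemma asum_integrable d (T : measurableType d) (R : realType) (mu : {measure set T -> \bar R})
    (u : nat -> T -> R) : (forall j, measurable_fun setT (u j)) ->
  (\sum_(0 <= j <oo) \int[mu]_x `|u j x|%:E < +oo)%E ->
  mu.-integrable setT (EFin \o (fun x => asum (u ^~ x))).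
Proof.
move=> mu_u uoo.
have mnuE j : measurable_fun setT (fun x => `|u j x|%:E).
  by apply/measurable_EFinP; exact: (measurableT_comp (@normr_measurable R setT)).
have ma := measurable_asum mu_u.
apply: integrable_norm_lty => //; apply: le_lt_trans uoo; rewrite -integral_nneseries//.
apply: ge0_le_integral => //.
- apply/measurable_EFinP; exact: (measurableT_comp (@normr_measurable R setT)).
- by apply: ge0_emeasurable_sum => [j x _ _|j _].
- by move=> x _; exact: asum_le.
Qed.

Lemma weak_const_ge0 (R : realType) (p : R) : 0 < p -> p < 1 -> 0 <= weak_const p.
Proof.
move=> p0 p1; have th0 : 0 <= (1 - p) / p by rewrite divr_ge0 ?subr_ge0 ?(ltW p1) ?(ltW p0).
rewrite /weak_const addr_ge0// divr_ge0 ?mulr_ge0 ?powR_ge0// subr_ge0.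
rewrite -[leRHS](powRr0 (2^-1 : R)); apply: ger_powR => //.
by rewrite invr_gt0 ltr0n/= invf_le1// ler1n.
Qed.

Lemma measure_le_eps d (T : measurableType d) (R : realType) (mu : {measure set T -> \bar R})
    (B : set T) : (forall e : R, 0 < e -> (mu B <= e%:E)%E) -> mu B = 0%E.
Proof.
move=> h; apply/eqP; rewrite eq_le measure_ge0 andbT; apply/lee_addgt0Pr => e e0.
by rewrite add0e; exact: h.
Qed.

(** The intersections increase with M and each lies in a single [V m], so continuity from below
    carries the bound to their union. *)
Lemma measure_liminf_le d (T : measurableType d) (R : realType) (mu : {measure set T -> \bar R})
    (V : nat -> set T) (c : \bar R) : (forall m, measurable (V m)) -> (forall m, (mu (V m) <= c)%E) ->
  measurable (\bigcup_M \bigcap_(m in [set m | (M <= m)%N]) V m) /\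
  (mu (\bigcup_M \bigcap_(m in [set m | (M <= m)%N]) V m) <= c)%E.
Proof.
move=> mV Vc; pose A M := \bigcap_(m in [set m | (M <= m)%N]) V m.
have mA M : measurable (A M) by apply: bigcap_measurable => // ; exists M => /=.
have mUA : measurable (\bigcup_M A M) by exact: bigcup_measurable.
have ndA : nondecreasing_seq A.
  by move=> M N MN; apply/subsetPset => x Ax m /= Nm; apply: Ax; exact: leq_trans Nm.
split => //.
have cv := @nondecreasing_cvg_mu _ _ _ mu A mA mUA ndA.
rewrite -(cvg_lim _ cv)//; apply: lime_le; first by apply/cvg_ex; eexists; exact: cv.
apply: nearW => M; apply: (le_trans _ (Vc M)); apply: le_measure; rewrite ?inE//.
by move=> x Ax; apply: Ax => /=.
Qed.

Lemma integrable_mul_indic d (T : measurableType d) (R : realType) (mu : {measure set T -> \bar R})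
    (D : T -> R) (E : set T) : measurable E -> mu.-integrable setT (EFin \o D) ->
  mu.-integrable setT (EFin \o (fun x => D x * \1_E x)).
Proof.
move=> mE iD; apply: (le_integrable measurableT _ _ iD) => [|x _].
  apply/measurable_EFinP; apply: measurable_funM => //.
  by apply/measurable_EFinP; exact: (measurable_int _ iD).
by rewrite /= lee_fin normrM ler_piMr// indicE; case: (x \in E); rewrite ?normr1 ?normr0.
Qed.

Lemma Rintegral_sub_indic d (T : measurableType d) (R : realType) (mu : {measure set T -> \bar R})
    (D D' : T -> R) (E : set T) : measurable E ->
  mu.-integrable setT (EFin \o D) -> mu.-integrable setT (EFin \o D') ->
  \int[mu]_x (D x * \1_E x) = \int[mu]_x (D' x * \1_E x) ->
  \int[mu]_x ((D x - D' x) * \1_E x) = 0.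
Proof.
move=> mE iD iD' e; under eq_Rintegral do rewrite mulrBl.
by rewrite RintegralB ?integrable_mul_indic// e subrr.
Qed.

Lemma ae_eq0_balls (R : realType) (n : nat) (D : 'rV[R]_n -> R) :
  (lebesgue_rV n).-integrable setT (EFin \o D) ->
  (forall (i : nat) E, E `<=` eball 0 i%:R -> measurable E -> \int[lebesgue_rV n]_x (D x * \1_E x) = 0) ->
  {ae lebesgue_rV n, forall x, D x = 0}.
Proof.
move=> iD hD.
have onball (i : nat) : {ae lebesgue_rV n, forall x, eball 0 i%:R x -> (EFin \o D) x = cst 0%E x}.
  have mB : measurable (eball (0 : 'rV[R]_n) i%:R) by exact: measurable_eball.
  apply: (integral_ae_eq mB _ (measurable_cst 0%E)) => [|E EB mE].
    exact: (integrableS measurableT mB (@subsetT _ _) iD).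
  rewrite integral0 integral_EFin_indic.
  have fin : (\int[lebesgue_rV n]_x (EFin \o (fun x => D x * \1_E x)%R) x)%E \is a fin_num.
    exact: (integrable_fin_num measurableT (integrable_mul_indic mE iD)).
  by rewrite -[LHS](fineK fin); congr (_%:E); exact: (hD i).
have := ae_foralln onball; apply: filterS => x h.
have /= : (EFin \o D) x = cst 0%E x.
  apply: (h (Num.truncn (enorm x)).+1).
  by rewrite /eball/= subr0 ltW// truncnS_gt.
by move=> [].
Qed.

Section uniqueness.
Context (R : realType) (n : nat).
Hypothesis n0 : (0 < n)%N.
Local Notation mu := (@lebesgue_rV R n).
Variables (beta A C1 C2 C3 p C L : R) (Om b : 'rV[R]_n -> R).
Hypotheses (beta0 : 0 < beta) (beta1 : beta < 1) (A1 : 1 <= A).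
Hypotheses (C10 : 0 < C1) (C20 : 0 <= C2) (C30 : 0 <= C3).
Hypotheses (p0 : 0 < p) (p1 : p < 1) (C0 : 0 < C) (L0 : 0 < L).
Hypothesis hOm : forall chi, cutoff chi ->
  singular_kernel beta A C1 C2 C3 (kernel (fun z => Om z * chi (enorm z))).
Hypothesis bL : holder L beta b.

Let mb : measurable_fun setT b. Proof. exact: holder_measurable bL. Qed.

Let cc : R := cint_const beta A C1 C2 C3 * L * C.
Let cc0 : 0 < cc.
Proof.
rewrite !mulr_gt0// /cint_const -addrA ltr_pwDl//.
  by rewrite mulr_gt0// powR_gt0// addr_gt0// (lt_le_trans ltr01 A1).
by rewrite addr_ge0 ?mulr_ge0 ?powR_ge0.
Qed.

Section one_series.
Variables (lam : nat -> R) (a : nat -> 'rV[R]_n -> R).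
Hypothesis hs : bump_series beta C p lam a.

Let ma j : measurable_fun setT (a j).
Proof. by have [x0 [d [_ h]]] := hs.1 j; exact: bump_measurable h. Qed.

Section one_kernel.
Variable k : 'rV[R]_n -> R.
Hypothesis hk : singular_kernel beta A C1 C2 C3 k.

Let mk := singular_kernel_measurable hk.

Lemma measurable_term j : measurable_fun setT (fun x => lam j * cint b k (a j) x).
Proof. by apply: measurable_funM => //; exact: measurable_cint. Qed.

Let mterm j : measurable_fun setT (fun x => `|lam j * cint b k (a j) x|%:E).
Proof.
by apply/measurable_EFinP; apply: (measurableT_comp (@normr_measurable R setT)); exact: measurable_term.
Qed.

Lemma measurable_tail N : measurable_fun setT
  (fun x => \sum_(N <= j <oo) `|lam j * cint b k (a j) x|%:E)%E.
Proof.
rewrite (_ : (fun _ => _) = (fun x => \sum_(0 <= j <oo) `|lam (j + N)%N * cint b k (a (j + N)%N) x|%:E)%E).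
  by apply: ge0_emeasurable_sum => [j x _ _|j _].
by apply/funext => x; rewrite -nneseries_addn.
Qed.

(** [weak_series] for the shifted sequence, with c_j = cc |lam_j|. The bound is the same for all
    kernels with the given constants, in particular for all truncations. *)
Lemma weak_tail N (S t : R) : 0 < S -> (\sum_(N <= j <oo) (`|lam j| `^ p)%:E <= S%:E)%E -> 0 < t ->
  (mu [set x | (t%:E < \sum_(N <= j <oo) `|lam j * cint b k (a j) x|%:E)%E] <=
    (weak_const p * cc * S `^ p^-1 / t)%:E)%E.
Proof.
move=> S0 lamS t0.
have S'0 : 0 < cc `^ p * S by rewrite mulr_gt0// powR_gt0.
pose u j x := `|lam (j + N)%N * cint b k (a (j + N)%N) x|%:E.
pose c j := cc * `|lam (j + N)%N|.
have c0 j : 0 <= c j by rewrite mulr_ge0// ltW.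
have uc j s : 0 < s -> (mu [set x | (s%:E < u j x)%E] <= (c j / s)%:E)%E.
  move=> s0; rewrite /u /c; have [l0|l0] := eqVneq (lam (j + N)%N) 0.
    rewrite l0 normr0 mulr0 mul0r (_ : [set x | _] = set0) ?measure0//.
    by apply/seteqP; split => x //=; rewrite mul0r normr0 lte_fin ltNge ltW.
  have lj0 : 0 < `|lam (j + N)%N| by rewrite normr_gt0.
  have [x0 [d [d0 hj]]] := hs.1 (j + N)%N.
  have := cint_weak beta0 A1 (ltW C10) C20 hk (ltW L0) bL (ltW C0) d0 hj (divr_gt0 s0 lj0).
  rewrite (_ : [set x | (s%:E < _)%E] = [set x | s / `|lam (j + N)%N| < `|cint b k (a (j + N)%N) x|]); last first.
    by apply/seteqP; split => x /=; rewrite lte_fin normrM ltr_pdivrMr// [X in s < X]mulrC.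
  move=> h; apply: (le_trans h); rewrite lee_fin; apply: ler_of_eq.
  by rewrite invfM invrK /cc; ring.
have sumc : (\sum_(0 <= j <oo) (c j `^ p)%:E <= (cc `^ p * S)%:E)%E.
  rewrite (eq_eseriesr (g := fun j => ((cc `^ p)%:E * (`|lam (j + N)%N| `^ p)%:E)%E)); last first.
    by move=> j _; rewrite /c powRM ?(ltW cc0).
  rewrite nneseriesZl; last by move=> j _; rewrite lee_fin powR_ge0.
  rewrite EFinM; apply: lee_wpmul2l; first by rewrite lee_fin powR_ge0.
  rewrite (@nneseries_addn _ (fun j => (`|lam j| `^ p)%:E) N)//.
have := weak_series p0 p1 S'0 (fun j => mterm (j + N)%N) (fun j x => _) c0 uc sumc t0.
have E x : (\sum_(N <= j <oo) `|lam j * cint b k (a j) x|%:E = \sum_(0 <= j <oo) u j x)%E.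
  by rewrite -nneseries_addn.
move=> h; rewrite (_ : [set x | _] = [set x | (t%:E < \sum_(0 <= j <oo) u j x)%E]); last first.
  by apply/seteqP; split => x /=; rewrite E.
apply: (le_trans (h _)) => //; rewrite lee_fin; apply: ler_of_eq; congr (_ / t).
rewrite powRM ?powR_ge0 ?(ltW S0)// -powRrM mulfV ?gt_eqF// powRr1 ?(ltW cc0)// mulrA//.
Qed.

(** The set where the sum is infinite lies in every level set, whose measure is of order 1/t. *)
Lemma series_ae_finite :
  {ae mu, forall x, (\sum_(0 <= j <oo) `|lam j * cint b k (a j) x|%:E < +oo)%E}.
Proof.
have l0 : (0 <= \sum_(0 <= j <oo) (`|lam j| `^ p)%:E)%E.
  by apply: nneseries_ge0 => j _ _; rewrite lee_fin powR_ge0.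
have lfin : (\sum_(0 <= j <oo) (`|lam j| `^ p)%:E)%E \is a fin_num by rewrite ge0_fin_numE// hs.2.
(* One is added so that S is positive even if all coefficients vanish. *)
pose S := fine (\sum_(0 <= j <oo) (`|lam j| `^ p)%:E)%E + 1.
have S0 : 0 < S by rewrite ltr_wpDl// fine_ge0.
have lS : (\sum_(0 <= j <oo) (`|lam j| `^ p)%:E <= S%:E)%E by rewrite -(fineK lfin) lee_fin lerDl.
pose f x := (\sum_(0 <= j <oo) `|lam j * cint b k (a j) x|%:E)%E.
have mf : measurable_fun setT f by exact: measurable_tail.
pose B := [set x | f x = +oo%E].
have mB : measurable B.
  rewrite (_ : B = setT `&` f @^-1` [set +oo%E]); first exact: mf.
  by rewrite setTI.
exists B; split => //; last first.
  by move=> x /= /negP; rewrite -leNgt leye_eq => /eqP.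
apply: measure_le_eps => e e0.
pose K := weak_const p * cc * S `^ p^-1; pose t := (`|K| + 1) / e.
have t0 : 0 < t by rewrite divr_gt0// ltr_wpDl.
apply: (@le_trans _ _ (mu [set x | (t%:E < f x)%E])).
  apply: le_measure; rewrite ?inE//.
    by rewrite -[X in measurable X]setTI; exact: emeasurable_fun_o_infty.
  by move=> x /= ->; rewrite ltry.
apply: (le_trans (weak_tail S0 lS t0)); rewrite lee_fin -/K ler_pdivrMr//.
rewrite /t mulrCA divff ?gt_eqF// mulr1.
by rewrite (le_trans (ler_norm K))// lerDl.
Qed.

End one_kernel.

Section truncated.
Variable m : nat.

Let hk : singular_kernel beta A C1 C2 C3 (tkernel Om m) := tkernel_singular hOm m.
Let mk := singular_kernel_measurable hk.

(** For fixed m the terms are bounded in L1 by a multiple of |lam_j|, and p < 1 makes these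
    summable. *)
Lemma truncated_L1 : (\sum_(0 <= j <oo) \int[mu]_x `|lam j * cint b (tkernel Om m) (a j) x|%:E < +oo)%E.
Proof.
have [kap kap0 hkap] := tkernel_L1 beta0 beta1 (ltW C10) hOm m.
pose K := (C1 * (A + 1) `^ beta + 2 `^ beta * C2 + kap) * L * C.
have K0 : 0 <= K by rewrite !mulr_ge0 ?(ltW L0) ?(ltW C0)// !addr_ge0// mulr_ge0 ?powR_ge0 ?(ltW C10).
have lamoo := summable_powR p0 p1 hs.2.
apply: (@le_lt_trans _ _ (\sum_(0 <= j <oo) (K%:E * `|lam j|%:E))%E).
  apply: lee_nneseries => [j _ _|j _]; first by apply: integral_ge0 => x _; rewrite lee_fin.
  have [x0 [d [d0 hj]]] := hs.1 j.
  under eq_integral do rewrite normrM EFinM.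
  rewrite ge0_integralZl//; last first.
    apply/measurable_EFinP; apply: (measurableT_comp (@normr_measurable R setT)).
    exact: measurable_cint.
  rewrite muleC; apply: lee_wpmul2r; first by rewrite lee_fin.
  exact: (cint_L1 beta0 A1 (ltW C10) C20 hk (ltW L0) bL (ltW C0) d0 hj hkap).
by rewrite nneseriesZl// lte_mul_pinfty.
Qed.

Variables (h : 'rV[R]_n -> R) (rho : R).
Hypotheses (mh : measurable_fun setT h) (h1 : forall x, `|h x| <= 1).
Hypothesis h_support : forall x, h x != 0 -> enorm x <= rho.

Lemma truncated_dual : exists2 K, 0 <= K & holder K beta (dual (tkernel Om m) b h) /\
  forall x, dual (tkernel Om m) b h x != 0 -> enorm x <= rho + m.+1%:R.
Proof.
have [kap kap0 hkap] := tkernel_L1 beta0 beta1 (ltW C10) hOm m.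
exists (L * (2 * (C1 * (A + 1) `^ beta) + C2 + kap)).
  by rewrite mulr_ge0 ?(ltW L0)// !addr_ge0// mulr_ge0// mulr_ge0 ?powR_ge0 ?(ltW C10).
split.
  apply: (dual_holder beta0 A1 (ltW C10) C20 kap0 _ hk hkap _ (ltW L0) bL mh h1 (m := m.+1%:R)) => //.
  exact: tkernel_eq0.
by apply: (dual_support (m := m.+1%:R)) => //; exact: tkernel_eq0.
Qed.

(** Both sides are limits of the same partial sums: on the left by convergence in L1, on the right
    because the pairings are dominated by K C |lam_j|. *)
Lemma truncated_pairing :
  \int[mu]_x (asum (fun j => lam j * cint b (tkernel Om m) (a j) x) * h x) =
  asum (fun j => lam j * \int[mu]_x (a j x * dual (tkernel Om m) b h x)).
Proof.
have [kap kap0 hkap] := tkernel_L1 beta0 beta1 (ltW C10) hOm m.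
have [K K0 [hK _]] := truncated_dual.
have lamoo := summable_powR p0 p1 hs.2.
have c1 := asum_Rintegral (measurable_term hk) mh h1 truncated_L1.
have c2 : (fun N => \sum_(0 <= j < N) lam j * \int[mu]_x (a j x * dual (tkernel Om m) b h x)) @ \oo -->
    asum (fun j => lam j * \int[mu]_x (a j x * dual (tkernel Om m) b h x)).
  apply: asum_cvg; apply: (@le_lt_trans _ _ (\sum_(0 <= j <oo) ((K * C)%:E * `|lam j|%:E))%E).
    apply: lee_nneseries => [j _ _|j _]; first by rewrite lee_fin.
    rewrite -EFinM lee_fin normrM mulrC ler_wpM2r//.
    by have [x0 [d [d0 hj]]] := hs.1 j; exact: (bump_pairing_le beta0 K0 hK d0 hj).
  rewrite nneseriesZl; last by move=> j _; rewrite lee_fin.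
  by rewrite lte_mul_pinfty// lee_fin mulr_ge0// ltW.
apply: (cvg_unique _ c1) => //.
rewrite (_ : (fun N => _) = (fun N => \sum_(0 <= j < N) lam j * \int[mu]_x (a j x * dual (tkernel Om m) b h x)))//.
apply/funext => N; apply: eq_bigr => j _.
have [x0 [d [d0 hj]]] := hs.1 j.
rewrite -(dual_pairing beta0 kap0 _ hk hkap _ (ltW L0) bL mh h1 (ltW C0) d0 hj (m := m.+1%:R))//; last exact: tkernel_eq0.
rewrite -RintegralZl//; first by apply: eq_Rintegral => x _; rewrite mulrA.
have mT : measurable_fun setT (cint b (tkernel Om m) (a j)) by exact: measurable_cint.
apply: integrable_norm_lty; first exact: measurable_funM.
have := cint_L1 beta0 A1 (ltW C10) C20 hk (ltW L0) bL (ltW C0) d0 hj hkap.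
move=> /le_lt_trans/(_ (ltry _)); apply: le_lt_trans.
apply: integral_le_mono => //.
- by apply: (measurableT_comp (@normr_measurable R setT)); exact: measurable_funM.
- exact: (measurableT_comp (@normr_measurable R setT)).
- by move=> x _; rewrite normrM ler_piMr.
Qed.

End truncated.

End one_series.

Section two_series.
Variables (lam lam' : nat -> R) (a a' : nat -> 'rV[R]_n -> R) (f : ('rV[R]_n -> R) -> R).
Hypotheses (hs : bump_series beta C p lam a) (hs' : bump_series beta C p lam' a').
Hypothesis hf : forall phi, test_function phi ->
  (fun N => \sum_(0 <= j < N) lam j * \int[mu]_x (a j x * phi x)) @ \oo --> f phi.
Hypothesis hf' : forall phi, test_function phi ->
  (fun N => \sum_(0 <= j < N) lam' j * \int[mu]_x (a' j x * phi x)) @ \oo --> f phi.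

(** One approximating sequence of test functions serves both decompositions, and f takes the same
    values along it. *)
Lemma pairing_unique (K rho : R) (phi : 'rV[R]_n -> R) : 0 <= K -> holder K beta phi ->
  (forall x, phi x != 0 -> enorm x <= rho) ->
  asum (fun j => lam j * \int[mu]_x (a j x * phi x)) =
  asum (fun j => lam' j * \int[mu]_x (a' j x * phi x)).
Proof.
move=> K0 hphi sphi.
have [K' K'0 /choice[psi hpsi]] := holder_approx beta0 beta1 K0 hphi sphi.
have c := pairing_cvg beta0 (ltW C0) p0 p1 hs hf K0 hphi K'0 hpsi.
have c' := pairing_cvg beta0 (ltW C0) p0 p1 hs' hf' K0 hphi K'0 hpsi.
exact: (cvg_unique _ c c').
Qed.

(** Indicators of bounded measurable sets are admissible as h, and they separate integrable
    functions. *)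
Lemma truncated_agree m : {ae mu, forall x,
  asum (fun j => lam j * cint b (tkernel Om m) (a j) x) =
  asum (fun j => lam' j * cint b (tkernel Om m) (a' j) x)}.
Proof.
have hk := tkernel_singular hOm m.
have iG := asum_integrable (measurable_term hs hk) (truncated_L1 hs m).
have iG' := asum_integrable (measurable_term hs' hk) (truncated_L1 hs' m).
set G := (fun x => asum _) in iG; set G' := (fun x => asum _) in iG'.
have : {ae mu, forall x, G x - G' x = 0}.
  apply: (ae_eq0_balls (integrableB measurableT iG iG')) => i E EB mE.
  have mI : measurable_fun setT (\1_E : 'rV[R]_n -> R) by exact: measurable_indic.
  have I1 (x : 'rV[R]_n) : `|\1_E x : R| <= 1 by rewrite indicE; case: (x \in E); rewrite ?normr1 ?normr0.
  have Is (x : 'rV[R]_n) : (\1_E x : R) != 0 -> enorm x <= i%:R.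
    rewrite indicE; case: (boolP (x \in E)) => [/set_mem/EB|]; last by rewrite eqxx.
    by rewrite /eball/= subr0.
  have [K K0 [hK sK]] := truncated_dual m mI I1 Is.
  have e := truncated_pairing hs m mI I1 Is.
  have e' := truncated_pairing hs' m mI I1 Is.
  have ee := pairing_unique K0 hK sK; rewrite -e -e' in ee.
  exact: Rintegral_sub_indic mE iG iG' ee.
by apply: filterS => x /eqP; rewrite subr_eq0 => /eqP.
Qed.

Let hk1 := kernel_singular1 hOm.

Let tail_le (lam1 : nat -> R) (a1 : nat -> 'rV[R]_n -> R) (k : 'rV[R]_n -> R) N x (s : R) :
  s < `|asum (fun j => lam1 j * cint b k (a1 j) x) - \sum_(0 <= j < N) lam1 j * cint b k (a1 j) x| ->
  (s%:E < \sum_(N <= j <oo) `|lam1 j * cint b k (a1 j) x|%:E)%E.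
Proof. by rewrite -lte_fin => /lt_le_trans; apply; exact: asum_tail. Qed.

Let ae_partial (lam1 : nat -> R) (a1 : nat -> 'rV[R]_n -> R) : bump_series beta C p lam1 a1 ->
  {ae mu, forall x, forall N, (fun m => \sum_(0 <= j < N) lam1 j * cint b (tkernel Om m) (a1 j) x) @ \oo -->
    \sum_(0 <= j < N) lam1 j * cint b (kernel Om) (a1 j) x}.
Proof.
move=> hs1.
have : {ae mu, forall x, forall j, (fun m => cint b (tkernel Om m) (a1 j) x) @ \oo --> cint b (kernel Om) (a1 j) x}.
  apply: ae_foralln => j; have [x0 [d [d0 hj]]] := hs1.1 j.
  have := cint_absolutely_convergent beta0 A1 (ltW C10) hOm (ltW L0) bL d0 hj.
  apply: filterS => x hx; exact: (cint_tkernel_cvg n0 beta0 hOm bL hj hx).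
apply: filterS => x hx; elim=> [|N IH].
  under eq_fun do rewrite big_geq//; rewrite big_geq//; exact: cvg_cst.
under eq_fun do rewrite big_nat_recr//=; rewrite big_nat_recr//=.
apply: cvgD => //; have cl : (fun _ : nat => lam1 N) @ \oo --> lam1 N by exact: cvg_cst.
exact: cvgM cl (hx N).
Qed.

(** Partial sums converge pointwise as m grows, but the tails for the truncated kernels are small
    only off a set [V m] that moves with m. A point with |F x - F' x| > t outside the null set [Z]
    and the tail set [U0] of the full kernel must lie in [V m] for all large m. So only the liminf
    of these sets counts, and its measure is bounded like that of each of them. *)
Lemma series_unique : {ae mu, forall x,
  asum (fun j => lam j * cint b (kernel Om) (a j) x) =
  asum (fun j => lam' j * cint b (kernel Om) (a' j) x)}.
Proof.
pose F x := asum (fun j => lam j * cint b (kernel Om) (a j) x).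
pose F' x := asum (fun j => lam' j * cint b (kernel Om) (a' j) x).
have mF : measurable_fun setT F := measurable_asum (measurable_term hs hk1).
have mF' : measurable_fun setT F' := measurable_asum (measurable_term hs' hk1).
have mFF : measurable_fun setT (fun x => `|F x - F' x|).
  by apply: (measurableT_comp (@normr_measurable R setT)); exact: measurable_funB.
have l0 (lam1 : nat -> R) j : (0 <= (`|lam1 j| `^ p)%:E)%E by rewrite lee_fin powR_ge0.
have mset (g : 'rV[R]_n -> \bar R) (s : R) : measurable_fun setT g -> measurable [set x | (s%:E < g x)%E].
  by move=> mg; rewrite -[X in measurable X]setTI; exact: emeasurable_fun_o_infty.
have [Z1 [mZ1 Z10 hZ1]] := ae_partial hs; have [Z2 [mZ2 Z20 hZ2]] := ae_partial hs'.
have [Z3 [mZ3 Z30 hZ3]] := ae_foralln truncated_agree.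
pose Z := Z1 `|` Z2 `|` Z3.
have mZ : measurable Z by apply: measurableU => //; exact: measurableU.
have Z0 : mu Z = 0%E by rewrite null_set_setU// ?null_set_setU//; exact: measurableU.
have small (t e : R) : 0 < t -> 0 < e -> (mu [set x | (t < `|F x - F' x|)%R] <= e%:E)%E.
  (* Six errors: for each series the tail for the full kernel, the tail for the truncated one, and
     the change of the partial sum. *)
  move=> t0 e0; have t60 : 0 < t / 6 by rewrite divr_gt0.
  pose Kc := weak_const p * cc.
  have Kc0 : 0 <= Kc.
    by rewrite mulr_ge0 ?(ltW cc0)// weak_const_ge0.
  (* Makes the weak bound of each of the four tails at level t/6 at most e/4. *)
  pose S := (e * t / (24 * (Kc + 1))) `^ p.
  have S0 : 0 < S by rewrite powR_gt0// divr_gt0 ?mulr_gt0// ltr_wpDl.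
  have Sp : S `^ p^-1 = e * t / (24 * (Kc + 1)).
    by rewrite -powRrM mulfV ?gt_eqF// powRr1// divr_ge0 ?mulr_ge0 ?(ltW e0) ?(ltW t0) ?addr_ge0.
  have bound : Kc * S `^ p^-1 / (t / 6) <= e / 4.
    rewrite Sp (_ : _ / (t / 6) = e / 4 * (Kc / (Kc + 1))); last first.
      by field; rewrite !gt_eqF// ltr_wpDl.
    rewrite ler_piMr ?divr_ge0 ?(ltW e0)// ler_pdivrMr ?mul1r ?lerDl// ltr_wpDl//.
  have S0E : (0 < S%:E)%E by rewrite lte_fin.
  have small_tail (lam1 : nat -> R) : (\sum_(0 <= j <oo) (`|lam1 j| `^ p)%:E < +oo)%E ->
      exists N0, forall N, (N0 <= N)%N -> (\sum_(N <= j <oo) (`|lam1 j| `^ p)%:E <= S%:E)%E.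
    move=> loo; have /fine_cvgP[[B1 _ hB1] /cvgrPdist_le/(_ _ S0)[B2 _ hB2]] := nneseries_tail_cvg loo (fun k _ => l0 lam1 k).
    exists (maxn B1 B2) => N; rewrite geq_max => /andP[N1 N2].
    rewrite -(fineK (hB1 _ N1)) lee_fin.
    by have := hB2 N N2; rewrite /= sub0r normrN; apply: le_trans; exact: ler_norm.
  have [N1 hN1] := small_tail lam hs.2; have [N2 hN2] := small_tail lam' hs'.2.
  pose N := maxn N1 N2.
  have lS := hN1 N (leq_maxl _ _); have lS' := hN2 N (leq_maxr _ _).
  pose U (lam1 : nat -> R) (a1 : nat -> 'rV[R]_n -> R) (k : 'rV[R]_n -> R) :=
    [set x | ((t / 6)%:E < \sum_(N <= j <oo) `|lam1 j * cint b k (a1 j) x|%:E)%E].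
  have mU k : singular_kernel beta A C1 C2 C3 k -> measurable (U lam a k) /\ measurable (U lam' a' k).
    by move=> hk; split; apply: mset; [exact: (measurable_tail hs hk)|exact: (measurable_tail hs' hk)].
  have muU k : singular_kernel beta A C1 C2 C3 k -> (mu (U lam a k `|` U lam' a' k) <= (e / 2)%:E)%E.
    move=> hk; have [m1 m2] := mU k hk; apply: (le_trans (measureU2 _ m1 m2)).
    rewrite (_ : e / 2 = e / 4 + e / 4); last by field.
    rewrite EFinD; apply: leeD.
      by apply: (le_trans (weak_tail hs hk S0 lS t60)); rewrite lee_fin.
    by apply: (le_trans (weak_tail hs' hk S0 lS' t60)); rewrite lee_fin.
  pose V m := U lam a (tkernel Om m) `|` U lam' a' (tkernel Om m).
  have mV m : measurable (V m) by have [m1 m2] := mU _ (tkernel_singular hOm m); exact: measurableU.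
  have [mW muW] := measure_liminf_le mV (fun m => muU _ (tkernel_singular hOm m)).
  set W := \bigcup_M _ in mW muW.
  pose U0 := U lam a (kernel Om) `|` U lam' a' (kernel Om).
  have mU0 : measurable U0 by have [m1 m2] := mU _ hk1; exact: measurableU.
  have mB : measurable [set x | t < `|F x - F' x|].
    by have := mset (EFin \o (fun x => `|F x - F' x|)) t; apply; exact/measurable_EFinP.
  apply: (@le_trans _ _ (mu (Z `|` (U0 `|` W)))); last first.
    apply: (le_trans (measureU2 _ mZ _)); first exact: measurableU.
    rewrite [X in (X + _)%E](_ : _ = 0%E)// add0e.
    apply: (le_trans (measureU2 _ mU0 mW)).
    have -> : e%:E = ((e / 2)%:E + (e / 2)%:E)%E by rewrite -EFinD -splitr.
    by apply: leeD => //; exact: muU.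
  apply: mono_measure => //; first by apply: measurableU => //; exact: measurableU.
  move=> x /= tx; have [Zx|nZ] := pselect (Z x); first by left.
  right; have [U0x|nU0] := pselect (U0 x); first by left.
  right.
  have c1 : forall N, (fun m => \sum_(0 <= j < N) lam j * cint b (tkernel Om m) (a j) x) @ \oo -->
      \sum_(0 <= j < N) lam j * cint b (kernel Om) (a j) x.
    by apply: contrapT => h; apply: nZ; left; left; apply: hZ1.
  have c2 : forall N, (fun m => \sum_(0 <= j < N) lam' j * cint b (tkernel Om m) (a' j) x) @ \oo -->
      \sum_(0 <= j < N) lam' j * cint b (kernel Om) (a' j) x.
    by apply: contrapT => h; apply: nZ; left; right; apply: hZ2.
  have c3 : forall m, asum (fun j => lam j * cint b (tkernel Om m) (a j) x) =
      asum (fun j => lam' j * cint b (tkernel Om m) (a' j) x).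
    by apply: contrapT => h; apply: nZ; right; apply: hZ3.
  have /cvgrPdist_le/(_ _ t60)[M1 _ hM1] := c1 N.
  have /cvgrPdist_le/(_ _ t60)[M2 _ hM2] := c2 N.
  exists (maxn M1 M2) => // m; rewrite /= geq_max => /andP[m1 m2].
  have {hM1}h1 := hM1 m m1; have {hM2}h2 := hM2 m m2.
  apply: contrapT => nV.
  have n1 : `|F x - \sum_(0 <= j < N) lam j * cint b (kernel Om) (a j) x| <= t / 6.
    by rewrite leNgt; apply/negP => h; apply: nU0; left; exact: tail_le.
  have n2 : `|F' x - \sum_(0 <= j < N) lam' j * cint b (kernel Om) (a' j) x| <= t / 6.
    by rewrite leNgt; apply/negP => h; apply: nU0; right; exact: tail_le.
  have n3 : `|asum (fun j => lam j * cint b (tkernel Om m) (a j) x) -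
      \sum_(0 <= j < N) lam j * cint b (tkernel Om m) (a j) x| <= t / 6.
    by rewrite leNgt; apply/negP => h; apply: nV; left; exact: tail_le.
  have n4 : `|asum (fun j => lam' j * cint b (tkernel Om m) (a' j) x) -
      \sum_(0 <= j < N) lam' j * cint b (tkernel Om m) (a' j) x| <= t / 6.
    by rewrite leNgt; apply/negP => h; apply: nV; right; exact: tail_le.
  rewrite c3 in n3.
  move: tx; rewrite ltNge => /negP; apply; move: n1 n2 n3 n4 h1 h2.
  move: (F x) (F' x) (asum _) (\sum_(0 <= j < N) lam j * cint b (kernel Om) (a j) x)
    (\sum_(0 <= j < N) lam' j * cint b (kernel Om) (a' j) x)
    (\sum_(0 <= j < N) lam j * cint b (tkernel Om m) (a j) x)
    (\sum_(0 <= j < N) lam' j * cint b (tkernel Om m) (a' j) x) => u1 u2 u3 u4 u5 u6 u7.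
  rewrite !ler_norml => /andP[? ?] /andP[? ?] /andP[? ?] /andP[? ?] /andP[? ?] /andP[? ?].
  by apply/andP; split; lra.
have null (i : nat) : {ae mu, forall x, ~ (i.+1%:R^-1 < `|F x - F' x|)}.
  exists [set x | i.+1%:R^-1 < `|F x - F' x|]; split.
  - by have := mset (EFin \o (fun x => `|F x - F' x|)) i.+1%:R^-1; apply; exact/measurable_EFinP.
  - by apply: measure_le_eps => e e0; exact: small.
  - by move=> x /= /contrapT.
have := ae_foralln null; apply: filterS => x h.
have : `|F x - F' x| <= 0.
  apply/ler_addgt0Pr => e e0; rewrite add0r leNgt; apply/negP => he.
  apply: (h (Num.truncn e^-1)); apply: le_lt_trans he.
  by rewrite -[leRHS]invrK lef_pV2 ?posrE ?invr_gt0// ltW// truncnS_gt.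
by rewrite normr_le0 subr_eq0 => /eqP.
Qed.

End two_series.

End uniqueness.

(** * The weak type bound *)

(** The upper level sets are intervals. The modulus is monotone by definition, and its measurability
    comes from this. *)
Lemma nondecreasing_emeasurable (R : realType) (f : R -> \bar R) :
  (forall x y, x <= y -> (f x <= f y)%E) -> measurable_fun setT f.
Proof.
move=> nd; apply: (measurability _ (ErealGenOInfty.measurableE R)) => //.
move=> _ [_ [r ->] <-]; rewrite setTI; apply: is_interval_measurable => x y /= fx fy z /andP[xz zy].
rewrite /= in fx *; move: fx; rewrite !in_itv/= !andbT => fx.
by apply: (lt_le_trans fx); exact: nd.
Qed.

(** From 2^-(k+1) to 2^-k the modulus is at least its value at the left end and the weight at least
    its value at the right end. Times the length 2^-(k+1) this gives the coefficient 2^(beta k) /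
    2. *)
Lemma dini_sum (R : realType) (beta : R) (om : R -> \bar R) : 0 < beta ->
  (forall x y, x <= y -> (om x <= om y)%E) -> (forall x, 0 < x -> (0 <= om x)%E) ->
  (\sum_(0 <= k <oo) (((2 `^ beta) ^+ k / 2)%:E * om (2 ^- k.+1)) <=
   \int[lebesgue_measure]_(d in `]0%R, 1%R[) (om d * ((d `^ (1 + beta))^-1)%:E))%E.
Proof.
move=> b0 nd om0; pose F k : set R := `[2 ^- k.+1, 2 ^- k[%classic.
have p2 k : 0 < 2 ^- k :> R by rewrite invr_gt0 exprn_gt0.
have dec k j : (k <= j)%N -> 2 ^- j <= 2 ^- k :> R.
  by move=> kj; rewrite lef_pV2 ?posrE ?exprn_gt0// ler_weXn2l// ler1n.
pose g (d : R) := (om d * ((d `^ (1 + beta))^-1)%:E)%E.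
have mg : measurable_fun setT g.
  apply: emeasurable_funM; first exact: nondecreasing_emeasurable.
  apply/measurable_EFinP.
  rewrite (_ : (fun d => _) = (fun d : R => (d `^ (1 + beta)) `^ (-1))).
    by apply: (measurableT_comp (measurable_powR _)); exact: measurable_powR.
  by apply/funext => d; rewrite powR_inv1// powR_ge0.
have mF k : measurable (F k) by exact: measurable_itv.
have F01 : \bigcup_k F k `<=` `]0, 1[%classic.
  move=> d [k _]; rewrite /F/= !in_itv/= => /andP[h1 h2].
  rewrite (lt_le_trans (p2 _) h1)/= (lt_le_trans h2)//.
  by have := dec 0%N k (leq0n k); rewrite expr0 invr1.
have g0 d : (`]0, 1[%classic : set R) d -> (0 <= g d)%E.
  rewrite /= in_itv/= => /andP[d0 _]; rewrite mule_ge0 ?om0//.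
  by rewrite lee_fin invr_ge0 powR_ge0.
have tF : trivIset setT F.
  apply: ltn_trivIset => j k kj; apply/seteqP; split => // d [].
  rewrite /F/= !in_itv/= => /andP[h1 h2] /andP[h3 h4].
  by have := lt_le_trans h4 (le_trans (dec _ _ kj) h1); rewrite ltxx.
apply: (@le_trans _ _ (\int[lebesgue_measure]_(d in \bigcup_k F k) g d)%E); last first.
  apply: ge0_subset_integral => //.
  - by apply: bigcup_measurable => k _; exact: mF.
  - exact: measurable_funTS.
rewrite ge0_integral_bigcup//; last 2 first.
- exact: measurable_funTS.
- by move=> d Fd; apply: g0; exact: F01.
apply: lee_nneseries => [k _ _|k _].
  by rewrite mule_ge0 ?om0// lee_fin divr_ge0// exprn_ge0// powR_ge0.
apply: (@le_trans _ _ (\int[lebesgue_measure]_(d in F k)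
   cst (om (2 ^- k.+1) * (((2 ^- k) `^ (1 + beta))^-1)%:E)%E d)%E).
  rewrite integral_cst; last exact: mF.
  rewrite [X in (_ <= _ * X)%E](_ : _ = (2 ^- k - 2 ^- k.+1)%:E); last first.
    apply: (etrans (lebesgue_measure_itv _)).
    by rewrite /= lte_fin ltf_pV2 ?posrE ?exprn_gt0// ltr_eXn2l ?ltr1n// ltnSn.
  rewrite -muleA -EFinM muleC; apply: lee_wpmul2l; first exact: om0.
  rewrite lee_fin; apply: ler_of_eq.
  have e : (2 ^- k) `^ (1 + beta) = 2 ^- k / (2 `^ beta) ^+ k :> R.
    rewrite powRD_gt0// powRr1 ?(ltW (p2 k))//; congr (_ * _).
    by rewrite -exprVn powR_expr ?invr_ge0// -exprVn; congr (_ ^+ _); rewrite -powR_inv1// powRAC powR_inv1// powR_ge0.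
  rewrite e exprS.
  have : 2 ^+ k != 0 :> R by rewrite gt_eqF// exprn_gt0.
  have : (2 `^ beta) ^+ k != 0 :> R by rewrite gt_eqF// exprn_gt0// powR_gt0.
  by move: (2 ^+ k) ((2 `^ beta) ^+ k) => u v v0 u0; field; rewrite u0 v0.
apply: ge0_le_integral => //; first exact: mF.
- by move=> d _; rewrite /cst mule_ge0 ?om0// lee_fin invr_ge0 powR_ge0.
- exact: measurable_funTS.
move=> d; rewrite /F/= in_itv/= => /andP[h1 h2]; rewrite /g.
have d0 : 0 < d by exact: lt_le_trans (p2 _) h1.
apply: lee_pmul; rewrite ?om0// ?lee_fin ?invr_ge0 ?powR_ge0//; first exact: nd.
rewrite lef_pV2 ?posrE ?powR_gt0//; apply: ge0_ler_powR; rewrite ?nnegrE ?addr_ge0 ?ltW//.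
Qed.

Section integral_modulus.
Context (R : realType) (n : nat) (r : R) (Om : 'rV[R]_n -> R).

Lemma integral_modulus_le (x y : R) : x <= y ->
  (integral_modulus r Om x <= integral_modulus r Om y)%E.
Proof.
move=> xy; apply: ereal_sup_le => _ [rho [hr hs] <-].
by exists rho => //; split => //; apply: lt_le_trans hs _; rewrite lee_fin.
Qed.

Lemma integral_modulus_ge0 (x : R) : 0 < x -> (0 <= integral_modulus r Om x)%E.
Proof.
move=> x0; apply: (@le_trans _ _ ('N[sphere_measure]_(r%:E)[EFin \o (fun z => Om (z *m 1%:M) - Om z)%R])%E).
  exact: Lnorm_ge0.
apply: ereal_sup_ubound; exists 1%:M => //; split.
  by split; [rewrite trmx1 mulmx1|exact: det1].
apply: (@le_lt_trans _ _ 0%E); last by rewrite lte_fin.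
by apply: ge_ereal_sup => _ [z _ <-]; rewrite mulmx1 subrr enorm0.
Qed.

End integral_modulus.

Lemma singular_kernel_weaken (R : realType) (n : nat) (beta A C1 C2 C3 A' C1' C2' C3' : R)
    (k : 'rV[R]_n -> R) : A <= A' -> C1 <= C1' -> C2 <= C2' -> C3 <= C3' ->
  singular_kernel beta A C1 C2 C3 k -> singular_kernel beta A' C1' C2' C3' k.
Proof.
move=> AA h1 h2 h3 /(singular_kernel_widen AA)[mk kl ks kw]; split => //.
- move=> rho rho0; apply: (le_trans (kl _ rho0)).
  by rewrite lee_fin ler_wpM2r// powR_ge0.
- move=> d y d0 yd; apply: (le_trans (ks _ _ d0 yd)).
  by rewrite lee_fin ler_wpM2r// powR_ge0.
- move=> t t0; apply: (le_trans (kw _ t0)).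
  by rewrite lee_fin ler_wpM2r// invr_ge0 ltW.
Qed.

Section rough_singular.
Context (R : realType) (n : nat) (beta r : R) (Om : 'rV[R]_n -> R).
Hypotheses (n0 : (0 < n)%N) (beta0 : 0 < beta) (beta1 : beta < 1) (r1 : 1 < r).
Hypotheses (hom : homogeneous0 Om) (mOm : measurable_fun [set: 'rV[R]_n] Om).
Hypothesis Om_r : ('N[sphere_measure]_(r%:E)[EFin \o Om] < +oo)%E.
Hypothesis dini : (\int[lebesgue_measure]_(d in `]0%R, 1%R[)
     (integral_modulus r Om d * ((d `^ (1 + beta))^-1)%:E) < +oo)%E.

Lemma rough_singular_kernel : exists A C1 C2 C3 : R,
  [/\ 1 <= A, 0 < C1, 0 <= C2, 0 <= C3 & forall chi, cutoff chi ->
     singular_kernel beta A C1 C2 C3 (kernel (fun z => Om z * chi (enorm z)))].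
Proof.
have r0 : 0 < r by exact: lt_trans r1.
pose om := integral_modulus r Om.
have om0 x : 0 < x -> (0 <= om x)%E by exact: integral_modulus_ge0.
have pk k : 0 < 2 ^- k.+1 :> R by rewrite invr_gt0 exprn_gt0.
have sumoo := le_lt_trans (dini_sum beta0 (@integral_modulus_le R n r Om) om0) dini.
have c0 k : 0 < (2 `^ beta) ^+ k / 2 :> R by rewrite divr_gt0// exprn_gt0// powR_gt0.
have t0 k : (0 <= ((2 `^ beta) ^+ k / 2)%:E * om (2 ^- k.+1))%E.
  by rewrite mule_ge0 ?om0// lee_fin ltW.
(* A finite sum with positive coefficients forces each sampled value to be finite. *)
have omfin k : om (2 ^- k.+1) \is a fin_num.
  rewrite ge0_fin_numE ?om0//; have := le_lt_trans (nneseries_ge_term k t0) sumoo.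
  have K (c : R) (v : \bar R) : 0 < c -> (0 <= v)%E -> (c%:E * v < +oo)%E -> (v < +oo)%E.
    case: v => [v||] c_gt0 v_ge0 h; [exact: ltry|by move: h; rewrite gt0_muley|by []].
  by apply: K; [exact: c0|exact: om0].
pose w k := fine (om (2 ^- k.+1)).
have w0 k : 0 <= w k by rewrite fine_ge0// om0.
have sfin : (\sum_(0 <= k <oo) (((2 `^ beta) ^+ k / 2)%:E * om (2 ^- k.+1)))%E \is a fin_num.
  by rewrite ge0_fin_numE// nneseries_ge0.
(* The factor 2 undoes the 1/2 in [dini_sum]. *)
pose W := 2 * fine (\sum_(0 <= k <oo) (((2 `^ beta) ^+ k / 2)%:E * om (2 ^- k.+1)))%E.
have wW : (\sum_(0 <= k <oo) ((2 `^ beta) ^+ k * w k)%:E <= W%:E)%E.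
  rewrite /W EFinM fineK// -nneseriesZl//; apply: lee_nneseries => [k _ _|k _].
    by rewrite lee_fin mulr_ge0// exprn_ge0// powR_ge0.
  rewrite -(fineK (omfin k)) -!EFinM lee_fin -/(w k); apply: ler_of_eq; by field.
have rotw k (rho : 'M[R]_n) : rotation rho -> (rotation_size rho < (2 ^- k.+1)%:E)%E ->
    (\int[sphere_measure]_z `|Om (z *m rho) - Om z|%:E <= (w k)%:E)%E.
  move=> hr hs; rewrite /w fineK//.
  have mrot : measurable_fun setT (fun z => Om (z *m rho) - Om z).
    by apply: measurable_funB => //; apply: (measurableT_comp mOm); exact: measurable_mulmx.
  apply: (le_trans (Lnorm_sphere_ge n0 r1 mrot)).
  by apply: ereal_sup_ubound; exists rho.
have Ifin : (\int[sphere_measure]_z (`|Om z| `^ r)%:E < +oo)%E.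
  have := powR_Lnorm sphere_measure (EFin \o Om) (lt0r_neq0 r0).
  by rewrite /= => <-; exact: poweR_lty.
have I0 : (0 <= \int[sphere_measure]_z (`|Om z| `^ r)%:E)%E.
  by apply: integral_ge0 => z _; rewrite lee_fin powR_ge0.
have OmMr : morrey (fun x => `|Om x| `^ r) (ball_vol R n * fine (\int[sphere_measure]_z (`|Om z| `^ r)%:E)%E).
  apply: homogeneous0_morrey => //.
  - by apply: (measurableT_comp (measurable_powR _)); exact: (measurableT_comp (@normr_measurable R setT)).
  - by move=> t x tt; rewrite hom.
  - by rewrite fineK// ge0_fin_numE.
have hk := kernel_singular n0 mOm hom beta0 beta1 r1 OmMr w0 rotw wW.
(* Replacing each constant by its absolute value plus 1 gives the required signs, and A >= 1,
   without inspecting the constants. *)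
have le1 (x : R) : x <= `|x| + 1 by rewrite (le_trans (ler_norm x))// lerDl.
do 4 eexists; split; last first.
- move=> chi hchi; exact: (singular_kernel_weaken (le1 _) (le1 _) (le1 _) (le1 _) (hk chi hchi)).
- by rewrite addr_ge0.
- by rewrite addr_ge0.
- by rewrite ltr_wpDl.
- by rewrite lerDr.
Qed.

End rough_singular.

Section assembly.
Context (R : realType) (n : nat) (beta r p l : R) (s : nat) (Om : 'rV[R]_n -> R).
Hypotheses (n0 : (0 < n)%N) (beta0 : 0 < beta) (beta1 : beta < 1) (r1 : 1 < r).
Hypotheses (pE : p = n%:R / (n%:R + beta)) (l1 : 1 < l).
Hypotheses (hom : homogeneous0 Om) (mOm : measurable_fun [set: 'rV[R]_n] Om).
Hypothesis Om_r : ('N[sphere_measure]_(r%:E)[EFin \o Om] < +oo)%E.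
Hypothesis dini : (\int[lebesgue_measure]_(d in `]0%R, 1%R[)
     (integral_modulus r Om d * ((d `^ (1 + beta))^-1)%:E) < +oo)%E.
Local Notation mu := (lebesgue_rV n).

Let nR0 : 0 < n%:R :> R. Proof. by rewrite ltr0n. Qed.
Let p0 : 0 < p. Proof. by rewrite pE divr_gt0// addr_gt0. Qed.
Let p1 : p < 1. Proof. by rewrite pE ltr_pdivrMr ?addr_gt0// mul1r ltrDl. Qed.

Let Cb : R := ball_vol R n `^ (- (beta / n%:R)).
Let Cb0 : 0 < Cb. Proof. by rewrite powR_gt0// ball_vol_gt0. Qed.

Lemma atomic_bump_series (f : ('rV[R]_n -> R) -> R) (lam : nat -> R) (a : nat -> 'rV[R]_n -> R) :
  atomic_decomposition p l s f lam a -> bump_series beta Cb p lam a.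
Proof. by move=> [ha hl _]; split => // j; exact: (atom_bump n0 beta0 pE l1 (ha j)). Qed.

Lemma hardy_norm_ge0 (f : ('rV[R]_n -> R) -> R) : (0 <= hardy_norm p l s f)%E.
Proof.
by apply: le_ereal_inf_tmp => _ [lam [a [_ ->]]]; exact: poweR_ge0.
Qed.

Lemma hardy_commutator_weak : exists2 C : R, 0 < C &
  forall b : 'rV[R]_n -> R, Lip beta b ->
  forall f : ('rV[R]_n -> R) -> R, hardy p l s f ->
  exists2 F : 'rV[R]_n -> R, hardy_commutator b Om p l s f F &
    forall lambda : R, 0 < lambda ->
      (mu [set x | (lambda < `|F x|)%R] <=
         C%:E * lip_norm beta b * (lambda^-1)%:E * hardy_norm p l s f)%E.
Proof.
have [A [C1 [C2 [C3 [A1 C10 C20 C30 hOm]]]]] := rough_singular_kernel n0 beta0 beta1 r1 hom mOm Om_r dini.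
pose C := weak_const p * (cint_const beta A C1 C2 C3 * Cb) + 1.
have K0 : 0 <= weak_const p * (cint_const beta A C1 C2 C3 * Cb).
  rewrite mulr_ge0 ?weak_const_ge0// mulr_ge0 ?(ltW Cb0)//.
  by rewrite !addr_ge0 ?mulr_ge0 ?powR_ge0 ?(ltW C10).
have C0 : 0 < C by rewrite ltr_wpDl.
exists C => // b bLip f [_ [lam [a hd]]].
have [L L0 [LE bL]] := lip_norm_holder n0 beta0 bLip.
(* If L = 0 then b is constant and F = 0 serves; the uniqueness results ask for L > 0. *)
have [L00|Ln0] := eqVneq L 0.
  have b_cst x y : b x - b y = 0.
    by apply/eqP; rewrite -normr_eq0 eq_le normr_ge0 andbT (le_trans (bL x y))// L00 mul0r.
  exists (fun=> 0); last first.
    move=> t t0; rewrite (_ : [set x | _] = set0); last first.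
      by apply/seteqP; split => x //=; rewrite normr0 ltNge ltW.
    rewrite measure0 LE; apply: mule_ge0; last exact: hardy_norm_ge0.
    by rewrite -!EFinM lee_fin mulr_ge0 ?invr_ge0 ?(ltW t0)// mulr_ge0// ltW.
  split; first exact: measurable_cst.
  move=> lam' a' _; apply: aeW => x.
  have E N : \sum_(0 <= j < N) lam' j * commutator b Om (a' j) x = 0.
    rewrite big1// => j _; rewrite /commutator /Rintegral integral0_eq ?mulr0// => y _.
    by rewrite b_cst mulr0 mul0r.
  by under eq_fun do rewrite E; exact: cvg_cst.
have {}L0 : 0 < L by rewrite lt_neqAle eq_sym Ln0.
have hk1 := kernel_singular1 hOm.
pose F lam a x := asum (fun j => lam j * cint b (kernel Om) (a j) x).
have mF lam1 a1 : bump_series beta Cb p lam1 a1 -> measurable_fun setT (F lam1 a1).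
  by move=> hs; exact: measurable_asum (measurable_term beta0 bL hs hk1).
have hs := atomic_bump_series hd.
have agree lam' a' : atomic_decomposition p l s f lam' a' -> {ae mu, forall x, F lam a x = F lam' a' x}.
  move=> hd'; have hs' := atomic_bump_series hd'.
  have [_ _ hf] := hd; have [_ _ hf'] := hd'.
  exact: (series_unique n0 beta0 beta1 A1 C10 C20 C30 p0 p1 Cb0 L0 hOm bL hs hs' hf hf').
(* F comes from one decomposition; by uniqueness any other has the same sum almost everywhere. *)
exists (F lam a).
  split; first exact: mF.
  move=> lam' a' hd'; have hs' := atomic_bump_series hd'.
  have fin := series_ae_finite beta0 A1 C10 C20 C30 p0 p1 Cb0 L0 bL hs' hk1.
  apply: filterS2 fin (agree _ _ hd') => x fx ->.
  exact: asum_cvg.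
move=> t t0; rewrite LE -!EFinM.
have c0 : 0 < C * L * t^-1 by rewrite !mulr_gt0// invr_gt0.
(* The norm is an infimum, so the bound is proved for each decomposition separately, with F replaced
   by the sum for that decomposition. *)
rewrite -lee_pdivrMl//; apply: le_ereal_inf_tmp => _ [lam' [a' [hd' ->]]].
rewrite lee_pdivrMl//.
have hs' := atomic_bump_series hd'.
have mset lam1 a1 : bump_series beta Cb p lam1 a1 -> measurable [set x | t < `|F lam1 a1 x|].
  move=> hs1; rewrite (_ : [set x | _] = setT `&` (fun x => `|F lam1 a1 x|) @^-1` `]t, +oo[).
    by have := measurableT_comp (@normr_measurable R setT) (mF _ _ hs1); apply.
  by rewrite setTI; apply/seteqP; split => x /=; rewrite in_itv/= andbT.
have -> : mu [set x | t < `|F lam a x|] = mu [set x | t < `|F lam' a' x|].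
  have [Z [mZ Z0 hZ]] := agree _ _ hd'.
  have le lam1 a1 lam2 a2 : bump_series beta Cb p lam1 a1 -> bump_series beta Cb p lam2 a2 ->
      (forall x, ~ Z x -> F lam1 a1 x = F lam2 a2 x) ->
      (mu [set x | (t < `|F lam1 a1 x|)%R] <= mu [set x | (t < `|F lam2 a2 x|)%R])%E.
    move=> hs1 hs2 e; apply: (@le_trans _ _ (mu (Z `|` [set x | t < `|F lam2 a2 x|]))).
      apply: mono_measure; [exact: mset|by apply: measurableU => //; exact: mset|].
      by move=> x /= h; have [Zx|nZ] := pselect (Z x); [left|right; rewrite /= -e].
    apply: (le_trans (measureU2 _ mZ _)); first exact: mset.
    by rewrite [X in (X + _)%E](_ : _ = 0%E)// add0e.
  apply/eqP; rewrite eq_le; apply/andP; split;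
    [apply: (le _ _ _ _ hs hs') => x nZ|apply: (le _ _ _ _ hs' hs) => x nZ].
    by apply: contrapT => h; apply: nZ; exact: hZ.
  by apply: contrapT => h; apply: nZ; apply: hZ => /= e; apply: h.
have l0 j : (0 <= (`|lam' j| `^ p)%:E)%E by rewrite lee_fin powR_ge0.
have s0 : (0 <= \sum_(0 <= j <oo) (`|lam' j| `^ p)%:E)%E by apply: nneseries_ge0.
have [S SE] : exists S, (\sum_(0 <= j <oo) (`|lam' j| `^ p)%:E)%E = S%:E.
  by exists (fine (\sum_(0 <= j <oo) (`|lam' j| `^ p)%:E)%E); rewrite fineK// ge0_fin_numE// hs'.2.
rewrite SE poweR_EFin -EFinM; rewrite SE lee_fin in s0.
(* If S = 0 all coefficients vanish and the level set is empty; [weak_tail] needs S > 0. *)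
have [S0|Sn0] := eqVneq S 0.
  rewrite (_ : [set x | _] = set0).
    by rewrite measure0 lee_fin; apply: mulr_ge0; [exact: ltW|exact: powR_ge0].
  apply/seteqP; split => x //=; rewrite ltNge => /negP; apply.
  apply: le_trans (ltW t0); rewrite -lee_fin; apply: (le_trans (asum_le _)).
  rewrite eseries0// => j _ _.
  have : ((`|lam' j| `^ p)%:E <= 0%:E)%E.
    by rewrite -S0 -SE; exact: (nneseries_ge_term j l0).
  rewrite lee_fin => h; have /eqP : `|lam' j| `^ p == 0 by rewrite eq_le h powR_ge0.
  by move/powR_eq0_eq0/eqP; rewrite normr_eq0 => /eqP ->; rewrite mul0r normr0.
have Sp : 0 < S by rewrite lt_neqAle eq_sym Sn0.
have lS : (\sum_(0 <= j <oo) (`|lam' j| `^ p)%:E <= S%:E)%E by rewrite SE.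
apply: (@le_trans _ _ (mu [set x | (t%:E < \sum_(0 <= j <oo) `|lam' j * cint b (kernel Om) (a' j) x|%:E)%E])).
  apply: mono_measure.
  - exact: mset.
  - rewrite -[X in measurable X]setTI; apply: emeasurable_fun_o_infty => //.
    exact: (measurable_tail beta0 bL hs' hk1).
  - by move=> x /= h; apply: lt_le_trans (asum_le _); rewrite lte_fin.
apply: (le_trans (weak_tail beta0 A1 C10 C20 C30 p0 p1 Cb0 L0 bL hs' hk1 Sp lS t0)).
rewrite lee_fin (_ : weak_const p * _ * _ / t = weak_const p * (cint_const beta A C1 C2 C3 * Cb) * (L * t^-1 * S `^ p^-1)); last by ring.
rewrite (_ : C * L / t * _ = C * (L * t^-1 * S `^ p^-1)); last by ring.
by rewrite ler_wpM2r ?lerDl// !mulr_ge0 ?powR_ge0 ?(ltW L0)// invr_ge0 ltW.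
Qed.

End assembly.

Theorem theorem1p4 (R : realType) (n : nat) (beta r p l : R) (s : nat)
    (Omega : 'rV[R]_n -> R) :
  (2 <= n)%N -> 0 < beta -> beta < 1 -> 1 < r ->
  p = n%:R / (n%:R + beta) -> 1 < l ->
  Num.floor (n%:R * (p^-1 - 1)) <= s%:Z ->
  homogeneous0 Omega ->
  measurable_fun [set: 'rV[R]_n] Omega ->
  ('N[sphere_measure]_(r%:E)[EFin \o Omega] < +oo)%E ->
  \int[sphere_measure]_z Omega z = 0 ->
  (\int[lebesgue_measure]_(d in `]0%R, 1%R[)
     (integral_modulus r Omega d * ((d `^ (1 + beta))^-1)%:E) < +oo)%E ->
  exists2 C : R, 0 < C &
    forall b : 'rV[R]_n -> R, Lip beta b ->
    forall f : ('rV[R]_n -> R) -> R, hardy p l s f ->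
    exists2 F : 'rV[R]_n -> R, hardy_commutator b Omega p l s f F &
      forall lambda : R, 0 < lambda ->
        (lebesgue_rV n [set x | (lambda < `|F x|)%R] <=
           C%:E * lip_norm beta b * (lambda^-1)%:E * hardy_norm p l s f)%E.
Proof.
move=> n2 beta0 beta1 r1 pE l1 _ hom mOm Om_r _ dini.
have n0 : (0 < n)%N by exact: leq_trans n2.
exact: (hardy_commutator_weak s n0 beta0 beta1 r1 pE l1 hom mOm Om_r dini).
Qed.
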